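(* Let $A$ be a finite local $\mathbb{C}$-algebra with maximal ideal $m$, let $X$ be a compact Riemann surface, and let $f,g$ be two invertible meromorphic functions on $X$ with coefficients in $A$. Let $s\in X$ be a zero or pole of $f$ or of $g$ (or both), let $x$ be a uniformizer (local holomorphic coordinate) at $s$, and write the Laurent expansions of $f,g$ at $s$, as elements of $A((x))^\times$, in the product form $$f=a_0x^{\nu_f}\prod_{j=-N_f}^{-1}(1-a_jx^j)\prod_{j=1}^{\infty}(1-a_jx^j),\qquad g=b_0x^{\nu_g}\prod_{j=-N_g}^{-1}(1-b_jx^j)\prod_{j=1}^{\infty}(1-b_jx^j),$$ where $\nu_f,\nu_g\in\mathbb{Z}$, $a_0,b_0\in A^\times$, $a_j,b_j\in m$ for $j<0$ and $a_j,b_j\in A$ for $j>0$; put $a_{-j}=0$ for $j>N_f$ and $b_{-j}=0$ for $j>N_g$. Let $P\in X$ be a point which is not a zero or pole of $f$ or $g$, and let $\sigma$ be a simple loop starting and ending at $P$, avoiding the zeros and poles of $f$ and $g$, which goes around $s$ once in the counterclockwise direction (that is, it bounds, counterclockwise, a disk containing $s$) and does not go around any other zero or pole of $f$ or $g$. Then $$\exp\left(\frac{1}{2\pi i}\int_\sigma\frac{df}{f}\circ\frac{dg}{g}\right)=(-1)^{\nu_f\nu_g}\,\frac{g(P)^{\nu_f}\,a_0^{\nu_g}\prod_{j=1}^{\infty}\prod_{k=1}^{\infty}\left(1-a_j^{k/(j,k)}b_{-k}^{j/(j,k)}\right)^{(j,k)}}{f(P)^{\nu_g}\,b_0^{\nu_f}\prod_{j=1}^{\infty}\prod_{k=1}^{\infty}\left(1-a_{-j}^{k/(j,k)}b_{k}^{j/(j,k)}\right)^{(j,k)}}$$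 in $A^\times$, where $(j,k)$ denotes the greatest common divisor of $j$ and $k$.
   Context: $A$ is a local $\mathbb{C}$-algebra, finite-dimensional over $\mathbb{C}$; its maximal ideal $m$ is nilpotent and $A=\mathbb{C}\oplus m$. Choose a $\mathbb{C}$-basis $e_0=1,e_1,\dots,e_n$ of $A$ with $e_i\in m$ for $i\ge 1$. A meromorphic function on $X$ with coefficients in $A$ is a sum $f=\sum_{i=0}^n e_if_i$ with each $f_i$ an ordinary meromorphic function on $X$; it is invertible when $f_0\neq 0$. It is holomorphic at a point if all $f_i$ are. The poles of $f$ are the points where some $f_i$ has a pole, and the zeros of $f$ are the zeros of $f_0$; at every other point $f$ is holomorphic with value in $A^\times$. Meromorphic $1$-forms with coefficients in $A$ are defined likewise as sums $\sum e_i\omega_i$. Iterated integrals: for ordinary $1$-forms $\omega_1,\dots,\omega_r$ and a path $\gamma:[0,1]\to X$ avoiding their poles, $\int_\gamma\omega_1\circ\cdots\circ\omega_r=\int_{0\le t_1\le\cdots\le t_r\le1}\gamma^*\omega_1(t_1)\wedge\cdots\wedge\gamma^*\omega_r(t_r)$ (with $\omega_1$ integrated at the smallest parameter $t_1$); this is extended multilinearly over $A$ to forms with coefficients in $A$, so the integral takes values in $A$. The exponential $\exp:A\to A^\times$ is $\exp(c+u)=e^c\sum_{k\ge0}u^k/k!$ for $c\in\mathbb{C}$, $u\in m$. Every element of $A((x))^\times$ has a unique product expansion of the displayed form. The double products on the right-hand side have only finitely many factors different from $1$, because only finitely many $a_{-j},b_{-k}$ are nonzero and these are nilpotent. *)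

(* Defs.v *)
From HB Require Import structures.
From mathcomp Require Import all_boot all_order all_algebra falgebra complex.
From mathcomp Require Import all_classical all_reals all_analysis.

Set Implicit Arguments.
Unset Strict Implicit.
Unset Printing Implicit Defensive.

Import Order.TTheory GRing.Theory Num.Theory numFieldNormedType.Exports.

Local Open Scope classical_set_scope.
Local Open Scope ring_scope.
Local Open Scope complex_scope.

(* The topology of R[i] is the one of its norm, and derivability of a function
   R[i] -> R[i] is complex differentiability. *)
HB.instance Definition _ (R : realType) := NormedModule.copy R[i] (R[i])^o.

#[short(type="comFalgType")]
HB.structure Definition ComFalgebra (K : fieldType) :=
  {A of Falgebra K A & GRing.ComUnitAlgebra K A}.

(* idealr_closed describes proper ideals. *)
Definition maximal_ideal (A : comNzRingType) (I : {pred A}) : Prop :=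
  idealr_closed I /\
  forall J : {pred A}, idealr_closed J -> {subset I <= J} -> J =i I.

Definition local_with_maximal_ideal (A : comNzRingType) (m : {pred A}) : Prop :=
  maximal_ideal m /\ forall m' : {pred A}, maximal_ideal m' -> m' =i m.

Definition expC (R : realType) (z : R[i]) : R[i] :=
  (expR (complex.Re z))%:C *
  (cos (complex.Im z) +i* sin (complex.Im z)).

Section Exponential.
Context (R : realType) (A : comFalgType R[i]) (m : {pred A}).

(* The component c of a = c + u in A = C (+) m. *)
Definition residue (a : A) : R[i] := xget 0 [set c | a - c%:A \in m].

(* The exponential series of u in m stops before dim A, because u is nilpotent
   and hence u ^+ \dim {:A} = 0. *)
Definition expA (a : A) : A :=
  expC (residue a) *:
  \sum_(k < \dim {:A}) (k`!%:R : R[i])^-1 *: (a - (residue a)%:A) ^+ k.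

End Exponential.

Definition holomorphic_near (R : realType) (f : R[i] -> R[i]) (z : R[i]) : Prop :=
  \forall w \near z, derivable f w 1.

Record chart (R : realType) (X : topologicalType) := Chart {
  chart_dom : set X;
  chart_map :> X -> R[i];
  chart_inv : R[i] -> X;
  chart_dom_open : open chart_dom;
  chart_im_open : open (chart_map @` chart_dom);
  chart_mapK : {in chart_dom, cancel chart_map chart_inv};
  chart_map_continuous : {in chart_dom, continuous chart_map};
  chart_inv_continuous : {in chart_map @` chart_dom, continuous chart_inv} }.

Definition holomorphic_transition (R : realType) (X : topologicalType)
    (c d : chart R X) : Prop :=
  forall p, chart_dom c p -> chart_dom d p ->
    holomorphic_near (d \o chart_inv c) (c p).

(* The charts chart_at p form the atlas. *)
HB.mixin Record isRiemannSurface (R : realType) X of Topological X := {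
  chart_at : X -> chart R X;
  chart_at_dom : forall p, chart_dom (chart_at p) p;
  chart_at_compatible : forall p q,
    holomorphic_transition (chart_at p) (chart_at q);
  surface_hausdorff : hausdorff_space X;
  surface_connected : connected [set: X] }.

#[short(type="riemannSurfaceType")]
HB.structure Definition RiemannSurface (R : realType) :=
  {X of Topological X & isRiemannSurface R X}.

Section Surface.
Context (R : realType) (X : riemannSurfaceType R).
Local Notation C := R[i].

Definition uniformizer (s : X) (x : chart R X) : Prop :=
  [/\ chart_dom x s, x s = 0,
      forall p, holomorphic_transition x (chart_at p) &
      forall p, holomorphic_transition (chart_at p) x].

Definition holomorphic_at (h : X -> C) (p : X) : Prop :=
  holomorphic_near (h \o chart_inv (chart_at p)) (chart_at p p).

(* A holomorphic function off a closed set of isolated points, at which its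
   modulus tends to infinity; the value of mero_fun at a pole is irrelevant. *)
Record meromorphic := Meromorphic {
  mero_fun :> X -> C;
  poles : set X;
  poles_closed : closed poles;
  poles_isolated : forall p, poles p -> \forall q \near p^', ~ poles q;
  mero_holomorphic : forall p, ~ poles p -> holomorphic_at mero_fun p;
  mero_pole : forall p, poles p -> `|mero_fun q| @[q --> p^'] --> +oo }.

(* A V-valued form of type (1,0) is given by its coefficients: w stands for the
   form whose value at p is w p times the differential of chart_at p. *)
Definition form (V : Type) := X -> V.

Definition differential (h : X -> C) : form C :=
  fun p => derive1 (h \o chart_inv (chart_at p)) (chart_at p p).

Definition velocity (sigma : R -> X) (t : R) : C :=
  derive1 (fun u => complex.Re (chart_at (sigma t) (sigma u))) t +i*
  derive1 (fun u => complex.Im (chart_at (sigma t) (sigma u))) t.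

(* The coefficient of dt. *)
Definition pullback (sigma : R -> X) (w : form C) (t : R) : C :=
  w (sigma t) * velocity sigma t.

Definition simplex2 : set (R * R) :=
  [set t | [&& 0 <= t.1, t.1 <= t.2 & t.2 <= 1]].

Definition iterated_integral (sigma : R -> X) (w1 w2 : form C) : C :=
  let mu := (@lebesgue_measure R \x @lebesgue_measure R)%E in
  let F t := pullback sigma w1 t.1 * pullback sigma w2 t.2 in
  (\int[mu]_(t in simplex2) complex.Re (F t)) +i*
  (\int[mu]_(t in simplex2) complex.Im (F t)).

Definition C1_near (c : R -> R) (t : R) : Prop :=
  \forall u \near t, derivable c u 1 /\ continuous_at u (derive1 c).

(* At each point of `[a, b], the path read in a chart is locally the restriction
   to `[a, b] of a C^1 function. *)
Definition C1_on (sigma : R -> X) (a b : R) : Prop :=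
  forall t, t \in `[a, b] -> exists2 c : R -> C,
    C1_near (@complex.Re R \o c) t /\ C1_near (@complex.Im R \o c) t &
    \forall u \near t, u \in `[a, b] -> chart_at (sigma t) (sigma u) = c u.

Definition piecewise_C1_path (sigma : R -> X) : Prop :=
  {within `[0, 1], continuous sigma} /\
  exists ts : seq R,
    [/\ path <%R 0 ts, last 0 ts = 1 &
        forall i, (i < size ts)%N ->
          C1_on sigma (nth 0 (0 :: ts) i) (nth 0 ts i)].

Definition simple_loop_at (P : X) (sigma : R -> X) : Prop :=
  [/\ sigma 0 = P, sigma 1 = P & {in `[0, 1[ &, injective sigma}].

Definition unit_circle (t : R) : C := cos (2 * pi * t) +i* sin (2 * pi * t).

(* The closed path c, restricted to `[0, 1], avoids 0 and has winding number k
   around it. *)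
Definition winds_around_zero (c : R -> C) (k : int) : Prop :=
  exists theta : R -> R,
    [/\ {within `[0, 1], continuous theta}, theta 1 = theta 0 + k%:~R &
        forall t, t \in `[0, 1] ->
          c t != 0 /\ c t = `|c t| * unit_circle (theta t)].

(* sigma bounds, counterclockwise, a closed disk whose interior contains s and
   which contains no other point of Z. The disk is the homeomorphic image under
   h of the closed unit disk; the last condition says that h preserves the
   orientation, its local degree at the point z0 over s being 1. *)
Definition encircles_only (sigma : R -> X) (s : X) (Z : set X) : Prop :=
  let D := [set z : C | `|z| <= 1] in
  exists (h : C -> X) (z0 : C),
    [/\ {within D, continuous h} /\ {in D &, injective h},
        forall t, t \in `[0, 1] -> sigma t = h (unit_circle t),
        `|z0| < 1 /\ h z0 = s,
        forall z, D z -> Z (h z) -> h z = s &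
        \forall r \near 0^'+,
          winds_around_zero
            (fun t => chart_at s (h (z0 + r%:C * unit_circle t)) - chart_at s s)
            1].

End Surface.

Section Coefficients.
Context (R : realType) (X : riemannSurfaceType R) (A : comFalgType R[i]).
Context (n : nat) (e : n.+1.-tuple A).

(* The family f stands for the sum of the e_i f_i. *)
Definition meromorphicA := 'I_n.+1 -> meromorphic X.

Definition invertible (f : meromorphicA) : Prop :=
  exists p, ~ poles (f ord0) p /\ f ord0 p != 0.

Definition zero_or_pole (f : meromorphicA) : set X :=
  [set p | (exists i, poles (f i) p) \/ (~ poles (f ord0) p /\ f ord0 p = 0)].

Definition valueA (f : meromorphicA) (p : X) : A :=
  \sum_i f i p *: tnth e i.

Definition differentialA (f : meromorphicA) : form X A :=
  fun p => \sum_i differential (f i) p *: tnth e i.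

Definition dlog (f : meromorphicA) : form X A :=
  fun p => (valueA f p)^-1 * differentialA f p.

Definition iterated_integralA (sigma : R -> X) (w1 w2 : form X A) : A :=
  \sum_i \sum_j
    iterated_integral sigma (fun p => coord e i (w1 p)) (fun p => coord e j (w2 p))
    *: (tnth e i * tnth e j).

(* A formal Laurent series is given by its coefficients, a function on int which
   vanishes below some bound. *)
Definition laurent_expansion (s : X) (x : chart R X) (h : X -> R[i])
    (c : int -> R[i]) : Prop :=
  exists2 N : nat, forall k : int, k < - N%:Z -> c k = 0 &
    \forall p \near s^',
      series (fun k : nat => c (k%:Z - N%:Z) * x p ^ (k%:Z - N%:Z)) @ \oo --> h p.

Definition laurent_expansionA (s : X) (x : chart R X) (f : meromorphicA)
    (c : int -> A) : Prop :=
  forall i, laurent_expansion s x (f i) (fun k => coord e i (c k)).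

Definition laurent_monomial (a : A) (nu : int) : int -> A :=
  fun k => if k == nu then a else 0.

(* Multiplication of a Laurent series by 1 - a x^j. *)
Definition laurent_mul_factor (a : A) (j : int) (c : int -> A) : int -> A :=
  fun k => c k - a * c (k - j).

(* a_0 x^nu \prod_(-N <= j <= -1) (1 - a_j x^j) \prod_(1 <= j <= M) (1 - a_j x^j) *)
Definition laurent_partial_product (nu : int) (N : nat) (a : int -> A) (M : nat) :
    int -> A :=
  foldr (fun j : nat => laurent_mul_factor (a j%:Z) j%:Z)
    (foldr (fun j : nat => laurent_mul_factor (a (- j%:Z)) (- j%:Z))
       (laurent_monomial (a 0) nu) (iota 1 N))
    (iota 1 M).

(* The infinite product converges x-adically: each coefficient of the partial
   products is eventually constant. *)
Definition laurent_product (nu : int) (N : nat) (a : int -> A) (c : int -> A) :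
    Prop :=
  forall k : int, \forall M \near \oo, laurent_partial_product nu N a M k = c k.

Definition product_expansion (m : {pred A}) (s : X) (x : chart R X)
    (f : meromorphicA) (nu : int) (N : nat) (a : int -> A) : Prop :=
  [/\ a 0 \is a GRing.unit,
      forall j : int, j < 0 -> a j \in m,
      forall j : int, j < - N%:Z -> a j = 0 &
      exists2 c, laurent_expansionA s x f c & laurent_product nu N a c].

End Coefficients.

(* Main.v *)
Require Import Defs.
From HB Require Import structures.
From mathcomp Require Import all_boot all_order all_algebra falgebra complex.
From mathcomp Require Import all_classical all_reals all_analysis.
From mathcomp Require Import measurable_realfun.
From mathcomp Require Import ring lra zify.
Set Implicit Arguments.
Unset Strict Implicit.
Unset Printing Implicit Defensive.
Import Order.TTheory GRing.Theory Num.Theory numFieldNormedType.Exports.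
Local Open Scope classical_set_scope.
Local Open Scope ring_scope.
Local Open Scope complex_scope.

(** The functions f and g have logarithmic primitives F and G near each point outside the
    zeros and poles, and F dG has a primitive K. Along a path, a continuation of (F, G, K)
    (a [lift]) computes the iterated integral of df/f and dg/g from its end values as
    K(1) - K(0) - F(0) (G(1) - G(0)) ([iterated_integral_lift]). Two continuations along the
    same path differ by a constant element (a, b, c) of the Heisenberg group, acting by
    (F + a, G + b, K + a G + c) ([lift_path]).

    The disk bounded by sigma provides a homotopy from sigma to a small loop around s which
    avoids all zeros and poles ([homotopy_to_s]). The triple continues over the square of the
    homotopy ([square_lift_from]). Its two sides which join the loops are the same path,
    so the triples over them differ by the Heisenberg element of the small loop ([square_period]),
    and the integral along sigma follows from this element and the values of F and G at P.

    Near s the product expansions give f = a_0 x^nu_f exp U and g = b_0 x^nu_g exp V, where U and V are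
    a principal part coming from the nilpotent a_j and b_j with j < 0 plus a holomorphic germ
    ([local_form]). In terms of a logarithm l of x, F = nu_f l + U, G = nu_g l + V and
    K = nu_f nu_g l^2 / 2 + nu_f l V + rho l + Y with a single valued Y, where rho is the residue of
    U dV + (nu_g U - nu_f V) dx / x ([lift_near_s]). The loop adds 2 i pi to l, and the integral
    along sigma is 2 i pi (nu_f G(P) - nu_g F(P) + rho + i pi nu_f nu_g) ([period_identity]). The
    exponential turns the terms into the powers of g(P) / b_0 and f(P) / a_0, the double products and
    the sign.

    The double products come from the residue: it pairs the principal part of each of U and V with
    the derivative of the regular part of the other ([local_residue]). The principal part of log f
    is a sum of - a_-p^l x^(- p l) / l and dV is a sum of - q b_q^i x^(i q - 1) dx; the
    monomials with i q = p l add up to minus gcd(p, q) times the logarithm of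
    1 - a_-p^(q / gcd(p, q)) b_q^(p / gcd(p, q)) ([pair_sum]).

    The complex analysis that this needs is local: holomorphic germs have primitives
    ([hol_prim]), holomorphic derivatives ([hol_deriv]) and can be divided by z ([hol_divide]),
    which follows from Goursat's theorem for rectangles. *)

(** * The modulus with real values *)

Section Modulus.
Context (R : realType).
Local Notation C := R[i].

(** The norm of R[i] as a real number, so that estimates are inequalities in R. *)
Definition cmod (z : C) : R := ComplexField.Normc.normc z.

#[global] Arguments cmod : simpl never.

Lemma cmodE (z : C) : `|z| = (cmod z)%:C.
Proof. by rewrite normc_def; case: z. Qed.

Lemma cmod_ge0 (z : C) : 0 <= cmod z.
Proof. by rewrite -lecR -cmodE normr_ge0. Qed.

Lemma cmodD (z w : C) : cmod (z + w) <= cmod z + cmod w.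
Proof. exact: le_normcD. Qed.

Lemma cmodN (z : C) : cmod (- z) = cmod z.
Proof. exact: normcN. Qed.

Lemma cmodBC (z w : C) : cmod (z - w) = cmod (w - z).
Proof. by rewrite -cmodN opprB. Qed.

Lemma cmodM (z w : C) : cmod (z * w) = cmod z * cmod w.
Proof. exact: ComplexField.Normc.normcM. Qed.

Lemma cmodV (z : C) : cmod z^-1 = (cmod z)^-1.
Proof. exact: ComplexField.Normc.normcV. Qed.

Lemma cmodX (z : C) n : cmod (z ^+ n) = cmod z ^+ n.
Proof.
elim: n => [|n IH]; first exact: ComplexField.Normc.normc1.
by rewrite !exprS cmodM IH.
Qed.

Lemma cmod0 : cmod (0 : C) = 0.
Proof. exact: ComplexField.Normc.normc0. Qed.

Lemma cmod1 : cmod (1 : C) = 1.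
Proof. exact: ComplexField.Normc.normc1. Qed.

Lemma cmod_eq0 (z : C) : (cmod z == 0) = (z == 0).
Proof.
apply/eqP/eqP => [|->]; last exact: cmod0.
exact: ComplexField.Normc.eq0_normc.
Qed.

Lemma cmod_gt0 (z : C) : (0 < cmod z) = (z != 0).
Proof. by rewrite lt_neqAle cmod_ge0 andbT eq_sym cmod_eq0. Qed.

Lemma cmod_real (x : R) : cmod x%:C = `|x|.
Proof. by rewrite /cmod /= expr0n /= addr0 sqrtr_sqr. Qed.

Lemma cmodB_le (z w : C) : cmod z - cmod w <= cmod (z - w).
Proof. by rewrite lerBlDr (le_trans _ (cmodD _ _)) // subrK. Qed.

Lemma cmod_triangle (w z v : C) : cmod (z - v) <= cmod (z - w) + cmod (w - v).
Proof. by rewrite (le_trans _ (cmodD _ _)) // addrA subrK. Qed.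

Lemma cmod_sum (I : Type) (r : seq I) (P : pred I) (F : I -> C) :
  cmod (\sum_(i <- r | P i) F i) <= \sum_(i <- r | P i) cmod (F i).
Proof.
elim/big_ind2: _ => [|z x w y zx wy|//]; first by rewrite cmod0.
by rewrite (le_trans (cmodD _ _)) // lerD.
Qed.

Lemma Re_le_cmod (z : C) : `|complex.Re z| <= cmod z.
Proof.
case: z => a b; rewrite /cmod /= -sqrtr_sqr ler_sqrt ?addr_ge0 ?sqr_ge0 //.
by rewrite lerDl sqr_ge0.
Qed.

Lemma Im_le_cmod (z : C) : `|complex.Im z| <= cmod z.
Proof.
case: z => a b; rewrite /cmod /= -sqrtr_sqr ler_sqrt ?addr_ge0 ?sqr_ge0 //.
by rewrite lerDr sqr_ge0.
Qed.

Lemma cmod_le_ReIm (z : C) : cmod z <= `|complex.Re z| + `|complex.Im z|.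
Proof.
rewrite {1}[z]complexE (le_trans (cmodD _ _)) // cmodM !cmod_real.
have -> : cmod 'i%C = 1 by rewrite /cmod /= expr0n /= add0r expr1n sqrtr1.
by rewrite mul1r.
Qed.

Lemma ReD (z w : C) : complex.Re (z + w) = complex.Re z + complex.Re w.
Proof. by case: z; case: w. Qed.

Lemma ImD (z w : C) : complex.Im (z + w) = complex.Im z + complex.Im w.
Proof. by case: z; case: w. Qed.

Lemma ReN (z : C) : complex.Re (- z) = - complex.Re z.
Proof. by case: z. Qed.

Lemma ImN (z : C) : complex.Im (- z) = - complex.Im z.
Proof. by case: z. Qed.

Lemma ReM (z w : C) : complex.Re (z * w) =
  complex.Re z * complex.Re w - complex.Im z * complex.Im w.
Proof. by case: z; case: w. Qed.

Lemma ImM (z w : C) : complex.Im (z * w) =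
  complex.Re z * complex.Im w + complex.Im z * complex.Re w.
Proof. by case: z => a b; case: w => c d /=; ring. Qed.

Definition ReE := (ReD, ReN, ReM, ImD, ImN, ImM).

Lemma complex_ext (z w : C) :
  complex.Re z = complex.Re w -> complex.Im z = complex.Im w -> z = w.
Proof. by case: z => a b; case: w => c d /= -> ->. Qed.

Lemma nearCP (z : C) (P : C -> Prop) :
  (\forall w \near z, P w) <->
  exists2 d : R, 0 < d & forall w, cmod (w - z) < d -> P w.
Proof.
rewrite nbhs_normP; split.
- move=> [[d d'] /= ]; rewrite ltcE /= => /andP[/eqP d'0 d0] dP.
  exists d => // w wz; apply: dP => /=.
  by rewrite -opprB normrN cmodE ltcE /= d'0 eqxx.
- move=> [d d0 dP]; exists d%:C; first by rewrite /= ltcR.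
  by move=> w /=; rewrite -opprB normrN cmodE ltcR; exact: dP.
Qed.

Lemma nearRP (t : R) (P : R -> Prop) :
  (\forall u \near t, P u) <->
  exists2 d : R, 0 < d & forall u, `|u - t| < d -> P u.
Proof.
rewrite nbhs_normP; split=> -[d d0 dP]; exists d => // u ut; apply: dP => /=.
  by rewrite distrC.
by move: ut; rewrite /= distrC.
Qed.

Lemma near_puncturedCP (z : C) (P : C -> Prop) :
  (\forall w \near z^', P w) <->
  exists2 d : R, 0 < d & forall w, cmod (w - z) < d -> w != z -> P w.
Proof. by rewrite -nearCP. Qed.

End Modulus.

(** * Derivatives relative to a coordinate *)

Section RelativeDerivative.
Context (R : realType).
Local Notation C := R[i].

Definition cont_at (T : topologicalType) (u : T -> C) (p : T) : Prop :=
  forall eps : R, 0 < eps -> \forall q \near p, cmod (u q - u p) <= eps.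

(** The derivative of u with respect to x at p. One notion serves three times: with x
    the identity of R[i] it is the complex derivative, with x the inclusion of R in R[i]
    the derivative along the real line, and with x a chart the coefficient of du on dx.
    The factor |x q - x p| in place of a quotient makes the rules of calculus hold where
    x is not injective. *)
Definition rder (T : topologicalType) (x u : T -> C) (p : T) (d : C) : Prop :=
  forall eps : R, 0 < eps ->
    \forall q \near p, cmod (u q - u p - (x q - x p) * d) <= eps * cmod (x q - x p).

Section Rules.
Context (T : topologicalType) (x : T -> C) (p : T).
Hypothesis xp : cont_at x p.
Implicit Types (u v : T -> C).

Lemma cont_at_nearP u : cont_at u p <->
  forall eps : R, 0 < eps -> \forall q \near p, cmod (u q - u p) < eps.
Proof.
split=> uc e e0.
  have e20 : 0 < e / 2 by rewrite divr_gt0.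
  by apply: filterS (uc _ e20) => q /le_lt_trans; apply; rewrite ltr_pdivrMr // ltr_pMr // ltr1n.
by apply: filterS (uc _ e0) => q /ltW.
Qed.

Lemma rder_lip u d : rder x u p d -> \forall q \near p,
  cmod (u q - u p) <= (cmod d + 1) * cmod (x q - x p).
Proof.
move=> /(_ 1 ltr01); apply: filterS => q uq.
have := cmodB_le (u q - u p) ((x q - x p) * d).
rewrite cmodM => h; move: uq; rewrite mul1r => uq; rewrite mulrDl mul1r [cmod d * _]mulrC.
by move: (le_trans h uq); rewrite lerBlDl.
Qed.

Lemma rder_cont u d : rder x u p d -> cont_at u p.
Proof.
move=> /rder_lip ud e e0.
have d1 : 0 < cmod d + 1 by rewrite ltr_wpDl ?cmod_ge0.
have ed : 0 < e / (cmod d + 1) by rewrite divr_gt0.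
apply: filterS2 ud (xp ed) => q uq xq; rewrite (le_trans uq) //.
by rewrite mulrC -ler_pdivlMr.
Qed.

Lemma cont_bounded u : cont_at u p -> \forall q \near p, cmod (u q) <= cmod (u p) + 1.
Proof.
move=> /(_ 1 ltr01); apply: filterS => q uq.
by rewrite -lerBlDl (le_trans (cmodB_le _ _)).
Qed.

Lemma rder_cst c : rder x (fun=> c) p 0.
Proof.
move=> e e0; near=> q; rewrite subrr mulr0 subr0 cmod0 mulr_ge0 ?cmod_ge0 //.
exact: ltW.
Unshelve. all: by end_near. Qed.

Lemma rder_id : rder x x p 1.
Proof.
move=> e e0; near=> q; rewrite mulr1 subrr cmod0 mulr_ge0 ?cmod_ge0 //.
exact: ltW.
Unshelve. all: by end_near. Qed.

Lemma rder_eq u d d' : d = d' -> rder x u p d -> rder x u p d'.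
Proof. by move=> ->. Qed.

Lemma rder_near u v d : (\forall q \near p, u q = v q) -> rder x u p d -> rder x v p d.
Proof.
move=> uv ud e e0; have uvp : u p = v p by exact: nbhs_singleton uv.
by apply: filterS2 uv (ud _ e0) => q <-; rewrite uvp.
Qed.

Lemma rderD u v d d' : rder x u p d -> rder x v p d' ->
  rder x (fun q => u q + v q) p (d + d').
Proof.
move=> ud vd e e0; have e20 : 0 < e / 2 by rewrite divr_gt0.
apply: filterS2 (ud _ e20) (vd _ e20) => q uq vq.
have -> : u q + v q - (u p + v p) - (x q - x p) * (d + d') =
  (u q - u p - (x q - x p) * d) + (v q - v p - (x q - x p) * d') by ring.
by rewrite (le_trans (cmodD _ _)) // (le_trans (lerD uq vq)) // -mulrDl -splitr.
Qed.

Lemma rderZ u d c : rder x u p d -> rder x (fun q => c * u q) p (c * d).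
Proof.
move=> ud e e0.
have c1 : 0 < cmod c + 1 by rewrite ltr_wpDl ?cmod_ge0.
have ec : 0 < e / (cmod c + 1) by rewrite divr_gt0.
apply: filterS (ud _ ec) => q uq.
have -> : c * u q - c * u p - (x q - x p) * (c * d) =
  c * (u q - u p - (x q - x p) * d) by ring.
rewrite cmodM (le_trans (ler_wpM2l (cmod_ge0 _) uq)) // mulrA ler_wpM2r ?cmod_ge0 //.
by rewrite mulrCA ger_pMr // ler_pdivrMr // mul1r lerDl.
Qed.

Lemma rderN u d : rder x u p d -> rder x (fun q => - u q) p (- d).
Proof.
move=> /(rderZ (-1)); rewrite mulN1r; apply: rder_near.
by apply: nearW => q; rewrite mulN1r.
Qed.

Lemma rderB u v d d' : rder x u p d -> rder x v p d' ->
  rder x (fun q => u q - v q) p (d - d').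
Proof. by move=> ud /rderN vd; exact: rderD. Qed.

Lemma rderM u v d d' : rder x u p d -> rder x v p d' ->
  rder x (fun q => u q * v q) p (d * v p + u p * d').
Proof.
move=> ud vd e e0; have uc := rder_cont ud.
set K := cmod (u p) + 1 + cmod (v p) + cmod d' + 1.
have K0 : 0 < K.
  by move: (cmod_ge0 (u p)) (cmod_ge0 (v p)) (cmod_ge0 d'); rewrite /K; lra.
have eK : 0 < e / K by rewrite divr_gt0.
near=> q.
have -> : u q * v q - u p * v p - (x q - x p) * (d * v p + u p * d') =
  u q * (v q - v p - (x q - x p) * d') + (u q - u p) * ((x q - x p) * d') +
  (u q - u p - (x q - x p) * d) * v p by ring.
have uq : cmod (u q - u p - (x q - x p) * d) <= e / K * cmod (x q - x p).
  by near: q; exact: ud.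
have vq : cmod (v q - v p - (x q - x p) * d') <= e / K * cmod (x q - x p).
  by near: q; exact: vd.
have ub : cmod (u q) <= cmod (u p) + 1 by near: q; exact: cont_bounded.
have uqp : cmod (u q - u p) <= e / K by near: q; exact: uc.
have X0 := cmod_ge0 (x q - x p).
have h1 : cmod (u q * (v q - v p - (x q - x p) * d')) <=
    (cmod (u p) + 1) * (e / K * cmod (x q - x p)).
  by rewrite cmodM ler_pM ?cmod_ge0.
have h2 : cmod ((u q - u p) * ((x q - x p) * d')) <=
    cmod d' * (e / K * cmod (x q - x p)).
  rewrite !cmodM mulrA mulrC; apply: ler_wpM2l; first exact: cmod_ge0.
  by rewrite ler_wpM2r.
have h3 : cmod ((u q - u p - (x q - x p) * d) * v p) <=
    cmod (v p) * (e / K * cmod (x q - x p)).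
  by rewrite cmodM mulrC ler_pM ?cmod_ge0.
apply: (le_trans (cmodD _ _)); apply: le_trans (lerD (cmodD _ _) (lexx _)) _.
apply: le_trans (lerD (lerD h1 h2) h3) _; rewrite -!mulrDl mulrA.
apply: ler_wpM2r => //; rewrite mulrCA ger_pMr // ler_pdivrMr // mul1r /K.
by rewrite addrAC lerDl.
Unshelve. all: by end_near. Qed.

Lemma rderV u d : u p != 0 -> rder x u p d ->
  rder x (fun q => (u q)^-1) p (- d / u p ^+ 2).
Proof.
move=> up0 ud; have uc := rder_cont ud.
have m0 : 0 < cmod (u p) by rewrite cmod_gt0.
have m20 : 0 < cmod (u p) / 2 by rewrite divr_gt0.
move=> e e0.
set k := cmod (u p) ^+ 2 / 2.
have k0 : 0 < k by rewrite divr_gt0 ?exprn_gt0.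
have e10 : 0 < e / 2 * k by apply: mulr_gt0 => //; exact: divr_gt0.
set e2 := e / 2 * k * cmod (u p) / (cmod d + 1).
have d1 : 0 < cmod d + 1 by rewrite ltr_wpDl ?cmod_ge0.
have e20 : 0 < e2 by apply: divr_gt0 => //; exact: mulr_gt0.
near=> q.
have uqp : cmod (u q - u p) <= cmod (u p) / 2 by near: q; exact: uc.
have uq : cmod (u p) / 2 <= cmod (u q).
  have := cmodB_le (u p) (u q); rewrite cmodBC => h.
  have := le_trans h uqp; rewrite lerBlDr => h'.
  by rewrite -(lerD2l (cmod (u p) / 2)) -splitr.
have uq0 : u q != 0 by rewrite -cmod_gt0 (lt_le_trans _ uq).
have h1 : cmod (u q - u p - (x q - x p) * d) <= e / 2 * k * cmod (x q - x p).
  by near: q; exact: ud.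
have h2 : cmod (u q - u p) <= e2 by near: q; exact: uc.
have -> : (u q)^-1 - (u p)^-1 - (x q - x p) * (- d / u p ^+ 2) =
   (- (u q - u p - (x q - x p) * d) + (u q - u p) * (x q - x p) * d / u p) / (u q * u p).
  by field; rewrite up0 uq0.
rewrite cmodM cmodV ler_pdivrMr ?cmod_gt0 ?mulf_neq0 //.
have kq : k <= cmod (u q * u p).
  by rewrite cmodM /k expr2 -mulrA [_ / 2]mulrC mulrA ler_wpM2r ?cmod_ge0 // mulrC.
have X0 := cmod_ge0 (x q - x p).
apply: (@le_trans _ _ (e * cmod (x q - x p) * k)); last first.
  by rewrite ler_wpM2l // mulr_ge0 // ltW.
rewrite (le_trans (cmodD _ _)) // cmodN.
have h3 : cmod ((u q - u p) * (x q - x p) * d / u p) <= e / 2 * k * cmod (x q - x p).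
  rewrite 3!cmodM cmodV ler_pdivrMr // [leRHS]mulrAC.
  apply: (@le_trans _ _ (e2 * cmod (x q - x p) * (cmod d + 1))).
    by rewrite !ler_pM ?mulr_ge0 ?cmod_ge0 // lerDl.
  by rewrite [leLHS]mulrAC {1}/e2 divfK // lt0r_neq0.
apply: le_trans (lerD h1 h3) _; rewrite le_eqVlt; apply/orP; left; apply/eqP; field.
Unshelve. all: by end_near. Qed.

(** The hypothesis says that x p is not an isolated value of x; it is needed because
    rder says nothing at the points where x takes the value x p. *)
Lemma rder_uniq u d d' : (forall P : T -> Prop, (\forall q \near p, P q) ->
    exists2 q, P q & x q != x p) ->
  rder x u p d -> rder x u p d' -> d = d'.
Proof.
move=> xn ud ud'; apply/eqP; rewrite -subr_eq0 -cmod_eq0; apply/negPn/negP => dd.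
have {}dd : 0 < cmod (d - d') by rewrite lt_neqAle cmod_ge0 eq_sym dd.
have e0 : 0 < cmod (d - d') / 4 by rewrite divr_gt0.
have [q [uq uq'] xq] := xn _ (filterS2 _ (fun q a b => conj a b) (ud _ e0) (ud' _ e0)).
have xq0 : 0 < cmod (x q - x p) by rewrite cmod_gt0 subr_eq0.
have := le_trans (cmodD _ _) (lerD uq' (le_trans _ uq)).
move=> /(_ (- (u q - u p - (x q - x p) * d))); rewrite cmodN => /(_ (lexx _)).
have -> : u q - u p - (x q - x p) * d' - (u q - u p - (x q - x p) * d) =
  (x q - x p) * (d - d') by ring.
rewrite cmodM -mulrDl [leLHS]mulrC ler_pM2r // => h.
move: dd; rewrite ltNge => /negP; apply; lra.
Qed.

End Rules.

Lemma rder_comp (T S : topologicalType) (x : T -> C) (y v : S -> C) (h : T -> S)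
    (p : T) (c d : C) :
  {for p, continuous h} -> rder x (y \o h) p c -> rder y v (h p) d ->
  rder x (v \o h) p (c * d).
Proof.
move=> hc yc vd e e0.
have d1 : 0 < cmod d + 1 by rewrite ltr_wpDl ?cmod_ge0.
have c1 : 0 < cmod c + 1 by rewrite ltr_wpDl ?cmod_ge0.
have e10 : 0 < e / 2 / (cmod c + 1) by rewrite !divr_gt0.
have e20 : 0 < e / 2 / (cmod d + 1) by rewrite !divr_gt0.
have vh : \forall q \near p,
    cmod (v (h q) - v (h p) - (y (h q) - y (h p)) * d) <=
    e / 2 / (cmod c + 1) * cmod (y (h q) - y (h p)).
  exact: hc _ (vd _ e10).
near=> q.
have h1 : cmod (v (h q) - v (h p) - (y (h q) - y (h p)) * d) <=
    e / 2 / (cmod c + 1) * cmod (y (h q) - y (h p)) by near: q.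
have h2 : cmod (y (h q) - y (h p)) <= (cmod c + 1) * cmod (x q - x p).
  by near: q; exact: (rder_lip yc).
have h3 : cmod (y (h q) - y (h p) - (x q - x p) * c) <=
    e / 2 / (cmod d + 1) * cmod (x q - x p) by near: q; exact: yc.
rewrite /=.
have -> : v (h q) - v (h p) - (x q - x p) * (c * d) =
  (v (h q) - v (h p) - (y (h q) - y (h p)) * d) +
  (y (h q) - y (h p) - (x q - x p) * c) * d by ring.
have X0 := cmod_ge0 (x q - x p).
rewrite (le_trans (cmodD _ _)) // cmodM [e in leRHS]splitr [leRHS]mulrDl lerD //.
  apply: (le_trans h1); have -> : e / 2 * cmod (x q - x p) =
    e / 2 / (cmod c + 1) * ((cmod c + 1) * cmod (x q - x p)).
    by field; exact: lt0r_neq0.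
  by apply: ler_wpM2l; rewrite ?(ltW e10).
rewrite -[leRHS](divfK (lt0r_neq0 d1)) ler_pM ?cmod_ge0 //; last by rewrite lerDl.
by rewrite mulrAC.
Unshelve. all: by end_near. Qed.

Lemma cont_at_id z : cont_at (id : C -> C) z.
Proof. by move=> e e0; apply/nearCP; exists e => // w /ltW. Qed.

Lemma cont_at_real t : cont_at (fun t : R => t%:C) t.
Proof.
by move=> e e0; apply/nearRP; exists e => // w /ltW; rewrite -rmorphB cmod_real.
Qed.

(** The topology of R[i] is that of its norm, so continuity is the condition on cmod. *)
Lemma cont_atE (T : topologicalType) (u : T -> C) p :
  {for p, continuous u} <-> cont_at u p.
Proof.
split=> [uc e e0|uc P /= /nearCP[d d0 dP]].
  by apply: (uc [set w | cmod (w - u p) <= e]); apply/nearCP; exists e => // w /ltW.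
rewrite /nbhs /=; move/cont_at_nearP: uc => /(_ _ d0).
by apply: filterS => q /dP.
Qed.

Lemma rderC_uniq (u : C -> C) z d d' : rder id u z d -> rder id u z d' -> d = d'.
Proof.
apply: rder_uniq => P /nearCP[e e0 eP].
exists (z + (e / 2)%:C); last by rewrite -subr_eq0 addrAC subrr add0r -cmod_eq0 cmod_real gt_eqF // normr_gt0 gt_eqF // divr_gt0.
apply: eP; rewrite addrAC subrr add0r cmod_real gtr0_norm ?divr_gt0 //.
by rewrite ltr_pdivrMr // ltr_pMr // ltr1n.
Qed.

Lemma rderR_uniq (u : R -> C) t d d' :
  rder (real_complex R) u t d -> rder (real_complex R) u t d' -> d = d'.
Proof.
apply: rder_uniq => P /nearRP[e e0 eP].
exists (t + (e / 2)); last first.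
  by rewrite -subr_eq0 -rmorphB -cmod_eq0 cmod_real addrAC subrr add0r gt_eqF // normr_gt0 gt_eqF // divr_gt0.
apply: eP; rewrite addrAC subrr add0r gtr0_norm ?divr_gt0 //.
by rewrite ltr_pdivrMr // ltr_pMr // ltr1n.
Qed.

Lemma derivable_rder (u : C -> C) z : derivable u z 1 -> rder id u z (derive1 u z).
Proof.
move=> du e e0; rewrite derive1E.
have /cvg_ex[l ul] := du.
have -> : 'D_1 u z = l by apply/cvg_lim => //.
have /ul : nbhs l [set w | cmod (w - l) < e] by apply/nearCP; exists e.
move=> /near_puncturedCP[d d0 dP]; apply/nearCP; exists d => // w wz.
have [->|wz0] := eqVneq w z; first by rewrite !subrr mul0r subr0 cmod0 mulr0.
have wz0' : w - z != 0 by rewrite subr_eq0.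
have := dP (w - z); rewrite subr0 => /(_ wz wz0') /=.
rewrite /GRing.scale /= mulr1 subrK => /ltW h.
have -> : u w - u z - (w - z) * l = ((w - z)^-1 * (u w - u z) - l) * (w - z).
  by rewrite [RHS]mulrBl mulrAC mulVf // mul1r [l * _]mulrC.
by rewrite cmodM ler_wpM2r ?cmod_ge0.
Qed.

Lemma rderRP (u : R -> C) t d : rder (real_complex R) u t d <->
  is_derive t 1 (@complex.Re R \o u) (complex.Re d) /\
  is_derive t 1 (@complex.Im R \o u) (complex.Im d).
Proof.
have aux (v : R -> R) l : is_derive t 1 v l <-> forall e : R, 0 < e -> \forall q \near t,
    `|v q - v t - (q - t) * l| <= e * `|q - t|.
  split=> [[dv vl] e e0|vl].
    have /cvg_ex[l' ul] := dv.
    have ll' : l = l' by rewrite -vl; apply/cvg_lim.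
    have /ul : nbhs l' [set w | `|w - l'| < e] by apply/nearRP; exists e.
    move=> /nbhs_normP[e' /= e'0 eP]; apply/nearRP; exists e' => // q qt.
    have [->|qt0] := eqVneq q t; first by rewrite !subrr mul0r subr0 normr0 mulr0.
    have qt0' : q - t != 0 by rewrite subr_eq0.
    have := eP (q - t); rewrite /= sub0r normrN => /(_ qt qt0') /=.
    rewrite /GRing.scale /= mulr1 subrK => /ltW h.
    have -> : v q - v t - (q - t) * l = ((q - t)^-1 * (v q - v t) - l) * (q - t).
      by rewrite [RHS]mulrBl mulrAC mulVf // mul1r [l * _]mulrC.
    by rewrite normrM ler_wpM2r // ll'.
  have cv : h^-1 *: ((v \o shift t) (h *: 1) - v t) @[h --> 0^'] --> l.
    apply/cvgrPdist_le => e e0; near=> h.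
    have h0 : h != 0 by near: h; exact: nbhs_dnbhs_neq.
    have : `|v (h + t) - v t - h * l| <= e * `|h|.
      near: h; apply: nbhs_dnbhs.
      have /nearRP[d' d'0 d'P] := vl _ e0.
      apply/nearRP; exists d' => // w; rewrite subr0 => wd.
      by have := d'P (w + t); rewrite addrK; apply.
    rewrite /GRing.scale /= mulr1 => hh.
    have -> : l - h^-1 * (v (h + t) - v t) = - (h^-1 * (v (h + t) - v t - h * l)).
      by field.
    by rewrite normrN normrM normfV mulrC ler_pdivrMr ?normr_gt0.
  split; first by apply/cvg_ex; exists l.
  exact/cvg_lim.
rewrite !aux; split=> [ud|[udr udi] e e0].
  split=> e e0; apply: filterS (ud _ e0) => q; rewrite -rmorphB cmod_real => /(le_trans _); apply.
    by rewrite (le_trans _ (Re_le_cmod _)) // !ReE /= mul0r subr0.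
  by rewrite (le_trans _ (Im_le_cmod _)) // !ReE /= mul0r addr0.
have e20 : 0 < e / 2 by rewrite divr_gt0.
apply: filterS2 (udr _ e20) (udi _ e20) => q h1 h2.
rewrite -rmorphB cmod_real (le_trans (cmod_le_ReIm _)) // !ReE /= !mul0r subr0 addr0.
by rewrite (le_trans (lerD h1 h2)) // -mulrDl -splitr.
Unshelve. all: by end_near. Qed.

End RelativeDerivative.

(** * The complex exponential *)

Section Exponential.
Context (R : realType).
Local Notation C := R[i].
Local Notation rc := (real_complex R).

Lemma expCD (z w : C) : expC (z + w) = expC z * expC w.
Proof.
case: z => a b; case: w => c d; rewrite /expC /= expRD cosD sinD.
by apply: complex_ext; rewrite !ReE /=; ring.
Qed.

Lemma expC0 : expC 0 = 1 :> C.
Proof. by apply: complex_ext; rewrite /expC !ReE /= expR0 cos0 sin0; ring. Qed.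

Lemma expCN (z : C) : expC (- z) = (expC z)^-1.
Proof.
have h : expC z * expC (- z) = 1 by rewrite -expCD subrr expC0.
have z0 : expC z != 0 by apply: contra_eq_neq h => ->; rewrite mul0r eq_sym oner_eq0.
by apply: (mulfI z0); rewrite h divff.
Qed.

Lemma expC_neq0 (z : C) : expC z != 0.
Proof.
have h : expC z * expC (- z) = 1 by rewrite -expCD subrr expC0.
by apply: contra_eq_neq h => ->; rewrite mul0r eq_sym oner_eq0.
Qed.

Lemma cmod_expC (z : C) : cmod (expC z) = expR (complex.Re z).
Proof.
rewrite /expC cmodM cmod_real ger0_norm ?expR_ge0 //.
by rewrite /cmod /= cos2Dsin2 sqrtr1 mulr1.
Qed.

Lemma expC_real (x : R) : expC x%:C = (expR x)%:C.
Proof. by rewrite /expC /= cos0 sin0 mulr1. Qed.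

(** exp (a + i b) - 1 splits into the real exponential, the circle, and a product of
    order 2. *)
Lemma rder_expC0 : rder id (@expC R) 0 1.
Proof.
have dE : rder rc (fun t => (expR t)%:C) 0 1.
  apply/rderRP; split => /=; last exact: is_derive_cst.
  by apply: is_derive_eq; rewrite expR0.
have dK : rder rc (fun t => (cos t +i* sin t : C)) 0 'i%C.
  apply/rderRP; split => /=.
    by apply: is_derive_eq; rewrite sin0 oppr0.
  by apply: is_derive_eq; rewrite cos0.
move=> e e0.
have e40 : 0 < e / 4 by rewrite divr_gt0.
have [d1 d10 h1] := (nearRP _ _).1 (dE _ e40).
have [d2 d20 h2] := (nearRP _ _).1 (dK _ e40).
have [d3 d30 h3] := (nearRP _ _).1 (rder_lip dE).
have [d4 d40 h4] := (nearRP _ _).1 (rder_lip dK).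
apply/nearCP; exists (Num.min (Num.min d1 d2) (Num.min (Num.min d3 d4) (e / 8))).
  by rewrite !lt_min d10 d20 d30 d40 divr_gt0.
move=> [a b] /=; rewrite !subr0 !lt_min => /andP[/andP[z1 z2] /andP[/andP[z3 z4] z5]].
have ha := Re_le_cmod (a +i* b); have hb := Im_le_cmod (a +i* b).
rewrite /= in ha hb.
have {}h1 := h1 a; have {}h2 := h2 b; have {}h3 := h3 a; have {}h4 := h4 b.
rewrite !subr0 in h1 h2 h3 h4.
have {}h1 := h1 (le_lt_trans ha z1); have {}h2 := h2 (le_lt_trans hb z2).
have {}h3 := h3 (le_lt_trans ha z3); have {}h4 := h4 (le_lt_trans hb z4).
move: h1 h2 h3 h4; rewrite !(cmod_real, cmod1, normr1) expR0 cos0 sin0.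
have -> : cmod ('i%C : C) = 1 by rewrite /cmod /= expr0n /= add0r expr1n sqrtr1.
have -> : (1 +i* 0 : C) = 1 by [].
set E := (expR a)%:C; set K := (cos b +i* sin b : C) => h1 h2 h3 h4.
rewrite expC0; have -> : expC (a +i* b) = E * K by [].
have -> : E * K - 1 - (a +i* b) * 1 = (E - 1 - a%:C * 1) + (K - 1 - b%:C * 'i%C) +
   (E - 1) * (K - 1).
  have -> : (a +i* b : C) = a%:C + b%:C * 'i%C by apply: complex_ext; rewrite !ReE /=; ring.
  ring.
apply: (le_trans (cmodD _ _)); rewrite cmodM.
have h34 : cmod (E - 1) * cmod (K - 1) <= e / 2 * cmod (a +i* b).
  apply: (@le_trans _ _ (2 * `|a| * (2 * `|b|))).
    by apply: ler_pM; rewrite ?cmod_ge0.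
  have : `|a| * `|b| <= e / 8 * cmod (a +i* b).
    by apply: ler_pM => //; rewrite (le_trans ha) // ltW.
  by lra.
have h12 := le_trans (cmodD _ _) (lerD h1 h2).
have ea : e / 4 * `|a| <= e / 4 * cmod (a +i* b) by rewrite ler_wpM2l // ltW.
have eb : e / 4 * `|b| <= e / 4 * cmod (a +i* b) by rewrite ler_wpM2l // ltW.
by lra.
Qed.

Lemma rder_expC (z : C) : rder id (@expC R) z (expC z).
Proof.
move=> e e0; have c0 : 0 < cmod (expC z) by rewrite cmod_gt0 expC_neq0.
have ec0 : 0 < e / cmod (expC z) by rewrite divr_gt0.
have [d d0 dP] := (nearCP _ _).1 (rder_expC0 ec0).
apply/nearCP; exists d => // w wz.
have := dP (w - z); rewrite subr0 => /(_ wz).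
have -> : expC w = expC z * expC (w - z) by rewrite -expCD addrC subrK.
rewrite expC0 mulr1 => h.
have -> : expC z * expC (w - z) - expC z - (w - z) * expC z =
  expC z * (expC (w - z) - 1 - (w - z)) by ring.
by rewrite cmodM mulrC -ler_pdivlMr // mulrAC.
Qed.

(** The exponential is injective near 0: exp w - 1 - w is small compared with w. *)
Lemma expC_eq1_near0 : \forall w \near (0 : C), expC w = 1 -> w = 0.
Proof.
have e0 : 0 < 2^-1 :> R by rewrite invr_gt0.
apply: filterS (rder_expC0 e0) => w h w1; move: h.
rewrite w1 expC0 !subr0 subrr sub0r mulr1 cmodN => h.
apply/eqP; rewrite -cmod_eq0 eq_le cmod_ge0 andbT.
by move: h; set m := cmod w; lra.
Qed.

Lemma unit_circleE (t : R) : unit_circle t = expC (0 +i* (2 * pi * t)).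
Proof. by rewrite /unit_circle /expC /= expR0 mul1r. Qed.

Lemma expC_2pi : expC (0 +i* (2 * pi)) = 1 :> C.
Proof.
rewrite /expC /= expR0 mulr_natl cos2pi sin2pi.
by apply: complex_ext; rewrite !ReE /=; ring.
Qed.

End Exponential.

(** * Integrals of complex functions on the real line *)

Section LineIntegral.
Context (R : realType).
Local Notation C := R[i].
Local Notation rc := (real_complex R).

(** The fundamental theorem of calculus gives a primitive on each [-n, n]; normalised at
    0, these agree where they are both defined. *)
Lemma prim_exR (c : R -> R) : continuous c ->
  exists D : R -> R, forall t, is_derive t (1 : R) D (c t).
Proof.
move=> cc.
have ci (a b : R) : lebesgue_measure.-integrable `[a, b] (EFin \o c).
  apply: continuous_compact_integrable; first exact: segment_compact.
  by apply: continuous_subspaceT.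
have loc (n : nat) : exists D : R -> R, forall t : R, - n%:R < t < n%:R -> is_derive t (1 : R) D (c t).
  exists (fun x => \int[lebesgue_measure]_(t in `[- n%:R, x]) c t).
  move=> t /andP[t1 t2]; have [] := @continuous_FTC1_closed R c (- n%:R) t n%:R t2 (ci _ _) t1 (cc t).
  by move=> d1 d2; rewrite -d2 derive1E; exact: DeriveDef.
have [G GP] := choice loc.
pose D t := let n := (Num.truncn `|t|).+2 in G n t - G n 0.
have GD n t : - n%:R < t < n%:R -> forall m, - m%:R < t < m%:R -> G n t - G n 0 = G m t - G m 0.
  suff H n' m : (n' <= m)%N -> - n'%:R < t < n'%:R -> G n' t - G n' 0 = G m t - G m 0.
    by move=> tn m tm; have [nm|/ltnW nm] := leqP n m; [exact: H|symmetry; exact: H].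
  move=> nm /andP[t1 t2].
  have n0 : (0 : R) < n'%:R by lra.
  have nm' : (n'%:R : R) <= m%:R by rewrite ler_nat.
  suff : G n' t - G m t = G n' 0 - G m 0 by move=> h; lra.
  have dd (x : R) : - n'%:R < x < n'%:R -> is_derive x (1 : R) (fun t => G n' t - G m t) 0.
    move=> /andP[x1 x2].
    have h1 : is_derive x (1 : R) (G n') (c x) by apply: GP; rewrite x1 x2.
    have h2 : is_derive x (1 : R) (G m) (c x) by apply: GP; apply/andP; split; lra.
    by apply: is_derive_eq; rewrite subrr.
  have aux (a b : R) : - n'%:R < a -> a < b -> b < n'%:R -> G n' a - G m a = G n' b - G m b.
    move=> na ab bn.
    have [x|x|x] := @MVT R (fun t => G n' t - G m t) (fun=> 0) a b ab.
    - by rewrite in_itv /= => /andP[x1 x2]; apply: dd; apply/andP; split; lra.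
    - move: x; apply: derivable_within_continuous => x; rewrite in_itv /= => /andP[x1 x2].
      by have [] : is_derive x (1 : R) (fun t => G n' t - G m t) 0 by apply: dd; apply/andP; split; lra.
    - by move=> _; rewrite mul0r => h; apply/eqP; rewrite -subr_eq0 -oppr_eq0 opprB h.
  have [t0|t0|->//] := ltgtP t 0; [exact: aux|].
  by symmetry; apply: aux => //; lra.
exists D => t.
pose n := (Num.truncn `|t|).+3.
have tn : `|t| + 1 < n%:R.
  rewrite /n -natr1 ltrD2r.
  have := truncnS_gt `|t|; rewrite -natr1 => h.
  by rewrite -!natr1; lra.
have h : is_derive t (1 : R) (fun t => G n t - G n 0) (c t).
  have hG : is_derive t (1 : R) (G n) (c t).
    by apply: GP; move: tn; rewrite -ltr_norml; lra.
  by apply: is_derive_eq; rewrite subr0.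
apply: (near_eq_is_derive _ h) => //.
apply/nearRP; exists 1 => // u ut; rewrite /D; apply: GD.
  by rewrite -ltr_norml (le_lt_trans _ tn) // -[u](subrK t) (le_trans (ler_normD _ _)) // addrC lerD2l ltW.
have := truncnS_gt `|u|; rewrite -ltr_norml -!natr1; lra.
Qed.

Lemma prim_ex (c : R -> C) : (forall t, cont_at c t) ->
  exists D : R -> C, forall t, rder rc D t (c t).
Proof.
move=> cc.
have [|D1 D1P] := @prim_exR (@complex.Re R \o c).
  move=> t; apply/cvgrPdist_le => e e0; apply: filterS (cc t _ e0) => u.
  by rewrite /= -normrN opprB -ReN -ReD => /(le_trans (Re_le_cmod _)).
have [|D2 D2P] := @prim_exR (@complex.Im R \o c).
  move=> t; apply/cvgrPdist_le => e e0; apply: filterS (cc t _ e0) => u.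
  by rewrite /= -normrN opprB -ImN -ImD => /(le_trans (Im_le_cmod _)).
by exists (fun t => D1 t +i* D2 t) => t; apply/rderRP; split; [exact: D1P|exact: D2P].
Qed.

Lemma rder0_cst (D : R -> C) a b : (forall t, rder rc D t 0) -> D a = D b.
Proof.
move=> dD; apply: complex_ext.
  apply: (@is_derive_0_is_cst R (@complex.Re R \o D)) => t.
  by have /rderRP[] := dD t.
apply: (@is_derive_0_is_cst R (@complex.Im R \o D)) => t.
by have /rderRP[] := dD t.
Qed.

(** The factor 2 comes from treating the real and imaginary parts separately. *)
Lemma cmvt (D c : R -> C) (a b B : R) :
  (forall t, Num.min a b <= t <= Num.max a b -> rder rc D t (c t)) ->
  (forall t, Num.min a b <= t <= Num.max a b -> cmod (c t) <= B) ->
  cmod (D b - D a) <= 2 * B * `|b - a|.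
Proof.
wlog ab : a b / a <= b => [H|].
  move=> h1 h2; have [ab|/ltW ba] := leP a b; first exact: (H a b).
  by rewrite cmodBC distrC; apply: (H b a) => //; rewrite minC maxC.
rewrite min_l // max_r // => dD cB.
move: ab; rewrite le_eqVlt => /orP[/eqP->|ab]; first by rewrite !subrr cmod0 normr0 mulr0.
have aux (p : C -> R) : (forall z, `|p z| <= cmod z) ->
   (forall t, a <= t <= b -> is_derive t (1 : R) (p \o D) (p (c t))) ->
   `|p (D b) - p (D a)| <= B * `|b - a|.
  move=> pz dp.
  have [x|x|x xab /= ->] := @MVT R (p \o D) (p \o c) a b ab.
  - by rewrite in_itv /= => /andP[x1 x2]; apply: dp; rewrite !ltW.
  - move: x; apply: derivable_within_continuous => x; rewrite in_itv /= => xab.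
    by have [] := dp x xab.
  rewrite normrM ler_wpM2r // (le_trans (pz _)) // cB //.
  by move: xab; rewrite in_itv /= => /andP[? ?]; rewrite !ltW.
have h1 : `|complex.Re (D b) - complex.Re (D a)| <= B * `|b - a|.
  by apply: aux => [z|t /dD /rderRP[]//]; exact: Re_le_cmod.
have h2 : `|complex.Im (D b) - complex.Im (D a)| <= B * `|b - a|.
  by apply: aux => [z|t /dD /rderRP[]//]; exact: Im_le_cmod.
rewrite (le_trans (cmod_le_ReIm _)) // !ReE (le_trans (lerD h1 h2)) //.
by rewrite -mulrA mulr_natl mulr2n.
Qed.

Definition prim (c : R -> C) : R -> C :=
  xget (fun=> 0) [set D | forall t, rder rc D t (c t)].

(** The integral from a to b, for either order of a and b, as the increment of a
    primitive. *)
Definition intC (c : R -> C) (a b : R) : C := prim c b - prim c a.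

Lemma primP (c : R -> C) : (forall t, cont_at c t) -> forall t, rder rc (prim c) t (c t).
Proof.
move=> cc; have [D DP] := prim_ex cc.
exact: (@xgetPex _ (fun=> 0) [set D | forall t, rder rc D t (c t)] (ex_intro _ D DP)).
Qed.

Lemma intC_prim (c D : R -> C) a b : (forall t, rder rc D t (c t)) ->
  (forall t, cont_at c t) -> intC c a b = D b - D a.
Proof.
move=> dD cc; rewrite /intC.
have : prim c b - D b = prim c a - D a.
  apply: (@rder0_cst (fun t => prim c t - D t)) => t.
  by apply: rder_eq (subrr _) _; apply: rderB; [exact: primP|exact: dD].
move=> h; apply/eqP; rewrite -subr_eq0; apply/eqP.
have -> : prim c b - prim c a - (D b - D a) = (prim c b - D b) - (prim c a - D a) by ring.
by rewrite h subrr.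
Qed.

Lemma cont_atD (T : topologicalType) (u v : T -> C) p :
  cont_at u p -> cont_at v p -> cont_at (fun q => u q + v q) p.
Proof.
move=> uc vc e e0; have e20 : 0 < e / 2 by rewrite divr_gt0.
apply: filterS2 (uc _ e20) (vc _ e20) => q h1 h2.
have -> : u q + v q - (u p + v p) = (u q - u p) + (v q - v p) by ring.
by rewrite (le_trans (cmodD _ _)) // [e]splitr lerD.
Qed.

Lemma intCD (c c' : R -> C) a b : (forall t, cont_at c t) -> (forall t, cont_at c' t) ->
  intC (fun t => c t + c' t) a b = intC c a b + intC c' a b.
Proof.
move=> cc cc'; rewrite (@intC_prim _ (fun t => prim c t + prim c' t)).
- by rewrite /intC; ring.
- by move=> t; apply: rderD; exact: primP.
- by move=> t; exact: cont_atD.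
Qed.

Lemma intC_bound (c : R -> C) a b B : (forall t, cont_at c t) ->
  (forall t, Num.min a b <= t <= Num.max a b -> cmod (c t) <= B) ->
  cmod (intC c a b) <= 2 * B * `|b - a|.
Proof. by move=> cc cB; apply: cmvt cB => t _; exact: primP. Qed.

End LineIntegral.

(** * Subdivision of rectangles *)

Section Quartering.
Context (R : realType).

(** Subdividing into quarters: a failure of P would persist in a nested sequence
    of rectangles shrinking to a point, near which P holds. *)
Lemma quartering (P : R -> R -> R -> R -> Prop) (x1 x2 y1 y2 : R) :
  x1 <= x2 -> y1 <= y2 ->
  (forall a b c d, x1 <= a -> a <= b -> b <= x2 -> y1 <= c -> c <= d -> d <= y2 ->
     let m := (a + b) / 2 in let n := (c + d) / 2 in
     P a m c n -> P m b c n -> P a m n d -> P m b n d -> P a b c d) ->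
  (forall x y, x1 <= x <= x2 -> y1 <= y <= y2 -> exists2 e : R, 0 < e &
     forall a b c d, x1 <= a -> a <= x <= b -> b <= x2 ->
       y1 <= c -> c <= y <= d -> d <= y2 -> b - a < e -> d - c < e -> P a b c d) ->
  P x1 x2 y1 y2.
Proof.
move=> x12 y12 glue loc; apply: contrapT => nP.
pose Q (s : R * R * (R * R)) := P s.1.1 s.1.2 s.2.1 s.2.2.
pose q1 (s : R * R * (R * R)) := ((s.1.1, (s.1.1 + s.1.2) / 2), (s.2.1, (s.2.1 + s.2.2) / 2)).
pose q2 (s : R * R * (R * R)) := (((s.1.1 + s.1.2) / 2, s.1.2), (s.2.1, (s.2.1 + s.2.2) / 2)).
pose q3 (s : R * R * (R * R)) := ((s.1.1, (s.1.1 + s.1.2) / 2), ((s.2.1 + s.2.2) / 2, s.2.2)).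
pose q4 (s : R * R * (R * R)) := (((s.1.1 + s.1.2) / 2, s.1.2), ((s.2.1 + s.2.2) / 2, s.2.2)).
pose step s := if ~~ `[< Q (q1 s) >] then q1 s else if ~~ `[< Q (q2 s) >] then q2 s
  else if ~~ `[< Q (q3 s) >] then q3 s else q4 s.
pose s n := iter n step ((x1, x2), (y1, y2)).
have stepE t : step t = q1 t \/ step t = q2 t \/ step t = q3 t \/ step t = q4 t.
  by rewrite /step; do 3 (case: ifP => _; first by tauto); tauto.
pose ok (t : R * R * (R * R)) := [/\ x1 <= t.1.1, t.1.1 <= t.1.2, t.1.2 <= x2 &
  [/\ y1 <= t.2.1, t.2.1 <= t.2.2 & t.2.2 <= y2]].
have stepP t : ok t -> [/\ ok (step t),
    [/\ t.1.1 <= (step t).1.1, (step t).1.2 <= t.1.2,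
    t.2.1 <= (step t).2.1 & (step t).2.2 <= t.2.2],
    (step t).1.2 - (step t).1.1 = (t.1.2 - t.1.1) / 2 &
    (step t).2.2 - (step t).2.1 = (t.2.2 - t.2.1) / 2].
  case: t (stepE t) => [[a b] [c d]] h [/= h1 h2 h3 [h4 h5 h6]].
  have [m1 m2] : a <= (a + b) / 2 /\ (a + b) / 2 <= b by split; lra.
  have [m3 m4] : c <= (c + d) / 2 /\ (c + d) / 2 <= d by split; lra.
  have [m5 m6] : x1 <= (a + b) / 2 /\ (a + b) / 2 <= x2.
    by split; [exact: le_trans m1|exact: le_trans h3].
  have [m7 m8] : y1 <= (c + d) / 2 /\ (c + d) / 2 <= y2.
    by split; [exact: le_trans m3|exact: le_trans h6].
  by case: h => [->|[->|[->|->]]] /=; split => //; field.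
have sok n : ok (s n) /\ ~ Q (s n).
  elim: n => [|n [okn nQ]]; first by do !split.
  rewrite /s iterS -/(s n); split; first by have [] := stepP _ okn.
  have [h1 h2 h3 [h4 h5 h6]] := okn.
  rewrite /step; do 3 (case: ifP => [/negP nn|/negbFE/asboolP ?]; first by move/asboolP).
  by move=> Q4; apply: nQ; apply: glue.
have mono n : [/\ (s n).1.1 <= (s n.+1).1.1, (s n.+1).1.2 <= (s n).1.2,
    (s n).2.1 <= (s n.+1).2.1 & (s n.+1).2.2 <= (s n).2.2].
  by have [_ h _ _] := stepP _ (sok n).1.
have wid n : (s n).1.2 - (s n).1.1 = (x2 - x1) / 2 ^+ n /\
    (s n).2.2 - (s n).2.1 = (y2 - y1) / 2 ^+ n.
  elim: n => [|n [h1 h2]]; first by rewrite expr0 !divr1.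
  have [_ _ h3 h4] := stepP _ (sok n).1.
  by rewrite /s iterS -/(s n) exprSr invfM !mulrA -h1 -h2.
have limit (lo hi : nat -> R) : (forall n, lo n <= hi n) -> (forall n, lo n <= lo n.+1) ->
   (forall n, hi n.+1 <= hi n) -> exists x, forall n, lo n <= x <= hi n.
  move=> lh lom him.
  have lo_mono m n : (m <= n)%N -> lo m <= lo n.
    by move=> /subnK <-; elim: (n - m)%N => [|k IH]; rewrite ?add0n // addSn (le_trans IH).
  have hi_mono m n : (m <= n)%N -> hi n <= hi m.
    by move=> /subnK <-; elim: (n - m)%N => [|k IH]; rewrite ?add0n // addSn (le_trans _ IH).
  have lohi m n : lo m <= hi n.
    by rewrite (le_trans (lo_mono _ _ (leq_maxl m n))) // (le_trans (lh _)) // hi_mono // leq_maxr.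
  exists (sup (range lo)) => n; apply/andP; split.
    apply: ub_le_sup; first by exists (hi 0) => _ [k _ <-].
    by exists n.
  by apply: ge_sup; [exists (lo 0), 0|move=> _ [k _ <-]].
have [x xP] := limit (fun n => (s n).1.1) (fun n => (s n).1.2)
  (fun n => let: conj (And4 _ h _ _) _ := sok n in h)
  (fun n => let: And4 h _ _ _ := mono n in h) (fun n => let: And4 _ h _ _ := mono n in h).
have [y yP] := limit (fun n => (s n).2.1) (fun n => (s n).2.2)
  (fun n => let: conj (And4 _ _ _ (And3 _ h _)) _ := sok n in h)
  (fun n => let: And4 _ _ h _ := mono n in h) (fun n => let: And4 _ _ _ h := mono n in h).
have [e e0 eP] := loc x y (xP 0) (yP 0).
have [n nP2] : exists n : nat, (x2 - x1) + (y2 - y1) < e * 2 ^+ n.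
  pose w := ((x2 - x1) + (y2 - y1)) / e.
  have : w < (Num.truncn `|w|).+1%:R by rewrite (le_lt_trans (ler_norm _)) // truncnS_gt.
  rewrite ltr_pdivrMr // => h; exists (Num.truncn `|w|).+1.
  rewrite (lt_trans h) // mulrC ltr_pM2l // -natrX ltr_nat.
  exact: ltn_expl.
have [[h1 h2 h3 [h4 h5 h6]] nQ] := sok n; have [w1 w2] := wid n.
have p2 : 0 < 2 ^+ n :> R by rewrite exprn_gt0.
apply: nQ; apply: eP => //.
- by rewrite w1 ltr_pdivrMr //; lra.
- by rewrite w2 ltr_pdivrMr //; lra.
Qed.

End Quartering.

(** * Goursat's theorem *)

Section Goursat.
Context (R : realType).
Local Notation C := R[i].
Local Notation rc := (real_complex R).

(** The integrals of f dz along horizontal and vertical segments. *)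
Definition Hz (f : C -> C) (y a b : R) : C := intC (fun t => f (t +i* y)) a b.
Definition Vt (f : C -> C) (x a b : R) : C := 'i%C * intC (fun t => f (x +i* t)) a b.

(** The integral of f along the boundary of the rectangle [a, b] x [c, d]. *)
Definition bdry (f : C -> C) (a b c d : R) : C :=
  Hz f c a b + Vt f b c d - Hz f d a b - Vt f a c d.

Lemma cont_at_hline (f : C -> C) y t : cont_at f (t +i* y) -> cont_at (fun t => f (t +i* y)) t.
Proof.
move=> fc e /fc /nearCP[d d0 dP]; apply/nearRP; exists d => // u ut; apply: dP.
have -> : (u +i* y : C) - t +i* y = (u - t)%:C by apply: complex_ext; rewrite !ReE /=; ring.
by rewrite cmod_real.
Qed.

Lemma cont_at_vline (f : C -> C) x t : cont_at f (x +i* t) -> cont_at (fun t => f (x +i* t)) t.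
Proof.
move=> fc e /fc /nearCP[d d0 dP]; apply/nearRP; exists d => // u ut; apply: dP.
have -> : (x +i* u : C) - x +i* t = 'i%C * (u - t)%:C by apply: complex_ext; rewrite !ReE /=; ring.
rewrite cmodM cmod_real.
by have -> : cmod ('i%C : C) = 1; rewrite ?mul1r // /cmod /= expr0n /= add0r expr1n sqrtr1.
Qed.

Lemma bdryD (f g : C -> C) a b c d : (forall z, cont_at f z) -> (forall z, cont_at g z) ->
  bdry (fun z => f z + g z) a b c d = bdry f a b c d + bdry g a b c d.
Proof.
move=> fc gc; rewrite /bdry /Hz /Vt.
rewrite !(@intCD _ (fun t => f (t +i* _)) (fun t => g (t +i* _)));
  try by move=> t; apply: cont_at_hline.
rewrite !(@intCD _ (fun t => f (_ +i* t)) (fun t => g (_ +i* t)));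
  try by move=> t; apply: cont_at_vline.
ring.
Qed.

Lemma rder_ofR (t : R) : rder rc rc t 1.
Proof. exact: rder_id. Qed.

(** An affine function has a polynomial primitive. *)
Lemma bdry_affine (p q : C) a b c d : bdry (fun z => p + q * z) a b c d = 0.
Proof.
have fc z : cont_at (fun z => p + q * z) z.
  apply: (@rder_cont _ _ id); first exact: cont_at_id.
  by apply: rderD; [exact: rder_cst|apply: rderZ; exact: rder_id].
have h2 y t : rder rc (fun t : R => (p + q * ('i%C * y%:C)) * t%:C + q / 2 * (t%:C * t%:C)) t (p + q * (t +i* y)).
  have -> : (t +i* y : C) = t%:C + 'i%C * y%:C by apply: complex_ext; rewrite !ReE /=; ring.
  apply: rder_eq; last first.
    apply: rderD; first by apply: rderZ; exact: rder_ofR.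
    apply: rderZ; apply: rderM; [exact: cont_at_real|exact: rder_ofR|exact: rder_ofR].
  by field.
have h1 y t : rder rc (fun t : R => (p + q * y%:C) * t%:C + q * 'i%C / 2 * (t%:C * t%:C)) t (p + q * (y +i* t)).
  have -> : (y +i* t : C) = y%:C + 'i%C * t%:C by apply: complex_ext; rewrite !ReE /=; ring.
  apply: rder_eq; last first.
    apply: rderD; first by apply: rderZ; exact: rder_ofR.
    apply: rderZ; apply: rderM; [exact: cont_at_real|exact: rder_ofR|exact: rder_ofR].
  by field.
rewrite /bdry /Hz /Vt !(intC_prim _ _ (h1 _)) ?(intC_prim _ _ (h2 _)).
- by field.
all: move=> t; try (exact: (@cont_at_hline (fun z => p + q * z)));
  exact: (@cont_at_vline (fun z => p + q * z)).
Qed.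

(** By quartering, it is enough to bound the boundary integral by e times the square of
    the size of the rectangle for small rectangles around a point; there f differs from
    an affine function, whose integral vanishes, by e times the size. Continuity on the
    whole plane makes intC the integral along every segment that occurs. *)
Lemma goursat_continuous (f : C -> C) a b c d : a <= b -> c <= d ->
  (forall z, cont_at f z) ->
  (forall x y, a <= x <= b -> c <= y <= d -> exists l, rder id f (x +i* y) l) ->
  bdry f a b c d = 0.
Proof.
move=> ab cd fc fd.
suff H e : 0 < e -> cmod (bdry f a b c d) <= e * ((b - a) + (d - c)) ^+ 2.
  apply/eqP; rewrite -cmod_eq0; apply/negPn/negP => n0.
  have m0 : 0 < cmod (bdry f a b c d) by rewrite lt_neqAle cmod_ge0 eq_sym n0.
  set S := ((b - a) + (d - c)) ^+ 2 in H.
  have S0 : 0 <= S by rewrite sqr_ge0.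
  have S1 : 0 < 2 * (S + 1) by lra.
  have := H (cmod (bdry f a b c d) / (2 * (S + 1))) (divr_gt0 m0 S1).
  by rewrite mulrAC ler_pdivlMr // ler_pM2l // leNgt => /negP; apply; lra.
move=> e0.
apply: (quartering (P := fun a b c d => cmod (bdry f a b c d) <= e * ((b - a) + (d - c)) ^+ 2)) => //.
  move=> a' b' c' d' _ _ _ _ _ _ m n h1 h2 h3 h4.
  have -> : bdry f a' b' c' d' =
      (bdry f a' m c' n + bdry f m b' c' n) + (bdry f a' m n d' + bdry f m b' n d').
    by rewrite /bdry /Hz /Vt /intC; ring.
  apply: (le_trans (cmodD _ _)).
  apply: (le_trans (lerD (le_trans (cmodD _ _) (lerD h1 h2)) (le_trans (cmodD _ _) (lerD h3 h4)))).
  by rewrite le_eqVlt; apply/orP; left; apply/eqP; rewrite /m /n; field.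
move=> x y xab ycd; have [l fl] := fd x y xab ycd.
have e80 : 0 < e / 8 by rewrite divr_gt0.
have [r r0 rP] := (nearCP _ _).1 (fl _ e80).
exists (r / 2) => [|a' b' c' d' _ /andP[ax xb] _ _ /andP[cy yd] _ ba dc]; first by rewrite divr_gt0.
set z0 := x +i* y in fl rP.
pose lin z := (f z0 - z0 * l) + l * z.
pose rho z := f z - lin z.
have linc z : cont_at lin z.
  apply: (@rder_cont _ _ id); first exact: cont_at_id.
  by apply: rderD; [exact: rder_cst|apply: rderZ; exact: rder_id].
have rhoc z : cont_at rho z.
  have linNc : cont_at (fun z => - lin z) z.
    move=> k k0; apply: filterS (linc z k k0) => w; rewrite -opprD cmodN //.
  exact: cont_atD (fc z) linNc.
have fE : f = (fun z => lin z + rho z).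
  by apply/funext => z; rewrite /rho addrC subrK.
have -> : bdry f a' b' c' d' = bdry rho a' b' c' d'.
  rewrite {1}fE (@bdryD lin rho) //.
  by rewrite [bdry lin _ _ _ _](bdry_affine (f z0 - z0 * l) l) add0r.
set S := (b' - a') + (d' - c').
have rhoB u v : a' <= u <= b' -> c' <= v <= d' -> cmod (rho (u +i* v)) <= e / 8 * S.
  move=> /andP[u1 u2] /andP[v1 v2].
  have uv : cmod ((u +i* v) - z0) <= S.
    rewrite (le_trans (cmod_le_ReIm _)) // !ReE /= /S; clear -u1 u2 v1 v2 ax xb cy yd.
    by apply: lerD; rewrite ler_norml; apply/andP; split; lra.
  have := rP (u +i* v); have uvr : cmod ((u +i* v) - z0) < r by rewrite (le_lt_trans uv) // /S; clear -ba dc; lra.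
  move=> /(_ uvr); have -> : f (u +i* v) - f z0 - ((u +i* v) - z0) * l = rho (u +i* v).
    by have gen (p q s t : C) : p - s - (q - t) * l = p - (s - t * l + l * q) by ring; exact: gen.
  by move=> /le_trans; apply; rewrite ler_pM2l.
have ab' : a' <= b' by exact: le_trans xb.
have cd' : c' <= d' by exact: le_trans yd.
have i1 : cmod ('i%C : C) = 1 by rewrite /cmod /= expr0n /= add0r expr1n sqrtr1.
have hH v : c' <= v <= d' -> cmod (Hz rho v a' b') <= 2 * (e / 8 * S) * (b' - a').
  move=> vv; rewrite -[b' - a']ger0_norm ?subr_ge0 //; apply: intC_bound.
    by move=> t; exact: cont_at_hline.
  by move=> t; rewrite min_l // max_r // => tt; exact: rhoB.
have hV v : a' <= v <= b' -> cmod (Vt rho v c' d') <= 2 * (e / 8 * S) * (d' - c').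
  move=> vv; rewrite cmodM i1 mul1r -[d' - c']ger0_norm ?subr_ge0 //; apply: intC_bound.
    by move=> t; exact: cont_at_vline.
  by move=> t; rewrite min_l // max_r // => tt; exact: rhoB.
have h1 := hH c' _; have h2 := hH d' _; have h3 := hV a' _; have h4 := hV b' _.
rewrite lexx cd' /= in h1; rewrite lexx cd' /= in h2.
rewrite lexx ab' /= in h3; rewrite lexx ab' /= in h4.
have {}h1 := h1 isT; have {}h2 := h2 isT; have {}h3 := h3 isT; have {}h4 := h4 isT.
rewrite /bdry; apply: (le_trans (cmodD _ _)); rewrite cmodN.
apply: (@le_trans _ _ (2 * (e / 8 * S) * (b' - a') + 2 * (e / 8 * S) * (d' - c') +
   2 * (e / 8 * S) * (b' - a') + 2 * (e / 8 * S) * (d' - c'))).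
  apply: lerD; last exact: h3.
  apply: (le_trans (cmodD _ _)); rewrite cmodN; apply: lerD; last exact: h2.
  by apply: (le_trans (cmodD _ _)); apply: lerD; [exact: h1|exact: h4].
have S2 := sqr_ge0 S; apply: (@le_trans _ _ (e / 2 * S ^+ 2)).
  by rewrite le_eqVlt; apply/orP; left; apply/eqP; rewrite /S; field.
by apply: ler_wpM2r => //; lra.
Qed.

Definition clamp (a b t : R) : R := Num.max a (Num.min b t).

Lemma clampP a b t : a <= b -> a <= clamp a b t <= b.
Proof. by move=> ab; rewrite /clamp le_max lexx /= ge_max ab ge_min lexx. Qed.

Lemma clamp_id a b t : a <= t <= b -> clamp a b t = t.
Proof. by move=> /andP[at_ tb]; rewrite /clamp min_r // max_r. Qed.

Lemma clamp_lip a b t u : a <= b -> `|clamp a b t - clamp a b u| <= `|t - u|.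
Proof.
move=> ab; rewrite /clamp.
have [h1|h1] := leP b t; have [h2|h2] := leP b u; have [h3|h3] := leP a _;
  try (have [h4|h4] := leP a _); rewrite ?ler_norml /=; try lra.
all: try (by have := ler_norm (t - u); have := ler_norm (- (t - u)); rewrite normrN; lra).
all: by have := ler_norm (t - u); have := ler_norm (- (t - u)); rewrite normrN;
  case: (leP a t) => ?; case: (leP a u) => ?; lra.
Qed.

Definition clampC (a b c d : R) (z : C) : C :=
  clamp a b (complex.Re z) +i* clamp c d (complex.Im z).

Lemma cont_at_clampC (f : C -> C) a b c d : a <= b -> c <= d ->
  (forall x y, a <= x <= b -> c <= y <= d -> cont_at f (x +i* y)) ->
  forall z, cont_at (f \o clampC a b c d) z.
Proof.
move=> ab cd fc z e e0.
have [r r0 rP] := (nearCP _ _).1 (fc _ _ (clampP (complex.Re z) ab) (clampP (complex.Im z) cd) e e0).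
apply/nearCP; exists (r / 2) => [|w wz]; first by rewrite divr_gt0.
apply: rP; rewrite (le_lt_trans (cmod_le_ReIm _)) // !ReE /= [r]splitr ltrD //.
  rewrite (le_lt_trans (clamp_lip _ _ ab)) // (le_lt_trans _ wz) //.
  by rewrite -ReN -ReD Re_le_cmod.
rewrite (le_lt_trans (clamp_lip _ _ cd)) // (le_lt_trans _ wz) //.
by rewrite -ImN -ImD Im_le_cmod.
Qed.

Lemma clampC_near (a b c d x y : R) : a < x < b -> c < y < d ->
  \forall z \near (x +i* y : C), clampC a b c d z = z.
Proof.
move=> /andP[ax xb] /andP[cy yd]; apply/nearCP.
exists (Num.min (Num.min (x - a) (b - x)) (Num.min (y - c) (d - y))).
  by rewrite !lt_min !subr_gt0 ax xb cy yd.
move=> z; rewrite !lt_min => /andP[/andP[h1 h2] /andP[h3 h4]].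
have := Re_le_cmod (z - (x +i* y)); have := Im_le_cmod (z - (x +i* y)).
rewrite !ReE /= => g1 g2.
have {}g1 := le_trans (ler_norm _) g1; have {}g2 := le_trans (ler_norm _) g2.
have := Re_le_cmod (z - (x +i* y)); have := Im_le_cmod (z - (x +i* y)).
rewrite !ReE /= -normrN => g3; rewrite -normrN => g4.
have {}g3 := le_trans (ler_norm _) g3; have {}g4 := le_trans (ler_norm _) g4.
by apply: complex_ext => /=; apply: clamp_id; lra.
Qed.

Definition hol (z0 : C) (f : C -> C) : Prop := \forall z \near z0, exists d, rder id f z d.

(** Composing with the retraction on a smaller closed rectangle turns a function which
    is holomorphic on an open rectangle into one which is continuous on the plane. *)
Lemma goursat_rect (f : C -> C) (a b c d : R) :
  (forall x y, a < x < b -> c < y < d -> exists l, rder id f (x +i* y) l) ->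
  forall a' b' c' d', a < a' -> a' <= b' -> b' < b -> c < c' -> c' <= d' -> d' < d ->
  forall a1 b1 c1 d1, a1 < a' -> a < a1 -> b' < b1 -> b1 < b ->
    c < c1 -> c1 < c' -> d' < d1 -> d1 < d ->
  bdry (f \o clampC a1 b1 c1 d1) a' b' c' d' = 0.
Proof.
move=> fd a' b' c' d' aa ab bb cc cd dd a1 b1 c1 d1 ? ? ? ? ? ? ? ?.
apply: goursat_continuous => //.
  apply: cont_at_clampC; [lra|lra|] => x y /andP[? ?] /andP[? ?].
  have [||l fl] := fd x y; [apply/andP; split; lra..|].
  by apply: (rder_cont (@cont_at_id _ _) fl).
move=> x y /andP[? ?] /andP[? ?].
have [||l fl] := fd x y; [apply/andP; split; lra..|].
exists l; apply: rder_near fl.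
have : \forall z \near (x +i* y : C), clampC a1 b1 c1 d1 z = z.
  by apply: clampC_near; apply/andP; split; lra.
by apply: filterS => z /= ->.
Qed.

End Goursat.

(** * Local primitives of holomorphic functions *)

Section Holomorphic.
Context (R : realType).
Local Notation C := R[i].
Local Notation rc := (real_complex R).

Lemma cont_atN (T : topologicalType) (u : T -> C) p :
  cont_at u p -> cont_at (fun q => - u q) p.
Proof. by move=> uc e e0; apply: filterS (uc e e0) => q; rewrite -opprD cmodN. Qed.

Lemma intC_dist (c c0 : R -> C) a b B : (forall t, cont_at c t) -> (forall t, cont_at c0 t) ->
  (forall t, Num.min a b <= t <= Num.max a b -> cmod (c t - c0 t) <= B) ->
  cmod (intC c a b - intC c0 a b) <= 2 * B * `|b - a|.
Proof.
move=> cc cc0 cB.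
have -> : intC c a b - intC c0 a b = intC (fun t => c t - c0 t) a b.
  have c0N t : cont_at (fun t => - c0 t) t by exact: cont_atN.
  rewrite (@intCD _ c (fun t => - c0 t)) //; congr (_ + _).
  rewrite (@intC_prim _ (fun t => - c0 t) (fun t => - prim c0 t)) //; first by rewrite /intC; ring.
  by move=> t; apply: rderN; exact: primP.
apply: intC_bound => // t; apply: cont_atD => //; exact: cont_atN.
Qed.

Lemma intC_cst (k : C) a b : intC (fun=> k) a b = (b - a)%:C * k.
Proof.
rewrite (@intC_prim _ _ (fun t => k * t%:C)); first by rewrite rmorphB; ring.
  by move=> t; rewrite -{2}[k]mulr1; apply: rderZ; exact: rder_id.
by move=> t e e0; near=> q; rewrite subrr cmod0 ltW.
Unshelve. all: by end_near. Qed.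

Lemma bdry_eq0_any (f : C -> C) a b c d :
  (forall a' b' c' d', a <= a' -> a' <= b' -> b' <= b -> c <= c' -> c' <= d' -> d' <= d ->
     bdry f a' b' c' d' = 0) ->
  forall x x' y y', a <= x <= b -> a <= x' <= b -> c <= y <= d -> c <= y' <= d ->
    bdry f x x' y y' = 0.
Proof.
move=> H x x' y y' /andP[? ?] /andP[? ?] /andP[? ?] /andP[? ?].
have h1 : bdry f x x' y y' = - bdry f x' x y y' by rewrite /bdry /Hz /Vt /intC; ring.
have h2 : bdry f x x' y y' = - bdry f x x' y' y by rewrite /bdry /Hz /Vt /intC; ring.
have h3 : bdry f x x' y y' = bdry f x' x y' y by rewrite /bdry /Hz /Vt /intC; ring.
have [xx|/ltW xx] := leP x x'; have [yy|/ltW yy] := leP y y'.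
- exact: H.
- by rewrite h2 H ?oppr0.
- by rewrite h1 H ?oppr0.
- by rewrite h3 H.
Qed.

(** Goursat's theorem makes the integrals along the two L-shaped paths between
    opposite corners of a rectangle agree, so that either defines a primitive. *)
Lemma hol_prim (z0 : C) (f : C -> C) : hol z0 f ->
  exists F, \forall z \near z0, rder id F z (f z).
Proof.
case: z0 => x0 y0 /nearCP[dl dl0 fd].
pose r := dl / 8; have r0 : 0 < r by rewrite divr_gt0.
have dlE : dl = 8 * r by rewrite /r mulrC divfK.
pose ft := f \o clampC (x0 - 2 * r) (x0 + 2 * r) (y0 - 2 * r) (y0 + 2 * r).
have fd' x y : x0 - 4 * r < x < x0 + 4 * r -> y0 - 4 * r < y < y0 + 4 * r ->
    exists l, rder id f (x +i* y) l.
  move=> /andP[x1 x2] /andP[y1 y2]; apply: fd.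
  rewrite (le_lt_trans (cmod_le_ReIm _)) // !ReE /= dlE.
  have -> : 8 * r = 4 * r + 4 * r by ring.
  by apply: ltrD; rewrite ltr_norml; apply/andP; split; lra.
have fc x y : x0 - 4 * r < x < x0 + 4 * r -> y0 - 4 * r < y < y0 + 4 * r -> cont_at f (x +i* y).
  by move=> hx hy; have [l /(rder_cont (@cont_at_id _ _))] := fd' x y hx hy.
have ftc z : cont_at ft z.
  apply: cont_at_clampC; [lra|lra|] => x y /andP[? ?] /andP[? ?].
  by apply: fc; apply/andP; split; lra.
have J0 : forall x x' y y', x0 - r <= x <= x0 + r -> x0 - r <= x' <= x0 + r ->
    y0 - r <= y <= y0 + r -> y0 - r <= y' <= y0 + r -> bdry ft x x' y y' = 0.
  apply: bdry_eq0_any => a b c d *.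
  by apply: (goursat_rect fd'); lra.
pose F (z : C) := Hz ft y0 x0 (complex.Re z) + Vt ft (complex.Re z) y0 (complex.Im z).
have FE (z w : C) : x0 - r <= complex.Re z <= x0 + r -> x0 - r <= complex.Re w <= x0 + r ->
    y0 - r <= complex.Im z <= y0 + r ->
  F w - F z = Hz ft (complex.Im z) (complex.Re z) (complex.Re w) +
     Vt ft (complex.Re w) (complex.Im z) (complex.Im w).
  move=> h1 h2 h3; have h4 : y0 - r <= y0 <= y0 + r by apply/andP; split; lra.
  have := J0 _ _ _ _ h1 h2 h4 h3; rewrite /bdry /F /Hz /Vt /intC => h.
  by apply/eqP; rewrite -subr_eq0; apply/eqP; rewrite -[RHS]h; ring.
exists F; apply/nearCP; exists r => // -[x y] zr e e0.
have := Re_le_cmod ((x +i* y) - (x0 +i* y0)); have := Im_le_cmod ((x +i* y) - (x0 +i* y0)).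
rewrite !ReE /= => /le_lt_trans/(_ zr) yr /le_lt_trans/(_ zr) xr.
move: xr yr; rewrite !ltr_norml => /andP[xr1 xr2] /andP[yr1 yr2].
have ftz : ft (x +i* y) = f (x +i* y).
  by rewrite /ft /clampC /= !clamp_id //; apply/andP; split; lra.
have e40 : 0 < e / 4 by rewrite divr_gt0.
have [eta eta0 etaP] := (nearCP _ _).1 (ftc (x +i* y) _ e40).
apply/nearCP; exists (Num.min (eta / 2) (Num.min (Num.min (x0 + r - x) (x - (x0 - r))) (Num.min (y0 + r - y) (y - (y0 - r))))).
  by rewrite !lt_min divr_gt0 //=; do !(apply/andP; split); lra.
move=> [x' y']; rewrite !lt_min => /andP[w1 /andP[/andP[w2 w3] /andP[w4 w5]]].
have hx := Re_le_cmod ((x' +i* y') - (x +i* y)); have hy := Im_le_cmod ((x' +i* y') - (x +i* y)).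
rewrite !ReE /= in hx hy; set m := cmod _ in w1 w2 w3 w4 w5 hx hy *.
move: (hx) (hy); rewrite !ler_norml => /andP[hx1 hx2] /andP[hy1 hy2].
rewrite FE /=; [|apply/andP; split; lra..].
have bnd u v : `|u - x| <= m -> `|v - y| <= m -> cmod (ft (u +i* v) - f (x +i* y)) <= e / 4.
  move=> hu hv; rewrite -ftz; apply: etaP.
  by rewrite (le_lt_trans (cmod_le_ReIm _)) // !ReE /= (le_lt_trans (lerD hu hv)) //; lra.
have between (u a b : R) : Num.min a b <= u <= Num.max a b -> `|u - a| <= `|b - a|.
  have [ab|ab] := leP a b => /andP[h1 h2].
    by rewrite !ger0_norm ?subr_ge0 //; lra.
  by rewrite !ler0_norm ?subr_le0 ?(ltW ab) //; lra.
have h1 : cmod (Hz ft y x x' - (x' - x)%:C * f (x +i* y)) <= 2 * (e / 4) * `|x' - x|.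
  rewrite -intC_cst; apply: intC_dist.
  - by move=> t; exact: cont_at_hline.
  - by move=> t k k0; near=> q; rewrite subrr cmod0 ltW.
  - move=> t /between ht; apply: bnd; first exact: le_trans hx.
    by rewrite subrr normr0 cmod_ge0.
have h2 : cmod (Vt ft x' y y' - 'i%C * ((y' - y)%:C * f (x +i* y))) <= 2 * (e / 4) * `|y' - y|.
  rewrite /Vt -mulrBr cmodM.
  have -> : cmod ('i%C : C) = 1 by rewrite /cmod /= expr0n /= add0r expr1n sqrtr1.
  rewrite mul1r -intC_cst; apply: intC_dist.
  - by move=> t; exact: cont_at_vline.
  - by move=> t k k0; near=> q; rewrite subrr cmod0 ltW.
  - by move=> t /between ht; apply: bnd => //; exact: le_trans hy.
have -> : Hz ft y x x' + Vt ft x' y y' - ((x' +i* y') - (x +i* y)) * f (x +i* y) =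
  (Hz ft y x x' - (x' - x)%:C * f (x +i* y)) + (Vt ft x' y y' - 'i%C * ((y' - y)%:C * f (x +i* y))).
  have -> : (x' +i* y' : C) - x +i* y = (x' - x)%:C + 'i%C * (y' - y)%:C.
    by apply: complex_ext; rewrite !ReE /=; ring.
  ring.
rewrite (le_trans (cmodD _ _)) // (le_trans (lerD h1 h2)) //.
have e2 : 0 <= 2 * (e / 4) by lra.
rewrite (le_trans (lerD (ler_wpM2l e2 hx) (ler_wpM2l e2 hy))) //.
by rewrite le_eqVlt; apply/orP; left; apply/eqP; field.
Unshelve. all: by end_near. Qed.

End Holomorphic.

(** * Cauchy's estimate *)

Section CauchyEstimate.
Context (R : realType).
Local Notation C := R[i].
Local Notation rc := (real_complex R).

(** In the coordinate zeta with z = z0 + exp zeta, the circles around z0 become vertical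
    segments over a period; by Goursat's theorem the integral of f exp(- zeta) over a
    period does not depend on the radius, and it tends to 2 pi f'(z0) when the radius
    tends to 0. *)
Lemma cauchy_estimate (f : C -> C) (z0 : C) (rho M : R) (d : C) : 0 < rho ->
  (forall z, cmod (z - z0) <= rho -> exists l, rder id f z l) ->
  (forall z, cmod (z - z0) <= rho -> cmod (f z) <= M) ->
  rder id f z0 d -> cmod d <= 4 * M / rho.
Proof.
move=> rho0 fd fM fz0.
(* Only the period of the exponential matters; naming it keeps pi out of the inequalities. *)
have [tau tau0 tauE] : exists2 tau : R, 0 < tau & expC (0 +i* tau) = 1 :> C.
  by exists (2 * pi); [rewrite mulr_gt0 // pi_gt0|exact: expC_2pi].
have M0 : 0 <= M by rewrite (le_trans (cmod_ge0 (f z0))) // fM // subrr cmod0 ltW.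
suff H e : 0 < e -> cmod d <= 4 * M / rho + e.
  by apply/ler_addgt0Pr => e e0; exact: H.
move=> e0; have e20 : 0 < e / 2 by rewrite divr_gt0.
have [dl dl0 dlP] := (nearCP _ _).1 (fz0 _ e20).
pose g zeta := f (z0 + expC zeta) * expC (- zeta).
pose xi1 := ln (rho / 2).
have xi1E : expR xi1 = rho / 2 by rewrite lnK // posrE divr_gt0.
have lnr : expR (ln rho) = rho by rewrite lnK // posrE.
have xi1r : xi1 < ln rho by rewrite -ltr_expR xi1E lnr; lra.
pose xi0 := Num.min (ln (dl / 2)) (xi1 - 1).
have xi0E : expR xi0 < dl.
  have : expR xi0 <= dl / 2.
    by rewrite -[leRHS]lnK ?posrE ?divr_gt0 // ler_expR /xi0 ge_min lexx.
  lra.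
have xi01 : xi0 <= xi1 - 1 by rewrite /xi0 ge_min lexx orbT.
have r2 : 0 <= 2 / rho by apply: divr_ge0; [exact: ler0n|exact: ltW].
clearbody xi0 xi1.
have inball zeta : complex.Re zeta <= ln rho -> cmod (z0 + expC zeta - z0) <= rho.
  by rewrite addrAC subrr add0r cmod_expC -{2}lnr ler_expR.
have gd x y : xi0 - 2 < x < ln rho -> - 2 < y < tau + 2 -> exists l, rder id g (x +i* y) l.
  move=> /andP[_ x2] _; have [l fl] := fd _ (inball (x +i* y) (ltW x2)).
  eexists; apply: rderM; first exact: cont_at_id.
    apply: (rder_comp (y := id) (h := fun zeta => z0 + expC zeta) _ _ fl).
      apply/cont_atE; apply: cont_atD; last exact: (rder_cont (@cont_at_id _ _) (rder_expC _)).
      by move=> k k0; near=> q; rewrite subrr cmod0 ltW.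
    by apply: rderD; [exact: rder_cst|exact: rder_expC].
  apply: (rder_comp (y := id) (h := fun zeta => - zeta) _ _ (rder_expC _)).
    by apply/cont_atE; apply: cont_atN; exact: cont_at_id.
  by apply: rderN; exact: rder_id.
pose b1 := (xi1 + ln rho) / 2.
have [b1l b1r] : xi1 < b1 /\ b1 < ln rho by rewrite /b1; split; lra.
have in1 : xi0 - 1 <= xi1 <= b1 by apply/andP; split; lra.
have in0 : xi0 - 1 <= xi0 <= b1 by apply/andP; split; lra.
clearbody b1.
have pi20 := ltW tau0.
pose gt := g \o clampC (xi0 - 1) b1 (- 1) (tau + 1).
have J0 : bdry gt xi0 xi1 0 tau = 0.
  by apply: (goursat_rect gd); lra.
have gtc z : cont_at gt z.
  apply: cont_at_clampC; [lra|lra|] => x y /andP[? ?] /andP[? ?].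
  have [||l gl] := gd x y; [apply/andP; split; lra|apply/andP; split; lra|].
  exact: (rder_cont (@cont_at_id _ _) gl).
have gper x y : g (x +i* (y + tau)) = g (x +i* y).
  have -> : (x +i* (y + tau) : C) = (x +i* y) + (0 +i* tau).
    by apply: complex_ext; rewrite !ReE /=; ring.
  by rewrite /g opprD !expCD expCN tauE !expCN tauE invr1 !mulr1.
have gtE x y : xi0 - 1 <= x <= b1 -> 0 <= y <= tau -> gt (x +i* y) = g (x +i* y).
  move=> hx /andP[? ?].
  by rewrite /gt /= /clampC /= !clamp_id //; apply/andP; split; lra.
have HzE : Hz gt 0 xi0 xi1 = Hz gt tau xi0 xi1.
  congr (intC _ _ _); apply/funext => t; rewrite /gt /= /clampC /= -[X in _ = g X]/(_ +i* _).
  rewrite (@clamp_id _ _ _ 0) ?(@clamp_id _ _ _ tau); [|apply/andP; split; lra..].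
  by rewrite -[tau]add0r gper.
have V : intC (fun t => gt (xi1 +i* t)) 0 tau = intC (fun t => gt (xi0 +i* t)) 0 tau.
  have i0 : 'i%C != 0 :> C by rewrite eq_complex /= oner_eq0 andbF.
  have aux (H1 H2 V1 V2 : C) : H1 = H2 -> H1 + V1 - H2 - V2 = 0 -> V1 = V2.
    by move=> -> h; apply/eqP; rewrite -subr_eq0; apply/eqP; rewrite -[RHS]h; ring.
  apply: (mulfI i0); move: HzE J0; rewrite /bdry; exact: aux.
(* On the small circle, f is replaced by its affine approximation, integrated by hand. *)
pose c0 (t : R) := f z0 * expC (- (xi0 +i* t)) + d.
pose D0 (t : R) := f z0 * 'i%C * expC (- (xi0 +i* t)) + d * t%:C.
have D0d t : rder rc D0 t (c0 t).
  rewrite /D0 /c0; apply: rderD; last first.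
    by rewrite -{2}[d]mulr1; apply: rderZ; exact: rder_id.
  have -> : f z0 * expC (- (xi0 +i* t)) = f z0 * 'i%C * (- 'i%C * expC (- (xi0 +i* t))).
    have ii : 'i%C * (- 'i%C) = 1 :> C by rewrite mulrN -expr2 sqr_i opprK.
    by rewrite [RHS]mulrA -[f z0 * 'i%C * _]mulrA ii mulr1.
  apply: rderZ.
  apply: (rder_comp (y := id) (h := fun t : R => - (xi0 +i* t)) _ _ (rder_expC _)).
    apply/cont_atE; apply: cont_atN; apply: (@cont_at_vline _ id); exact: cont_at_id.
  have -> : id \o (fun t : R => - (xi0 +i* t : C)) = (fun t => - xi0%:C + - 'i%C * t%:C).
    by apply/funext => u /=; apply: complex_ext; rewrite !ReE /=; ring.
  rewrite -[X in rder _ _ _ X]add0r; apply: rderD; first exact: rder_cst.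
  by rewrite -{2}[- 'i%C]mulr1; apply: rderZ; exact: rder_id.
have c0c t : cont_at c0 t.
  apply: cont_atD; last by move=> k k0; near=> q; rewrite subrr cmod0 ltW.
  apply: (@rder_cont _ _ rc); first exact: cont_at_real.
  apply: rderZ.
  apply: (rder_comp (y := id) (h := fun t : R => - (xi0 +i* t)) _ _ (rder_expC _)).
    apply/cont_atE; apply: cont_atN; apply: (@cont_at_vline _ id); exact: cont_at_id.
  have -> : id \o (fun t : R => - (xi0 +i* t : C)) = (fun t => - xi0%:C + - 'i%C * t%:C).
    by apply/funext => u /=; apply: complex_ext; rewrite !ReE /=; ring.
  apply: rderD; first exact: rder_cst.
  by apply: rderZ; exact: rder_id.
have I0 : intC c0 0 tau = tau%:C * d.
  rewrite (intC_prim _ _ D0d c0c) /D0.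
  have -> : expC (- (xi0 +i* tau)) = expC (- (xi0 +i* 0)) :> C.
    have -> : (xi0 +i* tau : C) = (xi0 +i* 0) + (0 +i* tau).
      by apply: complex_ext; rewrite !ReE /=; ring.
    by rewrite opprD expCD [expC (- (0 +i* _))]expCN tauE invr1 mulr1.
  have -> : (0 : R)%:C = 0 :> C by [].
  ring.
have pi2 : `|tau - 0| = tau :> R by rewrite subr0 ger0_norm //; lra.
(* The circle of radius rho / 2 gives the bound, that of radius exp xi0 < dl the value. *)
have h1 : cmod (intC (fun t => gt (xi1 +i* t)) 0 tau) <= 2 * (2 * M / rho) * tau.
  have := @intC_bound R (fun t => gt (xi1 +i* t)) 0 tau (2 * M / rho); rewrite pi2; apply.
    by move=> t; exact: cont_at_vline.
  move=> t; rewrite (min_l pi20) (max_r pi20) => tt.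
  rewrite (gtE _ _ in1 tt).
  rewrite /g cmodM cmod_expC /= expRN xi1E invf_div.
  have -> : 2 * M / rho = M * (2 / rho) by rewrite mulrAC mulrC.
  by apply: (ler_wpM2r r2); apply: fM; apply: inball; exact: ltW xi1r.
have h2 : cmod (intC (fun t => gt (xi0 +i* t)) 0 tau - intC c0 0 tau) <= 2 * (e / 2) * tau.
  have := @intC_dist R (fun t => gt (xi0 +i* t)) c0 0 tau (e / 2); rewrite pi2; apply; [by move=> t; exact: cont_at_vline|exact: c0c|].
  move=> t; rewrite (min_l pi20) (max_r pi20) => tt.
  rewrite (gtE _ _ in0 tt).
  set zeta := xi0 +i* t.
  have -> : g zeta - c0 t = (f (z0 + expC zeta) - f z0 - (z0 + expC zeta - z0) * d) * expC (- zeta).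
    rewrite /g /c0 -/zeta expCN; field; exact: expC_neq0.
  have ez : cmod (z0 + expC zeta - z0) = expR xi0 by rewrite addrAC subrr add0r cmod_expC.
  rewrite cmodM cmod_expC /= expRN ler_pdivrMr; last exact: expR_gt0.
  rewrite -ez; apply: dlP.
  by rewrite ez.
clear -h1 h2 V I0 tau0 rho0; clearbody gt c0.
have : cmod (tau%:C * d) <= 2 * (2 * M / rho) * tau + 2 * (e / 2) * tau.
  rewrite -I0 -[intC c0 0 tau](subrK (intC (fun t => gt (xi0 +i* t)) 0 tau)).
  apply: (le_trans (cmodD _ _)); rewrite addrC; apply: lerD; first by rewrite -V.
  by rewrite cmodBC.
rewrite cmodM cmod_real (ger0_norm (ltW tau0)) -mulrDl mulrC ler_pM2r // => /le_trans; apply.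
by rewrite le_eqVlt; apply/orP; left; apply/eqP; field; exact: lt0r_neq0.
Unshelve. all: by end_near. Qed.

End CauchyEstimate.

(** * Holomorphic germs: derivatives, division by z, logarithms *)

Section Derivatives.
Context (R : realType).
Local Notation C := R[i].
Local Notation rc := (real_complex R).

Lemma rder_ext (T : topologicalType) (x u v : T -> C) p d :
  (forall q, u q = v q) -> rder x u p d -> rder x v p d.
Proof. by move=> uv; have -> : u = v by apply/funext. Qed.

Lemma cmvtC (F F' : C -> C) (z w : C) (B : R) :
  (forall t : R, 0 <= t <= 1 -> rder id F (z + t%:C * (w - z)) (F' (z + t%:C * (w - z)))) ->
  (forall t : R, 0 <= t <= 1 -> cmod (F' (z + t%:C * (w - z))) <= B) ->
  cmod (F w - F z) <= 2 * B * cmod (w - z).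
Proof.
move=> dF FB; pose h (t : R) := z + t%:C * (w - z).
have hd t : rder rc h t (w - z).
  rewrite /h -[X in rder _ _ _ X]add0r; apply: rderD; first exact: rder_cst.
  apply: (@rder_ext _ _ (fun t : R => (w - z) * t%:C)) => [q|]; first by rewrite mulrC.
  by rewrite -[X in rder _ _ _ X]mulr1; apply: rderZ; exact: rder_id.
have := @cmvt R (F \o h) (fun t => (w - z) * F' (h t)) 0 1 (cmod (w - z) * B).
rewrite min_l // max_r // subr0 normr1 mulr1 /h /= !mul0r addr0 mul1r.
have -> : z + (w - z) = w by ring.
rewrite mulrA mulrAC; apply.
  move=> t t01; apply: (rder_comp (y := id) (h := h)) (dF t t01).
    by apply/cont_atE; apply: (rder_cont (@cont_at_real _ _) (hd t)).
  exact: hd.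
by move=> t t01; rewrite cmodM ler_wpM2l ?cmod_ge0 ?FB.
Qed.

(** A Cauchy criterion with a rate: each of the real and imaginary parts of q h is
    within K |h| of the supremum of its lower bounds p (q h) - K |h|. *)
Lemma limit_ex (q : C -> C) (r K : R) : 0 < r ->
  (forall h k, h != 0 -> k != 0 -> cmod h < r -> cmod k < r ->
     cmod (q h - q k) <= K * (cmod h + cmod k)) ->
  exists l, forall h, h != 0 -> cmod h < r -> cmod (q h - l) <= 2 * K * cmod h.
Proof.
move=> r0 qK.
pose S := [set h : C | h != 0 /\ cmod h < r].
have S0 : S (r / 2)%:C.
  split; first by rewrite -cmod_eq0 cmod_real gt_eqF // normr_gt0 gt_eqF // divr_gt0.
  by rewrite cmod_real gtr0_norm ?divr_gt0 //; lra.
have lim (p : C -> R) : (forall z, `|p z| <= cmod z) -> (forall z w, p (z - w) = p z - p w) ->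
    exists l, forall h, S h -> `|p (q h) - l| <= K * cmod h.
  move=> pc pB; exists (sup [set p (q h) - K * cmod h | h in S]).
  have cmp h k : S h -> S k -> p (q h) - K * cmod h <= p (q k) + K * cmod k.
    move=> [h0 hr] [k0 kr]; have := qK h k h0 k0 hr kr.
    move=> /(le_trans (pc _)); rewrite pB => /(le_trans (ler_norm _)); lra.
  move=> h Sh; rewrite ler_distlC; apply/andP; split.
    apply: ub_le_sup; last by exists h.
    exists (p (q (r / 2)%:C) + K * cmod (r / 2)%:C) => _ [k Sk <-]; exact: cmp.
  apply: ge_sup; first by exists (p (q (r / 2)%:C) - K * cmod (r / 2)%:C), (r / 2)%:C.
  by move=> _ [k Sk <-]; exact: cmp.
have [l1 l1P] := lim (@complex.Re R) (@Re_le_cmod R) (fun z w => etrans (ReD _ _) (congr1 _ (ReN _))).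
have [l2 l2P] := lim (@complex.Im R) (@Im_le_cmod R) (fun z w => etrans (ImD _ _) (congr1 _ (ImN _))).
exists (l1 +i* l2) => h h0 hr; rewrite (le_trans (cmod_le_ReIm _)) // !ReE /=.
have := l1P h (conj h0 hr); have := l2P h (conj h0 hr); lra.
Qed.

Lemma convex_lt (t u v a : R) : 0 <= t <= 1 -> u < a -> v < a -> (1 - t) * u + t * v < a.
Proof.
move=> /andP[t0 t1] ua va; apply: (@le_lt_trans _ _ (Num.max u v)); last by rewrite gt_max ua va.
have -> : Num.max u v = (1 - t) * Num.max u v + t * Num.max u v by ring.
by apply: lerD; apply: ler_wpM2l; rewrite ?subr_ge0 // le_max lexx ?orbT.
Qed.

Lemma sub_addl (a b c : C) : a - b = (a - c) + (c - b). Proof. by rewrite addrA subrK. Qed.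

(** Cauchy's estimate is applied three times: to f it bounds f', to the increments f (w
    + h) - f w it makes f' Lipschitz, and to the differences of two difference quotients
    of f it makes the difference quotients of f' a Cauchy family, so that f' is
    differentiable. *)
Lemma hol_deriv (z0 : C) (f : C -> C) : hol z0 f ->
  exists f', (\forall z \near z0, rder id f z (f' z)) /\ hol z0 f'.
Proof.
move=> fh.
have [l0 fz0] : exists d, rder id f z0 d by exact: nbhs_singleton fh.
have fb := cont_bounded (rder_cont (@cont_at_id _ _) fz0).
have [dl dl0 dlP] := (nearCP _ _).1 (filterI fh fb).
(* Each application of the estimate needs a margin of radius r: the discs of radius 8 r, 6 r,
   4 r and 2 r around z0 are used in turn. *)
pose r := dl / 8; have r0 : 0 < r by rewrite divr_gt0.
have dlE : dl = 8 * r by rewrite /r mulrC divfK.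
pose M := cmod (f z0) + 1.
have M0 : 0 <= M by rewrite addr_ge0 ?cmod_ge0.
pose f' z := xget 0 [set d | rder id f z d].
have f'P z : cmod (z - z0) < 8 * r -> rder id f z (f' z).
  move=> zr; have [|[d fd] _] := dlP z; first by rewrite dlE.
  by rewrite /f'; exact: (@xgetPex _ 0 [set d | rder id f z d] (ex_intro _ d fd)).
have fM z : cmod (z - z0) < 8 * r -> cmod (f z) <= M.
  by move=> zr; have [|_ ] := dlP z; rewrite ?dlE.
have ball2 (z w : C) a b : cmod (z - z0) < a -> cmod (w - z) <= b -> cmod (w - z0) < a + b.
  move=> h1 h2; rewrite (sub_addl w z0 z) (le_lt_trans (cmodD _ _)) //; lra.
pose B := 4 * M / r.
have D1 z : cmod (z - z0) < 6 * r -> cmod (f' z) <= B.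
  move=> zr; have br w : cmod (w - z) <= r -> cmod (w - z0) < 8 * r.
    by move=> wz; have := ball2 _ _ _ _ zr wz; lra.
  apply: (@cauchy_estimate _ f z r M) => //.
  - by move=> w /br wr; exists (f' w); exact: f'P.
  - by move=> w /br; exact: fM.
  - by apply: f'P; lra.
have B0 : 0 <= B by rewrite /B divr_ge0 // ?(ltW r0) // mulr_ge0.
have convex (z w : C) a t : 0 <= t <= 1 -> cmod (z - z0) < a -> cmod (w - z0) < a ->
    cmod (z + t%:C * (w - z) - z0) < a.
  move=> t01 za wa; have /andP[t0 t1] := t01.
  have -> : z + t%:C * (w - z) - z0 = (1 - t)%:C * (z - z0) + t%:C * (w - z0).
    by rewrite rmorphB rmorph1; ring.
  rewrite (le_lt_trans (cmodD _ _)) // !cmodM !cmod_real !ger0_norm ?subr_ge0 //.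
  exact: convex_lt.
have D2 z w : cmod (z - z0) < 6 * r -> cmod (w - z0) < 6 * r ->
    cmod (f w - f z) <= 2 * B * cmod (w - z).
  move=> zr wr; apply: (@cmvtC f f') => t t01.
    by apply: f'P; apply: (lt_trans (convex _ _ _ _ t01 zr wr)); lra.
  by apply: D1; exact: convex.
pose B2 := 8 * B / r.
have B20 : 0 <= B2 by rewrite /B2 divr_ge0 // ?(ltW r0) // mulr_ge0.
have rder_shift (h z d : C) : rder id f (z + h) d -> rder id (fun w => f (w + h)) z d.
  move=> fd; rewrite -[d]mul1r.
  apply: (rder_comp (y := id) (h := fun w => w + h) _ _ fd).
    apply/cont_atE; apply: cont_atD; first exact: cont_at_id.
    by move=> k k0; near=> q; rewrite subrr cmod0 ltW.
  by rewrite -[X in rder _ _ _ X]addr0; apply: rderD; [exact: rder_id|exact: rder_cst].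
have D3 z h : cmod (z - z0) < 4 * r -> cmod h < r ->
    cmod (f' (z + h) - f' z) <= B2 * cmod h.
  move=> zr hr.
  have b1 w : cmod (w - z) <= r -> cmod (w - z0) < 6 * r.
    by move=> wz; have := ball2 _ _ _ _ zr wz; lra.
  have b2 w : cmod (w - z) <= r -> cmod (w + h - z0) < 6 * r.
    move=> wz; have h1 := ball2 _ _ _ _ zr wz.
    have h2 : cmod (w + h - w) <= r by rewrite addrAC subrr add0r ltW.
    by have := ball2 _ _ _ _ h1 h2; lra.
  have -> : B2 * cmod h = 4 * (2 * B * cmod h) / r by rewrite /B2; field; exact: lt0r_neq0.
  apply: (@cauchy_estimate _ (fun w => f (w + h) - f w) z) => //.
  - move=> w wz; exists (f' (w + h) - f' w); apply: rderB.
      by apply: rder_shift; apply: f'P; have := b2 w wz; lra.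
    by apply: f'P; have := b1 w wz; lra.
  - move=> w wz; have -> : cmod h = cmod (w + h - w) by rewrite addrAC subrr add0r.
    by apply: D2; [exact: b1|exact: b2].
  - have zz : cmod (z - z) <= r by rewrite subrr cmod0 ltW.
    apply: rderB; first by apply: rder_shift; apply: f'P; have := b2 z zz; lra.
    by apply: f'P; have := b1 z zz; lra.
have D4 z h : cmod (z - z0) < 4 * r -> cmod h < r -> h != 0 ->
    cmod ((f (z + h) - f z) / h - f' z) <= 2 * B2 * cmod h.
  move=> zr hr h0; have m0 : 0 < cmod h by rewrite cmod_gt0.
  pose F w := f w - f' z * w.
  have zhr : cmod (z + h - z0) < 6 * r.
    have h2 : cmod (z + h - z) <= r by rewrite addrAC subrr add0r ltW.
    by have := ball2 _ _ _ _ zr h2; lra.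
  have -> : (f (z + h) - f z) / h - f' z = (F (z + h) - F z) / h by rewrite /F; field.
  rewrite cmodM cmodV ler_pdivrMr //.
  have hE : z + h - z = h by rewrite addrAC subrr add0r.
  have := @cmvtC F (fun w => f' w - f' z) z (z + h) (B2 * cmod h).
  rewrite hE mulrA; apply=> t t01.
    rewrite /F; apply: rderB.
      apply: f'P; have zr' : cmod (z - z0) < 6 * r by lra.
      by have := convex _ _ _ _ t01 zr' zhr; rewrite hE; lra.
    by rewrite -[X in rder _ _ _ X]mulr1; apply: rderZ; exact: rder_id.
  have th : cmod (t%:C * h) <= cmod h.
    case/andP: t01 => t0 t1.
    by rewrite cmodM cmod_real ger0_norm // ger_pMl.
  apply: (le_trans (D3 z (t%:C * h) zr (le_lt_trans th hr))).
  by rewrite ler_wpM2l.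
exists f'; split; first by apply/nearCP; exists (8 * r) => //; rewrite mulr_gt0.
apply/nearCP; exists (2 * r) => [|z zr]; first by rewrite mulr_gt0.
have b1 w : cmod (w - z) <= r -> cmod (w - z0) < 4 * r.
  by move=> wz; have := ball2 _ _ _ _ zr wz; lra.
have b2 w h : cmod (w - z) <= r -> cmod h < r -> cmod (w + h - z0) < 8 * r.
  move=> wz hr; have h2 : cmod (w + h - w) <= r by rewrite addrAC subrr add0r ltW.
  by have := ball2 _ _ _ _ (b1 w wz) h2; lra.
have zz : cmod (z - z) <= r by rewrite subrr cmod0 ltW.
have qd w h : cmod (w - z) <= r -> cmod h < r ->
    rder id (fun w => (f (w + h) - f w) / h) w ((f' (w + h) - f' w) / h).
  move=> wz hr; rewrite mulrC.
  apply: (@rder_ext _ _ (fun w => h^-1 * (f (w + h) - f w))) => [q|]; first by rewrite mulrC.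
  apply: rderZ; apply: rderB; first by apply: rder_shift; apply: f'P; exact: b2.
  by apply: f'P; have := b1 w wz; lra.
pose K := 8 * B2 / r.
have [|l lP] := @limit_ex (fun h => (f' (z + h) - f' z) / h) r K r0.
  move=> h k h0 k0 hr kr.
  have -> : K * (cmod h + cmod k) = 4 * (2 * B2 * cmod h + 2 * B2 * cmod k) / r.
    by rewrite /K; field; exact: lt0r_neq0.
  apply: (@cauchy_estimate _ (fun w => (f (w + h) - f w) / h - (f (w + k) - f w) / k) z) => //.
  - by move=> w wz; eexists; apply: rderB; exact: qd.
  - move=> w wz; apply: (le_trans (cmod_triangle (f' w) _ _)).
    rewrite [X in _ + X <= _]cmodBC.
    by apply: lerD; apply: D4 => //; exact: b1.
  - by apply: rderB; exact: qd.
exists l => e e0.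
have K0 : 0 <= K by rewrite /K divr_ge0 // ?(ltW r0) // mulr_ge0.
have K1 : 0 < 2 * K + 1 by lra.
apply/nearCP; exists (Num.min r (e / (2 * K + 1))); first by rewrite lt_min r0 divr_gt0.
move=> w; rewrite lt_min => /andP[wr we].
have [->|wz] := eqVneq w z; first by rewrite !subrr mul0r subr0 cmod0 mulr0.
have wz0 : w - z != 0 by rewrite subr_eq0.
have := lP (w - z) wz0 wr.
have -> : z + (w - z) = w by ring.
move=> h; have -> : f' w - f' z - (w - z) * l = ((f' w - f' z) / (w - z) - l) * (w - z).
  by rewrite [RHS]mulrBl (divfK wz0) [l * _]mulrC.
rewrite cmodM ler_wpM2r ?cmod_ge0 // (le_trans h) //.
rewrite (ltr_pdivlMr _ _ K1) in we; move: we; have := cmod_ge0 (w - z).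
by clear -K0; clearbody K; lra.
Unshelve. all: by end_near. Qed.

Lemma hol_rder (z0 : C) (f f' : C -> C) : (\forall z \near z0, rder id f z (f' z)) -> hol z0 f.
Proof. by apply: filterS => z ?; exists (f' z). Qed.

Lemma hol_near (z0 : C) (f g : C -> C) : (\forall z \near z0, f z = g z) -> hol z0 f -> hol z0 g.
Proof.
move=> /near_join fg fh; apply: filterS2 fg fh => z fgz [d fd].
by exists d; exact: rder_near fd.
Qed.

Lemma hol_cst z0 (k : C) : hol z0 (fun=> k).
Proof. by near=> z; exists 0; exact: rder_cst. Unshelve. all: by end_near. Qed.

Lemma hol_id (z0 : C) : hol z0 id.
Proof. by near=> z; exists 1; exact: rder_id. Unshelve. all: by end_near. Qed.

Lemma holD z0 (f g : C -> C) : hol z0 f -> hol z0 g -> hol z0 (fun z => f z + g z).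
Proof. by apply: filterS2 => z [d fd] [d' gd]; exists (d + d'); exact: rderD. Qed.

Lemma holM z0 (f g : C -> C) : hol z0 f -> hol z0 g -> hol z0 (fun z => f z * g z).
Proof.
apply: filterS2 => z [d fd] [d' gd]; exists (d * g z + f z * d').
by apply: rderM => //; exact: cont_at_id.
Qed.

Lemma hol_cont z0 (f : C -> C) : hol z0 f -> cont_at f z0.
Proof. by move=> /nbhs_singleton[d]; apply: rder_cont; exact: cont_at_id. Qed.

Lemma cont_near_neq0 (T : topologicalType) (u : T -> C) p :
  cont_at u p -> u p != 0 -> \forall q \near p, u q != 0.
Proof.
move=> /cont_at_nearP uc up0; have m0 : 0 < cmod (u p) by rewrite cmod_gt0.
apply: filterS (uc _ m0) => q; apply: contraTneq => ->.
by rewrite sub0r cmodN ltxx.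
Qed.

Lemma holV z0 (f : C -> C) : hol z0 f -> f z0 != 0 -> hol z0 (fun z => (f z)^-1).
Proof.
move=> fh f0; have := cont_near_neq0 (hol_cont fh) f0.
apply: filterS2 fh => z [d fd] fz0; exists (- d / f z ^+ 2).
by apply: rderV => //; exact: cont_at_id.
Qed.

(** The derivative at 0 is 0. *)
Lemma hol_at0_order2 (f : C -> C) B : f 0 = 0 ->
  (\forall z \near (0 : C)^', exists d, rder id f z d) ->
  (\forall z \near (0 : C), cmod (f z) <= B * cmod z ^+ 2) -> hol 0 f.
Proof.
move=> f0 /near_puncturedCP[d d0 dP] fB; apply/nearCP; exists d => // z zd.
have [->|z0] := eqVneq z 0; last exact: dP.
exists 0 => e e0.
have B1 : 0 < `|B| + 1 by rewrite ltr_wpDl.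
have eB : 0 < e / (`|B| + 1) by rewrite divr_gt0.
apply: filterS2 fB (@cont_at_id R 0 _ eB) => w; rewrite f0 mulr0 !subr0 => h1 h2.
rewrite (le_trans h1) // expr2 mulrA ler_wpM2r ?cmod_ge0 //.
rewrite ler_pdivlMr // in h2; rewrite (le_trans _ h2) // mulrC ler_wpM2l ?cmod_ge0 //.
by rewrite (le_trans (ler_norm _)) // lerDl.
Qed.

Lemma order_integrate (f f' : C -> C) (B : R) k : f 0 = 0 ->
  (\forall z \near (0 : C), rder id f z (f' z)) ->
  (\forall z \near (0 : C), cmod (f' z) <= B * cmod z ^+ k) ->
  \forall z \near (0 : C), cmod (f z) <= 2 * `|B| * cmod z ^+ k.+1.
Proof.
move=> f0 fd f'B; have [d d0 dP] := (nearCP _ _).1 (filterI fd f'B).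
apply/nearCP; exists d => // z; rewrite subr0 => zd.
have seg (t : R) : 0 <= t <= 1 -> cmod (0 + t%:C * (z - 0)) <= cmod z.
  move=> /andP[t0 t1]; rewrite add0r subr0 cmodM cmod_real ger0_norm //.
  by rewrite ler_piMl ?cmod_ge0.
have := @cmvtC f f' 0 z (`|B| * cmod z ^+ k).
rewrite f0 !subr0 exprSr !mulrA; apply=> t t01; have st := seg t t01.
  rewrite !subr0 in st; have [|//] := dP (0 + t%:C * z).
  by rewrite subr0; exact: le_lt_trans st zd.
rewrite !subr0 in st; have [|_ h] := dP (0 + t%:C * z); first by rewrite subr0; exact: le_lt_trans st zd.
rewrite (le_trans h) // (le_trans (ler_wpM2r _ (ler_norm _))) ?exprn_ge0 ?cmod_ge0 //.
by rewrite ler_wpM2l // lerXn2r ?nnegrE ?cmod_ge0.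
Qed.

(** Subtracting the Taylor polynomial of degree 2 leaves O(z^3), whose quotient
    by z is O(z^2) and thus differentiable at 0. *)
Lemma hol_divide (f : C -> C) : hol 0 f ->
  exists q, hol 0 q /\ \forall z \near (0 : C), f z = f 0 + z * q z.
Proof.
move=> fh; have [f1 [f1d f1h]] := hol_deriv fh; have [f2 [f2d f2h]] := hol_deriv f1h.
have [d3 f2z] := nbhs_singleton f2h.
pose E2 z := f2 z - f2 0; pose E1 z := f1 z - f1 0 - f2 0 * z.
pose E z := f z - f 0 - f1 0 * z - f2 0 / 2 * (z * z).
have E1d : \forall z \near (0 : C), rder id E1 z (E2 z).
  apply: filterS f2d => z f2d'; apply: rderB; last first.
    by rewrite -[X in rder _ _ _ X]mulr1; apply: rderZ; exact: rder_id.
  by rewrite -[X in rder _ _ _ X]subr0; apply: (rderB f2d'); exact: rder_cst.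
have Ed : \forall z \near (0 : C), rder id E z (E1 z).
  apply: filterS f1d => z h; apply: rder_eq; last first.
    apply: rderB; last by apply: rderZ; apply: rderM; [exact: cont_at_id|exact: rder_id|exact: rder_id].
    apply: rderB; last by apply: rderZ; exact: rder_id.
    by apply: rderB; [exact: h|exact: rder_cst].
  by rewrite /E1; field.
have E2B : \forall z \near (0 : C), cmod (E2 z) <= (cmod d3 + 1) * cmod z ^+ 1.
  by apply: filterS (rder_lip f2z) => z; rewrite subr0 expr1.
have E10 : E1 0 = 0 by rewrite /E1 subrr mulr0 subrr.
have E0 : E 0 = 0 by rewrite /E subrr !mulr0 !subr0.
have EB := order_integrate E0 Ed (order_integrate E10 E1d E2B).
set K := 2 * _ in EB.
have qh : hol 0 (fun z => E z / z).
  apply: (@hol_at0_order2 _ K).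
  - by rewrite E0 mul0r.
  - have [d d0 dP] := (nearCP _ _).1 (hol_rder Ed).
    apply/near_puncturedCP; exists d => // z zd z0; have [l El] := dP z zd.
    eexists; apply: rderM; [exact: cont_at_id|exact: El|].
    apply: (@rderV _ _ id) => //; [exact: cont_at_id|exact: rder_id].
  - apply: filterS EB => z h; have [->|z0] := eqVneq z 0.
      by rewrite invr0 mulr0 cmod0 expr0n mulr0.
    rewrite cmodM cmodV ler_pdivrMr ?cmod_gt0 //.
    by rewrite (le_trans h) // -[leRHS]mulrA -exprSr.
exists (fun z => f1 0 + f2 0 / 2 * z + E z / z); split.
  apply: holD => //; apply: holD; first exact: hol_cst.
  by apply: holM; [exact: hol_cst|exact: hol_id].
near=> z; have [->|z0] := eqVneq z 0; first by rewrite mul0r addr0.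
by rewrite /E; field.
Unshelve. all: by end_near. Qed.

Lemma hol_cst_near (z0 : C) (f : C -> C) : (\forall z \near z0, rder id f z 0) ->
  \forall z \near z0, f z = f z0.
Proof.
move=> /nearCP[d d0 dP]; apply/nearCP; exists d => // z zd.
apply/eqP; rewrite -subr_eq0 -cmod_eq0 eq_le cmod_ge0 andbT.
have := @cmvtC f (fun=> 0) z0 z 0; rewrite mulr0 mul0r; apply=> t /andP[t0 t1].
  apply: dP; rewrite addrAC subrr add0r cmodM cmod_real ger0_norm //.
  by rewrite (le_lt_trans _ zd) // ler_piMl ?cmod_ge0.
by rewrite cmod0.
Qed.

Lemma hol_cst_global (f : C -> C) z w : (forall z, rder id f z 0) -> f z = f w.
Proof.
move=> fd; apply/eqP; rewrite -subr_eq0 -cmod_eq0 eq_le cmod_ge0 andbT.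
have := @cmvtC f (fun=> 0) w z 0; rewrite mulr0 mul0r; apply=> t _; first exact: fd.
by rewrite cmod0.
Qed.

(** A primitive L of 1/z with value w0 at z0: the derivative of z exp (- L z) is 0. *)
Lemma log_ex (z0 w0 : C) : expC w0 = z0 ->
  exists L : C -> C, [/\ L z0 = w0, \forall z \near z0, expC (L z) = z &
    \forall z \near z0, rder id L z z^-1].
Proof.
move=> w0E; have z00 : z0 != 0 by rewrite -w0E expC_neq0.
have [L0 L0d] := hol_prim (holV (hol_id z0) z00).
pose L z := L0 z - L0 z0 + w0.
have Ld : \forall z \near z0, rder id L z z^-1.
  apply: filterS L0d => z h; rewrite -[X in rder _ _ _ X]addr0 -[X in X + _]subr0.
  by apply: rderD; [apply: rderB => //; exact: rder_cst|exact: rder_cst].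
have Lz0 : L z0 = w0 by rewrite /L subrr add0r.
exists L; split => //.
have : \forall z \near z0, z * expC (- L z) = z0 * expC (- L z0).
  apply: (@hol_cst_near z0 (fun z => z * expC (- L z))).
  have nz := cont_near_neq0 (@cont_at_id R z0) z00.
  apply: filterS2 Ld nz => z h zn0; apply: rder_eq; last first.
    apply: rderM; [exact: cont_at_id|exact: rder_id|].
    apply: (rder_comp (y := id) (h := fun z => - L z) _ _ (rder_expC _)).
      by apply/cont_atE; apply: cont_atN; exact: (rder_cont (@cont_at_id _ _) h).
    by apply: rderN; exact: h.
  by rewrite mul1r mulrA mulrN divff // mulN1r subrr.
apply: filterS => z; rewrite Lz0 -{1}w0E -expCD subrr expC0 expCN => h.
by apply: (mulIf (invr_neq0 (expC_neq0 (L z)))); rewrite h divff // expC_neq0.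
Unshelve. all: by end_near. Qed.

End Derivatives.

(** * The local algebra A and its exponential *)

Section LocalAlgebra.
Context (R : realType) (A : comFalgType R[i]) (m : {pred A}).
Local Notation C := R[i].
Hypothesis localA : local_with_maximal_ideal m.

Lemma ideal_m : idealr_closed m.
Proof. by case: localA => -[]. Qed.

Lemma m_0 : 0 \in m. Proof. by case: ideal_m. Qed.

Lemma m_1 : 1 \notin m. Proof. by case: ideal_m. Qed.

Lemma m_D u v : u \in m -> v \in m -> u + v \in m.
Proof. by case: ideal_m => _ _ mP um vm; rewrite -[u]mul1r mP. Qed.

Lemma m_M a u : u \in m -> a * u \in m.
Proof. by case: ideal_m => m0 _ mP um; rewrite -[a * u]addr0 mP. Qed.

Lemma m_Z c u : u \in m -> c *: u \in m.
Proof. by move=> um; rewrite -mulr_algl m_M. Qed.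

Lemma m_N u : u \in m -> - u \in m.
Proof. by rewrite -scaleN1r; exact: m_Z. Qed.

Lemma m_X u k : u \in m -> u ^+ k.+1 \in m.
Proof. by move=> um; rewrite exprSr m_M. Qed.

Lemma m_sum (I : Type) (r : seq I) (P : pred I) (F : I -> A) :
  (forall i, P i -> F i \in m) -> \sum_(i <- r | P i) F i \in m.
Proof. by move=> Fm; elim/big_ind: _ => //; [exact: m_0|exact: m_D]. Qed.

(** A proper ideal of largest dimension containing a is maximal, hence equal to m. *)
Lemma nonunit_in_m (a : A) : a \isn't a GRing.unit -> a \in m.
Proof.
move=> aU.
pose Q (W : {vspace A}) := [/\ forall b u, u \in W -> b * u \in W, 1 \notin W & a \in W].
pose Pk (k : nat) := `[< exists W, Q W /\ \dim W = k >].
have principal (b u : A) : u \in (amull b @: fullv)%VS -> exists c, u = b * c.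
  by move=> /memv_imgP[c _ ->]; exists c; rewrite lfunE.
have in_principal (b c : A) : b * c \in (amull b @: fullv)%VS.
  by apply/memv_imgP; exists c; rewrite ?memvf // lfunE.
have exP : exists k, Pk k.
  exists (\dim (amull a @: fullv)%VS); apply/asboolP; exists (amull a @: fullv)%VS.
  split => //; split.
  - by move=> b _ /principal[c ->]; rewrite mulrCA in_principal.
  - by apply: contra aU => /principal[c ac]; apply/unitrPr; exists c.
  - by have := in_principal a 1; rewrite mulr1.
have ub k : Pk k -> (k <= \dim {:A})%N.
  by move=> /asboolP[W [_ <-]]; apply: dimvS; exact: subvf.
case: (ex_maxnP exP ub) => k /asboolP[W [[WM W1 Wa] <-]] Wmax.
have Wideal : idealr_closed [pred u | u \in W].
  split; rewrite ?inE ?mem0v // => b u v; rewrite !inE => uW vW.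
  by rewrite memvD // WM.
have : maximal_ideal [pred u | u \in W].
  split => // J [J0 J1 JP] WJ b; apply/idP/idP => [bJ|]; last exact: WJ.
  rewrite inE; apply/negPn/negP => bW.
  pose W' := (W + amull b @: fullv)%VS.
  have bW' : b \in W'.
    by rewrite -[X in X \in _]add0r memv_add ?mem0v //; have := in_principal b 1; rewrite mulr1.
  have WW' : (W <= W')%VS by exact: addvSl.
  have QW' : Q W'.
    split; last exact: subvP WW' _ Wa.
    - move=> c _ /memv_addP[w wW [_ /principal[d ->] ->]].
      by rewrite mulrDr mulrCA memv_add // WM.
    - apply: contra J1 => /memv_addP[w wW [_ /principal[d ->] ->]].
      by rewrite addrC mulrC JP // WJ.
  have := Wmax (\dim W'); rewrite /Pk => /(_ (asboolT _)) h.
  have {}h : (\dim W' <= \dim W)%N by apply: h; exists W'.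
  have := dimv_leqif_sup WW'; move=> [le eq].
  have : \dim W == \dim W' by rewrite eqn_leq le h.
  by rewrite eq => /subvP/(_ b bW'); apply/negP.
by case: localA => _ /[apply] /(_ a); rewrite inE Wa => <-.
Qed.

Lemma notin_m_unit (a : A) : a \notin m -> a \is a GRing.unit.
Proof. by apply: contraR; exact: nonunit_in_m. Qed.

Lemma unit_notin_m (a : A) : a \is a GRing.unit -> a \notin m.
Proof.
move=> aU; apply/negP => /(m_M a^-1); rewrite mulVr //; apply/negP; exact: m_1.
Qed.

Lemma alg_notin_m (c : C) : c != 0 -> c%:A \notin m.
Proof.
move=> c0; apply/negP => /(m_Z c^-1); rewrite scalerA mulVf // scale1r.
by apply/negP; exact: m_1.
Qed.

(** There is a nontrivial linear relation between 1, u, ..., u^d. Its term of lowest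
    degree j factors out, and the cofactor is a nonzero constant plus an element of m,
    hence a unit; so u^j = 0. *)
Lemma m_nilpotent u : u \in m -> u ^+ \dim {:A} = 0.
Proof.
move=> um; set d := \dim {:A}.
pose X := [tuple u ^+ (i : nat) | i < d.+1].
have nf : ~~ free X.
  apply/negP => /eqP; rewrite size_tuple => h.
  by have := dimvS (subvf <<X>>%VS); rewrite h ltnn.
have [k [k0 [i ki]]] : exists k : 'I_d.+1 -> C, \sum_i k i *: X`_i = 0 /\ exists i, k i != 0.
  have h : ~ (forall k : 'I_d.+1 -> C, \sum_i k i *: X`_i = 0 -> forall i, k i = 0).
    by move/freeP; apply/negP.
  apply: contrapT => nk; apply: h => k k0 i.
  by apply: contrapT => ki; apply: nk; exists k; split => //; exists i; apply/eqP.
have Xi (j : 'I_d.+1) : X`_j = u ^+ j by rewrite -tnth_nth tnth_mktuple.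
case: (@arg_minnP _ i (fun j => k j != 0) (fun j : 'I_d.+1 => (j : nat)) ki) => j kj jmin.
have : u ^+ j * ((k j)%:A + \sum_(l < d.+1 | (j < l)%N) k l *: u ^+ (l - j)) = 0.
  rewrite -[RHS]k0 mulrDr [RHS](bigID (fun l : 'I_d.+1 => (j < l)%N)) /= [RHS]addrC.
  congr (_ + _); last first.
    rewrite mulr_sumr; apply: eq_bigr => l jl.
    by rewrite Xi -scalerAr -exprD subnKC // ltnW.
  rewrite (bigD1 j) ?ltnn //= Xi -scalerAr mulr1 big1 ?addr0 // => l.
  rewrite -leqNgt => /andP[lj nlj].
  have [->|kl] := eqVneq (k l) 0; first by rewrite scale0r.
  have := jmin l kl => jl; case/negP: nlj; apply/eqP/val_inj; apply/eqP.
  by rewrite eqn_leq lj jl.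
have cU : (k j)%:A + \sum_(l < d.+1 | (j < l)%N) k l *: u ^+ (l - j) \is a GRing.unit.
  apply: notin_m_unit; apply: contra (alg_notin_m kj) => h.
  have sm : \sum_(l < d.+1 | (j < l)%N) k l *: u ^+ (l - j) \in m.
    by apply: m_sum => l jl; apply: m_Z; rewrite -[(l - j)%N]prednK ?subn_gt0 // m_X.
  by have := m_D h (m_N sm); rewrite addrK.
move=> /(congr1 (fun a => a / ((k j)%:A + \sum_(l < d.+1 | (j < l)%N) k l *: u ^+ (l - j)))).
rewrite mulrK // mul0r => uj.
by rewrite -[d](@subnK j) ?exprD ?uj ?mulr0 // -ltnS.
Qed.

Lemma m_nilpotent_ge u k : u \in m -> (\dim {:A} <= k)%N -> u ^+ k = 0.
Proof. by move=> um /subnK <-; rewrite exprD (m_nilpotent um) mulr0. Qed.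

(** The exponential series on m, where it is a finite sum. *)
Definition expm (u : A) : A := \sum_(k < \dim {:A}) (k`!%:R : C)^-1 *: u ^+ k.

Lemma expm_wide u T : u \in m -> (\dim {:A} <= T)%N ->
  expm u = \sum_(k < T) (k`!%:R : C)^-1 *: u ^+ k.
Proof.
move=> um dT; rewrite /expm.
rewrite (big_ord_widen T (fun k => (k`!%:R : C)^-1 *: u ^+ k)) // big_mkcond /=.
apply: eq_bigr => k _; case: ltnP => // dk.
by rewrite (m_nilpotent_ge um dk) scaler0.
Qed.

(** Both sides are read off the product of the two truncated exponential polynomials:
    the terms omitted by the truncation vanish because u and v are nilpotent. *)
Lemma expmD u v : u \in m -> v \in m -> expm (u + v) = expm u * expm v.
Proof.
move=> um vm; set D := \dim {:A}.
pose p (w : A) : {poly A} := \poly_(k < D) ((k`!%:R : C)^-1 *: w ^+ k).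
have pE w : expm w = (p w).[1].
  by rewrite horner_poly; apply: eq_bigr => k _; rewrite expr1n mulr1.
have pc w k : w \in m -> (p w)`_k = (k`!%:R : C)^-1 *: w ^+ k.
  move=> wm; rewrite coef_poly; case: ltnP => // dk.
  by rewrite (m_nilpotent_ge wm dk) scaler0.
rewrite (@expm_wide _ (D + D)) ?m_D ?leq_addr // !pE -hornerM.
rewrite (@horner_coef_wide _ (D + D)); last first.
  rewrite (leq_trans (size_polyMleq _ _)) // (leq_trans (leq_pred _)) // leq_add //; exact: size_poly.
apply: eq_bigr => k _; rewrite expr1n mulr1 coefM addrC exprDn scaler_sumr.
apply: eq_bigr => i _; rewrite !pc // -scalerAl -scalerAr scalerA [u ^+ _ * _]mulrC.
have -> (w : A) q : w *+ q = (q%:R : C) *: w by rewrite scaler_nat.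
rewrite scalerA; congr (_ *: _).
have ik : (i <= k)%N by rewrite -ltnS.
have f0 j : (j`!%:R : C) != 0 by rewrite pnatr_eq0 -lt0n fact_gt0.
rewrite -(bin_fact ik) !natrM; field; rewrite !f0 /= pnatr_eq0 -lt0n bin_gt0 ik.
by [].
Qed.

Lemma expm0 : expm 0 = 1.
Proof.
have d0 : (0 < \dim {:A})%N by rewrite dimvf FalgType_proper.
rewrite /expm -(prednK d0) big_ord_recl expr0 fact0 invr1 scale1r big1 ?addr0 // => i _.
by rewrite expr0n /= scaler0.
Qed.

(** The inverse of 1 - u for u in m. *)
Definition geom (u : A) : A := \sum_(k < \dim {:A}) u ^+ k.

Lemma geomP u : u \in m -> (1 - u) * geom u = 1.
Proof. by move=> um; rewrite -opprB mulNr -subrX1 (m_nilpotent um) sub0r opprK. Qed.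

(** The logarithm of 1 - u. *)
Definition lg (u : A) : A := - \sum_(k < \dim {:A}) (k.+1%:R : C)^-1 *: u ^+ k.+1.

Lemma unit_1B u : u \in m -> 1 - u \is a GRing.unit.
Proof.
move=> um; apply: notin_m_unit; apply: contra m_1 => h.
by rewrite -[1](subrK u) m_D.
Qed.

Section Basis.
Context (n : nat) (e : n.+1.-tuple A).
Hypothesis basis_e : basis_of {:A} e.
Hypothesis e0 : tnth e ord0 = 1.
Hypothesis em : forall i, i != ord0 -> tnth e i \in m.

Lemma coord_sum (a : A) : a = \sum_i coord e i a *: tnth e i.
Proof.
rewrite {1}(coord_basis basis_e (memvf a)); apply: eq_bigr => i _.
by rewrite (tnth_nth 0).
Qed.

Lemma coord_comb (k : 'I_n.+1 -> C) j : coord e j (\sum_i k i *: tnth e i) = k j.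
Proof.
under eq_bigr do rewrite (tnth_nth 0).
exact: coord_sum_free (basis_free basis_e).
Qed.

Lemma coordA_ext (a b : A) : (forall i, coord e i a = coord e i b) -> a = b.
Proof. by move=> ab; rewrite (coord_sum a) (coord_sum b); apply: eq_bigr => i _; rewrite ab. Qed.

(** The basis elements other than e_0 = 1 lie in m, so A = C + m is visible on
    coordinates. *)
Lemma coord_in_m (a : A) : (a - (coord e ord0 a)%:A) \in m.
Proof.
rewrite {1}(coord_sum a) big_ord_recl e0 addrAC subrr add0r.
by apply: m_sum => i _; apply/m_Z/em.
Qed.

Lemma residueP (a : A) : residue m a = coord e ord0 a.
Proof.
rewrite /residue; case: xgetP => [c _ /= cm|/(_ (coord e ord0 a))]; last first.
  by have := coord_in_m a.
apply/eqP; rewrite -subr_eq0; apply: contraT => /alg_notin_m/negP; case.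
have := m_D (coord_in_m a) (m_N cm).
by rewrite opprB [_ + (c%:A - a)]addrC addrA subrK -scalerBl.
Qed.

Lemma residue_nilp (a : A) : a - (residue m a)%:A \in m.
Proof. by rewrite residueP coord_in_m. Qed.

Lemma residue_uniq (a : A) c : a - c%:A \in m -> residue m a = c.
Proof.
move=> cm; apply/eqP; rewrite -subr_eq0; apply: contraT => /alg_notin_m/negP; case.
have := m_D cm (m_N (residue_nilp a)).
by rewrite opprB addrC addrA subrK -scalerBl.
Qed.

Lemma unit_residue (a : A) : (a \is a GRing.unit) = (residue m a != 0).
Proof.
apply/idP/idP => [aU|r0].
  apply: contraL aU => /eqP r0; apply: contraL (residue_nilp a) => /unit_notin_m.
  by rewrite r0 scale0r subr0.
apply: notin_m_unit; apply: contra r0 => am.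
by rewrite (@residue_uniq a 0) // scale0r subr0.
Qed.

Lemma residueD (a b : A) : residue m (a + b) = residue m a + residue m b.
Proof. by rewrite !residueP linearD. Qed.

Lemma expAE (a : A) : expA m a = expC (residue m a) *: expm (a - (residue m a)%:A).
Proof. by []. Qed.

Lemma expAD (a b : A) : expA m (a + b) = expA m a * expA m b.
Proof.
rewrite !expAE residueD expCD scalerDl opprD addrACA (expmD (residue_nilp a) (residue_nilp b)).
by rewrite -scalerAl -scalerAr scalerA.
Qed.

Lemma expA_m (u : A) : u \in m -> expA m u = expm u.
Proof.
move=> um; rewrite expAE (@residue_uniq u 0) scale0r ?subr0 // expC0 scale1r //.
Qed.

Lemma expA_alg (c : C) : expA m c%:A = (expC c)%:A.
Proof.
by rewrite expAE (@residue_uniq _ c) subrr ?expm0 // m_0.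
Qed.

Lemma expA0 : expA m 0 = 1.
Proof. by rewrite expA_m ?m_0 // expm0. Qed.

Lemma expANM (a : A) : expA m a * expA m (- a) = 1.
Proof. by rewrite -expAD subrr expA0. Qed.

Lemma expA_unit (a : A) : expA m a \is a GRing.unit.
Proof. by apply/unitrPr; exists (expA m (- a)); exact: expANM. Qed.

Lemma expAN (a : A) : expA m (- a) = (expA m a)^-1.
Proof. by apply: (mulrI (expA_unit a)); rewrite expANM mulrV ?expA_unit. Qed.

Lemma expAMn (a : A) k : expA m (a *+ k) = expA m a ^+ k.
Proof. by elim: k => [|k IH]; rewrite ?mulr0n ?expA0 // mulrS expAD IH exprS. Qed.

Lemma expAMz (a : A) (k : int) : expA m (a *~ k) = expA m a ^ k.
Proof.
by case: k => k; rewrite ?NegzE ?mulrNz /= ?expAN -?pmulrn expAMn // -exprnN.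
Qed.

Lemma expA_sum (I : Type) (r : seq I) (P : pred I) (F : I -> A) :
  expA m (\sum_(i <- r | P i) F i) = \prod_(i <- r | P i) expA m (F i).
Proof. exact: (big_morph (expA m) expAD expA0). Qed.

End Basis.
End LocalAlgebra.

(** * Differentiation of functions with values in A *)

Section AlgebraCalculus.
Context (R : realType) (A : comFalgType R[i]) (m : {pred A}).
Context (n : nat) (e : n.+1.-tuple A).
Local Notation C := R[i].
Hypothesis localA : local_with_maximal_ideal m.
Hypothesis basis_e : basis_of {:A} e.
Hypothesis e0 : tnth e ord0 = 1.
Hypothesis em : forall i, i != ord0 -> tnth e i \in m.

(** Functions with values in A are differentiated coordinate by coordinate. *)
Definition rderA (T : topologicalType) (x : T -> C) (F : T -> A) (p : T) (a : A) : Prop :=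
  forall i, rder x (fun q => coord e i (F q)) p (coord e i a).

Definition cont_atA (T : topologicalType) (F : T -> A) (p : T) : Prop :=
  forall i, cont_at (fun q => coord e i (F q)) p.

Section Rules.
Context (T : topologicalType) (x : T -> C) (p : T).
Hypothesis xp : cont_at x p.
Implicit Types (F G : T -> A).

Lemma rderA_ext F G a : (forall q, F q = G q) -> rderA x F p a -> rderA x G p a.
Proof. by move=> FG; have -> : F = G by apply/funext. Qed.

Lemma rderA_near F G a : (\forall q \near p, F q = G q) -> rderA x F p a -> rderA x G p a.
Proof.
by move=> FG Fa i; apply: rder_near (Fa i); apply: filterS FG => q ->.
Qed.

Lemma rderAZc F c a : rderA x F p a -> rderA x (fun q => c *: F q) p (c *: a).
Proof.
move=> Fa i; rewrite linearZ /=.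
by apply: rder_ext (rderZ c (Fa i)) => q; rewrite linearZ.
Qed.

Lemma rderA_eq F a b : a = b -> rderA x F p a -> rderA x F p b.
Proof. by move=> ->. Qed.

Lemma rderA_cst (a : A) : rderA x (fun=> a) p 0.
Proof. by move=> i; rewrite linear0; exact: rder_cst. Qed.

Lemma rderAD F G a b : rderA x F p a -> rderA x G p b -> rderA x (fun q => F q + G q) p (a + b).
Proof.
move=> Fa Gb i; rewrite linearD.
by apply: rder_ext (rderD (Fa i) (Gb i)) => q; rewrite linearD.
Qed.

Lemma rderAN F a : rderA x F p a -> rderA x (fun q => - F q) p (- a).
Proof.
move=> Fa i; rewrite linearN.
by apply: rder_ext (rderN (Fa i)) => q; rewrite linearN.
Qed.

Lemma rderAB F G a b : rderA x F p a -> rderA x G p b -> rderA x (fun q => F q - G q) p (a - b).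
Proof. by move=> Fa /rderAN; exact: rderAD. Qed.

Lemma rderA_sum (I : Type) (r : seq I) (P : pred I) (F : I -> T -> A) (a : I -> A) :
  (forall i, P i -> rderA x (F i) p (a i)) ->
  rderA x (fun q => \sum_(i <- r | P i) F i q) p (\sum_(i <- r | P i) a i).
Proof.
move=> Fa; elim: r => [|i r IH].
  by rewrite big_nil; apply: rderA_ext (rderA_cst 0) => q; rewrite big_nil.
rewrite big_cons; case: ifP => Pi.
  by apply: rderA_ext (rderAD (Fa i Pi) IH) => q; rewrite big_cons Pi.
by apply: rderA_ext IH => q; rewrite big_cons Pi.
Qed.

Lemma rderA_scale (u : T -> C) (a : A) d : rder x u p d -> rderA x (fun q => u q *: a) p (d *: a).
Proof.
move=> ud i; rewrite linearZ /= mulrC.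
by apply: rder_ext (rderZ (coord e i a) ud) => q; rewrite linearZ /= mulrC.
Qed.

Lemma coordM (a b : A) k :
  coord e k (a * b) = \sum_i \sum_j coord e i a * coord e j b * coord e k (tnth e i * tnth e j).
Proof.
rewrite {1}(coord_sum basis_e a) {1}(coord_sum basis_e b) mulr_suml linear_sum.
apply: eq_bigr => i _; rewrite mulr_sumr linear_sum; apply: eq_bigr => j _.
by rewrite -scalerAl -scalerAr scalerA linearZ.
Qed.

Lemma rder_sum (I : Type) (r : seq I) (u : I -> T -> C) (d : I -> C) :
  (forall i, rder x (u i) p (d i)) ->
  rder x (fun q => \sum_(i <- r) u i q) p (\sum_(i <- r) d i).
Proof.
move=> ud; elim: r => [|i r IH].
  by rewrite big_nil; apply: rder_ext (rder_cst _ _ 0) => q; rewrite big_nil.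
rewrite big_cons; by apply: rder_ext (rderD (ud i) IH) => q; rewrite big_cons.
Qed.

(** The product of A is bilinear in coordinates. *)
Lemma rderAM F G a b : rderA x F p a -> rderA x G p b ->
  rderA x (fun q => F q * G q) p (a * G p + F p * b).
Proof.
move=> Fa Gb k; rewrite linearD /= !coordM -big_split /=.
apply: (rder_ext (u := fun q => \sum_i \sum_j coord e i (F q) * coord e j (G q) * coord e k (tnth e i * tnth e j))).
  by move=> q; rewrite coordM.
apply: rder_sum => i; rewrite -big_split /=; apply: rder_sum => j.
rewrite -mulrDl [_ * coord e k _]mulrC.
apply: rder_ext (rderZ (coord e k (tnth e i * tnth e j)) (rderM xp (Fa i) (Gb j))) => q.
by rewrite [LHS]mulrC.
Qed.

Lemma rderAMl F a b : rderA x F p a -> rderA x (fun q => b * F q) p (b * a).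
Proof.
move=> Fa; apply: rderA_eq (rderAM (rderA_cst b) Fa).
by rewrite mul0r add0r.
Qed.

Lemma rderAZ (u : T -> C) F d a : rder x u p d -> rderA x F p a ->
  rderA x (fun q => u q *: F q) p (d *: F p + u p *: a).
Proof.
move=> ud Fa; apply: rderA_eq; last first.
  apply: (rderA_ext (F := fun q => (u q)%:A * F q)); first by move=> q; rewrite mulr_algl.
  exact: (rderAM (rderA_scale 1 ud) Fa).
by rewrite !mulr_algl.
Qed.

Lemma rderAX F a k : rderA x F p a -> rderA x (fun q => F q ^+ k.+1) p (k.+1%:R *: (F p ^+ k * a)).
Proof.
move=> Fa; elim: k => [|k IH].
  by rewrite scale1r mul1r; apply: rderA_ext Fa => q.
apply: rderA_eq (rderA_ext _ (rderAM Fa IH)); last by move=> q; rewrite -exprS.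
rewrite -scalerAr mulrA -exprS [a * _]mulrC -[X in X + _]scale1r -scalerDl.
by congr (_ *: _); rewrite -natr1 addrC.
Qed.

Lemma rderA_contA F a : rderA x F p a -> cont_atA F p.
Proof. by move=> Fa i; have h := Fa i; exact: (rder_cont xp h). Qed.

Lemma rder_residue F a : rderA x F p a -> rder x (fun q => residue m (F q)) p (residue m a).
Proof.
move=> /(_ ord0); rewrite (residueP localA basis_e e0 em).
by apply: rder_ext => q; rewrite (residueP localA basis_e e0 em).
Qed.

Lemma rderA_nilp F a : rderA x F p a ->
  rderA x (fun q => F q - (residue m (F q))%:A) p (a - (residue m a)%:A).
Proof. by move=> Fa; apply: rderAB => //; apply: rderA_scale; exact: rder_residue. Qed.

(** A difference factored through a continuous function; the derivative of an inverse
    comes from such a factorisation. *)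
Lemma rderA_factor F H K a : rderA x F p a -> cont_atA K p ->
  (\forall q \near p, H q - H p = (F q - F p) * K q) -> rderA x H p (a * K p).
Proof.
move=> Fa Kc HF.
have key (u k : T -> C) d : rder x u p d -> cont_at k p ->
    rder x (fun q => (u q - u p) * k q) p (d * k p).
  move=> ud kc eps eps0.
  have d1 : 0 < cmod d + 1 by rewrite ltr_wpDl ?cmod_ge0.
  have k1 : 0 < cmod (k p) + 1 by rewrite ltr_wpDl ?cmod_ge0.
  have e1 : 0 < eps / 2 / (cmod d + 1) by rewrite !divr_gt0.
  have e2 : 0 < eps / 2 / (cmod (k p) + 1) by rewrite !divr_gt0.
  near=> q.
  have h1 : cmod (k q - k p) <= eps / 2 / (cmod d + 1) by near: q; exact: kc.
  have h2 : cmod (u q - u p - (x q - x p) * d) <= eps / 2 / (cmod (k p) + 1) * cmod (x q - x p).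
    by near: q; exact: ud.
  have h3 : cmod (u q - u p) <= (cmod d + 1) * cmod (x q - x p).
    by near: q; exact: (rder_lip ud).
  have -> : (u q - u p) * k q - (u p - u p) * k p - (x q - x p) * (d * k p) =
    (u q - u p) * (k q - k p) + (u q - u p - (x q - x p) * d) * k p by ring.
  rewrite (le_trans (cmodD _ _)) // !cmodM [eps in leRHS]splitr [leRHS]mulrDl lerD //.
    apply: le_trans (ler_pM _ _ h3 h1) _; rewrite ?cmod_ge0 //.
    by rewrite le_eqVlt; apply/orP; left; apply/eqP; field; exact: lt0r_neq0.
  have hk : cmod (k p) <= cmod (k p) + 1 by rewrite lerDl.
  apply: le_trans (ler_pM _ _ h2 hk) _; rewrite ?cmod_ge0 //.
  by rewrite le_eqVlt; apply/orP; left; apply/eqP; field; exact: lt0r_neq0.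
apply: (rderA_near (F := fun q => H p + (F q - F p) * K q)).
  by apply: filterS HF => q h; rewrite -h addrC subrK.
rewrite -[a * _]add0r; apply: rderAD; first exact: rderA_cst.
move=> l; rewrite coordM.
apply: (rder_ext (u := fun q => \sum_i \sum_j (coord e i (F q) - coord e i (F p)) * coord e j (K q) * coord e l (tnth e i * tnth e j))).
  move=> q; rewrite coordM; apply: eq_bigr => i _; apply: eq_bigr => j _.
  by rewrite linearB.
apply: rder_sum => i; apply: rder_sum => j; rewrite [_ * coord e l _]mulrC.
apply: rder_ext (rderZ (coord e l (tnth e i * tnth e j)) (key _ _ _ (Fa i) (Kc j))) => q.
by rewrite [LHS]mulrC.
Unshelve. all: by end_near. Qed.

Lemma unit_near F : cont_atA F p -> F p \is a GRing.unit -> \forall q \near p, F q \is a GRing.unit.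
Proof.
move=> Fc FU; have := cont_near_neq0 (Fc ord0).
rewrite -(residueP localA basis_e e0 em) -(unit_residue localA basis_e e0 em) => /(_ FU).
by apply: filterS => q; rewrite -(residueP localA basis_e e0 em) -(unit_residue localA basis_e e0 em).
Qed.

(** Scaling by the residue reduces the inverse of a unit to that of 1 - u with u in m,
    which is polynomial in u. *)
Lemma invA_geom (a : A) : a \is a GRing.unit ->
  a^-1 = (residue m a)^-1 *: geom (1 - (residue m a)^-1 *: a).
Proof.
move=> aU; have r0 : residue m a != 0 by rewrite -(unit_residue localA basis_e e0 em).
have um : 1 - (residue m a)^-1 *: a \in m.
  have := m_Z localA (- (residue m a)^-1) (residue_nilp localA basis_e e0 em a).
  by rewrite scalerBr scalerA mulNr mulVf // !scaleNr scale1r opprK addrC.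
apply: (mulrI aU); rewrite mulrV //.
have {1}-> : a = residue m a *: (1 - (1 - (residue m a)^-1 *: a)).
  by rewrite opprB addrC subrK scalerA divff // scale1r.
by rewrite -scalerAl -scalerAr scalerA divff // scale1r (geomP localA).
Qed.

(** The formula of invA_geom shows that the inverse is differentiable, and in particular
    continuous; the derivative is then found from (1 / F q - 1 / F p) = - (F q - F p) /
    (F p F q). *)
Lemma rderA_inv F a : F p \is a GRing.unit -> rderA x F p a ->
  rderA x (fun q => (F q)^-1) p (- a * (F p)^-1 ^+ 2).
Proof.
move=> FU Fa; have Fc := rderA_contA Fa.
have nU := unit_near Fc FU.
have r0 : residue m (F p) != 0 by rewrite -(unit_residue localA basis_e e0 em).
have [b Gb] : exists b, rderA x (fun q => (F q)^-1) p b.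
  have [b Gb] : exists b, rderA x (fun q => (residue m (F q))^-1 *: geom (1 - (residue m (F q))^-1 *: F q)) p b.
    have rV := rderV xp r0 (rder_residue Fa).
    have hk k : exists b, rderA x (fun q => (1 - (residue m (F q))^-1 *: F q) ^+ k) p b.
      case: k => [|k]; first by exists 0; exact: rderA_cst.
      by eexists; apply: rderAX; apply: rderAB (rderA_cst 1) (rderAZ rV Fa).
    have [b bP] := choice hk.
    by eexists; apply: rderAZ rV _; apply: rderA_sum => i _; exact: (bP (i : nat)).
  by exists b; apply: rderA_near Gb; apply: filterS nU => q /invA_geom ->.
have -> : - a * (F p)^-1 ^+ 2 = a * (- (F p)^-1 * (F p)^-1) by rewrite expr2 mulNr -mulrN mulNr.
apply: (@rderA_factor F _ (fun q => - (F p)^-1 * (F q)^-1)) => //.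
  exact: rderA_contA (rderAMl _ Gb).
apply: filterS nU => q qU.
apply: (mulrI FU); apply: (mulrI qU).
rewrite mulNr !mulrN mulrBl !mulrBr.
have -> : F q * (F p * (F q * ((F p)^-1 * (F q)^-1))) = F q.
  by rewrite [F q * (_^-1 * _)]mulrCA mulrV // mulr1 mulrV // mulr1.
have -> : F q * (F p * (F p * ((F p)^-1 * (F q)^-1))) = F p.
  by rewrite [F p * (_^-1 * _)]mulrA mulrV // mul1r mulrCA mulrV // mulr1.
by rewrite [F q * (F p * _)]mulrCA mulrV // [F p * (F p)^-1]mulrV // !mulr1 opprB.
Qed.

(** Term by term, on the series with one term more than expm, which vanishes by
    nilpotency: the derivatives of its terms are then the terms of expm. *)
Lemma rderA_expm F a : (forall q, F q \in m) -> a \in m -> rderA x F p a ->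
  rderA x (fun q => expm (F q)) p (a * expm (F p)).
Proof.
move=> Fm am Fa; set D := \dim {:A}.
apply: (rderA_ext (F := fun q => 1 + \sum_(k < D) (k.+1`!%:R : C)^-1 *: F q ^+ k.+1)).
  move=> q; rewrite (expm_wide localA (Fm q) (leqnSn D)) big_ord_recl.
  by rewrite expr0 fact0 invr1 scale1r.
have S : rderA x (fun q => \sum_(k < D) (k.+1`!%:R : C)^-1 *: F q ^+ k.+1) p
    (\sum_(k < D) (k.+1`!%:R : C)^-1 *: (k.+1%:R *: (F p ^+ k * a))).
  by apply: rderA_sum => k _; apply: rderAZc; exact: rderAX.
apply: rderA_eq (rderAD (rderA_cst 1) S).
rewrite add0r /expm mulr_sumr; apply: eq_bigr => k _.
rewrite scalerA -scalerAr [a * _]mulrC; congr (_ *: _).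
rewrite factS natrM invfM mulrAC mulVf ?mul1r // pnatr_eq0.
Qed.

Lemma rderA_expA F a : rderA x F p a -> rderA x (fun q => expA m (F q)) p (a * expA m (F p)).
Proof.
move=> Fa; have rF := rder_residue Fa.
have rm (b : A) : b - (residue m b)%:A \in m by have h := residue_nilp localA basis_e e0 em b; exact: h.
have NE := rderA_expm (fun q => rm (F q)) (rm a) (rderA_nilp Fa).
have rE : rder x (fun q => expC (residue m (F q))) p (residue m a * expC (residue m (F p))).
  apply: (rder_comp (y := id) (h := fun q => residue m (F q)) _ rF (rder_expC _)).
  by apply/cont_atE; exact: (rder_cont xp rF).
apply: rderA_eq (rderAZ rE NE).
rewrite (expAE m (F p)); move: (expm _) (expC _) (residue m a) => E c r.
by rewrite mulrBl mulr_algl scalerBr scalerA [c * r]mulrC addrC subrK -scalerAr.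
Qed.

End Rules.

Lemma rderA_id_scale (z : C) (u : A) : rderA id (fun w => w *: u) z u.
Proof. by rewrite -[X in rderA _ _ _ X]scale1r; apply: rderA_scale; exact: rder_id. Qed.

Lemma rderA_cst_near (z0 : C) (F : C -> A) : (\forall z \near z0, rderA id F z 0) ->
  \forall z \near z0, F z = F z0.
Proof.
move=> Fd; have h i : \forall z \near z0, coord e i (F z) = coord e i (F z0).
  apply: (@hol_cst_near _ z0 (fun z => coord e i (F z))).
  by apply: filterS Fd => z /(_ i); rewrite linear0.
have : \forall z \near z0, forall i, coord e i (F z) = coord e i (F z0).
  exact: (@filter_forall _ _ (fun i z => coord e i (F z) = coord e i (F z0)) _ _ h).
by apply: filterS => z zP; apply: (coordA_ext basis_e).
Qed.

Lemma rderA_cst_global (F : C -> A) z w : (forall z, rderA id F z 0) -> F z = F w.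
Proof.
move=> Fd; apply: (coordA_ext basis_e) => i.
apply: (@hol_cst_global _ (fun z => coord e i (F z))) => v.
by have := Fd v i; rewrite linear0.
Qed.

Lemma rderA_lg (u : A) (z : C) : u \in m ->
  rderA id (fun w => lg (w *: u)) z (- u * geom (z *: u)).
Proof.
move=> um; set D := \dim {:A}.
have S : rderA id (fun w => \sum_(k < D) (k.+1%:R : C)^-1 *: (w *: u) ^+ k.+1) z
    (\sum_(k < D) (k.+1%:R : C)^-1 *: (k.+1%:R *: ((z *: u) ^+ k * u))).
  apply: rderA_sum => k _; apply: rderAZc; apply: rderAX; first exact: cont_at_id.
  exact: rderA_id_scale.
apply: rderA_eq (rderAN S).
rewrite mulNr /geom mulr_sumr; congr (- _); apply: eq_bigr => k _.
by rewrite scalerA mulVf ?pnatr_eq0 // scale1r mulrC.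
Qed.

(** The quotient of exp (lg (z u)) by 1 - z u has derivative 0 in z, and it is 1 at z =
    0. *)
Lemma expA_lg (u : A) : u \in m -> expA m (lg u) = 1 - u.
Proof.
move=> um.
have zu z : z *: u \in m by exact: (m_Z localA).
pose Y z := expA m (lg (z *: u)) * (1 - z *: u)^-1.
have Yd z : rderA id Y z 0.
  have cz := @cont_at_id R z.
  have U1 : 1 - z *: u \is a GRing.unit by exact: (unit_1B localA (zu z)).
  have d1 := rderAB (rderA_cst id z (1 : A)) (rderA_id_scale z u).
  apply: rderA_eq (rderAM cz (rderA_expA cz (rderA_lg z um)) (rderA_inv cz U1 d1)).
  have -> : geom (z *: u) = (1 - z *: u)^-1.
    by apply: (mulrI U1); rewrite mulrV // (geomP localA (zu z)).
  rewrite sub0r opprK expr2.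
  by move: (expA m _) ((1 - z *: u)^-1) => y v; ring.
have := rderA_cst_global 1 0 Yd.
rewrite /Y scale1r scale0r subr0 invr1 mulr1 => h.
have lg0 : lg 0 = 0 :> A.
  by rewrite /lg big1 ?oppr0 // => k _; rewrite expr0n /= scaler0.
move: h; rewrite lg0 (expA0 localA basis_e e0 em) => /(congr1 (fun y => y * (1 - u))).
by rewrite mul1r mulrVK // (unit_1B localA um).
Qed.

End AlgebraCalculus.

(** * Germs with values in A and residues *)

Section Germs.
Context (R : realType) (A : comFalgType R[i]) (m : {pred A}).
Context (n : nat) (e : n.+1.-tuple A).
Local Notation C := R[i].
Hypothesis localA : local_with_maximal_ideal m.
Hypothesis basis_e : basis_of {:A} e.
Hypothesis e0 : tnth e ord0 = 1.
Hypothesis em : forall i, i != ord0 -> tnth e i \in m.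
Local Notation rderA := (rderA e).
Local Notation cid := (@cont_at_id R _).

Definition holA (z0 : C) (F : C -> A) : Prop := \forall z \near z0, exists a, rderA id F z a.

Lemma holA_coord z0 F i : holA z0 F -> hol z0 (fun z => coord e i (F z)).
Proof. by apply: filterS => z [a Fa]; exists (coord e i a). Qed.

Lemma near_forall_ord (T : topologicalType) (p : T) (P : 'I_n.+1 -> T -> Prop) :
  (forall i, \forall q \near p, P i q) -> \forall q \near p, forall i, P i q.
Proof. by move=> h; exact: (@filter_forall _ _ P _ _ h). Qed.

Lemma holA_coords z0 F : (forall i, hol z0 (fun z => coord e i (F z))) -> holA z0 F.
Proof.
move=> /near_forall_ord; apply: filterS => z /choice[d dP].
by exists (\sum_i d i *: tnth e i) => i; rewrite coord_comb.
Qed.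

Lemma coords_fun (u : 'I_n.+1 -> C -> C) :
  forall i, (fun z => coord e i (\sum_j u j z *: tnth e j)) = u i.
Proof. by move=> i; apply/funext => z; rewrite coord_comb. Qed.

Lemma holA_prim z0 F : holA z0 F -> exists G, \forall z \near z0, rderA id G z (F z).
Proof.
move=> Fh; have h i : exists G : C -> C, \forall z \near z0, rder id G z (coord e i (F z)).
  exact: hol_prim (holA_coord i Fh).
have [G GP] := choice h; exists (fun z => \sum_j G j z *: tnth e j).
move: GP => /near_forall_ord; apply: filterS => z GP i.
by rewrite coords_fun; exact: GP.
Qed.

Lemma holA_deriv z0 F : holA z0 F -> exists F', (\forall z \near z0, rderA id F z (F' z)) /\ holA z0 F'.
Proof.
move=> Fh; have h i : exists G : C -> C, (\forall z \near z0, rder id (fun z => coord e i (F z)) z (G z)) /\ hol z0 G.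
  exact: hol_deriv (holA_coord i Fh).
have [G GP] := choice h; exists (fun z => \sum_j G j z *: tnth e j); split.
  have /near_forall_ord : forall i, \forall z \near z0, rder id (fun z => coord e i (F z)) z (G i z).
    by move=> i; case: (GP i).
  by apply: filterS => z {}GP i; rewrite coord_comb.
by apply: holA_coords => i; rewrite coords_fun; case: (GP i).
Qed.

Lemma rderA_uniq F z a b : rderA id F z a -> rderA id F z b -> a = b.
Proof. by move=> Fa Fb; apply: (coordA_ext basis_e) => i; exact: rderC_uniq (Fa i) (Fb i). Qed.

Lemma holA_near z0 F G : (\forall z \near z0, F z = G z) -> holA z0 F -> holA z0 G.
Proof.
move=> /near_join FG; apply: filterS2 FG => z FGz [a Fa].
by exists a; exact: rderA_near FGz Fa.
Qed.

Lemma holA_rder z0 F F' : (\forall z \near z0, rderA id F z (F' z)) -> holA z0 F.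
Proof. by apply: filterS => z h; exists (F' z). Qed.

(** Derivatives are unique, so any given derivative inherits the regularity of
    holA_deriv. *)
Lemma holA_rder_deriv z0 F F' : (\forall z \near z0, rderA id F z (F' z)) -> holA z0 F'.
Proof.
move=> Fd; have [F1 [F1d F1h]] := holA_deriv (holA_rder Fd).
by apply: holA_near F1h; apply: filterS2 Fd F1d => z h1 h2; exact: rderA_uniq h2 h1.
Qed.

Lemma holA_cst z0 (a : A) : holA z0 (fun=> a).
Proof. by near=> z; exists 0; exact: rderA_cst. Unshelve. all: by end_near. Qed.

Lemma holAD z0 F G : holA z0 F -> holA z0 G -> holA z0 (fun z => F z + G z).
Proof. by apply: filterS2 => z [a Fa] [b Gb]; exists (a + b); exact: rderAD. Qed.

Lemma holAN z0 F : holA z0 F -> holA z0 (fun z => - F z).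
Proof. by apply: filterS => z [a Fa]; exists (- a); exact: rderAN. Qed.

Lemma holAM z0 F G : holA z0 F -> holA z0 G -> holA z0 (fun z => F z * G z).
Proof.
apply: filterS2 => z [a Fa] [b Gb]; eexists.
exact: (rderAM basis_e cid Fa Gb).
Qed.

Lemma holA_scale z0 (u : C -> C) F : hol z0 u -> holA z0 F -> holA z0 (fun z => u z *: F z).
Proof.
apply: filterS2 => z [d ud] [a Fa]; eexists.
exact: (rderAZ basis_e cid ud Fa).
Qed.

Lemma holA_sum z0 (I : Type) (r : seq I) (F : I -> C -> A) :
  (forall i, holA z0 (F i)) -> holA z0 (fun z => \sum_(i <- r) F i z).
Proof.
move=> Fh; elim: r => [|i r IH].
  by apply: holA_near (holA_cst z0 0); near=> z; rewrite big_nil.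
by apply: holA_near (holAD (Fh i) IH); near=> z; rewrite big_cons.
Unshelve. all: by end_near. Qed.

Lemma holA_prod z0 (I : Type) (r : seq I) (F : I -> C -> A) :
  (forall i, holA z0 (F i)) -> holA z0 (fun z => \prod_(i <- r) F i z).
Proof.
move=> Fh; elim: r => [|i r IH].
  by apply: holA_near (holA_cst z0 1); near=> z; rewrite big_nil.
by apply: holA_near (holAM (Fh i) IH); near=> z; rewrite big_cons.
Unshelve. all: by end_near. Qed.

Lemma holA_cont z0 F : holA z0 F -> cont_atA e F z0.
Proof. by move=> Fh i; exact: hol_cont (holA_coord i Fh). Qed.

Lemma holA_unit z0 F : holA z0 F -> F z0 \is a GRing.unit -> \forall z \near z0, F z \is a GRing.unit.
Proof. by move=> /holA_cont; exact: (unit_near localA basis_e e0 em). Qed.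

Lemma holA_inv z0 F : holA z0 F -> F z0 \is a GRing.unit -> holA z0 (fun z => (F z)^-1).
Proof.
move=> Fh FU; apply: filterS2 Fh (holA_unit Fh FU) => z [a Fa] FzU; eexists.
exact: (rderA_inv localA basis_e e0 em cid FzU Fa).
Qed.

Lemma hol_X (z0 : C) k : hol z0 (fun z : C => z ^+ k).
Proof.
elim: k => [|k IH]; first exact: hol_cst.
by apply: hol_near (holM (hol_id z0) IH); near=> z; rewrite exprS.
Unshelve. all: by end_near. Qed.

Lemma near_punctured (P : C -> Prop) : (\forall z \near (0 : C), P z) -> \forall z \near (0 : C)^', P z.
Proof. exact: nbhs_dnbhs. Qed.

Lemma punctured_neq0 : \forall z \near (0 : C)^', z != 0.
Proof. exact: nbhs_dnbhs_neq. Qed.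

Lemma punctured_join (P : C -> Prop) :
  (\forall z \near (0 : C)^', P z) -> \forall z \near (0 : C)^', \forall w \near z, P w.
Proof.
move=> /near_puncturedCP[d d0 dP]; apply/near_puncturedCP; exists d => // z zd z0.
rewrite subr0 in zd; have m0 : 0 < cmod z by rewrite cmod_gt0.
apply/nearCP; exists (Num.min (d - cmod z) (cmod z)); first by rewrite lt_min subr_gt0 zd.
move=> w; rewrite lt_min => /andP[w1 w2]; apply: dP.
  by rewrite subr0 -[w](subrK z) (le_lt_trans (cmodD _ _)) // -ltrBrDr.
by apply: contraTneq w2 => ->; rewrite sub0r cmodN ltxx.
Qed.

Lemma holA_divide F : holA 0 F ->
  exists Q, holA 0 Q /\ \forall z \near (0 : C), F z = F 0 + z *: Q z.
Proof.
move=> Fh; have h i := hol_divide (holA_coord i Fh).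
have [q qP] := choice h; exists (fun z => \sum_j q j z *: tnth e j); split.
  by apply: holA_coords => i; rewrite coords_fun; case: (qP i).
have /near_forall_ord : forall i, \forall z \near (0 : C), coord e i (F z) = coord e i (F 0) + z * q i z.
  by move=> i; case: (qP i).
apply: filterS => z zP; apply: (coordA_ext basis_e) => i.
by rewrite linearD linearZ /= coord_comb.
Qed.

(** Vanishing to order k at 0, after removal of the singularity at 0. *)
Definition divA (k : nat) (F : C -> A) : Prop :=
  exists Q, holA 0 Q /\ \forall z \near (0 : C)^', F z = z ^+ k *: Q z.

Lemma divA_le k l F : (l <= k)%N -> divA k F -> divA l F.
Proof.
move=> lk [Q [Qh FQ]]; exists (fun z => z ^+ (k - l) *: Q z); split.
  by apply: holA_scale Qh; exact: hol_X.
by apply: filterS FQ => z ->; rewrite scalerA -exprD subnKC.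
Qed.

Lemma divA_near k F G : (\forall z \near (0 : C)^', F z = G z) -> divA k F -> divA k G.
Proof.
by move=> FG [Q [Qh FQ]]; exists Q; split=> //; apply: filterS2 FG FQ => z <-.
Qed.

Lemma divAD k F G : divA k F -> divA k G -> divA k (fun z => F z + G z).
Proof.
move=> [Q [Qh FQ]] [S [Sh GS]]; exists (fun z => Q z + S z); split; first exact: holAD.
by apply: filterS2 FQ GS => z -> ->; rewrite scalerDr.
Qed.

Lemma divA0 k : divA k (fun=> 0).
Proof.
by exists (fun=> 0); split; [exact: holA_cst|near=> z; rewrite scaler0].
Unshelve. all: by end_near. Qed.

(** F dz has residue rho at 0 when subtracting rho dz / z leaves an exact form. This
    definition needs no integral. *)
Definition has_res (F : C -> A) (rho : A) : Prop :=
  exists M, \forall z \near (0 : C)^', rderA id M z (F z - z^-1 *: rho).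

Lemma has_res_near F G rho : (\forall z \near (0 : C)^', F z = G z) -> has_res F rho -> has_res G rho.
Proof. by move=> FG [M MP]; exists M; apply: filterS2 FG MP => z <-. Qed.

Lemma has_res_eq F rho tau : rho = tau -> has_res F rho -> has_res F tau.
Proof. by move=> ->. Qed.

Lemma has_resD F G rho tau : has_res F rho -> has_res G tau ->
  has_res (fun z => F z + G z) (rho + tau).
Proof.
move=> [M MP] [N NP]; exists (fun z => M z + N z); apply: filterS2 MP NP => z Md Nd.
by apply: rderA_eq (rderAD Md Nd); rewrite scalerDr opprD addrACA.
Qed.

Lemma has_resN F rho : has_res F rho -> has_res (fun z => - F z) (- rho).
Proof.
move=> [M MP]; exists (fun z => - M z); apply: filterS MP => z Md.
by apply: rderA_eq (rderAN Md); rewrite scalerN opprB opprK addrC.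
Qed.

Lemma has_res_exact F M : (\forall z \near (0 : C)^', rderA id M z (F z)) -> has_res F 0.
Proof. by move=> MP; exists M; apply: filterS MP => z Md; rewrite scaler0 subr0. Qed.

Lemma has_res_hol F : holA 0 F -> has_res F 0.
Proof. by move=> /holA_prim[G GP]; apply: (has_res_exact (M := G)); exact: near_punctured. Qed.

Lemma has_res_divA F : divA 0 F -> has_res F 0.
Proof.
move=> [Q [Qh FQ]]; apply: has_res_near (has_res_hol Qh).
by apply: filterS FQ => z ->; rewrite scale1r.
Qed.

Lemma has_res_sum (I : Type) (r : seq I) (F : I -> C -> A) (rho : I -> A) :
  (forall i, has_res (F i) (rho i)) ->
  has_res (fun z => \sum_(i <- r) F i z) (\sum_(i <- r) rho i).
Proof.
move=> Fh; elim: r => [|i r IH].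
  by rewrite big_nil; apply: has_res_near (has_res_hol (holA_cst 0 0)); near=> z; rewrite big_nil.
by rewrite big_cons; apply: has_res_near (has_resD (Fh i) IH); near=> z; rewrite big_cons.
Unshelve. all: by end_near. Qed.

Lemma rder_exprn (z : C) k : rder id (fun w => w ^+ k.+1) z (k.+1%:R * z ^+ k).
Proof.
elim: k => [|k IH]; first by rewrite mulr1; exact: rder_id.
suff h : rder id (fun w : C => w * w ^+ k.+1) z (k.+2%:R * z ^+ k.+1) by exact: h.
have -> : k.+2%:R * z ^+ k.+1 = 1 * z ^+ k.+1 + z * (k.+1%:R * z ^+ k).
  by rewrite mulrCA -exprS -mulrDl -[in LHS]natr1 addrC.
by apply: rderM; [exact: cid|exact: rder_id|exact: IH].
Qed.

Lemma rder_exprz (z : C) (k : int) : z != 0 -> rder id (fun w => w ^ k) z (k%:~R * z ^ (k - 1)).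
Proof.
move=> z0; case: k => [[|k]|k].
- by rewrite mul0r; exact: rder_cst.
- have -> : Posz k.+1 - 1 = k by rewrite -addn1 PoszD addrK.
  exact: rder_exprn.
- have zk : z ^+ k.+1 != 0 by rewrite expf_neq0.
  suff h : rder id (fun w : C => (w ^+ k.+1)^-1) z ((Negz k)%:~R * z ^ (Negz k - 1)) by exact: h.
  have -> : (Negz k)%:~R * z ^ (Negz k - 1) = - (k.+1%:R * z ^+ k) / (z ^+ k.+1) ^+ 2.
    have -> : Negz k - 1 = Negz k.+1 by rewrite !NegzE -[k.+2]addn1 PoszD opprD.
    have -> : (Negz k)%:~R = - k.+1%:R :> C by rewrite NegzE mulrNz.
    have -> : z ^ Negz k.+1 = (z ^+ k.+2)^-1 by [].
    have zk0 : z ^+ k != 0 by rewrite expf_neq0.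
    by rewrite !exprS expr0; field; rewrite z0 zk0.
  by apply: rderV; [exact: cid|exact: zk|exact: rder_exprn].
Qed.

Lemma has_res_mono (a : A) (k : int) : k != -1 -> has_res (fun z => z ^ k *: a) 0.
Proof.
move=> k1; have k0 : (k + 1)%:~R != 0 :> C by rewrite intr_eq0 addr_eq0.
apply: (has_res_exact (M := fun z => z ^ (k + 1) *: (((k + 1)%:~R)^-1 *: a))).
apply: filterS punctured_neq0 => z z0.
apply: rderA_eq; last by apply: rderA_scale; exact: (rder_exprz (k + 1) z0).
by rewrite scalerA addrK mulrAC divff // mul1r.
Qed.

Lemma has_res_inv (a : A) : has_res (fun z => z^-1 *: a) a.
Proof.
exists (fun=> 0); near=> z; rewrite subrr; exact: rderA_cst.
Unshelve. all: by end_near. Qed.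

Lemma has_res_monomial (a : A) (k : int) : has_res (fun z => z ^ k *: a) (if k == -1 then a else 0).
Proof.
case: eqP => [->|/eqP k1]; last exact: has_res_mono.
exact: has_res_inv.
Qed.

End Germs.

(** * Laurent polynomials and tails of Laurent series *)

Section Laurent.
Context (R : realType) (A : comFalgType R[i]) .
Context (n : nat) (e : n.+1.-tuple A).
Local Notation C := R[i].

(** The Laurent series c is the polynomial q shifted by X^-B. *)
Definition laurent_poly (c : int -> A) (B : nat) (q : {poly A}) : Prop :=
  (forall k : nat, c (k%:Z - B%:Z) = q`_k) /\ (forall k : int, k < - B%:Z -> c k = 0).

Definition laurent_eval (B : nat) (q : {poly A}) (z : C) : A :=
  z ^ (- B%:Z) *: q.[z%:A].

Lemma int_ge_shift (k : int) (B : nat) : - B%:Z <= k -> exists l : nat, k = l%:Z - B%:Z.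
Proof.
move=> Bk; exists (absz (k + B%:Z)); lia.
Qed.

Lemma laurent_poly_monomial (a : A) (nu : int) : exists (B : nat) (q : {poly A}),
  laurent_poly (laurent_monomial a nu) B q /\
  forall z, z != 0 -> laurent_eval B q z = z ^ nu *: a.
Proof.
pose B := `|nu|%N.
have [l nuE] : exists l : nat, nu = l%:Z - B%:Z.
  by apply: int_ge_shift; rewrite /B; lia.
exists B, (a *: 'X^l); split; first split.
- move=> k; rewrite /laurent_monomial coefZ coefXn nuE (inj_eq (addIr _)) eqz_nat.
  by case: eqP => _; rewrite ?mulr1 ?mulr0.
- move=> k kB; rewrite /laurent_monomial; case: eqP => // kE.
  by move: kB; rewrite kE nuE ltNge lerDr.
- move=> z z0; rewrite /laurent_eval hornerZ hornerXn exprZn expr1n mulr_algr scalerA.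
  by congr (_ *: _); rewrite nuE [in RHS]addrC expfzDr.
Qed.

Lemma laurent_poly_pos (a : A) (j : nat) c B q : (0 < j)%N -> laurent_poly c B q ->
  laurent_poly (laurent_mul_factor a j%:Z c) B (q * (1 - a *: 'X^j)).
Proof.
move=> j0 [cq c0]; split => [k|k kB].
  rewrite /laurent_mul_factor mulrBr mulr1 coefB -scalerAr coefZ coefMXn cq; congr (_ - _ * _).
  case: ltnP => kj; last first.
    by rewrite -cq; congr (c _); lia.
  by rewrite c0 //; lia.
by rewrite /laurent_mul_factor !c0 ?mulr0 ?subr0 //; lia.
Qed.

Lemma laurent_poly_neg (a : A) (j : nat) c B q : laurent_poly c B q ->
  laurent_poly (laurent_mul_factor a (- j%:Z) c) (B + j) (q * ('X^j - a%:P)).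
Proof.
move=> [cq c0]; split => [k|k kB].
  rewrite /laurent_mul_factor mulrBr coefB coefMXn coefMC mulrC opprK PoszD; congr (_ - _ * _).
    case: ltnP => kj.
      by rewrite c0 //; lia.
    by rewrite -cq; congr (c _); lia.
  by rewrite -cq; congr (c _); lia.
rewrite /laurent_mul_factor opprK !c0 ?mulr0 ?subr0 //; lia.
Qed.

Lemma laurent_eval_pos (a : A) (j B : nat) (q : {poly A}) z :
  laurent_eval B (q * (1 - a *: 'X^j)) z = laurent_eval B q z * (1 - z ^+ j *: a).
Proof.
rewrite /laurent_eval hornerM !hornerE exprZn expr1n mulr_algr -scalerAl.
by [].
Qed.

Lemma laurent_eval_neg (a : A) (j B : nat) (q : {poly A}) z : z != 0 ->
  laurent_eval (B + j) (q * ('X^j - a%:P)) z = laurent_eval B q z * (1 - z ^ (- j%:Z) *: a).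
Proof.
move=> z0; rewrite /laurent_eval hornerM !hornerE exprZn expr1n.
rewrite PoszD opprD expfzDr // -scalerA -scalerAl; congr (_ *: _).
rewrite scalerAr; congr (_ * _); rewrite scalerBr scalerA -exprz_inv -exprnP.
by rewrite exprVn mulVf ?expf_neq0 // scale1r.
Qed.

Lemma laurent_poly_foldr_pos (a : int -> A) (s : seq nat) c B q :
  all (leq 1) s -> laurent_poly c B q -> exists q',
  laurent_poly (foldr (fun j : nat => laurent_mul_factor (a j%:Z) j%:Z) c s) B q' /\
  forall z, laurent_eval B q' z =
    laurent_eval B q z * \prod_(j <- s) (1 - z ^+ j *: a j%:Z).
Proof.
elim: s => [|j s IH] /=.
  by move=> _ cq; exists q; split => // z; rewrite big_nil mulr1.
move=> /andP[j1 s1] cq; have [q' [cq' qE]] := IH s1 cq.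
exists (q' * (1 - a j%:Z *: 'X^j)); split; first exact: laurent_poly_pos.
by move=> z; rewrite laurent_eval_pos qE big_cons; ring.
Qed.

Lemma laurent_poly_foldr_neg (a : int -> A) (s : seq nat) c B q :
  laurent_poly c B q -> exists B' q',
  laurent_poly (foldr (fun j : nat => laurent_mul_factor (a (- j%:Z)) (- j%:Z)) c s) B' q' /\
  forall z, z != 0 -> laurent_eval B' q' z =
    laurent_eval B q z * \prod_(j <- s) (1 - z ^ (- j%:Z) *: a (- j%:Z)).
Proof.
move=> cq; elim: s => [|j s [B' [q' [cq' qE]]]] /=.
  by exists B, q; split => // z _; rewrite big_nil mulr1.
exists (B' + j)%N, (q' * ('X^j - (a (- j%:Z))%:P)); split; first exact: laurent_poly_neg.
by move=> z z0; rewrite laurent_eval_neg // qE // big_cons; ring.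
Qed.

Lemma foldr_pos_agree (a : int -> A) (s : seq nat) (c d : int -> A) (T : int) :
  (forall k, k < T -> c k = d k) -> forall k, k < T ->
  foldr (fun j : nat => laurent_mul_factor (a j%:Z) j%:Z) c s k =
  foldr (fun j : nat => laurent_mul_factor (a j%:Z) j%:Z) d s k.
Proof.
move=> cd; elim: s => [|j s IH] //= k kT; rewrite /laurent_mul_factor !IH //.
by lia.
Qed.

Lemma foldr_pos_tail (a : int -> A) (M l B : nat) (c : int -> A) :
  (forall k : int, k < - B%:Z -> c k = 0) -> forall k : int, k < M.+1%:Z - B%:Z ->
  foldr (fun j : nat => laurent_mul_factor (a j%:Z) j%:Z) c (iota M.+1 l) k = c k.
Proof.
move=> c0 k kM.
have : all (leq M.+1) (iota M.+1 l) by apply/allP => j; rewrite mem_iota => /andP[].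
have H : forall s : seq nat, all (leq M.+1) s ->
    (forall k : int, k < M.+1%:Z - B%:Z ->
     foldr (fun j : nat => laurent_mul_factor (a j%:Z) j%:Z) c s k = c k); last by move/H; exact.
elim=> [|j s IH] //= /andP[Mj Ms] {kM}k kM.
move: (IH Ms) => {IH}; set F := foldr _ c s => IH; rewrite /laurent_mul_factor IH //.
have kj : k - j%:Z < - B%:Z by lia.
rewrite (IH (k - j%:Z)); last by lia.
by rewrite (c0 _ kj) mulr0 subr0.
Qed.

(** Below degree M + 1 - B the infinite product agrees with its M-th partial product. *)
Lemma laurent_product_agree (nu : int) (N : nat) (a c : int -> A) :
  laurent_product nu N a c -> exists B : nat, forall M : nat, exists q : {poly A},
  [/\ laurent_poly (laurent_partial_product nu N a M) B q,
      forall k : int, k < M.+1%:Z - B%:Z -> c k = laurent_partial_product nu N a M k &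
      forall z, z != 0 -> laurent_eval B q z = z ^ nu *: (a 0 *
        \prod_(j <- iota 1 N) (1 - z ^ (- j%:Z) *: a (- j%:Z)) *
        \prod_(j <- iota 1 M) (1 - z ^+ j *: a j%:Z))].
Proof.
move=> cP.
have [B0 [q0 [cq0 q0E]]] := laurent_poly_monomial (a 0) nu.
have [B [q1 [cq1 q1E]]] := laurent_poly_foldr_neg a (iota 1 N) cq0.
exists B => M.
have [|q [cq qE]] := @laurent_poly_foldr_pos a (iota 1 M) _ _ _ _ cq1.
  by apply/allP => j; rewrite mem_iota => /andP[].
exists q; split => // [k kM|z z0]; last first.
  by rewrite qE q1E // q0E // -!scalerAl.
have [M1 _ M1P] := cP k.
have := M1P (M1 + M)%N (leq_addr _ _) => /= <-.
rewrite /laurent_partial_product addnC iotaD foldr_cat add1n.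
apply: (foldr_pos_agree _ _ _ kM) => l lM; apply: foldr_pos_tail lM; exact: cq1.2.
Qed.

Lemma cvg_cmod_le (s : nat -> C) (u : C) (K : R) :
  (forall k, cmod (s k) <= K) -> s @ \oo --> u -> cmod u <= K.
Proof.
move=> sK su; apply/ler_addgt0Pr => d d0.
have : nbhs u [set w | cmod (w - u) < d] by apply/nearCP; exists d.
move=> /su[k _ /(_ k (leqnn _)) /= h].
have -> : u = s k + - (s k - u) by ring.
by rewrite (le_trans (cmodD _ _)) // cmodN lerD // ltW.
Qed.

Lemma cvg_bounded (s : nat -> C) (u : C) : s @ \oo --> u ->
  exists K : R, forall k, cmod (s k) <= K.
Proof.
move=> su; have : nbhs u [set w | cmod (w - u) < 1] by apply/nearCP; exists 1.
move=> /su[k0 _ k0P].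
exists (cmod u + 1 + \sum_(k < k0) cmod (s k)) => k.
have S0 : 0 <= \sum_(k < k0) cmod (s k) by apply: sumr_ge0 => i _; exact: cmod_ge0.
have [kk|kk] := ltnP k k0.
  rewrite (bigD1 (Ordinal kk)) //= addrCA lerDl addr_ge0 ?addr_ge0 ?cmod_ge0 //.
  by apply: sumr_ge0 => i _; exact: cmod_ge0.
rewrite -[leLHS]addr0 lerD // -lerBlDl (le_trans (cmodB_le _ _)) // ltW //.
exact: k0P.
Qed.

(** The terms of the series at a fixed point z1 are bounded, so at |z| <= |z1| / 2 they
    are dominated by a geometric progression starting at degree T. *)
Lemma laurent_tail (d : int -> C) (u : C -> C) (N T : nat) :
  (forall k : int, k < T%:Z -> d k = 0) ->
  (\forall z \near (0 : C)^', series (fun k : nat => d (k%:Z - N%:Z) * z ^ (k%:Z - N%:Z)) @ \oo --> u z) ->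
  exists2 K : R, 0 <= K & \forall z \near (0 : C)^', cmod (u z) <= K * cmod z ^+ T.
Proof.
move=> d0 /near_puncturedCP[r r0 rP].
pose z1 : C := (r / 2)%:C.
have m1 : cmod z1 = r / 2 by rewrite cmod_real gtr0_norm // divr_gt0.
have m10 : 0 < cmod z1 by rewrite m1 divr_gt0.
have z10 : z1 != 0 by rewrite -cmod_gt0.
have [|K KP] := cvg_bounded (rP z1 _ z10); first by rewrite subr0 m1; lra.
pose K2 := 2 * `|K|.
have K20 : 0 <= K2 by rewrite mulr_ge0.
have tB k : cmod (d (k%:Z - N%:Z) * z1 ^ (k%:Z - N%:Z)) <= K2.
  have -> : d (k%:Z - N%:Z) * z1 ^ (k%:Z - N%:Z) =
     series (fun k : nat => d (k%:Z - N%:Z) * z1 ^ (k%:Z - N%:Z)) k.+1 -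
     series (fun k : nat => d (k%:Z - N%:Z) * z1 ^ (k%:Z - N%:Z)) k.
    by rewrite seriesSr addrAC subrr add0r.
  rewrite (le_trans (cmodD _ _)) // cmodN /K2 mulr_natl mulr2n.
  by apply: lerD; rewrite (le_trans (KP _)) // ler_norm.
exists (2 * K2 / cmod z1 ^+ T); first by rewrite divr_ge0 ?mulr_ge0 ?exprn_ge0 ?cmod_ge0.
apply/near_puncturedCP; exists (r / 4) => [|z]; first by rewrite divr_gt0.
rewrite subr0 => zr z0.
apply: (@cvg_cmod_le _ _ _ _ (rP z _ z0)); last by rewrite subr0; lra.
move=> k; rewrite /series /= (le_trans (cmod_sum _ _ _)) //.
pose q := cmod z / cmod z1.
have q0 : 0 <= q by rewrite divr_ge0 ?cmod_ge0.
have q2 : q <= 2^-1 by rewrite ler_pdivrMr // m1; lra.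
have term l : cmod (d (l%:Z - N%:Z) * z ^ (l%:Z - N%:Z)) <=
    if (N + T <= l)%N then K2 * q ^+ T * 2^-1 ^+ (l - (N + T)) else 0.
  case: leqP => lN; last first.
    by rewrite d0 ?mul0r ?cmod0 //; clear -lN; lia.
  have -> : (l%:Z - N%:Z) = (T + (l - (N + T)))%N%:Z.
    by clear -lN; lia.
  have := tB l.
  have -> : (l%:Z - N%:Z) = (T + (l - (N + T)))%N%:Z.
    by clear -lN; lia.
  set t := (l - (N + T))%N; rewrite !cmodM -!exprnP !cmodX => h.
  have zq : cmod z = q * cmod z1 by rewrite /q divfK // gt_eqF.
  rewrite zq exprMn mulrCA mulrC -mulrA.
  apply: ler_pM => //; rewrite ?mulr_ge0 ?exprn_ge0 ?cmod_ge0 //.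
  rewrite exprD ler_wpM2l ?exprn_ge0 // lerXn2r // nnegrE //.
rewrite (le_trans (ler_sum _ (fun l _ => term l))) //.
rewrite -big_mkcond /=.
have geo (a t : nat) : \sum_(0 <= l < t | (a <= l)%N) (2^-1 : R) ^+ (l - a) <= 2.
  have [ta|at_] := leqP t a.
    rewrite big_nat_cond big_pred0 // => l; case: (leqP a l) => al; rewrite ?andbF // andbT /=.
    by apply/negbTE; rewrite -leqNgt (leq_trans ta).
  rewrite (big_cat_nat _ (n := a)) //= ?(ltnW at_) //.
  rewrite [X in X + _]big_nat_cond [X in X + _]big_pred0 ?add0r; last first.
    by move=> l; case: (leqP a l) => al; rewrite ?andbF // andbT ltnNge al.
  rewrite -{1}[a]add0n big_addn big_mkord.
  rewrite (eq_bigl xpredT); last by move=> l; rewrite leq_addl.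
  rewrite (eq_bigr (fun l : 'I_(t - a) => (2^-1 : R) ^+ l)); last by move=> l _; rewrite addnK.
  have := subrX1 (2^-1 : R) (t - a) => h.
  have : 0 <= (2^-1 : R) ^+ (t - a) by rewrite exprn_ge0 // invr_ge0.
  move: h; set S := \sum_(_ < _) _; set p := _ ^+ _; lra.
rewrite -mulr_sumr.
have -> : 2 * K2 / cmod z1 ^+ T * cmod z ^+ T = K2 * q ^+ T * 2.
  by rewrite /q expr_div_n; ring.
by rewrite ler_wpM2l ?mulr_ge0 ?exprn_ge0.
Qed.

Lemma series_shift (g : int -> C) (l : C) (N t : nat) :
  (forall k : int, k < - N%:Z -> g k = 0) ->
  series (fun k : nat => g (k%:Z - N%:Z)) @ \oo --> l ->
  series (fun k : nat => g (k%:Z - (N + t)%N%:Z)) @ \oo --> l.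
Proof.
move=> g0 gl; rewrite -(cvg_shiftn t); apply: cvg_trans gl.
apply: near_eq_cvg; near=> k; rewrite /series /=.
rewrite [RHS](big_cat_nat _ (n := t)) //= ?leq_addl // [X in _ = X + _]big_nat [X in _ = X + _]big1 ?add0r.
  rewrite -{1}[t]add0n big_addn addnK; apply: eq_bigr => l0 _; congr (g _).
  by rewrite !PoszD; ring.
move=> l0 /andP[_ lt]; by apply: g0; lia.
Unshelve. all: by end_near. Qed.

Lemma laurent_poly_series c B q (z : C) i : z != 0 -> laurent_poly c B q ->
  series (fun k : nat => coord e i (c (k%:Z - B%:Z)) * z ^ (k%:Z - B%:Z)) @ \oo -->
    coord e i (laurent_eval B q z).
Proof.
move=> z0 [cq _]; apply: (@cvg_near_cst _ _ _ _ \oo); exists (size q) => // k /= sk.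
rewrite /series /= /laurent_eval (horner_coef_wide _ sk) linearZ linear_sum /= mulr_sumr big_mkord.
apply: eq_bigr => l _; rewrite cq exprZn expr1n mulr_algr linearZ /= mulrA [RHS]mulrC.
by congr (_ * _); rewrite addrC expfzDr.
Qed.

End Laurent.

(** * The exponential form of f near s *)

Section LocalForm.
Context (R : realType) (A : comFalgType R[i]) (m : {pred A}).
Context (n : nat) (e : n.+1.-tuple A).
Local Notation C := R[i].
Hypothesis localA : local_with_maximal_ideal m.
Hypothesis basis_e : basis_of {:A} e.
Hypothesis e0 : tnth e ord0 = 1.
Hypothesis em : forall i, i != ord0 -> tnth e i \in m.
Local Notation rderA := (rderA e).
Local Notation holA := (holA e).
Local Notation divA := (divA e).
Local Notation cid := (@cont_at_id R _).

Definition laurent_series_of (F : C -> A) (c : int -> A) : Prop := forall i,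
  exists2 N : nat, forall k : int, k < - N%:Z -> coord e i (c k) = 0 &
  \forall z \near (0 : C)^',
    series (fun k : nat => coord e i (c (k%:Z - N%:Z)) * z ^ (k%:Z - N%:Z)) @ \oo --> coord e i (F z).

Definition neg_part N (a : int -> A) (z : C) : A :=
  \prod_(j <- iota 1 N) (1 - z ^ (- j%:Z) *: a (- j%:Z)).

Definition pos_part M (a : int -> A) (z : C) : A :=
  \prod_(j <- iota 1 M) (1 - z ^+ j *: a j%:Z).

(** The coefficients of the partial products are eventually constant, so in low degrees
    the series of F agrees with that of a long enough partial product; laurent_tail
    bounds the difference. *)
Lemma laurent_difference F nu N (a c : int -> A) :
  laurent_series_of F c -> laurent_product nu N a c ->
  exists B : nat, forall T M : nat, (T + B <= M)%N -> forall i,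
    exists2 K : R, 0 <= K & \forall z \near (0 : C)^',
      cmod (coord e i (F z - z ^ nu *: (a 0 * neg_part N a z * pos_part M a z))) <= K * cmod z ^+ T.
Proof.
move=> Fc cP; have [B BP] := laurent_product_agree cP; exists B => T M TM i.
have [q [cq agree qE]] := BP M; have [N1 c0 cF] := Fc i.
set pp := laurent_partial_product nu N a M in cq agree.
apply: (@laurent_tail _ (fun k => coord e i (c k) - coord e i (pp k)) _ (N1 + B)) => [k kT|].
  by rewrite agree ?subrr //; clear -kT TM; lia.
apply: filterS2 cF (@punctured_neq0 R) => z cFz z0.
have H1 := series_shift (g := fun k => coord e i (c k) * z ^ k) (N := N1) (l := coord e i (F z)).
have H2 := series_shift (g := fun k => coord e i (pp k) * z ^ k) (N := B) (l := coord e i (laurent_eval B q z)).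
have cF : series (fun k : nat => coord e i (c (k%:Z - (N1 + B)%N%:Z)) * z ^ (k%:Z - (N1 + B)%N%:Z)) @ \oo --> coord e i (F z).
  by apply: H1 => [k kN|]; [rewrite c0 // mul0r|exact: cFz].
have cP' : series (fun k : nat => coord e i (pp (k%:Z - (B + N1)%N%:Z)) * z ^ (k%:Z - (B + N1)%N%:Z)) @ \oo --> coord e i (laurent_eval B q z).
  apply: H2 => [k kN|]; last exact: laurent_poly_series.
  by case: cq => _ cq0; rewrite cq0 // linear0 mul0r.
have := cvgB cF cP'.
have -> : coord e i (F z - z ^ nu *: (a 0 * neg_part N a z * pos_part M a z)) =
    coord e i (F z) - coord e i (laurent_eval B q z) by rewrite linearB (qE _ z0).
have -> : series (fun k : nat => coord e i (c (k%:Z - (N1 + B)%N%:Z)) * z ^ (k%:Z - (N1 + B)%N%:Z)) -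
    series (fun k : nat => coord e i (pp (k%:Z - (B + N1)%N%:Z)) * z ^ (k%:Z - (B + N1)%N%:Z)) =
    series (fun k : nat => (coord e i (c (k%:Z - (N1 + B)%N%:Z)) - coord e i (pp (k%:Z - (N1 + B)%N%:Z))) * z ^ (k%:Z - (N1 + B)%N%:Z)).
  rewrite addnC; apply/funext => k; rewrite /series /= fctE /= -sumrB.
  by apply: eq_bigr => l _; rewrite mulrBl.
move=> h; exact: h.
Qed.

(** The quotient by z^k is O(z^2), hence differentiable at 0 with derivative 0. The two
    spare orders are free, since Laurent tails vanish to any prescribed order. *)
Lemma divA_removable (k : nat) (G : C -> A) :
  (\forall z \near (0 : C)^', exists d, rderA id G z d) ->
  (forall i, exists2 K : R, 0 <= K & \forall z \near (0 : C)^',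
      cmod (coord e i (G z)) <= K * cmod z ^+ (k + 2)) ->
  divA k G.
Proof.
move=> Gd GB; pose Q z := if z == 0 then 0 else z ^- k *: G z.
exists Q; split; last first.
  apply: filterS (@punctured_neq0 R) => z z0.
  by rewrite /Q (negbTE z0) scalerA divff ?scale1r // expf_neq0.
have QE : \forall z \near (0 : C)^', \forall w \near z, Q w = w ^ (- k%:Z) *: G w.
  apply: punctured_join; apply: filterS (@punctured_neq0 R) => z z0.
  by rewrite /Q (negbTE z0) exprnN.
apply: (holA_coords basis_e) => i; have [K K0 KP] := GB i.
apply: (@hol_at0_order2 _ _ K); first by rewrite /Q eqxx linear0.
  near=> z.
  have [d Gz] : exists d, rderA id G z d by near: z.
  have zE : \forall w \near z, Q w = w ^ (- k%:Z) *: G w by near: z.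
  have z0 : z != 0 by near: z; exact: punctured_neq0.
  suff [d1 h] : exists d, rderA id Q z d by exists (coord e i d1); exact: h.
  have h := rderAZ basis_e cid (rder_exprz (- k%:Z) z0) Gz.
  eexists; apply: rderA_near h; apply: filterS zE => w ->; reflexivity.
move: KP => /near_puncturedCP[d d0 dP]; apply/nearCP; exists d => // z zd.
have [->|z0] := eqVneq z 0.
  by rewrite /Q eqxx linear0 cmod0 mulr_ge0 // exprn_ge0 ?cmod_ge0.
rewrite /Q (negbTE z0) linearZ /= cmodM cmodV cmodX.
have mz : 0 < cmod z by rewrite cmod_gt0.
rewrite ler_pdivrMl ?exprn_gt0 // mulrCA -exprD; exact: dP.
Unshelve. all: by end_near. Qed.

(** Each factor 1 - z^-j b with b nilpotent has the inverse sum_k z^(- j k) b^k, which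
    is polynomial in z^-1. *)
Lemma neg_part_inv N (a : int -> A) : (forall j, j < 0 -> a j \in m) ->
  exists (B : nat) (q : C -> A), holA 0 q /\
    forall z, z != 0 -> neg_part N a z * q z = (z ^+ B)%:A.
Proof.
move=> am; set D := \dim {:A}.
exists (\sum_(j <- iota 1 N) j * D)%N.
exists (fun z => \prod_(j <- iota 1 N) \sum_(k < D) z ^+ (j * (D - k)) *: a (- j%:Z) ^+ k); split.
  apply: (holA_prod basis_e) => j /=; apply: (@holA_sum _ _ _ e _ _ _ (fun (k : 'I_D) z => z ^+ (j * (D - k)) *: a (- j%:Z) ^+ k)) => k /=.
  by apply: (holA_scale basis_e (hol_X _ _)); exact: holA_cst.
move=> z z0; rewrite /neg_part.
have : all (leq 1) (iota 1 N) by apply/allP => j; rewrite mem_iota => /andP[].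
elim: (iota 1 N) => [|j s IH] /=; first by rewrite !big_nil mulr1 scale1r.
move=> /andP[j1 /IH]; rewrite !big_cons mulrACA => ->.
have -> : \sum_(k < D) z ^+ (j * (D - k)) *: a (- j%:Z) ^+ k =
    z ^+ (j * D) *: geom (z ^ (- j%:Z) *: a (- j%:Z)).
  rewrite scaler_sumr; apply: eq_bigr => k _; rewrite exprZn scalerA; congr (_ *: _).
  by rewrite -exprnN exprVn -exprM mulnBr expfB // ltn_pmul2l.
have ajm : z ^ (- j%:Z) *: a (- j%:Z) \in m by apply/(m_Z localA)/am; clear -j1; lia.
rewrite -[(1 - _) * (_ *: _)]scalerAr (geomP localA ajm).
by rewrite exprD -scalerAl mul1r scalerA.
Qed.

Definition log_derivative (F H : C -> A) : Prop :=
  \forall z \near (0 : C), rderA id F z (F z * H z).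

(** The first terms of the expansion of - p' / p at 0 for the product p of the 1 - a_j
    z^j with j in s. *)
Definition power_tail (a : int -> A) (s : seq nat) (I : nat) (z : C) : A :=
  \sum_(j <- s) \sum_(i <- iota 1 I) z ^+ (i * j - 1) *: (j%:R *: a j%:Z ^+ i).

Lemma holA_factor (b : A) j : holA 0 (fun z => 1 - z ^+ j *: b).
Proof.
apply: (holAD (holA_cst _ _ _)); apply: holAN.
by apply: (holA_scale basis_e (hol_X _ _)); exact: holA_cst.
Qed.

Lemma factor_unit_near (b : A) j : (0 < j)%N ->
  \forall z \near (0 : C), 1 - z ^+ j *: b \is a GRing.unit.
Proof.
move=> j0; apply: (holA_unit localA basis_e e0 em (holA_factor b j)).
by rewrite expr0n eqn0Ngt j0 scale0r subr0 unitr1.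
Qed.

(** The logarithmic derivative of 1 - z^j b is the geometric series - sum_i j z^(ij-1)
    b^i, here with its remainder. *)
Lemma log_derivative_factor (b : A) j : (0 < j)%N -> exists H,
  [/\ holA 0 H, log_derivative (fun z => 1 - z ^+ j *: b) H &
      forall I, divA I (fun z => H z + \sum_(i <- iota 1 I) z ^+ (i * j - 1) *: (j%:R *: b ^+ i))].
Proof.
case: j => // j _; pose w z := (1 - z ^+ j.+1 *: b)^-1.
have U := factor_unit_near b (ltn0Sn j).
have wh : holA 0 w.
  apply: (holA_inv localA basis_e e0 em (holA_factor b j.+1)).
  by rewrite expr0n scale0r subr0 unitr1.
exists (fun z => - (j.+1%:R * z ^+ j) *: (b * w z)); split.
- apply: (holA_scale basis_e).
    apply: (hol_near (f := fun z => (- j.+1%:R) * z ^+ j)); first by near=> z; rewrite mulNr.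
    by apply: holM; [exact: hol_cst|exact: hol_X].
  by apply: (holAM basis_e) wh; exact: holA_cst.
- apply: filterS U => z zU.
  have h := rderAB (rderA_cst e id z (1 : A)) (rderA_scale e b (rder_exprn z j)).
  apply: rderA_eq h; rewrite sub0r -scalerAr mulrCA divrr // mulr1 scaleNr //.
- move=> I.
  exists (fun z => (z ^+ (j * I + j) * - j.+1%:R) *: (b ^+ I.+1 * w z)); split.
    apply: (holA_scale basis_e); first by apply: holM; [exact: hol_X|exact: hol_cst].
    by apply: (holAM basis_e) wh; exact: holA_cst.
  apply: near_punctured; apply: filterS U => z zU.
  have wE : w z = 1 + z ^+ j.+1 *: (b * w z).
    have : (1 - z ^+ j.+1 *: b) * w z = 1 by rewrite /w divrr.
    by rewrite mulrBl mul1r -scalerAl => <-; rewrite subrK.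
  elim: I => [|I IH].
    by rewrite big_nil addr0 expr0 scale1r muln0 add0n expr1 mulrN mulrC.
  have -> : iota 1 I.+1 = iota 1 I ++ [:: I.+1] by rewrite -[I.+1]addn1 iotaD add1n addn1.
  rewrite big_cat big_seq1 /= addrA IH scalerA.
  have -> : (I.+1 * j.+1 - 1 = I + (j * I + j))%N by nia.
  have -> : (j * I.+1 + j = j * I + j + j)%N by nia.
  rewrite {1}wE mulrDr mulr1 scalerDr -addrA addrC scalerA -addrA -scalerDl.
  rewrite [X in X *: b ^+ I.+1](_ : _ = 0); last by rewrite exprD; ring.
  rewrite scale0r addr0 -scalerAr [b ^+ _ * (b * _)]mulrA -exprSr !scalerA; congr (_ *: _).
  by rewrite exprS !exprD exprS; ring.
Unshelve. all: by end_near. Qed.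

Lemma log_derivativeM F G H K : log_derivative F H -> log_derivative G K ->
  log_derivative (fun z => F z * G z) (fun z => H z + K z).
Proof.
apply: filterS2 => z Fz Gz; apply: rderA_eq (rderAM basis_e cid Fz Gz); ring.
Qed.

Lemma log_derivative_prod (a : int -> A) (s : seq nat) : all (leq 1) s -> exists H,
  [/\ holA 0 H, log_derivative (fun z => \prod_(j <- s) (1 - z ^+ j *: a j%:Z)) H &
      forall I, divA I (fun z => H z + power_tail a s I z)].
Proof.
elim: s => [_|j s IH /= /andP[j1 /IH[H [Hh Hd HI]]]].
  exists (fun=> 0); split; first exact: holA_cst.
    near=> z; rewrite mulr0; apply: (rderA_ext (F := fun=> 1)) (rderA_cst _ _ _ _) => q.
    by rewrite big_nil.
  move=> I; apply: divA_near (divA0 _ I); near=> z.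
  by rewrite /power_tail big_nil addr0.
have [K [Kh Kd KI]] := log_derivative_factor (a j%:Z) j1.
exists (fun z => K z + H z); split; first exact: holAD.
  apply: filterS (log_derivativeM Kd Hd) => z h; rewrite big_cons.
  by apply: rderA_ext h => q; rewrite big_cons.
move=> I; apply: divA_near (divAD (KI I) (HI I)); near=> z.
by rewrite /power_tail big_cons addrACA.
Unshelve. all: by end_near. Qed.

Lemma pos_part0 M a : pos_part M a 0 = 1.
Proof.
rewrite /pos_part big_seq big1 // => j; rewrite mem_iota => /andP[j1 _].
by rewrite expr0n eqn0Ngt j1 scale0r subr0.
Qed.

Lemma holA_pos_part M a : holA 0 (pos_part M a).
Proof. apply: (holA_prod basis_e) => j /=; exact: holA_factor. Qed.

Lemma hol_exprz (z0 : C) (k : int) : z0 != 0 -> hol z0 (fun z => z ^ k).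
Proof.
move=> z00; have := cont_near_neq0 (@cont_at_id R z0) z00; apply: filterS => z zn0.
by exists (k%:~R * z ^ (k - 1)); exact: rder_exprz.
Qed.

Lemma holA_neg_part N a z0 : z0 != 0 -> holA z0 (neg_part N a).
Proof.
move=> z00; apply: (holA_prod basis_e) => j /=; apply: (holAD (holA_cst _ _ _)); apply: holAN.
by apply: (holA_scale basis_e); [exact: hol_exprz|exact: holA_cst].
Qed.

Lemma near_of_punctured (P : C -> Prop) : P 0 -> (\forall z \near (0 : C)^', P z) ->
  \forall z \near (0 : C), P z.
Proof.
move=> P0 /near_puncturedCP[d d0 dP]; apply/nearCP; exists d => // z zd.
by have [->|z0] := eqVneq z 0; last exact: dP.
Qed.

(** A logarithm of neg_part, polynomial in z^-1 because the a_-j are nilpotent. *)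
Definition neg_log N (a : int -> A) (z : C) : A :=
  \sum_(j <- iota 1 N) lg (z ^ (- j%:Z) *: a (- j%:Z)).

Lemma expA_neg_log N a z : (forall j, j < 0 -> a j \in m) ->
  expA m (neg_log N a z) = neg_part N a z.
Proof.
move=> am; rewrite /neg_log (expA_sum localA basis_e e0 em) [LHS]big_seq [RHS]big_seq.
apply: eq_bigr => j; rewrite mem_iota => /andP[j1 _].
apply: (expA_lg localA basis_e e0 em); apply/(m_Z localA)/am; clear -j1; lia.
Qed.

(** If U' = F' / F then exp U / F has derivative 0, and it is 1 at 0. *)
Lemma log_germ (F F' : C -> A) : F 0 = 1 -> (\forall z \near (0 : C), rderA id F z (F' z)) ->
  exists U, [/\ U 0 = 0, \forall z \near (0 : C), rderA id U z (F' z * (F z)^-1) &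
    \forall z \near (0 : C), expA m (U z) = F z].
Proof.
move=> F0 Fd; have Fh := holA_rder Fd; have F'h := holA_rder_deriv basis_e Fd.
have F0U : F 0 \is a GRing.unit by rewrite F0 unitr1.
have U := holA_unit localA basis_e e0 em Fh F0U.
have Vh := holA_inv localA basis_e e0 em Fh F0U.
have [G Gd] := holA_prim basis_e (holAM basis_e F'h Vh).
have Ud : \forall z \near (0 : C), rderA id (fun z => G z - G 0) z (F' z * (F z)^-1).
  apply: filterS Gd => z Gz; have h := rderAB Gz (rderA_cst e id z (G 0)).
  by rewrite subr0 in h.
exists (fun z => G z - G 0); split=> //; first by rewrite subrr.
pose Y z := expA m (G z - G 0) * (F z)^-1.
have Yd : \forall z \near (0 : C), rderA id Y z 0.
  near=> z.
  have zU : F z \is a GRing.unit by near: z.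
  have Uz : rderA id (fun z => G z - G 0) z (F' z * (F z)^-1) by near: z.
  have Fz : rderA id F z (F' z) by near: z.
  have h1 := rderA_expA localA basis_e e0 em cid Uz.
  have h2 := rderA_inv localA basis_e e0 em cid zU Fz.
  apply: rderA_eq (rderAM basis_e cid h1 h2).
  by rewrite expr2; ring.
apply: filterS2 U (rderA_cst_near basis_e Yd) => z zU YE.
have : Y z * F z = F z.
  by rewrite YE /Y subrr (expA0 localA basis_e e0 em) F0 invr1 !mul1r.
by rewrite /Y -mulrA mulVr // mulr1.
Unshelve. all: by end_near. Qed.

(** Divided by a_0 z^nu and by the factors of negative index, F agrees to any order with
    a partial product of the factors of positive index. Hence the quotient extends
    holomorphically with value 1 at 0, and it has a logarithm U. The derivative of U
    agrees to any order with the sum of the logarithmic derivatives of the factors,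
    which is all that the residues below see of the infinite product. *)
Lemma local_form F nu N (a c : int -> A) :
  laurent_series_of F c -> laurent_product nu N a c ->
  a 0 \is a GRing.unit -> (forall j, j < 0 -> a j \in m) ->
  (\forall z \near (0 : C)^', exists d, rderA id F z d) ->
  exists U U' : C -> A,
  [/\ U 0 = 0, \forall z \near (0 : C), rderA id U z (U' z),
      \forall z \near (0 : C)^', F z = z ^ nu *: (a 0 * expA m (neg_log N a z + U z)) &
      forall K, exists M0 : nat, forall M I, (M0 <= M)%N -> (K <= I)%N ->
        divA K (fun z => U' z + power_tail a (iota 1 M) I z)].
Proof.
move=> Fc cP a0U am Fh.
have [B BP] := laurent_difference Fc cP.
have [B1 [q [qh qE]]] := neg_part_inv N am.
pose B2 := absz nu; have [l lE] : exists l : nat, l%:Z = B2%:Z - nu.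
  by exists (absz (B2%:Z - nu)); rewrite /B2; clear; lia.
(* Phi is F divided by a_0 z^nu and by neg_part, the quotient by the latter being written as
   multiplication by z^-B1 q. *)
pose Phi z := z ^ (- nu - B1%:Z) *: ((a 0)^-1 * (q z * F z)).
have PhiP K M : (K + 2 + B1 + B2 + B <= M)%N -> divA K (fun z => Phi z - pos_part M a z).
  move=> KM.
  have [Q [Qh DQ]] : divA (K + B1 + B2) (fun z => F z - z ^ nu *: (a 0 * neg_part N a z * pos_part M a z)).
    apply: divA_removable => [|i].
      apply: filterS2 Fh (@punctured_neq0 R) => z [d Fd] z0.
      suff [d' h] : exists d', rderA id (fun z => z ^ nu *: (a 0 * neg_part N a z * pos_part M a z)) z d'.
        by exists (d - d'); exact: rderAB.
      have ph : holA z (pos_part M a).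
        apply: (holA_prod basis_e) => j /=; apply: (holAD (holA_cst _ _ _)); apply: holAN.
        by apply: (holA_scale basis_e (hol_X _ _)); exact: holA_cst.
      suff h : holA z (fun z => z ^ nu *: (a 0 * neg_part N a z * pos_part M a z)).
        by have [d' h'] := nbhs_singleton h; exists d'.
      apply: (holA_scale basis_e (hol_exprz _ z0)).
      apply: (holAM basis_e) ph; apply: (holAM basis_e (holA_cst _ _ _)).
      exact: holA_neg_part.
    by apply: BP; clear -KM; lia.
  exists (fun z => z ^+ l *: ((a 0)^-1 * (q z * Q z))); split.
    apply: (holA_scale basis_e (hol_X _ _)); apply: (holAM basis_e (holA_cst _ _ _)).
    exact: (holAM basis_e).
  apply: filterS2 DQ (@punctured_neq0 R) => z DQz z0.
  have FE : F z = z ^ nu *: (a 0 * neg_part N a z * pos_part M a z) + z ^+ (K + B1 + B2) *: Q z.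
    by rewrite -DQz addrC subrK.
  rewrite /Phi FE mulrDr mulrDr scalerDr.
  have -> : z ^ (- nu - B1%:Z) *: ((a 0)^-1 * (q z * (z ^ nu *: (a 0 * neg_part N a z * pos_part M a z)))) =
      pos_part M a z.
    have -> : (a 0)^-1 * (q z * (z ^ nu *: (a 0 * neg_part N a z * pos_part M a z))) =
        z ^ nu *: (((a 0)^-1 * a 0) * ((neg_part N a z * q z) * pos_part M a z)).
      by rewrite -!scalerAr; congr (_ *: _); ring.
    rewrite mulVr // mul1r qE // -scalerAl mul1r !scalerA exprnP -!expfzDr //.
    by rewrite (_ : _ + _ = 0) ?expr0z ?scale1r //; clear; lia.
  rewrite addrC addKr -!scalerAr !scalerA; congr (_ *: _).
  rewrite !exprnP -!expfzDr //; congr (_ ^ _); rewrite lE; clear; lia.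
have [Q1 [Q1h Q1E]] := PhiP 1%N _ (leqnn _).
set M1 := (1 + 2 + B1 + B2 + B)%N in Q1E.
pose fp z := pos_part M1 a z + z *: Q1 z.
have fph : holA 0 fp.
  by apply: holAD; [exact: holA_pos_part|apply: (holA_scale basis_e (hol_id _))].
have fp0 : fp 0 = 1 by rewrite /fp pos_part0 scale0r addr0.
have PhiE : \forall z \near (0 : C)^', Phi z = fp z.
  by apply: filterS Q1E => z; rewrite expr1 /fp => <-; rewrite addrC subrK.
have FE : \forall z \near (0 : C)^', F z = z ^ nu *: (a 0 * neg_part N a z * fp z).
  apply: filterS2 PhiE (@punctured_neq0 R) => z <- z0; rewrite /Phi.
  rewrite -scalerAr scalerA.
  have -> : a 0 * neg_part N a z * ((a 0)^-1 * (q z * F z)) =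
      (a 0 / a 0) * ((neg_part N a z * q z) * F z) by ring.
  rewrite divrr // mul1r qE // -scalerAl mul1r scalerA exprnP -!expfzDr //.
  by rewrite (_ : _ + _ = 0) ?expr0z ?scale1r //; clear; lia.
have [fp' [fpd fp'h]] := holA_deriv basis_e fph.
have [U [U0 Ud UE]] := log_germ fp0 fpd.
exists U, (fun z => fp' z * (fp z)^-1); split=> //.
  apply: filterS2 FE (near_punctured UE) => z -> Uz.
  by rewrite (expAD localA basis_e e0 em) expA_neg_log // Uz mulrA.
(* A difference of order K + 1 between fp and pos_part gives one of order K between their
   logarithmic derivatives. *)
move=> K; exists (K.+1 + 2 + B1 + B2 + B)%N => M I KM KI.
have [Q [Qh QE]] := PhiP K.+1 M KM.
have [|H [Hh Hd HI]] := @log_derivative_prod a (iota 1 M).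
  by apply/allP => j; rewrite mem_iota => /andP[].
have SE : \forall z \near (0 : C), fp z = pos_part M a z + z ^+ K.+1 *: Q z.
  apply: near_of_punctured; first by rewrite fp0 pos_part0 exprS mul0r scale0r addr0.
  by apply: filterS2 QE PhiE => z <- ->; rewrite addrC subrK.
have fpU : fp 0 \is a GRing.unit by rewrite fp0 unitr1.
have U1 := holA_unit localA basis_e e0 em fph fpU.
have Vh := holA_inv localA basis_e e0 em fph fpU.
have [Q' [Qd Q'h]] := holA_deriv basis_e Qh.
suff h2 : divA K (fun z => fp' z * (fp z)^-1 - H z).
  apply: divA_near (divAD h2 (divA_le basis_e KI (HI I))).
  by near=> z; rewrite addrA subrK.
exists (fun z => (K.+1%:R *: Q z + z *: Q' z - z *: (Q z * H z)) * (fp z)^-1); split.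
  apply: (holAM basis_e) Vh; apply: holAD; first apply: holAD.
  - by apply: (holA_scale basis_e) Qh; exact: hol_cst.
  - by apply: (holA_scale basis_e) Q'h; exact: hol_id.
  - apply: holAN; apply: (holA_scale basis_e (hol_id _)); exact: (holAM basis_e).
apply: near_punctured; near=> z.
have zU : fp z \is a GRing.unit by near: z.
have fz : rderA id fp z (fp' z) by near: z.
have sz : \forall w \near z, fp w = pos_part M a w + w ^+ K.+1 *: Q w by near: z; exact: near_join.
have pz : rderA id (pos_part M a) z (pos_part M a z * H z) by near: z.
have Qz : rderA id Q z (Q' z) by near: z.
have h := rderAD pz (rderAZ basis_e cid (rder_exprn z K) Qz).
have E := rderA_uniq basis_e (rderA_near sz fz) h.
apply: (mulIr zU); rewrite mulrBl -mulrA mulVr // mulr1 -scalerAl -mulrA mulVr // mulr1.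
rewrite E (nbhs_singleton sz) !scalerBr !scalerDr !scalerA -exprSr mulrDr -scalerAr.
rewrite [H z * _]mulrC [H z * _]mulrC [z ^+ K * _]mulrC opprD addrA addrAC.
by rewrite addrAC [X in X - _ - _]addrC addrK.
Unshelve. all: by end_near. Qed.

End LocalForm.

(** * The residue that produces the double products *)

Section Pairing.
Context (R : realType) (A : comFalgType R[i]) (m : {pred A}).
Context (n : nat) (e : n.+1.-tuple A).
Local Notation C := R[i].
Hypothesis localA : local_with_maximal_ideal m.
Hypothesis basis_e : basis_of {:A} e.
Hypothesis e0 : tnth e ord0 = 1.
Hypothesis em : forall i, i != ord0 -> tnth e i \in m.
Local Notation rderA := (rderA e).
Local Notation holA := (holA e).
Local Notation divA := (divA e).
Local Notation has_res := (has_res e).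
Local Notation cid := (@cont_at_id R _).

Lemma sum_pick (V : nmodType) (r : seq nat) (x : nat) (y : V) : uniq r ->
  \sum_(i <- r) (if i == x then y else 0) = if x \in r then y else 0.
Proof.
move=> ur; rewrite -big_mkcond; case: ifP => xr.
  rewrite big_mkcond (bigD1_seq x) //= eqxx big1 ?addr0 // => i ix.
  by rewrite (negbTE ix).
by rewrite big_seq_cond big1 // => i /andP[ir /eqP ix]; rewrite -ix ir in xr.
Qed.

Lemma lgE (u : A) : lg u = - \sum_(l <- iota 1 (\dim {:A})) (l%:R : C)^-1 *: u ^+ l.
Proof.
rewrite /lg; congr (- _); rewrite -(big_mkord xpredT (fun k => (k.+1%:R : C)^-1 *: u ^+ k.+1)).
have -> : iota 1 (\dim {:A}) = index_iota 1 (\dim {:A}).+1 by rewrite /index_iota subn1.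
by rewrite big_add1.
Qed.

(** The solutions of i q = p l are l = t q / g, i = t p / g with g the gcd of p and q;
    the sum over t is the series of the logarithm of the factor with indices p, q of the
    double product. *)
Lemma pair_sum (p q I : nat) (a b : A) : (0 < p)%N -> (0 < q)%N -> a \in m ->
  (p * \dim {:A} <= I)%N ->
  \sum_(l <- iota 1 (\dim {:A})) \sum_(i <- iota 1 I)
    (if (i * q == p * l)%N then (q%:R / l%:R : C) *: (a ^+ l * b ^+ i) else 0) =
  - lg (a ^+ (q %/ gcdn p q) * b ^+ (p %/ gcdn p q)) *+ gcdn p q.
Proof.
move=> p0 q0 am pI; set D := \dim {:A}; set g := gcdn p q.
have g0 : (0 < g)%N by rewrite gcdn_gt0 p0.
pose p' := (p %/ g)%N; pose q' := (q %/ g)%N; rewrite -/p' -/q'.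
have pE : p = (p' * g)%N by rewrite divnK // dvdn_gcdl.
have qE : q = (q' * g)%N by rewrite divnK // dvdn_gcdr.
have p'0 : (0 < p')%N by move: p0; rewrite pE muln_gt0 => /andP[].
have q'0 : (0 < q')%N by move: q0; rewrite qE muln_gt0 => /andP[].
have cop : coprime q' p'.
  by rewrite coprime_sym /coprime -(eqn_pmul2r g0) muln_gcdl -pE -qE mul1n.
have gC : (g%:R : C) != 0 by rewrite pnatr_eq0 -lt0n.
have q'C : (q'%:R : C) != 0 by rewrite pnatr_eq0 -lt0n.
pose c (t : nat) := (g%:R / t%:R : C) *: (a ^+ q' * b ^+ p') ^+ t.
transitivity (\sum_(t <- iota 1 D) c t); last first.
  rewrite lgE opprK -sumrMnl; apply: eq_bigr => t _.
  by rewrite /c -scalerA scaler_nat.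
transitivity (\sum_(l <- iota 1 D) \sum_(i <- iota 1 I) \sum_(t <- iota 1 D)
    (if (i == p' * t)%N then if (l == q' * t)%N then c t else 0 else 0)).
  apply: eq_big_seq => l; rewrite mem_iota => /andP[l1 lD].
  apply: eq_big_seq => i; rewrite mem_iota => /andP[i1 _].
  case: eqP => [il|nil]; last first.
    rewrite big1 // => t _; case: eqP => // it; case: eqP => // lt.
    by case: nil; rewrite it lt pE {1}qE; clear; nia.
  have il' : (i * q' = p' * l)%N.
    by apply/eqP; rewrite -(eqn_pmul2r g0) -mulnA -qE il {1}pE; apply/eqP; clear; nia.
  have : (q' %| p' * l)%N by rewrite -il' dvdn_mull.
  rewrite Gauss_dvdr // => /dvdnP[t lE].
  have iE : i = (p' * t)%N.
    by apply/eqP; rewrite -(eqn_pmul2r q'0) il' lE mulnA.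
  have t0 : (0 < t)%N by rewrite lt0n; apply: contraTneq l1 => t0; rewrite lE t0.
  rewrite (eq_bigr (fun u => if u == t then c t else 0)) => [|u _].
    rewrite sum_pick ?iota_uniq // mem_iota t0 (_ : (t < 1 + D)%N) //; last first.
      by rewrite (leq_ltn_trans _ lD) // lE leq_pmulr.
    rewrite /c exprMn -!exprM iE lE [(t * q')%N]mulnC; congr (_ *: _).
    rewrite {1}qE !natrM; field.
    by rewrite q'C pnatr_eq0 -lt0n t0.
  rewrite iE lE [(t * q')%N]mulnC !eqn_pmul2l // [t == u]eq_sym.
  by case: eqP => // ->.
transitivity (\sum_(t <- iota 1 D) \sum_(l <- iota 1 D) \sum_(i <- iota 1 I)
    (if (i == p' * t)%N then if (l == q' * t)%N then c t else 0 else 0)).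
  by rewrite [RHS]exchange_big; apply: eq_bigr => l _; rewrite [LHS]exchange_big.
apply: eq_big_seq => t; rewrite mem_iota => /andP[t1 _].
under eq_bigr do rewrite sum_pick ?iota_uniq //.
(* The indices t for which t q / g or t p / g is out of range contribute 0 by nilpotency of a. *)
have [tD|tD] := leqP (q' * t)%N D; last first.
  have -> : c t = 0.
    by rewrite /c exprMn -exprM (m_nilpotent_ge localA am (ltnW tD)) mul0r scaler0.
  by rewrite big1 // => l _; rewrite !if_same.
have pt : (p' * t)%N \in iota 1 I.
  rewrite mem_iota muln_gt0 p'0 t1 /= add1n ltnS (leq_trans _ pI) // leq_mul //.
    by rewrite /p' leq_div.
  by rewrite (leq_trans _ tD) // leq_pmull.
by rewrite pt sum_pick ?iota_uniq // mem_iota muln_gt0 q'0 t1 /= add1n ltnS tD.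
Qed.

Lemma scaler_mulACA (c d : C) (u v : A) : (c *: u) * (d *: v) = (c * d) *: (u * v).
Proof. by rewrite -scalerAl -scalerAr scalerA. Qed.

Lemma neg_logE N (a : int -> A) z : neg_log N a z =
  - \sum_(p <- iota 1 N) \sum_(l <- iota 1 (\dim {:A}))
      z ^ (- (p * l)%N%:Z) *: ((l%:R : C)^-1 *: a (- p%:Z) ^+ l).
Proof.
rewrite /neg_log -sumrN; apply: eq_bigr => p _; rewrite lgE; congr (- _).
apply: eq_bigr => l _; rewrite exprZn scalerA mulrC -scalerA; congr (_ *: _).
by rewrite -!exprnN exprVn -exprM.
Qed.

(** The logarithm of the double product of the theorem, cut at p <= N and q <= M. *)
Definition pair_log (N M : nat) (a b : int -> A) : A :=
  \sum_(p <- iota 1 N) \sum_(q <- iota 1 M)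
    lg (a (- p%:Z) ^+ (q %/ gcdn p q) * b q%:Z ^+ (p %/ gcdn p q)) *+ gcdn p q.

(** The principal part has order at most N dim A, so V' may be replaced by - power_tail
    up to that order; the product is then a sum of monomials, and pair_sum collects
    those in z^-1. *)
Lemma pairing_res N (a b : int -> A) (V' : C -> A) :
  (forall j, j < 0 -> a j \in m) ->
  (forall K, exists M0 : nat, forall M I, (M0 <= M)%N -> (K <= I)%N ->
     divA K (fun z => V' z + power_tail b (iota 1 M) I z)) ->
  exists M0 : nat, forall M, (M0 <= M)%N ->
    has_res (fun z => neg_log N a z * V' z) (- pair_log N M a b).
Proof.
move=> am VP; set D := \dim {:A}; have [M0 M0P] := VP (N * D)%N.
exists M0 => M MM; have [Q [Qh QE]] := M0P M (N * D)%N MM (leqnn _).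
pose T z := power_tail b (iota 1 M) (N * D)%N z.
have H1 : has_res (fun z => neg_log N a z * (V' z + T z)) 0.
  apply: has_res_divA => //.
  exists (fun z => (- \sum_(p <- iota 1 N) \sum_(l <- iota 1 D)
      z ^+ (N * D - p * l) *: ((l%:R : C)^-1 *: a (- p%:Z) ^+ l)) * Q z); split.
    apply: (holAM basis_e) Qh; apply: holAN.
    apply: (@holA_sum _ _ _ e _ _ _ (fun p z => \sum_(l <- iota 1 D)
      z ^+ (N * D - p * l) *: ((l%:R : C)^-1 *: a (- p%:Z) ^+ l))) => p.
    apply: (@holA_sum _ _ _ e _ _ _ (fun l z => z ^+ (N * D - p * l) *: ((l%:R : C)^-1 *: a (- p%:Z) ^+ l))) => l.
    by apply: (holA_scale basis_e (hol_X _ _)); exact: holA_cst.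
  apply: filterS2 QE (@punctured_neq0 R) => z -> z0.
  rewrite expr0 scale1r -scalerAr scalerAl; congr (_ * _).
  rewrite neg_logE scalerN scaler_sumr; congr (- _).
  apply: eq_big_seq => p; rewrite mem_iota => /andP[p1 pN]; rewrite scaler_sumr.
  apply: eq_big_seq => l; rewrite mem_iota => /andP[l1 lD]; rewrite [LHS]scalerA; congr (_ *: _).
  have pl : (p * l <= N * D)%N by apply: leq_mul; clear -pN lD; lia.
  by rewrite -{1}(subnK pl) exprD -mulrA -exprnN divff ?mulr1 // expf_neq0.
have H2 : has_res (fun z => - (neg_log N a z * T z)) (- pair_log N M a b).
  have -> : - pair_log N M a b = \sum_(p <- iota 1 N) \sum_(q <- iota 1 M)
      \sum_(l <- iota 1 D) \sum_(i <- iota 1 (N * D)%N)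
    (if (i * q == p * l)%N then (q%:R / l%:R : C) *: (a (- p%:Z) ^+ l * b q%:Z ^+ i) else 0).
    rewrite /pair_log -sumrN; apply: eq_big_seq => p; rewrite mem_iota => /andP[p1 pN].
    rewrite -sumrN; apply: eq_big_seq => q; rewrite mem_iota => /andP[q1 _].
    rewrite pair_sum ?mulNrn //; first by apply: am; clear -p1; lia.
    by rewrite leq_mul2r -ltnS pN orbT.
  apply: (has_res_near (F := fun z => \sum_(p <- iota 1 N) \sum_(q <- iota 1 M)
      \sum_(l <- iota 1 D) \sum_(i <- iota 1 (N * D)%N)
      z ^ ((i * q)%N%:Z - 1 - (p * l)%N%:Z) *: ((q%:R / l%:R : C) *: (a (- p%:Z) ^+ l * b q%:Z ^+ i)))).
    apply: filterS (@punctured_neq0 R) => z z0.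
    rewrite neg_logE mulNr opprK mulr_suml; apply: eq_bigr => p _.
    rewrite mulr_suml exchange_big /=; apply: eq_bigr => l _.
    rewrite /T /power_tail mulr_sumr; apply: eq_big_seq => q; rewrite mem_iota => /andP[q1 _].
    rewrite mulr_sumr; apply: eq_big_seq => i; rewrite mem_iota => /andP[i1 _].
    rewrite -!scalerAl -!scalerAr !scalerA; congr (_ *: _).
    have -> : (i * q)%N%:Z - 1 - (p * l)%N%:Z = - (p * l)%N%:Z + (i * q - 1)%N%:Z.
      by clear -i1 q1; nia.
    by rewrite expfzDr // exprnP [q%:R / _]mulrC mulrACA.
  apply: (has_res_sum basis_e) => p; apply: (has_res_sum basis_e) => q; apply: (has_res_sum basis_e) => l; apply: (has_res_sum basis_e) => i.
  have h := has_res_monomial e ((q%:R / l%:R : C) *: (a (- p%:Z) ^+ l * b q%:Z ^+ i)) ((i * q)%N%:Z - 1 - (p * l)%N%:Z).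
  apply: has_res_eq h; congr (if _ then _ else _).
  by apply/eqP/eqP; clear; lia.
have := has_resD H1 H2; rewrite add0r; apply: has_res_near.
by near=> z; rewrite mulrDr addrK.
Unshelve. all: by end_near. Qed.

Definition neg_log_deriv N (a : int -> A) (z : C) : A :=
  \sum_(p <- iota 1 N) \sum_(l <- iota 1 (\dim {:A}))
    z ^ (- (p * l)%N%:Z - 1) *: ((p%:R : C) *: a (- p%:Z) ^+ l).

Lemma rderA_neg_log N (a : int -> A) z : z != 0 ->
  rderA id (neg_log N a) z (neg_log_deriv N a z).
Proof.
move=> z0; set D := \dim {:A}.
suff h : rderA id (fun z => - \sum_(p <- iota 1 N) \sum_(l <- iota 1 D)
    (if (l == 0)%N then 0 else z ^ (- (p * l)%N%:Z) *: ((l%:R : C)^-1 *: a (- p%:Z) ^+ l))) z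
    (- \sum_(p <- iota 1 N) \sum_(l <- iota 1 D)
      (if (l == 0)%N then 0 else ((- (p * l)%N%:Z)%:~R * z ^ (- (p * l)%N%:Z - 1)) *: ((l%:R : C)^-1 *: a (- p%:Z) ^+ l))).
  apply: rderA_eq; last first.
    apply: rderA_ext h => w; rewrite neg_logE; congr (- _); apply: eq_bigr => p _.
    by apply: eq_big_seq => l; rewrite mem_iota => /andP[]; case: l.
  rewrite -sumrN; apply: eq_bigr => p _; rewrite -sumrN; apply: eq_big_seq => l.
  rewrite mem_iota => /andP[l1 _]; rewrite -[l == 0%N]negbK -lt0n l1 /= -scaleNr !scalerA.
  have lC : (l%:R : C) != 0 by rewrite pnatr_eq0 -lt0n.
  congr (_ *: _); rewrite mulrNz -mulNr opprK PoszM intrM; rewrite -!pmulrn.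
  by set u := z ^ _; field.
apply: rderAN; apply: rderA_sum => p _; apply: rderA_sum => l _.
case: eqP => _; first exact: rderA_cst.
exact: (rderA_scale e _ (rder_exprz _ z0)).
Qed.

Lemma has_resZ (c : C) (F : C -> A) rho : has_res F rho -> has_res (fun z => c *: F z) (c *: rho).
Proof.
move=> [M MP]; exists (fun z => c *: M z); apply: filterS MP => z Mz.
by apply: rderA_eq (rderAZc c Mz); rewrite scalerBr !scalerA mulrC.
Qed.

Lemma has_res_neg_log_inv N (a : int -> A) : has_res (fun z => z^-1 *: neg_log N a z) 0.
Proof.
apply: (has_res_near (F := fun z => \sum_(p <- iota 1 N) \sum_(l <- iota 1 (\dim {:A}))
    z ^ (- (p * l)%N%:Z - 1) *: (- ((l%:R : C)^-1 *: a (- p%:Z) ^+ l)))).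
  apply: filterS (@punctured_neq0 R) => z z0; rewrite neg_logE scalerN -scaleNr scaler_sumr.
  apply: eq_bigr => p _; rewrite scaler_sumr; apply: eq_bigr => l _.
  have -> : z ^ (- (p * l)%N%:Z - 1) = z^-1 * z ^ (- (p * l)%N%:Z) by rewrite expfzDr // mulrC.
  by rewrite scalerN -scalerA scaleNr.
apply: (@has_res_eq _ _ _ e _ (\sum_(p <- iota 1 N) \sum_(l <- iota 1 (\dim {:A}))
   (if [&& 0 < p & 0 < l]%N then 0 else - ((l%:R : C)^-1 *: a (- p%:Z) ^+ l)))).
  rewrite big_seq big1 // => p; rewrite mem_iota => /andP[p1 _].
  by rewrite big_seq big1 // => l; rewrite mem_iota => /andP[l1 _]; rewrite p1 l1.
apply: (has_res_sum basis_e) => p; apply: (has_res_sum basis_e) => l.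
have h := has_res_monomial e (- ((l%:R : C)^-1 *: a (- p%:Z) ^+ l)) (- (p * l)%N%:Z - 1).
apply: has_res_eq h; case: eqP => pl; case: ifP => pl0 //; first by clear -pl pl0; nia.
by case: pl; clear -pl0; nia.
Qed.

Lemma has_res_neg_neg N N' (a b : int -> A) :
  has_res (fun z => neg_log N a z * neg_log_deriv N' b z) 0.
Proof.
set D := \dim {:A}.
pose X p l q k : A := - ((l%:R : C)^-1 *: a (- p%:Z) ^+ l) * ((q%:R : C) *: b (- q%:Z) ^+ k).
apply: (has_res_near (F := fun z => \sum_(p <- iota 1 N) \sum_(l <- iota 1 D)
    \sum_(q <- iota 1 N') \sum_(k <- iota 1 D)
    z ^ (- (p * l)%N%:Z + (- (q * k)%N%:Z - 1)) *: X p l q k)).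
  apply: filterS (@punctured_neq0 R) => z z0; rewrite neg_logE mulNr -mulrN mulr_suml.
  apply: eq_bigr => p _; rewrite mulr_suml; apply: eq_bigr => l _.
  rewrite -sumrN mulr_sumr; apply: eq_bigr => q _; rewrite -sumrN mulr_sumr; apply: eq_bigr => k _.
  by rewrite expfzDr // /X mulrN mulNr scalerN (scaler_mulACA (z ^ _) (z ^ _)).
apply: (@has_res_eq _ _ _ e _ (\sum_(p <- iota 1 N) \sum_(l <- iota 1 D)
   \sum_(q <- iota 1 N') \sum_(k <- iota 1 D)
   (if [&& 0 < p, 0 < l, 0 < q & 0 < k]%N then 0 else
     if - (p * l)%N%:Z + (- (q * k)%N%:Z - 1) == -1 then X p l q k else 0))).
  rewrite big_seq big1 // => p; rewrite mem_iota => /andP[p1 _].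
  rewrite big_seq big1 // => l; rewrite mem_iota => /andP[l1 _].
  rewrite big_seq big1 // => q; rewrite mem_iota => /andP[q1 _].
  by rewrite big_seq big1 // => k; rewrite mem_iota => /andP[k1 _]; rewrite p1 l1 q1 k1.
apply: (has_res_sum basis_e) => p; apply: (has_res_sum basis_e) => l; apply: (has_res_sum basis_e) => q; apply: (has_res_sum basis_e) => k.
have h := has_res_monomial e (X p l q k) (- (p * l)%N%:Z + (- (q * k)%N%:Z - 1)).
apply: has_res_eq h; case: eqP => pl; case: ifP => // /and4P[p1 l1 q1 k1].
by clear -pl p1 l1 q1 k1; nia.
Qed.

(** The terms of the product which involve two principal parts have degree below -1,
    those which involve none are holomorphic, and pairing_res computes the term with
    neg_log N a and V'. In the remaining term U neg_log_deriv, integration by parts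
    exchanges the roles of the two factors, up to an exact form and a sign. *)
Lemma local_residue N N' (a b : int -> A) (U U' V V' : C -> A) (nu mu : C) :
  (forall j, j < 0 -> a j \in m) -> (forall j, j < 0 -> b j \in m) ->
  U 0 = 0 -> V 0 = 0 ->
  (\forall z \near (0 : C), rderA id U z (U' z)) ->
  (\forall z \near (0 : C), rderA id V z (V' z)) ->
  (forall K, exists M0 : nat, forall M I, (M0 <= M)%N -> (K <= I)%N ->
     divA K (fun z => U' z + power_tail a (iota 1 M) I z)) ->
  (forall K, exists M0 : nat, forall M I, (M0 <= M)%N -> (K <= I)%N ->
     divA K (fun z => V' z + power_tail b (iota 1 M) I z)) ->
  exists M0 : nat, forall M, (M0 <= M)%N ->
  has_res (fun z => (neg_log N a z + U z) * (neg_log_deriv N' b z + V' z) +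
      z^-1 *: (mu *: (neg_log N a z + U z) - nu *: (neg_log N' b z + V z)))
    (pair_log N' M b a - pair_log N M a b).
Proof.
move=> am bm U0 V0 Ud Vd UP VP.
have [M1 M1P] := pairing_res N am VP; have [M2 M2P] := pairing_res N' bm UP.
exists (maxn M1 M2) => M; rewrite geq_max => /andP[MM1 MM2].
have invU W : W 0 = 0 -> holA 0 W -> has_res (fun z => z^-1 *: W z) 0.
  move=> W0 Wh; have [Q [Qh QE]] := holA_divide basis_e Wh.
  apply: has_res_near (has_res_hol basis_e Qh).
  apply: filterS2 (near_punctured QE) (@punctured_neq0 R) => z -> z0.
  by rewrite W0 add0r scalerA mulVf // scale1r.
have Uh := holA_rder Ud; have Vh := holA_rder Vd.
have V'h := holA_rder_deriv basis_e Vd.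
have hUV : has_res (fun z => U z * neg_log_deriv N' b z) (pair_log N' M b a).
  have ex : has_res (fun z => U' z * neg_log N' b z + U z * neg_log_deriv N' b z) 0.
    apply: (has_res_exact (M := fun z => U z * neg_log N' b z)).
    apply: filterS2 (near_punctured Ud) (@punctured_neq0 R) => z Uz z0.
    exact: (rderAM basis_e cid Uz (rderA_neg_log _ _ z0)).
  have := has_resD ex (has_resN (M2P M MM2)); rewrite add0r opprK; apply: has_res_near.
  by near=> z; rewrite [neg_log N' b z * _]mulrC addrAC subrr add0r.
have I1 := has_resZ mu (has_resD (has_res_neg_log_inv N a) (invU U U0 Uh)).
have I2 := has_resN (has_resZ nu (has_resD (has_res_neg_log_inv N' b) (invU V V0 Vh))).
have H1 := has_resD (has_res_neg_neg N N' a b) (M1P M MM1).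
have H2 := has_resD hUV (has_res_hol basis_e (holAM basis_e Uh V'h)).
have := has_resD (has_resD H1 H2) (has_resD I1 I2).
rewrite add0r !addr0 !scaler0 oppr0 !addr0 [- _ + _]addrC; apply: has_res_near.
near=> z; congr (_ + _); first by rewrite !mulrDl !mulrDr addrA.
by rewrite -!scalerDr scalerBr !scalerA ![z^-1 * _]mulrC.
Unshelve. all: by end_near. Qed.

End Pairing.

(** * Local primitives on the surface *)

Section SurfaceCalculus.
Context (R : realType) (X : riemannSurfaceType R) (A : comFalgType R[i]) (m : {pred A}).
Context (n : nat) (e : n.+1.-tuple A).
Local Notation C := R[i].
Hypothesis localA : local_with_maximal_ideal m.
Hypothesis basis_e : basis_of {:A} e.
Hypothesis e0 : tnth e ord0 = 1.
Hypothesis em : forall i, i != ord0 -> tnth e i \in m.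
Local Notation rderA := (rderA e).
Local Notation holA := (holA e).
Local Notation cid := (@cont_at_id R _).

Lemma chart_cont (x : chart R X) p : chart_dom x p -> {for p, continuous x}.
Proof. by move=> xp; apply: (chart_map_continuous (c := x)); exact: mem_set. Qed.

Lemma chart_inv_cont (x : chart R X) p : chart_dom x p -> {for x p, continuous (chart_inv x)}.
Proof.
move=> xp; apply: (chart_inv_continuous (c := x)); apply: mem_set; by exists p.
Qed.

Lemma chart_dom_near (x : chart R X) p : chart_dom x p -> \forall q \near p, chart_dom x q.
Proof. by move=> xp; apply: open_nbhs_nbhs; split; [exact: chart_dom_open|]. Qed.

Lemma chart_invK (x : chart R X) p : chart_dom x p -> chart_inv x (x p) = p.
Proof. by move=> xp; apply: (chart_mapK (c := x)); exact: mem_set. Qed.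

Lemma chart_im_near (x : chart R X) p : chart_dom x p ->
  \forall z \near x p, chart_dom x (chart_inv x z) /\ x (chart_inv x z) = z.
Proof.
move=> xp; have : nbhs (x p) (x @` chart_dom x).
  by apply: open_nbhs_nbhs; split; [exact: chart_im_open|exists p].
by apply: filterS => z [q xq <-]; rewrite chart_invK.
Qed.

Lemma near_chart (x : chart R X) p (P : C -> Prop) : chart_dom x p ->
  (\forall z \near x p, P z) -> \forall q \near p, P (x q).
Proof. by move=> /chart_cont xc xP; exact: xc. Qed.

Lemma near_chart_inv (x : chart R X) p (P : X -> Prop) : chart_dom x p ->
  (\forall q \near p, P q) -> \forall z \near x p, P (chart_inv x z).
Proof. by move=> xp pP; apply: (chart_inv_cont xp); rewrite chart_invK. Qed.

(** Charts have no isolated value, so derivatives with respect to them are unique. *)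
Lemma chart_accum (x : chart R X) p : chart_dom x p ->
  forall P : X -> Prop, (\forall q \near p, P q) -> exists2 q, P q & x q != x p.
Proof.
move=> xp P pP; have h1 := near_chart_inv xp pP; have h2 := chart_im_near xp.
have /nearCP[d d0 dP] : \forall z \near x p, P (chart_inv x z) /\ x (chart_inv x z) = z.
  by apply: filterS2 h1 h2 => z Pz [_ zz].
have dd : cmod (x p + (d / 2)%:C - x p) < d.
  by rewrite addrAC subrr add0r cmod_real gtr0_norm ?divr_gt0 //; lra.
have [Pz zz] := dP _ dd; exists (chart_inv x (x p + (d / 2)%:C)) => //.
by rewrite zz -subr_eq0 addrAC subrr add0r -cmod_eq0 cmod_real gt_eqF // normr_gt0 gt_eqF // divr_gt0.
Qed.

Lemma rderA_chart_uniq (x : chart R X) (F : X -> A) p a b : chart_dom x p ->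
  rderA x F p a -> rderA x F p b -> a = b.
Proof.
move=> xp Fa Fb; apply: (coordA_ext basis_e) => i.
exact: (rder_uniq (chart_accum xp) (Fa i) (Fb i)).
Qed.

Lemma rder_transition (c d : chart R X) p : holomorphic_transition c d ->
  chart_dom c p -> chart_dom d p -> exists t, rder c d p t.
Proof.
move=> cd cp dp; have h := derivable_rder (nbhs_singleton (cd p cp dp)).
have hc : rder c (id \o c) p 1 by exact: rder_id.
have := rder_comp (chart_cont cp) hc h => {}h; eexists.
apply: rder_near h; apply: filterS (chart_dom_near cp) => q cq /=.
by rewrite chart_invK.
Qed.

Lemma rderA_change (x y : X -> C) (F : X -> A) p a t : rder x y p t -> rderA y F p a ->
  rderA x F p (t *: a).
Proof.
move=> xy Fa i; rewrite linearZ /=.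
by apply: (@rder_comp R X X x y (fun q => coord e i (F q)) id p t) => //; exact: Fa.
Qed.

Lemma rderA_pull (x : chart R X) (Phi : C -> A) p a : chart_dom x p ->
  rderA id Phi (x p) a -> rderA x (Phi \o x) p a.
Proof.
move=> xp Pa i; rewrite -[coord e i a]mul1r.
apply: (@rder_comp R X C x id (fun z => coord e i (Phi z)) x p 1); last exact: Pa.
  exact: chart_cont.
exact: rder_id.
Qed.

(** The charts in which the derivatives are taken vary with the point; the transition
    maps bring them to one chart, where the one-variable statement applies. *)
Lemma near_constant (H : X -> A) p : (\forall q \near p, rderA (chart_at q) H q 0) ->
  \forall q \near p, H q = H p.
Proof.
move=> Hd; pose c := chart_at p; have cp : chart_dom c p := chart_at_dom p.
have Hc : \forall z \near c p, rderA id (H \o chart_inv c) z 0.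
  have h1 := chart_im_near cp; have h2 := near_chart_inv cp Hd.
  apply: filterS2 (near_join h1) h2 => z zz; set q := chart_inv c z => Hq.
  have [cq cqz] := nbhs_singleton zz.
  have [t tP] := rder_transition (@chart_at_compatible _ X p q) cq (chart_at_dom q).
  have := rderA_change tP Hq; rewrite scaler0 => {}Hq i; rewrite -[coord e i 0]mul1r.
  apply: (@rder_comp R C X id c (fun q => coord e i (H q)) (chart_inv c) z 1); last exact: Hq.
    by rewrite -cqz; exact: chart_inv_cont.
  have idd : rder (id : C -> C) id z 1 by exact: rder_id.
  apply: rder_near idd; by apply: filterS zz => w [_ E] /=; rewrite E.
have := near_chart cp (rderA_cst_near basis_e Hc).
apply: filterS2 (chart_dom_near cp) => q cq /=.
by rewrite !chart_invK.
Qed.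

Section Value.
Variable f : meromorphicA X n.
Local Notation val := (valueA e f).

Lemma coord_value i q : coord e i (val q) = f i q.
Proof. by rewrite /valueA coord_comb. Qed.

Lemma value_unit p : ~ zero_or_pole f p -> val p \is a GRing.unit.
Proof.
move=> fp; rewrite (unit_residue localA basis_e e0 em) (residueP localA basis_e e0 em).
rewrite coord_value; apply/negP => /eqP f0; apply: fp.
have [[i fi]|nf] := pselect (exists i, poles (f i) p); first by left; exists i.
by right; split=> // f0p; apply: nf; exists ord0.
Qed.

Lemma not_pole p i : ~ zero_or_pole f p -> ~ poles (f i) p.
Proof. by move=> fp fi; apply: fp; left; exists i. Qed.

Definition value_deriv (x : chart R X) (z : C) : A :=
  \sum_i derive1 (f i \o chart_inv x) z *: tnth e i.

Lemma rderA_value_inv p : ~ zero_or_pole f p ->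
  \forall z \near chart_at p p, rderA id (val \o chart_inv (chart_at p)) z (value_deriv (chart_at p) z).
Proof.
move=> fp; have : forall i, \forall z \near chart_at p p, derivable (f i \o chart_inv (chart_at p)) z 1.
  by move=> i; apply: mero_holomorphic; exact: not_pole.
move=> /(near_forall_ord (n := n)); apply: filterS => z fz i.
rewrite /value_deriv (coord_comb basis_e).
have -> : (fun q => coord e i ((val \o chart_inv (chart_at p)) q)) = f i \o chart_inv (chart_at p).
  by apply/funext => w /=; rewrite coord_value.
exact: derivable_rder (fz i).
Qed.

Lemma rderA_value p : ~ zero_or_pole f p -> rderA (chart_at p) val p (differentialA e f p).
Proof.
move=> fp; have h := nbhs_singleton (rderA_value_inv fp).
have := rderA_pull (chart_at_dom p) h; apply: rderA_near.
by apply: filterS (chart_dom_near (chart_at_dom p)) => q qp /=; rewrite chart_invK.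
Qed.

Lemma regular_near p : ~ zero_or_pole f p -> \forall q \near p, ~ zero_or_pole f q.
Proof.
move=> fp.
have np : forall i, \forall q \near p, ~ poles (f i) q.
  move=> i; apply: open_nbhs_nbhs; split; last exact: not_pole.
  by apply: closed_openC; exact: poles_closed.
have cc : cont_at (chart_at p) p by apply/cont_atE; exact: chart_cont (chart_at_dom p).
have vc : cont_at (f ord0) p.
  have h := rderA_value fp ord0; have := rder_cont cc h.
  by congr cont_at; apply/funext => q; rewrite coord_value.
have f0 : f ord0 p != 0.
  by apply/eqP => f0; apply: (fp); right; split=> //; exact: not_pole.
apply: filterS2 (near_forall_ord (n := n) np) (cont_near_neq0 vc f0) => q nq fq [[i fi]|[_ /eqP]].
  by case: (nq i).
by rewrite (negbTE fq).
Qed.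

(** Passing from the coordinate x to a chart of the atlas multiplies the derivatives of
    f and of Phi by the same factor. *)
Lemma dlog_from_coord (x : chart R X) p (phi phi' Phi : C -> A) :
  (forall q, holomorphic_transition (chart_at q) x) -> chart_dom x p ->
  ~ zero_or_pole f p ->
  (\forall q \near p, val q = phi (x q)) ->
  (\forall z \near x p, rderA id phi z (phi' z)) ->
  (\forall z \near x p, rderA id Phi z ((phi z)^-1 * phi' z)) ->
  \forall q \near p, rderA (chart_at q) (Phi \o x) q (dlog e f q).
Proof.
move=> xt xp fp fE phid Phid; near=> q.
have xq : chart_dom x q by near: q; exact: chart_dom_near.
have fq : ~ zero_or_pole f q by near: q; exact: regular_near.
have fqE : \forall w \near q, val w = phi (x w) by near: q; exact: near_join.
have phiq : rderA id phi (x q) (phi' (x q)) by near: q; exact: (@near_chart x p (fun z => rderA id phi z (phi' z)) xp).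
have Phiq : rderA id Phi (x q) ((phi (x q))^-1 * phi' (x q)).
  by near: q; exact: (@near_chart x p (fun z => rderA id Phi z ((phi z)^-1 * phi' z)) xp).
have [t tP] := rder_transition (xt q) (chart_at_dom q) xq.
have h1 := rderA_change tP (rderA_pull xq phiq).
have h2 := rderA_near fqE (rderA_value fq).
rewrite /dlog (nbhs_singleton fqE) (rderA_chart_uniq (chart_at_dom q) h2 h1) -scalerAr.
exact: rderA_change tP (rderA_pull xq Phiq).
Unshelve. all: by end_near. Qed.

End Value.

Variables f g : meromorphicA X n.
Local Notation Z := (zero_or_pole f `|` zero_or_pole g).

(** Local solutions of dF = df / f, dG = dg / g and dK = F dg / g. Changing F and G by
    constants a and b changes K by a G + c: the solutions form a torsor under the
    Heisenberg group. *)
Definition primitive_triple (F G K : X -> A) (p : X) : Prop := \forall q \near p,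
  [/\ rderA (chart_at q) F q (dlog e f q), rderA (chart_at q) G q (dlog e g q) &
      rderA (chart_at q) K q (F q * dlog e g q)].

Lemma triple_from_coord (x : chart R X) p (phi phi' Phi gam gam' Gam kap : C -> A) :
  (forall q, holomorphic_transition (chart_at q) x) -> chart_dom x p -> ~ Z p ->
  (\forall q \near p, valueA e f q = phi (x q)) ->
  (\forall z \near x p, rderA id phi z (phi' z)) ->
  (\forall z \near x p, rderA id Phi z ((phi z)^-1 * phi' z)) ->
  (\forall q \near p, valueA e g q = gam (x q)) ->
  (\forall z \near x p, rderA id gam z (gam' z)) ->
  (\forall z \near x p, rderA id Gam z ((gam z)^-1 * gam' z)) ->
  (\forall z \near x p, rderA id kap z (Phi z * ((gam z)^-1 * gam' z))) ->
  primitive_triple (Phi \o x) (Gam \o x) (kap \o x) p.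
Proof.
move=> xt xp Zp fE phid Phid gE gamd Gamd kapd.
have [fp gp] : ~ zero_or_pole f p /\ ~ zero_or_pole g p by apply/not_orP.
have h1 := dlog_from_coord xt xp fp fE phid Phid.
have h2 := dlog_from_coord xt xp gp gE gamd Gamd.
have h3 := @near_chart x p (fun z => rderA id Gam z ((gam z)^-1 * gam' z)) xp Gamd.
have h4 := @near_chart x p (fun z => rderA id kap z (Phi z * ((gam z)^-1 * gam' z))) xp kapd.
have h34 : \forall q \near p, [/\ chart_dom x q, rderA id Gam (x q) ((gam (x q))^-1 * gam' (x q)) &
    rderA id kap (x q) (Phi (x q) * ((gam (x q))^-1 * gam' (x q)))].
  by apply: filterS3 (chart_dom_near xp) h3 h4 => q.
apply: filterS3 h1 h2 h34 => q fq gq [xq Gq kq]; split=> //.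
have [t tP] := rder_transition (xt q) (chart_at_dom q) xq.
have h5 := rderA_change tP (rderA_pull xq Gq).
rewrite (rderA_chart_uniq (chart_at_dom q) gq h5) -scalerAr.
exact: rderA_change tP (rderA_pull xq kq).
Qed.

Lemma triple_exists p : ~ Z p -> exists F G K, primitive_triple F G K p.
Proof.
move=> Zp; have [fp gp] : ~ zero_or_pole f p /\ ~ zero_or_pole g p by apply/not_orP.
pose c := chart_at p; have cp : chart_dom c p := chart_at_dom p.
have hd (h : meromorphicA X n) : ~ zero_or_pole h p ->
    holA (c p) (fun z => (valueA e h (chart_inv c z))^-1 * value_deriv h c z).
  move=> hp; have h1 := rderA_value_inv hp.
  apply: (holAM basis_e); last exact: (holA_rder_deriv basis_e h1).
  apply: (holA_inv localA basis_e e0 em (holA_rder h1)).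
  by rewrite /= chart_invK //; exact: value_unit.
have [Phi Phid] := holA_prim basis_e (hd f fp).
have [Gam Gamd] := holA_prim basis_e (hd g gp).
have [kap kapd] := holA_prim basis_e (holAM basis_e (holA_rder Phid) (hd g gp)).
exists (Phi \o c), (Gam \o c), (kap \o c).
have E (h : meromorphicA X n) : \forall q \near p, valueA e h q = valueA e h (chart_inv c (c q)).
  by apply: filterS (chart_dom_near cp) => q cq; rewrite chart_invK.
by apply: (triple_from_coord _ cp Zp (E f) (rderA_value_inv fp) Phid (E g) (rderA_value_inv gp) Gamd kapd) => q; exact: chart_at_compatible.
Qed.

Lemma triple_shift F G K p a b c : primitive_triple F G K p ->
  primitive_triple (fun q => F q + a) (fun q => G q + b) (fun q => K q + a * G q + c) p.
Proof.
apply: filterS => q [Fq Gq Kq]; split.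
- by apply: rderA_eq (rderAD Fq (rderA_cst e _ q a)); rewrite addr0.
- by apply: rderA_eq (rderAD Gq (rderA_cst e _ q b)); rewrite addr0.
have cc : cont_at (chart_at q) q by apply/cont_atE; exact: chart_cont (chart_at_dom q).
apply: rderA_eq (rderAD (rderAD Kq (rderAMl basis_e cc a Gq)) (rderA_cst e _ q c)).
by rewrite addr0 mulrDl.
Qed.

(** F1 - F and G1 - G have derivative 0, and so has K1 - K once F1 = F. *)
Lemma triple_uniq F G K F1 G1 K1 p : primitive_triple F G K p -> primitive_triple F1 G1 K1 p ->
  F1 p = F p -> G1 p = G p -> K1 p = K p ->
  \forall q \near p, [/\ F1 q = F q, G1 q = G q & K1 q = K q].
Proof.
move=> T T1 Fp Gp Kp.
have FE : \forall q \near p, F1 q = F q.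
  have h : \forall q \near p, rderA (chart_at q) (fun q => F1 q - F q) q 0.
    by apply: filterS2 T T1 => q [Fq _ _] [F1q _ _]; apply: rderA_eq (rderAB F1q Fq); rewrite subrr.
  by apply: filterS (near_constant h) => q; rewrite Fp subrr => /subr0_eq.
have GE : \forall q \near p, G1 q = G q.
  have h : \forall q \near p, rderA (chart_at q) (fun q => G1 q - G q) q 0.
    by apply: filterS2 T T1 => q [_ Gq _] [_ G1q _]; apply: rderA_eq (rderAB G1q Gq); rewrite subrr.
  by apply: filterS (near_constant h) => q; rewrite Gp subrr => /subr0_eq.
have KE : \forall q \near p, K1 q = K q.
  have h : \forall q \near p, rderA (chart_at q) (fun q => K1 q - K q) q 0.
    by apply: filterS3 FE T T1 => q FEq [_ _ Kq] [_ _ K1q]; apply: rderA_eq (rderAB K1q Kq); rewrite FEq subrr.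
  by apply: filterS (near_constant h) => q; rewrite Kp subrr => /subr0_eq.
by apply: filterS3 FE GE KE => q -> -> ->.
Qed.

(** The derivative of exp F / f is 0. *)
Lemma triple_exp F G K p : ~ Z p -> primitive_triple F G K p -> \forall q \near p,
  expA m (F q) * (valueA e f q)^-1 = expA m (F p) * (valueA e f p)^-1 /\
  expA m (G q) * (valueA e g q)^-1 = expA m (G p) * (valueA e g p)^-1.
Proof.
move=> Zp T; have [fp gp] : ~ zero_or_pole f p /\ ~ zero_or_pole g p by apply/not_orP.
have aux (h : meromorphicA X n) (H : X -> A) : ~ zero_or_pole h p ->
    (\forall q \near p, rderA (chart_at q) H q (dlog e h q)) ->
    \forall q \near p, expA m (H q) * (valueA e h q)^-1 = expA m (H p) * (valueA e h p)^-1.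
  move=> hp Hd; apply: near_constant; apply: filterS2 Hd (regular_near hp) => q Hq hq.
  have cc : cont_at (chart_at q) q by apply/cont_atE; exact: chart_cont (chart_at_dom q).
  have h1 := rderA_expA localA basis_e e0 em cc Hq.
  have h2 := rderA_inv localA basis_e e0 em cc (value_unit hq) (rderA_value hq).
  by apply: rderA_eq (rderAM basis_e cc h1 h2); rewrite /dlog expr2; ring.
have hF : \forall q \near p, rderA (chart_at q) F q (dlog e f q) by apply: filterS T => q [].
have hG : \forall q \near p, rderA (chart_at q) G q (dlog e g q) by apply: filterS T => q [].
by apply: filterS2 (aux f F fp hF) (aux g G gp hG) => q.
Qed.

End SurfaceCalculus.

(** * Lifts along paths and squares *)

Section Lifts.
Context (R : realType) (X : riemannSurfaceType R) (A : comFalgType R[i]) (m : {pred A}).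
Context (n : nat) (e : n.+1.-tuple A).
Local Notation C := R[i].
Hypothesis localA : local_with_maximal_ideal m.
Hypothesis basis_e : basis_of {:A} e.
Hypothesis e0 : tnth e ord0 = 1.
Hypothesis em : forall i, i != ord0 -> tnth e i \in m.
Variables f g : meromorphicA X n.
Local Notation Z := (zero_or_pole f `|` zero_or_pole g).
Local Notation primitive_triple := (primitive_triple e f g).

(** A triple of functions on S which near each point is the pullback of a primitive
    triple by Th: the analytic continuation of the triple along Th, for a path as well
    as for a homotopy. *)
Definition lift (T : topologicalType) (S : set T) (Th : T -> X) (F G K : T -> A) : Prop :=
  forall z, S z -> exists F0 G0 K0, primitive_triple F0 G0 K0 (Th z) /\
    \forall w \near z, S w -> [/\ F w = F0 (Th w), G w = G0 (Th w) & K w = K0 (Th w)].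

Lemma cont_near (T T' : topologicalType) (h : T' -> T) (P : T -> Prop) t :
  {for t, continuous h} -> (\forall q \near h t, P q) -> \forall u \near t, P (h u).
Proof. by move=> hc hP; exact: hc. Qed.

Definition unit_segment : set R := [set t : R | 0 <= t <= 1].

Lemma lift_sub (T : topologicalType) (S S' : set T) Th F G K : S' `<=` S ->
  lift S Th F G K -> lift S' Th F G K.
Proof.
move=> SS L z /SS Sz; have [F0 [G0 [K0 [P h]]]] := L z Sz.
by exists F0, G0, K0; split=> //; apply: filterS h => w h /SS.
Qed.

Lemma lift_comp (T T' : topologicalType) (S : set T) (S' : set T') (h : T' -> T) Th F G K :
  (forall t, S' t -> S (h t)) -> (forall t, S' t -> {for t, continuous h}) ->
  lift S Th F G K -> lift S' (Th \o h) (F \o h) (G \o h) (K \o h).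
Proof.
move=> SS hc L t S't; have [F0 [G0 [K0 [P H]]]] := L _ (SS t S't).
exists F0, G0, K0; split=> //; have := cont_near (hc t S't) H.
by apply: filterS => u Hu /SS; exact: Hu.
Qed.

Lemma lift_shift (T : topologicalType) (S : set T) Th F G K a b c :
  lift S Th F G K ->
  lift S Th (fun q => F q + a) (fun q => G q + b) (fun q => K q + a * G q + c).
Proof.
move=> L z /L[F0 [G0 [K0 [P H]]]].
exists (fun q => F0 q + a), (fun q => G0 q + b), (fun q => K0 q + a * G0 q + c).
split; first exact: (triple_shift basis_e).
by apply: filterS H => w h /h[-> -> ->].
Qed.

Lemma lift_agree (T : topologicalType) (S : set T) Th F G K F1 G1 K1 z :
  {for z, continuous Th} -> S z -> lift S Th F G K -> lift S Th F1 G1 K1 ->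
  F1 z = F z -> G1 z = G z -> K1 z = K z ->
  \forall w \near z, S w -> [/\ F1 w = F w, G1 w = G w & K1 w = K w].
Proof.
move=> Tc Sz /(_ z Sz)[F0 [G0 [K0 [P H]]]] /(_ z Sz)[F2 [G2 [K2 [P2 H2]]]] Fz Gz Kz.
have [E1 E2 E3] := nbhs_singleton H Sz.
have [E1' E2' E3'] := nbhs_singleton H2 Sz.
have := triple_uniq basis_e P P2; rewrite -E1 -E2 -E3 -E1' -E2' -E3' => /(_ Fz Gz Kz) /(cont_near Tc) h.
by apply: filterS3 h H H2 => w [h1 h2 h3] Hw H2w Sw; case: (Hw Sw) (H2w Sw) => -> -> -> [-> -> ->].
Qed.

(** The segment is connected: the indicator function of P has derivative 0. *)
Lemma segment_ind (P : R -> Prop) :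
  (forall t : R, 0 <= t <= 1 -> \forall u \near t, 0 <= u <= 1 -> (P u <-> P t)) ->
  P 0 -> forall t, 0 <= t <= 1 -> P t.
Proof.
move=> Pl P0 t t01.
pose phi (s : R) : C := if `[< P (clamp 0 1 s) >] then 1 else 0.
have phid s : rder (real_complex R) phi s 0.
  have idd : rder (real_complex R) (fun=> phi s) s 0 by exact: rder_cst.
  apply: rder_near idd.
  have := Pl (clamp 0 1 s) (clampP s ler01) => /nearRP[d d0 dP].
  apply/nearRP; exists d => // u us.
  have /dP : `|clamp 0 1 u - clamp 0 1 s| < d by rewrite (le_lt_trans (clamp_lip _ _ ler01)).
  move=> /(_ (clampP u ler01)) PP; rewrite /phi.
  by congr (if _ then _ else _); apply/asboolP/asboolP => /PP.
have := rder0_cst 0 t phid; rewrite /phi !clamp_id ?lexx ?ler01 //.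
case: asboolP => // _; case: asboolP => // _ /eqP; by rewrite oner_eq0.
Qed.

(** Two lifts of the same path differ locally, hence globally, by a constant element of
    the Heisenberg group. *)
Lemma lift_path (Th : R -> X) F G K F1 G1 K1 : (forall t : R, 0 <= t <= 1 -> {for t, continuous Th}) ->
  lift unit_segment Th F G K -> lift unit_segment Th F1 G1 K1 ->
  forall t, 0 <= t <= 1 -> [/\ F1 t = F t + (F1 0 - F 0), G1 t = G t + (G1 0 - G 0) &
    K1 t = K t + (F1 0 - F 0) * G t + (K1 0 - K 0 - (F1 0 - F 0) * G 0)].
Proof.
move=> Tc L L1; set a := F1 0 - F 0; set b := G1 0 - G 0; set c := K1 0 - K 0 - _.
have L2 := lift_shift a b c L.
apply: segment_ind; last first.
  by rewrite /c /a /b; split; rewrite addrC ?subrK //; ring.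
move=> t t01; pose a' := F1 t - (F t + a); pose b' := G1 t - (G t + b).
pose c' := K1 t - (K t + a * G t + c) - a' * (G t + b).
have L3 := lift_shift a' b' c' L2.
have := lift_agree (Tc t t01) t01 L3 L1; rewrite /a' /b' /c' /=.
have E1 : F1 t = F t + a + (F1 t - (F t + a)) by rewrite addrC subrK.
have E2 : G1 t = G t + b + (G1 t - (G t + b)) by rewrite addrC subrK.
have E3 : K1 t = K t + a * G t + c + (F1 t - (F t + a)) * (G t + b) +
  (K1 t - (K t + a * G t + c) - (F1 t - (F t + a)) * (G t + b)) by ring.
move=> /(_ E1 E2 E3); apply: filterS => u H u01; have {H} [] := H u01.
rewrite -/a' -/b' => Fu Gu Ku; split=> [] [h1 h2 h3].
  have a0 : a' = 0 by move: Fu; rewrite h1 => /esym/eqP; rewrite -subr_eq0 addrAC subrr add0r => /eqP.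
  have b0 : b' = 0 by move: Gu; rewrite h2 => /esym/eqP; rewrite -subr_eq0 addrAC subrr add0r => /eqP.
  move: Ku; rewrite h3 a0 !mul0r addr0 subr0 => /esym/eqP.
  rewrite -subr_eq0 addrAC subrr add0r => /eqP c0.
  by split; apply/subr0_eq.
have a0 : a' = 0 by rewrite /a' h1 subrr.
have b0 : b' = 0 by rewrite /b' h2 subrr.
by rewrite Fu Gu Ku a0 b0 h3 !mul0r !addr0 subrr subr0 addr0.
Qed.

Section Plane.
Variable Th : C -> X.
Hypothesis Thc : forall z, {for z, continuous Th}.
Hypothesis ThZ : forall z, ~ Z (Th z).

(** The lifts on two pieces meeting along a path can be shifted so as to agree on that
    path. *)
Lemma lift_glue (S1 S2 : set C) (gam : R -> C) F1 G1 K1 F2 G2 K2 :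
  (forall z, ~ S1 z -> \forall w \near z, ~ S1 w) ->
  (forall z, ~ S2 z -> \forall w \near z, ~ S2 w) ->
  (forall t, {for t, continuous gam}) ->
  (forall t, 0 <= t <= 1 -> S1 (gam t) /\ S2 (gam t)) ->
  (forall z, S1 z -> S2 z -> exists2 t, 0 <= t <= 1 & z = gam t) ->
  lift S1 Th F1 G1 K1 -> lift S2 Th F2 G2 K2 ->
  exists F G K, lift (S1 `|` S2) Th F G K.
Proof.
move=> S1c S2c gc gS gE L1 L2.
have Tgc t : 0 <= t <= 1 -> {for t, continuous (Th \o gam)}.
  by move=> _; apply: continuous_comp; [exact: gc|exact: Thc].
have M1 : lift unit_segment (Th \o gam) (F1 \o gam) (G1 \o gam) (K1 \o gam).
  by apply: lift_comp L1 => t; [move=> /gS[]|move=> _; exact: gc].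
have M2 : lift unit_segment (Th \o gam) (F2 \o gam) (G2 \o gam) (K2 \o gam).
  by apply: lift_comp L2 => t; [move=> /gS[]|move=> _; exact: gc].
have E := lift_path Tgc M2 M1.
set a := (F1 \o gam) 0 - _ in E; set b := (G1 \o gam) 0 - _ in E.
set c := (K1 \o gam) 0 - _ - _ in E.
have {}L2 := lift_shift a b c L2.
set F3 := (fun q => F2 q + a) in L2; set G3 := (fun q => G2 q + b) in L2.
set K3 := (fun q => K2 q + a * G2 q + c) in L2.
have {}E z : S1 z -> S2 z -> [/\ F1 z = F3 z, G1 z = G3 z & K1 z = K3 z].
  by move=> S1z S2z; have [t t01 ->] := gE z S1z S2z; exact: E.
exists (fun z => if `[< S1 z >] then F1 z else F3 z).
exists (fun z => if `[< S1 z >] then G1 z else G3 z).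
exists (fun z => if `[< S1 z >] then K1 z else K3 z).
move=> z Sz; have [S1z|nS1z] := pselect (S1 z).
  have [F0 [G0 [K0 [P H]]]] := L1 z S1z; exists F0, G0, K0; split=> //.
  have [S2z|nS2z] := pselect (S2 z); last first.
    apply: filterS2 H (S2c z nS2z) => w Hw nS2w [S1w|//].
    by case: asboolP => // _; exact: Hw.
  have [F4 [G4 [K4 [P4 H4]]]] := L2 z S2z.
  have [E1 E2 E3] := nbhs_singleton H S1z; have [E1' E2' E3'] := nbhs_singleton H4 S2z.
  have [Fz Gz Kz] := E z S1z S2z.
  have := triple_uniq basis_e P P4; rewrite -E1 -E2 -E3 -E1' -E2' -E3' => /(_ (esym Fz) (esym Gz) (esym Kz)).
  move=> /(cont_near (@Thc z)) h; apply: filterS3 H H4 h => w Hw H4w [h1 h2 h3] Sw.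
  case: asboolP => [S1w|nS1w]; first exact: Hw.
  by case: Sw => // S2w; have [-> -> ->] := H4w S2w.
have S2z : S2 z by case: Sz.
have [F0 [G0 [K0 [P H]]]] := L2 z S2z; exists F0, G0, K0; split=> //.
apply: filterS2 H (S1c z nS1z) => w Hw nS1w [//|S2w].
by case: asboolP => // _; exact: Hw.
Qed.

Definition rect (a b c d : R) : set C :=
  [set z | a <= complex.Re z <= b /\ c <= complex.Im z <= d].

Lemma rect_closed a b c d z : ~ rect a b c d z -> \forall w \near z, ~ rect a b c d w.
Proof.
move=> nz.
have aux (r : R) (P : C -> Prop) : 0 < r -> (forall w, cmod (w - z) < r -> P w) -> \forall w \near z, P w.
  by move=> r0 rP; apply/nearCP; exists r.
have RI w : `|complex.Re w - complex.Re z| <= cmod (w - z) /\ `|complex.Im w - complex.Im z| <= cmod (w - z).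
  by split; [have := Re_le_cmod (w - z)|have := Im_le_cmod (w - z)]; rewrite !ReE.
have [h1|h1] := ltP (complex.Re z) a.
  apply: (aux (a - complex.Re z)) => [|w wz [/andP[h _] _]]; first by rewrite subr_gt0.
  by case: (RI w) => + _; rewrite ler_norml => /andP[_]; lra.
have [h2|h2] := ltP b (complex.Re z).
  apply: (aux (complex.Re z - b)) => [|w wz [/andP[_ h] _]]; first by rewrite subr_gt0.
  by case: (RI w) => + _; rewrite ler_norml => /andP[]; lra.
have [h3|h3] := ltP (complex.Im z) c.
  apply: (aux (c - complex.Im z)) => [|w wz [_ /andP[h _]]]; first by rewrite subr_gt0.
  by case: (RI w) => _; rewrite ler_norml => /andP[_]; lra.
have [h4|h4] := ltP d (complex.Im z).
  apply: (aux (complex.Im z - d)) => [|w wz [_ /andP[_ h]]]; first by rewrite subr_gt0.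
  by case: (RI w) => _; rewrite ler_norml => /andP[]; lra.
by case: nz; split; apply/andP.
Qed.

Definition liftable (S : set C) : Prop := exists F G K, lift S Th F G K.

Lemma affine_cont (z w : C) (t : R) : {for t, continuous (fun t : R => z + t%:C * w)}.
Proof.
apply/cont_atE => eps eps0; apply/nearRP; exists (eps / (cmod w + 1)).
  by rewrite divr_gt0 // ltr_wpDl ?cmod_ge0.
move=> u ut; rewrite opprD addrACA subrr add0r -mulrBl -rmorphB cmodM cmod_real.
have w1 : 0 < cmod w + 1 by rewrite ltr_wpDl ?cmod_ge0.
move: ut; rewrite ltr_pdivlMr // => ut; rewrite (le_trans _ (ltW ut)) // ler_wpM2l //.
by rewrite lerDl.
Qed.

Lemma liftable_h (a p b c d : R) : a <= p -> p <= b -> c <= d ->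
  liftable (rect a p c d) -> liftable (rect p b c d) -> liftable (rect a b c d).
Proof.
move=> ap pb cd [F1 [G1 [K1 L1]]] [F2 [G2 [K2 L2]]].
have gE t : (p +i* c : C) + t%:C * (0 +i* (d - c)) = p +i* (c + t * (d - c)).
  by apply: complex_ext; rewrite !ReE /=; ring.
have [|||||F [G [K L]]] := @lift_glue (rect a p c d) (rect p b c d)
    (fun t : R => (p +i* c : C) + t%:C * (0 +i* (d - c))) _ _ _ _ _ _ _ _ _ _ _ L1 L2.
- exact: rect_closed.
- exact: rect_closed.
- by move=> t; exact: affine_cont.
- move=> t /andP[t0 t1]; rewrite gE; split; split => /=; apply/andP; split => //; nra.
- move=> z [/andP[_ z1] /andP[z3 z4]] [/andP[z5 _] _].
  have [cd'|cd'] := eqVneq c d.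
    exists 0; rewrite ?lexx ?ler01 // gE; apply: complex_ext => /=; lra.
  have dc0 : 0 < d - c by rewrite subr_gt0 lt_neqAle cd'.
  exists ((complex.Im z - c) / (d - c)).
    by rewrite divr_ge0 ?subr_ge0 ?(ltW dc0) //= ler_pdivrMr // mul1r lerD2r.
  by rewrite gE divfK ?gt_eqF //; apply: complex_ext => /=; lra.
exists F, G, K; apply: lift_sub L => z [/andP[z1 z2] z3] /=.
by have [h|/ltW h] := leP (complex.Re z) p; [left|right]; split=> //; apply/andP.
Qed.

Lemma liftable_v (a b c p d : R) : a <= b -> c <= p -> p <= d ->
  liftable (rect a b c p) -> liftable (rect a b p d) -> liftable (rect a b c d).
Proof.
move=> ab cp pd [F1 [G1 [K1 L1]]] [F2 [G2 [K2 L2]]].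
have gE t : (a +i* p : C) + t%:C * ((b - a) +i* 0) = (a + t * (b - a)) +i* p.
  by apply: complex_ext; rewrite !ReE /=; ring.
have [|||||F [G [K L]]] := @lift_glue (rect a b c p) (rect a b p d)
    (fun t : R => (a +i* p : C) + t%:C * ((b - a) +i* 0)) _ _ _ _ _ _ _ _ _ _ _ L1 L2.
- exact: rect_closed.
- exact: rect_closed.
- by move=> t; exact: affine_cont.
- move=> t /andP[t0 t1]; rewrite gE; split; split => /=; apply/andP; split => //; nra.
- move=> z [/andP[z1 z2] /andP[_ z3]] [_ /andP[z4 _]].
  have [ab'|ab'] := eqVneq a b.
    exists 0; rewrite ?lexx ?ler01 // gE; apply: complex_ext => /=; lra.
  have dc0 : 0 < b - a by rewrite subr_gt0 lt_neqAle ab'.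
  exists ((complex.Re z - a) / (b - a)).
    by rewrite divr_ge0 ?subr_ge0 ?(ltW dc0) //= ler_pdivrMr // mul1r lerD2r.
  by rewrite gE divfK ?gt_eqF //; apply: complex_ext => /=; lra.
exists F, G, K; apply: lift_sub L => z [z3 /andP[z1 z2]] /=.
by have [h|/ltW h] := leP (complex.Im z) p; [left|right]; split=> //; apply/andP.
Qed.

(** Small rectangles are mapped into the domain of one primitive triple, and lifts glue. *)
Lemma square_lift : liftable (rect 0 1 0 1).
Proof.
apply: (@quartering _ (fun a b c d => liftable (rect a b c d))); [exact: ler01|exact: ler01| |].
  move=> a b c d _ ab _ _ cd _ p q H1 H2 H3 H4.
  have [p1 p2] : a <= p /\ p <= b by rewrite /p; lra.
  have [q1 q2] : c <= q /\ q <= d by rewrite /q; lra.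
  by apply: (liftable_v (p := q)) => //; apply: (liftable_h (p := p)).
move=> x y _ _.
have [F0 [G0 [K0 P]]] := triple_exists localA basis_e e0 em (@ThZ (x +i* y)).
have /nearCP[r r0 rP] := cont_near (@Thc (x +i* y)) (near_join P).
exists (r / 2); first by rewrite divr_gt0.
move=> a b c d _ /andP[ax xb] _ _ /andP[cy yd] _ bar dcr.
exists (F0 \o Th), (G0 \o Th), (K0 \o Th) => z [/andP[z1 z2] /andP[z3 z4]].
exists F0, G0, K0; split; last by near=> w.
apply: rP; rewrite (le_lt_trans (cmod_le_ReIm _)) // !ReE /=.
suff h : `|complex.Re z - x| <= b - a /\ `|complex.Im z - y| <= d - c by lra.
by split; rewrite ler_norml; apply/andP; split; lra.
Unshelve. all: by end_near. Qed.

End Plane.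

End Lifts.

(** * The explicit lift near s *)

Section NearS.
Context (R : realType) (X : riemannSurfaceType R) (A : comFalgType R[i]) (m : {pred A}).
Context (n : nat) (e : n.+1.-tuple A).
Local Notation C := R[i].
Hypothesis localA : local_with_maximal_ideal m.
Hypothesis basis_e : basis_of {:A} e.
Hypothesis e0 : tnth e ord0 = 1.
Hypothesis em : forall i, i != ord0 -> tnth e i \in m.
Local Notation rderA := (rderA e).
Local Notation divA := (divA e).
Local Notation cid := (@cont_at_id R _).

Lemma near_punctured_chart (x : chart R X) s (P : X -> Prop) : chart_dom x s -> x s = 0 ->
  (\forall p \near s^', P p) -> \forall z \near (0 : C)^',
    [/\ chart_dom x (chart_inv x z), x (chart_inv x z) = z & P (chart_inv x z)].
Proof.
move=> xs x0 sP.
have h1 := chart_im_near xs.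
have h2 : \forall z \near x s, chart_inv x z != s -> P (chart_inv x z).
  by apply: (near_chart_inv (P := fun q => q != s -> P q) xs).
rewrite x0 in h1 h2.
apply: filterS3 (near_punctured h1) (near_punctured h2) (@punctured_neq0 R) => z [xz zz] Pz z0.
split=> //; apply: Pz; apply: contra_neq z0 => zs; by rewrite -zz zs x0.
Qed.

(** Read in the coordinate x, f is holomorphic off 0, as local_form requires. *)
Lemma expansion_local_form (f : meromorphicA X n) (s : X) (x : chart R X) nu N a :
  uniformizer s x -> product_expansion e m s x f nu N a ->
  exists U U' : C -> A,
  [/\ U 0 = 0, \forall z \near (0 : C), rderA id U z (U' z),
      \forall z \near (0 : C)^',
        valueA e f (chart_inv x z) = z ^ nu *: (a 0 * expA m (neg_log N a z + U z)) &
      forall K, exists M0 : nat, forall M I, (M0 <= M)%N -> (K <= I)%N ->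
        divA K (fun z => U' z + power_tail a (iota 1 M) I z)].
Proof.
move=> [xs x0 xt xt'] [a0U am _ [c fc cP]].
apply: (local_form localA basis_e e0 em _ cP a0U am) => [i|].
  have [N1 N10 N1P] := fc i; exists N1 => //.
  apply: filterS (near_punctured_chart xs x0 N1P) => z [_ zz].
  by rewrite zz (coord_value basis_e).
have np i : \forall q \near s^', ~ poles (f i) q.
  have [ps|ps] := pselect (poles (f i) s); first exact: poles_isolated.
  apply: nbhs_dnbhs; apply: open_nbhs_nbhs; split=> //.
  by apply: closed_openC; exact: poles_closed.
have npA : \forall q \near s^', forall i, ~ poles (f i) q.
  exact: (@filter_forall _ _ (fun i q => ~ poles (f i) q) _ _ np).
have h1 := near_punctured_chart xs x0 npA.
have h2 : \forall z \near (0 : C)^', \forall w \near z, chart_dom x (chart_inv x w) /\ x (chart_inv x w) = w.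
  by apply: punctured_join; apply: filterS h1 => z [].
apply: filterS2 h1 h2 => z [xz zz pz] zw; set q := chart_inv x z.
have [t tP] := rder_transition (xt q) xz (chart_at_dom q).
have h i : exists d, rder id (fun w => f i (chart_inv x w)) z d.
  have qh := nbhs_singleton (mero_holomorphic (pz i)).
  have hd := derivable_rder qh.
  have hx : rder x (f i) q (t * derive1 (f i \o chart_inv (chart_at q)) (chart_at q q)).
    have E : \forall w \near q, f i (chart_inv (chart_at q) (chart_at q w)) = f i w.
      by apply: filterS (chart_dom_near (chart_at_dom q)) => w wq; rewrite chart_invK.
    have tP' : rder x (id \o chart_at q) q t by exact: tP.
    have hc := rder_comp (chart_cont (chart_at_dom q)) tP' hd.
    exact: rder_near E hc.
  exists (1 * (t * derive1 (f i \o chart_inv (chart_at q)) (chart_at q q))).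
  have ic : {for z, continuous (chart_inv x)} by rewrite -zz; exact: chart_inv_cont.
  have idd : rder (id : C -> C) id z 1 by exact: rder_id.
  have id2 : rder id (x \o chart_inv x) z 1.
    by apply: rder_near idd; apply: filterS zw => w [_ E] /=; rewrite E.
  exact: rder_comp ic id2 hx.
have [d dP] := choice h; exists (\sum_i d i *: tnth e i) => i.
rewrite (coord_comb basis_e); apply: rder_ext (dP i) => w.
by rewrite (coord_value basis_e).
Qed.

(** The derivative of the explicit K of lift_near_s is F times that of G; here l stands
    for the logarithm, zi for 1 / z, v' for the derivative of v, and the second bracket
    for the derivative of the remaining term. *)
Lemma triple_identity (cn cm l zi : C) (u v v' r : A) :
  (cn * cm / 2 * (zi * l + l * zi)) *: 1 + ((cn * zi) *: v + (cn * l) *: v') + zi *: r +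
    (u * v' + zi *: (cm *: u - cn *: v) - zi *: r) =
  ((cn * l)%:A + u) * ((cm * zi)%:A + v').
Proof.
have [al alM alS] : exists2 al : C -> A, forall c d, al (c * d) = al c * al d &
    forall c y, c *: y = al c * y.
  exists (fun c => c%:A) => [c d|c y]; last by rewrite mulr_algl.
  by rewrite mulr_algl scalerA.
have -> : cn * cm / 2 * (zi * l + l * zi) = cn * cm * (l * zi) by field.
by rewrite !alS !alM; ring.
Qed.

Section TwoFunctions.
Variables f g : meromorphicA X n.
Variables (s : X) (x : chart R X) (nu mu : int) (N N' : nat) (a b : int -> A).
Hypothesis x_unif : uniformizer s x.
Hypothesis f_exp : product_expansion e m s x f nu N a.
Hypothesis g_exp : product_expansion e m s x g mu N' b.
Local Notation Z := (zero_or_pole f `|` zero_or_pole g).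

(** With f = x^nu a_0 exp U and g = x^mu b_0 exp V near s, and ell a logarithm of x
    along the path, the primitives are F = nu ell + U and G = mu ell + V. Integrating F
    dG by parts leaves, besides explicit terms, the form U V' + (mu U - nu V) / x, which
    is single valued near s; by local_residue it is exact up to the residue, which
    becomes the coefficient of ell in K. *)
Lemma lift_near_s (M1 : nat) : exists (M : nat) (U V Y : C -> A) (delta : R),
  [/\ (M1 <= M)%N, 0 < delta,
    forall p, chart_dom x p -> x p != 0 -> cmod (x p) < delta ->
      valueA e f p = x p ^ nu *: (a 0 * expA m (U (x p))) /\
      valueA e g p = x p ^ mu *: (b 0 * expA m (V (x p))) &
    forall (p : R -> X) (ell : R -> C),
      (forall t : R, {for t, continuous p}) -> (forall t : R, cont_at ell t) ->
      (forall t : R, 0 <= t <= 1 -> [/\ chart_dom x (p t), ~ Z (p t), expC (ell t) = x (p t) &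
          cmod (x (p t)) < delta]) ->
      lift e f g (@unit_segment R) p
        (fun t => (nu%:~R * ell t)%:A + U (x (p t)))
        (fun t => (mu%:~R * ell t)%:A + V (x (p t)))
        (fun t => (nu%:~R * mu%:~R / 2 * ell t ^+ 2)%:A + (nu%:~R * ell t) *: V (x (p t)) +
           ell t *: (pair_log N' M b a - pair_log N M a b) + Y (x (p t)))].
Proof.
have dd (d : R) : 0 < d -> d / 4 + d / 4 < d by lra.
have [U [U' [U0 Ud UE UP]]] := expansion_local_form x_unif f_exp.
have [V [V' [V0 Vd VE VP]]] := expansion_local_form x_unif g_exp.
case: (f_exp) => a0U am _ _; case: (g_exp) => b0U bm _ _; case: (x_unif) => xs x0 _ xt'.
have [M0 M0P] := local_residue localA basis_e N N' nu%:~R mu%:~R am bm U0 V0 Ud Vd UP VP.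
have [Y Yd] := M0P (M0 + M1)%N (leq_addr _ _).
set rho := _ - _ in Yd.
pose Ut z := neg_log N a z + U z; pose Ut' z := neg_log_deriv N a z + U' z.
pose Vt z := neg_log N' b z + V z; pose Vt' z := neg_log_deriv N' b z + V' z.
have Utd : \forall z \near (0 : C)^', rderA id Ut z (Ut' z).
  apply: filterS2 (near_punctured Ud) (@punctured_neq0 R) => z Uz z0.
  exact: rderAD (rderA_neg_log e N a z0) Uz.
have Vtd : \forall z \near (0 : C)^', rderA id Vt z (Vt' z).
  apply: filterS2 (near_punctured Vd) (@punctured_neq0 R) => z Vz z0.
  exact: rderAD (rderA_neg_log e N' b z0) Vz.
have ALL : \forall z \near (0 : C)^', [/\ rderA id Ut z (Ut' z), rderA id Vt z (Vt' z),
    rderA id Y z (Ut z * Vt' z + z^-1 *: (mu%:~R *: Ut z - nu%:~R *: Vt z) - z^-1 *: rho),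
    valueA e f (chart_inv x z) = z ^ nu *: (a 0 * expA m (Ut z)) &
    valueA e g (chart_inv x z) = z ^ mu *: (b 0 * expA m (Vt z))].
  by apply: filterS3 (filterI Utd Vtd) (filterI UE VE) Yd => z [? ?] [? ?] ?.
have := punctured_join ALL => /near_puncturedCP[delta delta0 deltaP].
exists (M0 + M1)%N, Ut, Vt, Y, delta; split=> //; first exact: leq_addl.
  move=> p xp xp0 xpd; have := deltaP (x p); rewrite subr0 => /(_ xpd xp0) /nbhs_singleton[_ _ _].
  by rewrite !chart_invK.
move=> p ell pc ellc pP t t01; have [xp Zp expl xd] := pP t t01.
set z0 := x (p t) in expl xd; have z00 : z0 != 0 by rewrite -expl expC_neq0.
have [L [Lz0 Lexp Ld]] := log_ex expl.
have near0 : \forall z \near z0, [/\ rderA id Ut z (Ut' z), rderA id Vt z (Vt' z),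
    rderA id Y z (Ut z * Vt' z + z^-1 *: (mu%:~R *: Ut z - nu%:~R *: Vt z) - z^-1 *: rho),
    valueA e f (chart_inv x z) = z ^ nu *: (a 0 * expA m (Ut z)) &
    valueA e g (chart_inv x z) = z ^ mu *: (b 0 * expA m (Vt z))].
  by apply: deltaP; rewrite ?subr0.
have nz0 := cont_near_neq0 (cont_at_id z0) z00.
pose Phi z := (nu%:~R * L z)%:A + Ut z; pose Gam z := (mu%:~R * L z)%:A + Vt z.
pose kap z := (nu%:~R * mu%:~R / 2 * L z ^+ 2)%:A + (nu%:~R * L z) *: Vt z + L z *: rho + Y z.
have gen (h : meromorphicA X n) (W W' : C -> A) (k : int) (c0 : A) : c0 \is a GRing.unit ->
    (\forall z \near z0, [/\ rderA id W z (W' z), rder id L z z^-1, z != 0 &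
      valueA e h (chart_inv x z) = z ^ k *: (c0 * expA m (W z))]) ->
    exists phi phi' : C -> A, [/\ \forall q \near p t, valueA e h q = phi (x q),
      \forall z \near z0, rderA id phi z (phi' z),
      \forall z \near z0, (phi z)^-1 * phi' z = (k%:~R * z^-1)%:A + W' z &
      \forall z \near z0, rderA id (fun z => (k%:~R * L z)%:A + W z) z ((phi z)^-1 * phi' z)].
  move=> c0U WP; pose phi z := z ^ k *: (c0 * expA m (W z)).
  pose phi' z := phi z * ((k%:~R * z^-1)%:A + W' z).
  have phiU z : z != 0 -> phi z \is a GRing.unit.
    move=> zn0; rewrite /phi -mulr_algl unitrM unitrM c0U (expA_unit localA basis_e e0 em).
    rewrite !andbT; apply/unitrPr; exists (z ^ (- k))%:A.
    by rewrite mulr_algl scalerA -expfzDr // subrr scale1r.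
  have phiE : \forall z \near z0, (phi z)^-1 * phi' z = (k%:~R * z^-1)%:A + W' z.
    by apply: filterS WP => z [_ _ zn0 _]; rewrite /phi' mulrA mulVr ?phiU // mul1r.
  exists phi, phi'; split=> //.
  - have := near_chart xp WP; apply: filterS2 (chart_dom_near xp) => q xq [_ _ _].
    by rewrite chart_invK.
  - apply: filterS WP => z [Wz _ zn0 _].
    have h1 := rderAMl basis_e cid c0 (rderA_expA localA basis_e e0 em cid Wz).
    apply: rderA_eq (rderAZ basis_e cid (rder_exprz k zn0) h1).
    rewrite /phi' /phi mulrDr; congr (_ + _).
      rewrite mulr_algr scalerA; congr (_ *: _).
      by rewrite expfzDr // exprN1; ring.
    by rewrite -scalerAl; congr (_ *: _); ring.
  - apply: filterS2 WP phiE => z [Wz Lz _ _] ->; apply: rderAD => //.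
    have := rderA_scale e (1 : A) (rderZ k%:~R Lz); exact.
have [|phi [phi' [fE phid phiE Phid]]] := gen f Ut Ut' nu (a 0) a0U.
  by apply: filterS3 near0 nz0 Ld => z [? ? ? ? ?] ? ?.
have [|gam [gam' [gE gamd gamE Gamd]]] := gen g Vt Vt' mu (b 0) b0U.
  by apply: filterS3 near0 nz0 Ld => z [? ? ? ? ?] ? ?.
have kapd : \forall z \near z0, rderA id kap z (Phi z * ((gam z)^-1 * gam' z)).
  near=> z.
  have -> : (gam z)^-1 * gam' z = (mu%:~R * z^-1)%:A + Vt' z by near: z.
  have Lz : rder id L z z^-1 by near: z.
  have [Uz Vz Yz _ _] : [/\ rderA id Ut z (Ut' z), rderA id Vt z (Vt' z),
    rderA id Y z (Ut z * Vt' z + z^-1 *: (mu%:~R *: Ut z - nu%:~R *: Vt z) - z^-1 *: rho),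
    valueA e f (chart_inv x z) = z ^ nu *: (a 0 * expA m (Ut z)) &
    valueA e g (chart_inv x z) = z ^ mu *: (b 0 * expA m (Vt z))] by near: z.
  have L2 := rderM cid Lz Lz.
  have k1 := rderA_scale e (1 : A) (rderZ (nu%:~R * mu%:~R / 2) L2).
  have k2 := rderAZ basis_e cid (rderZ nu%:~R Lz) Vz.
  have k3 := rderA_scale e rho Lz.
  apply: rderA_eq (rderAD (rderAD (rderAD k1 k2) k3) Yz).
  exact: triple_identity.
have P := triple_from_coord basis_e xt' xp Zp fE phid Phid gE gamd Gamd kapd.
exists (Phi \o x), (Gam \o x), (kap \o x); split; first exact: P.
suff ellE : \forall u \near t, 0 <= u <= 1 -> ell u = L (x (p u)).
  by apply: filterS ellE => u uE /uE E; rewrite /Phi /Gam /kap /= -E.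
have xpc : cont_at (x \o p) t.
  by apply/cont_atE; apply: continuous_comp; [exact: pc|exact: chart_cont].
have Lc : cont_at (L \o (x \o p)) t.
  apply/cont_atE; apply: continuous_comp; first by apply/cont_atE.
  have Lc0 := rder_cont (cont_at_id z0) (nbhs_singleton Ld).
  by apply/cont_atE; exact: Lc0.
(* Both ell and L o x o p are continuous logarithms of x o p with the same value at t, and two
   logarithms of one number that are close to each other are equal. *)
have [d d0 dP] := (nearCP _ _).1 (@expC_eq1_near0 R).
have d40 : 0 < d / 4 by rewrite divr_gt0.
have Lexp' : \forall u \near t, expC (L (x (p u))) = x (p u).
  by apply: (cont_near (h := x \o p) (P := fun z => expC (L z) = z)) Lexp; apply/cont_atE.
apply: filterS3 (ellc t _ d40) (Lc _ d40) Lexp' => u h1 h2 h3 u01.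
apply/subr0_eq; apply: dP; last first.
  have [_ _ eu _] := pP u u01.
  by apply: (mulIf (expC_neq0 (L (x (p u))))); rewrite -expCD subrK mul1r eu h3.
rewrite subr0; have -> : ell u - L (x (p u)) = (ell u - ell t) - (L (x (p u)) - L z0) by rewrite Lz0; ring.
rewrite (le_lt_trans (cmodD _ _)) // cmodN; move: h1 h2 => /= h1 h2.
exact: le_lt_trans (lerD h1 h2) (dd _ d0).
Unshelve. all: by end_near. Qed.

End TwoFunctions.

End NearS.

(** * Integration off finitely many points and over the simplex *)

Section RealIntegrals.
Context (R : realType).
Local Notation mu := (@lebesgue_measure R).
Local Notation mu2 := (@lebesgue_measure R \x @lebesgue_measure R)%E.
Local Notation I01 := (`[0, 1]%classic : set R).
Variable S : seq R.

(** S is the finite set of the points where the path may fail to be differentiable. *)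
Definition bounded_piecewise (alpha : R -> R) : Prop :=
  (forall t, 0 < t < 1 -> t \notin S -> {for t, continuous alpha}) /\
  exists K : R, forall t, 0 <= t <= 1 -> `|alpha t| <= K.

Definition primitive_off (F alpha : R -> R) : Prop :=
  (forall t, {for t, continuous F}) /\
  (forall t, 0 < t < 1 -> t \notin S -> is_derive t (1 : R) F (alpha t)).

Lemma near_avoid (t0 : R) : exists2 d : R, 0 < d & forall u, `|u - t0| < d -> u != t0 -> u \notin S.
Proof.
elim: S => [|a s [d d0 dP]]; first by exists 1.
have [at0|at0] := eqVneq a t0.
  by exists d => // u ud ut; rewrite inE negb_or at0 ut dP.
have m0 : 0 < `|a - t0| by rewrite normr_gt0 subr_eq0.
exists (Num.min d `|a - t0|); first by rewrite lt_min d0.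
move=> u; rewrite lt_min => /andP[ud ua] ut; rewrite inE negb_or dP // andbT.
by apply: contraTneq ua => ->; rewrite ltxx.
Qed.

(** The mean value theorem applies on both sides of a point t, up to its neighbours in
    S. *)
Lemma cst_off (D : R -> R) : primitive_off D (fun=> 0) -> forall t, 0 <= t <= 1 -> D t = D 0.
Proof.
move=> [Dc Dd]; apply: (@segment_ind R (fun t => D t = D 0)) => // t t01.
have [d d0 dP] := near_avoid t; apply/nearRP; exists d => // u ud u01.
suff -> : D u = D t by [].
have Dw a b : {within `[a, b], continuous D} by apply: continuous_in_subspaceT => v _; exact: Dc.
have [ut|ut] := eqVneq u t; first by rewrite ut.
have mvt a b : a < b -> 0 <= a -> b <= 1 -> (forall v, a < v < b -> v \notin S) -> D b = D a.
  move=> ab a0 b1 av.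
  have [v|c cab /eqP] := @MVT R D (fun=> 0) a b ab _ (Dw a b).
    rewrite in_itv /= => /andP[v1 v2]; apply: Dd; last by apply: av; rewrite v1.
    by rewrite (le_lt_trans a0 v1) (lt_le_trans v2 b1).
  by rewrite mul0r subr_eq0 => /eqP.
move: t01 u01 ud => /andP[t0 t1] /andP[u0 u1] ud.
have [ltut|ltut] := ltP u t.
  symmetry; apply: mvt => // v /andP[v1 v2]; apply: dP; last by rewrite lt_eqF.
  by move: ud; rewrite !ltr_norml => /andP[]; lra.
have {}ltut : t < u by rewrite lt_neqAle eq_sym ut.
apply: mvt => // v /andP[v1 v2]; apply: dP; last by rewrite gt_eqF.
by move: ud; rewrite !ltr_norml => /andP[]; lra.
Qed.

(** A function is measurable on a single point, so finitely many points may be added. *)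
Lemma measurable_off (D : set R) (alpha : R -> R) (s : seq R) : measurable D ->
  measurable_fun (D `\` [set` s]) alpha -> measurable_fun D alpha.
Proof.
elim: s D => [|a s IH] D mD.
  by rewrite (_ : [set` [::]] = set0) ?setD0 //; apply/seteqP; split.
move=> h.
have m1 : measurable (D `\ a) by apply: measurableD.
have h1 : measurable_fun (D `\ a) alpha.
  apply: IH => //; rewrite (_ : D `\ a `\` [set` s] = D `\` [set` a :: s]) //.
  apply/seteqP; split => x /= => [[[Dx xa] xs]|[Dx]].
    by split=> //; rewrite inE => /orP[/eqP|].
  by rewrite inE => /negP; rewrite negb_or => /andP[/eqP xa /negP xs].
have -> : D = (D `\ a) `|` (D `&` [set a]).
  apply/seteqP; split=> [x Dx|x [[]|[]] //].
  have [xa|xa] := eqVneq x a; first by right; split=> //; exact: xa.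
  by left; split=> //; apply/eqP.
apply/measurable_funU => //; first exact: measurableI.
split=> //; apply: (@measurable_funS _ _ _ _ [set a]); [exact: measurable_set1|exact: subIsetr|].
exact: measurable_fun_set1.
Qed.

Lemma measurable_piecewise (alpha : R -> R) : bounded_piecewise alpha -> measurable_fun I01 alpha.
Proof.
move=> [ac _]; apply: (@measurable_off _ _ [:: 0, 1 & S]) => //.
apply: subspace_continuous_measurable_fun.
  apply: measurableD => //; apply: countable_measurable; first exact: measurable_set1.
  by apply: finite_set_countable; exact: finite_seq.
apply: continuous_in_subspaceT => t; rewrite inE /= in_itv /= !inE => -[/andP[t0 t1]].
move=> /negP; rewrite !negb_or => /and3P[tn0 tn1 tS]; apply: ac => //.
by rewrite !lt_neqAle t0 t1 tn1 eq_sym tn0.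
Qed.

Lemma integrable_piecewise (alpha : R -> R) (D : set R) : measurable D -> D `<=` I01 ->
  bounded_piecewise alpha -> mu.-integrable D (EFin \o alpha).
Proof.
move=> mD DI ab; apply: (@integrableS _ _ _ mu I01) => //.
apply: measurable_bounded_integrable => //.
- by rewrite /= lebesgue_measure_itv /= lte_fin ltr01 oppr0 adde0 ltry.
- exact: measurable_piecewise.
case: ab => _ [K KP]; exists K; split; first exact: num_real.
by move=> x Kx t /= /KP h; rewrite (le_trans h) // ltW.
Qed.

(** Clamping makes the antiderivative continuous on the whole line. *)
Definition antider (alpha : R -> R) (t : R) : R :=
  (\int[mu]_(u in `[0, clamp 0 1 t]) alpha u)%R.

Lemma within_comp (T T' U : topologicalType) (D : set T) (f : T -> U) (h : T' -> T) t :
  {within D, continuous f} -> (forall v, D (h v)) -> {for t, continuous h} ->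
  {for t, continuous (f \o h)}.
Proof.
move=> /subspace_continuousP fc Dh hc P /(fc _ (Dh t)) hP.
have : \forall u \near h t, D u -> P (f u) by exact: hP.
by move=> hq; have := cont_near hc hq; apply: filterS => v; exact.
Qed.

Lemma clamp_cont t : {for t, continuous (clamp 0 1 : R -> R)}.
Proof.
move=> P /= /nearRP[d d0 dP]; apply/nearRP; exists d => // u ut; apply: dP.
by rewrite (le_lt_trans (clamp_lip _ _ ler01)).
Qed.

Lemma antiderP (alpha : R -> R) : bounded_piecewise alpha -> primitive_off (antider alpha) alpha.
Proof.
move=> ab; have int01 := integrable_piecewise (measurable_itv _) (fun=> id) ab.
have wc := parameterized_integral_continuous ler01 int01.
have clampI v : I01 (clamp 0 1 v) by rewrite /= in_itv /= clampP ?ler01.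
split=> t; first exact: (within_comp wc clampI (@clamp_cont t)).
move=> /andP[t0 t1] tS.
have ac := ab.1 t (introT andP (conj t0 t1)) tS.
have [d1 d2] := @continuous_FTC1_closed R alpha 0 t 1 t1 int01 t0 ac.
have h : is_derive t (1 : R) (fun x => \int[mu]_(u in `[0, x]) alpha u)%R (alpha t).
  by rewrite -d2 derive1E; exact: DeriveDef.
apply: (near_eq_is_derive _ h).
have m0 : 0 < Num.min t (1 - t) by rewrite lt_min t0 subr_gt0.
apply/nearRP; exists (Num.min t (1 - t)) => // u; rewrite lt_min ltr_norml ltr_norml.
move=> /andP[/andP[u1 _] /andP[_ u2]]; rewrite /antider clamp_id //.
by apply/andP; split; lra.
Qed.

(** The difference of F and the antiderivative has derivative 0 off S and is continuous. *)
Lemma FTC_off (F alpha : R -> R) t : bounded_piecewise alpha -> primitive_off F alpha ->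
  0 <= t <= 1 -> (\int[mu]_(u in `[0, t]) alpha u)%R = F t - F 0.
Proof.
move=> ab [Fc Fd] t01; have [Nc Nd] := antiderP ab.
have Dd : primitive_off (fun t => antider alpha t - F t) (fun=> 0).
  split=> u; first by apply: continuousB; [exact: Nc|exact: Fc].
  move=> u01 uS; have h1 := Nd u u01 uS; have h2 := Fd u u01 uS.
  have -> : 0 = alpha u - alpha u by rewrite subrr.
  exact: is_deriveB.
have := cst_off Dd t01; rewrite /antider clamp_id // clamp_id ?lexx ?ler01 //.
rewrite set_itv1 Rintegral_set1 => /eqP; rewrite sub0r subr_eq => /eqP ->.
by rewrite addrC.
Qed.

Lemma bounded_piecewiseM (alpha beta : R -> R) : bounded_piecewise alpha -> bounded_piecewise beta ->
  bounded_piecewise (fun t => alpha t * beta t).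
Proof.
move=> [ac [K KP]] [bc [L LP]]; split=> [t t01 tS|].
  by apply: continuousM; [exact: ac|exact: bc].
exists (K * L) => t t01; rewrite normrM ler_pM //; [exact: KP|exact: LP].
Qed.

Lemma bounded_piecewise_cont (F : R -> R) : (forall t, {for t, continuous F}) -> bounded_piecewise F.
Proof.
move=> Fc; split=> [t _ _|]; first exact: Fc.
have Fw : {within `[0, 1], continuous F} by apply: continuous_in_subspaceT => v _; exact: Fc.
have [c _ cP] := EVT_max ler01 Fw; have [d _ dP] := EVT_min ler01 Fw.
exists (`|F c| + `|F d|) => t t01.
have t01' : t \in `[0, 1] by rewrite in_itv.
have h1 := cP t t01'; have h2 := dP t t01'.
rewrite ler_norml; have := ler_norm (F c); have := ler_norm (- F d); rewrite normrN.
have := normr_ge0 (F c); have := normr_ge0 (F d).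
by move=> ? ? ? ?; apply/andP; split; lra.
Qed.

(** The product alpha(t_1) beta(t_2) extended by 0 outside the simplex. *)
Definition simplex_prod (alpha beta : R -> R) (p : R * R) : R :=
  if p.1 <= p.2 then (alpha \_ I01) p.1 * (beta \_ I01) p.2 else 0.

Lemma patch_mul (a0 b0 : R) (p q : bool) : (if p then a0 else 0) * (if q then b0 else 0) =
  if p && q then a0 * b0 else 0.
Proof. by case: p; case: q; rewrite ?mul0r ?mulr0. Qed.

Lemma simplex_restrict (alpha beta : R -> R) :
  ((fun p : R * R => alpha p.1 * beta p.2 : R) \_ (@simplex2 R)) = simplex_prod alpha beta.
Proof.
apply/funext => -[u v]; rewrite /simplex_prod /patch /= patch_mul /simplex2.
have -> : ((u, v) \in [set t : R * R | [&& 0 <= t.1, t.1 <= t.2 & t.2 <= 1]]) =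
    [&& 0 <= u, u <= v & v <= 1] by apply/idP/idP; rewrite inE.
have I01E w : (w \in I01) = (0 <= w <= 1) by apply/idP/idP; rewrite inE /= in_itv.
rewrite !I01E; have [uv|uv] := leP u v; last by rewrite !andbF.
rewrite andTb; congr (if _ then _ else _); apply/idP/idP.
  by move=> /andP[u0 v1]; rewrite u0 v1 (le_trans uv v1) (le_trans u0 uv).
by move=> /andP[/andP[-> _] /andP[_ ->]].
Qed.

Lemma integrable_simplex_prod alpha beta : bounded_piecewise alpha -> bounded_piecewise beta ->
  mu2.-integrable setT (EFin \o simplex_prod alpha beta).
Proof.
move=> ab bb.
have mI : measurable I01 by exact: measurable_itv.
have ma := (measurable_restrictT alpha mI).1 (measurable_piecewise ab).
have mb := (measurable_restrictT beta mI).1 (measurable_piecewise bb).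
have mf : measurable_fun setT (simplex_prod alpha beta).
  apply: measurable_fun_ifT => //.
    by apply: measurable_fun_ler; [exact: measurable_fst|exact: measurable_snd].
  by apply: measurable_funM; apply: measurableT_comp.
have mII : measurable (I01 `*` I01) by exact: measurableX.
have -> : EFin \o simplex_prod alpha beta = (EFin \o simplex_prod alpha beta) \_ (I01 `*` I01).
  apply/funext => -[u v]; rewrite /patch; case: ifPn => // /negP h.
  rewrite /simplex_prod /= /patch patch_mul; case: ifP => // _; case: ifP => // /andP[ui vi].
  by case: h; rewrite inE; split; rewrite -inE.
apply: (proj1 (@integrable_mkcond _ _ _ mu2 (I01 `*` I01) (EFin \o simplex_prod alpha beta) mII)).
apply: measurable_bounded_integrable => //.
- rewrite [X in (X < _)%E](_ : _ = (mu I01 * mu I01)%E); last by apply: product_measure1E.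
  rewrite /= !lebesgue_measure_itv /= lte_fin ltr01 oppr0 adde0.
  by rewrite mule1 ltry.
- exact: measurable_funS mf.
case: ab => _ [K KP]; case: bb => _ [L LP].
exists (`|K| * `|L|); split; first exact: num_real.
move=> x Kx [u v] [/= uI vI]; move: uI vI; rewrite !in_itv /= => uI vI.
rewrite (le_trans _ (ltW Kx)) // /simplex_prod /=; case: ifP => _; last first.
  by rewrite normr0 mulr_ge0.
rewrite /patch !mem_set /= ?in_itv //= normrM ler_pM //.
  by rewrite (le_trans (KP u uI)) // ler_norm.
by rewrite (le_trans (LP v vI)) // ler_norm.
Qed.

(** By Fubini, with the inner integral over [0, t_2] given by FTC_off. *)
Lemma simplex_integral (alpha beta F : R -> R) :
  bounded_piecewise alpha -> bounded_piecewise beta -> primitive_off F alpha ->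
  (\int[mu2]_(p in @simplex2 R) (alpha p.1 * beta p.2))%R =
  (\int[mu]_(t in `[0, 1]) ((F t - F 0) * beta t))%R.
Proof.
move=> ab bb Fa; rewrite Rintegral_mkcond simplex_restrict [RHS]Rintegral_mkcond.
rewrite /Rintegral; congr fine.
rewrite -(integral21_prod_meas1 (integrable_simplex_prod ab bb)).
apply: eq_integral => v _ /=; rewrite /fubini_G /=.
have [vI|vI] := boolP (v \in I01); last first.
  rewrite /patch (negbTE vI); apply: integral0_eq => u _.
  by rewrite /simplex_prod /= /patch (negbTE vI) mulr0 if_same.
rewrite /patch vI.
have v01 : 0 <= v <= 1 by move: vI; rewrite inE /= in_itv.
have sub : `[0, v]%classic `<=` I01.
  move=> u /=; rewrite !in_itv /= => /andP[-> uv] /=.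
  by case/andP: v01 => _; exact: le_trans.
have iv := integrable_piecewise (measurable_itv _) sub ab.
transitivity (\int[mu]_(u in (`[0%R, v]%classic : set R)) ((alpha u)%:E * (beta v)%:E))%E.
  rewrite [RHS]integral_mkcond; apply: eq_integral => u _.
  have uE : (u \in `[0, v]%classic) = (u <= v) && (u \in I01).
    apply/idP/idP; first by rewrite inE => h; rewrite mem_set ?andbT; [move: h; rewrite /= in_itv /= => /andP[]|exact: sub].
    by move=> /andP[uv]; rewrite !inE /= !in_itv /= => /andP[-> _].
  rewrite /simplex_prod /= /patch vI uE; case: (u <= v) => //=.
  by case: ifP => _; [rewrite EFinM|exact: (congr1 EFin (mul0r (beta v)))].
rewrite integralZr // -(FTC_off ab Fa v01) /Rintegral EFinM fineK //.
exact: integrable_fin_num.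
Qed.

End RealIntegrals.

(** * Iterated integrals of complex functions *)

Section ComplexIntegrals.
Context (R : realType).
Local Notation C := R[i].
Local Notation rc := (real_complex R).
Local Notation mu := (@lebesgue_measure R).
Local Notation mu2 := (@lebesgue_measure R \x @lebesgue_measure R)%E.
Variable S : seq R.

Definition bounded_piecewiseC (u : R -> C) : Prop :=
  (forall t, 0 < t < 1 -> t \notin S -> cont_at u t) /\
  exists K : R, forall t, 0 <= t <= 1 -> cmod (u t) <= K.

Definition primitive_offC (F u : R -> C) : Prop :=
  (forall t, cont_at F t) /\
  (forall t, 0 < t < 1 -> t \notin S -> rder rc F t (u t)).

Lemma cont_Re (u : R -> C) t : cont_at u t -> {for t, continuous (@complex.Re R \o u)}.
Proof.
move=> /cont_at_nearP uc P /= /nearRP[d d0 dP]; apply: filterS (uc d d0) => v vd; apply: dP.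
by rewrite (le_lt_trans _ vd) //; have := Re_le_cmod (u v - u t); rewrite !ReE.
Qed.

Lemma cont_Im (u : R -> C) t : cont_at u t -> {for t, continuous (@complex.Im R \o u)}.
Proof.
move=> /cont_at_nearP uc P /= /nearRP[d d0 dP]; apply: filterS (uc d d0) => v vd; apply: dP.
by rewrite (le_lt_trans _ vd) //; have := Im_le_cmod (u v - u t); rewrite !ReE.
Qed.

Lemma cont_ReIm (u : R -> C) t : {for t, continuous (@complex.Re R \o u)} ->
  {for t, continuous (@complex.Im R \o u)} -> cont_at u t.
Proof.
move=> rc1 ic1 e0 e00; have e20 : 0 < e0 / 2 by rewrite divr_gt0.
have h1 : \forall v \near t, `|complex.Re (u v) - complex.Re (u t)| < e0 / 2.
  apply: (cont_near (P := fun w : R => `|w - complex.Re (u t)| < e0 / 2) rc1).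
  by apply/nearRP; exists (e0 / 2).
have h2 : \forall v \near t, `|complex.Im (u v) - complex.Im (u t)| < e0 / 2.
  apply: (cont_near (P := fun w : R => `|w - complex.Im (u t)| < e0 / 2) ic1).
  by apply/nearRP; exists (e0 / 2).
apply: filterS2 h1 h2 => v v1 v2; rewrite (le_trans (cmod_le_ReIm _)) // !ReE.
by rewrite (le_trans (ltW (ltrD v1 v2))) //; lra.
Qed.

Lemma bounded_Re u : bounded_piecewiseC u -> bounded_piecewise S (@complex.Re R \o u).
Proof.
move=> [uc [K KP]]; split=> [t t01 tS|]; first by apply: cont_Re; exact: uc.
by exists K => t t01; exact: le_trans (Re_le_cmod _) (KP t t01).
Qed.

Lemma bounded_Im u : bounded_piecewiseC u -> bounded_piecewise S (@complex.Im R \o u).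
Proof.
move=> [uc [K KP]]; split=> [t t01 tS|]; first by apply: cont_Im; exact: uc.
by exists K => t t01; exact: le_trans (Im_le_cmod _) (KP t t01).
Qed.

Lemma primitive_Re F u : primitive_offC F u -> primitive_off S (@complex.Re R \o F) (@complex.Re R \o u).
Proof.
move=> [Fc Fd]; split=> [t|t t01 tS]; first by apply: cont_Re; exact: Fc.
by have /rderRP[] := Fd t t01 tS.
Qed.

Lemma primitive_Im F u : primitive_offC F u -> primitive_off S (@complex.Im R \o F) (@complex.Im R \o u).
Proof.
move=> [Fc Fd]; split=> [t|t t01 tS]; first by apply: cont_Im; exact: Fc.
by have /rderRP[] := Fd t t01 tS.
Qed.

Lemma cst_offC (D : R -> C) : primitive_offC D (fun=> 0) -> D 1 = D 0.
Proof.
have t1 : 0 <= (1 : R) <= 1 by rewrite ler01 lexx.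
move=> DP; apply: complex_ext.
  exact: (cst_off (primitive_Re DP) t1).
exact: (cst_off (primitive_Im DP) t1).
Qed.

Lemma primitive_offD F G a b : primitive_off S F a -> primitive_off S G b ->
  primitive_off S (fun t => F t + G t) (fun t => a t + b t).
Proof.
move=> [Fc Fd] [Gc Gd]; split=> [t|t t01 tS]; first by apply: continuousD; [exact: Fc|exact: Gc].
have h1 := Fd t t01 tS; have h2 := Gd t t01 tS; exact: is_deriveD.
Qed.

Lemma primitive_offB F G a b : primitive_off S F a -> primitive_off S G b ->
  primitive_off S (fun t => F t - G t) (fun t => a t - b t).
Proof.
move=> [Fc Fd] [Gc Gd]; split=> [t|t t01 tS]; first by apply: continuousB; [exact: Fc|exact: Gc].
have h1 := Fd t t01 tS; have h2 := Gd t t01 tS; exact: is_deriveB.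
Qed.

Lemma simplex_primitive (a b F : R -> R) :
  bounded_piecewise S a -> bounded_piecewise S b -> primitive_off S F a ->
  exists2 k, primitive_off S k (fun t => (F t - F 0) * b t) &
    (\int[mu2]_(p in @simplex2 R) (a p.1 * b p.2))%R = k 1 - k 0.
Proof.
move=> ab bb Fa.
have wb : bounded_piecewise S (fun t => (F t - F 0) * b t).
  apply: bounded_piecewiseM => //; apply: bounded_piecewise_cont => t.
  by apply: continuousB; [exact: Fa.1|exact: cst_continuous].
exists (antider (fun t => (F t - F 0) * b t)); first exact: antiderP.
rewrite (simplex_integral ab bb Fa); apply: (FTC_off wb); first exact: antiderP.
by rewrite ler01 lexx.
Qed.

(** The product of complex numbers splits the integral into four real ones. *)
Lemma iterated_primitive (u v F : R -> C) :
  bounded_piecewiseC u -> bounded_piecewiseC v -> primitive_offC F u ->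
  exists2 k, primitive_offC k (fun t => (F t - F 0) * v t) &
    (\int[mu2]_(p in @simplex2 R) complex.Re (u p.1 * v p.2))%R +i*
    (\int[mu2]_(p in @simplex2 R) complex.Im (u p.1 * v p.2))%R = k 1 - k 0.
Proof.
move=> ub vb Fu.
have [ur ui vr vi] : [/\ bounded_piecewise S (@complex.Re R \o u), bounded_piecewise S (@complex.Im R \o u),
   bounded_piecewise S (@complex.Re R \o v) & bounded_piecewise S (@complex.Im R \o v)].
  by split; [exact: bounded_Re|exact: bounded_Im|exact: bounded_Re|exact: bounded_Im].
have Fr := primitive_Re Fu; have Fi := primitive_Im Fu.
have [krr krrP krrE] := simplex_primitive ur vr Fr.
have [kri kriP kriE] := simplex_primitive ur vi Fr.
have [kir kirP kirE] := simplex_primitive ui vr Fi.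
have [kii kiiP kiiE] := simplex_primitive ui vi Fi.
have rP := primitive_offB krrP kiiP; have iP := primitive_offD kriP kirP.
exists (fun t => (krr t - kii t) +i* (kri t + kir t)).
  split=> [t|t t01 tS].
    by apply: cont_ReIm; [exact: rP.1|exact: iP.1].
  apply/rderRP; split.
    have := rP.2 t t01 tS; congr (is_derive _ _ _ _); rewrite !ReE /=; ring.
  have := iP.2 t t01 tS; congr (is_derive _ _ _ _); rewrite !ReE /=; ring.
have ReP (p : R * R) : complex.Re (u p.1 * v p.2) =
   (@complex.Re R \o u) p.1 * (@complex.Re R \o v) p.2 - (@complex.Im R \o u) p.1 * (@complex.Im R \o v) p.2.
  by rewrite !ReE.
have ImP (p : R * R) : complex.Im (u p.1 * v p.2) =
   (@complex.Re R \o u) p.1 * (@complex.Im R \o v) p.2 + (@complex.Im R \o u) p.1 * (@complex.Re R \o v) p.2.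
  by rewrite !ReE.
have patchB (g h : R * R -> R) : (fun p => g p - h p) \_ (@simplex2 R) =
    (fun p => (g \_ (@simplex2 R)) p - (h \_ (@simplex2 R)) p).
  by apply/funext => p; rewrite /patch; case: ifP => // _; rewrite subrr.
have patchD (g h : R * R -> R) : (fun p => g p + h p) \_ (@simplex2 R) =
    (fun p => (g \_ (@simplex2 R)) p + (h \_ (@simplex2 R)) p).
  by apply/funext => p; rewrite /patch; case: ifP => // _; rewrite addr0.
have E1 : (\int[mu2]_(p in @simplex2 R) complex.Re (u p.1 * v p.2))%R =
    (krr 1 - krr 0) - (kii 1 - kii 0).
  rewrite -krrE -kiiE; under eq_Rintegral do rewrite ReP.
  rewrite Rintegral_mkcond patchB !simplex_restrict RintegralB //;
    [|exact: (integrable_simplex_prod ur vr)|exact: (integrable_simplex_prod ui vi)].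
  by rewrite -!simplex_restrict -!Rintegral_mkcond.
have E2 : (\int[mu2]_(p in @simplex2 R) complex.Im (u p.1 * v p.2))%R =
    (kri 1 - kri 0) + (kir 1 - kir 0).
  rewrite -kriE -kirE; under eq_Rintegral do rewrite ImP.
  rewrite Rintegral_mkcond patchD !simplex_restrict RintegralD //;
    [|exact: (integrable_simplex_prod ur vi)|exact: (integrable_simplex_prod ui vr)].
  by rewrite -!simplex_restrict -!Rintegral_mkcond.
rewrite E1 E2; apply: complex_ext; rewrite !ReE /=; ring.
Qed.

End ComplexIntegrals.

(** * The iterated integral in terms of a lift *)

Section PathSide.
Context (R : realType) (X : riemannSurfaceType R) (A : comFalgType R[i]) (m : {pred A}).
Context (n : nat) (e : n.+1.-tuple A).
Local Notation C := R[i].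
Local Notation rc := (real_complex R).
Hypothesis localA : local_with_maximal_ideal m.
Hypothesis basis_e : basis_of {:A} e.
Hypothesis e0 : tnth e ord0 = 1.
Hypothesis em : forall i, i != ord0 -> tnth e i \in m.
Local Notation rderA := (rderA e).
Local Notation cid := (@cont_at_id R _).

Lemma subdivision_mem (x : R) (ts : seq R) (t : R) : path <%R x ts -> x < t -> t < last x ts ->
  t \notin ts -> exists2 i, (i < size ts)%N & nth 0 (x :: ts) i < t < nth 0 ts i.
Proof.
elim: ts x => [|y ts IH] x /=; first by move=> _ xt /(lt_trans xt); rewrite ltxx.
move=> /andP[xy yts] xt tl; rewrite inE negb_or => /andP[ty tts].
have [lty|lty] := ltP t y; first by exists 0%N => //=; rewrite xt.
have yt : y < t by rewrite lt_neqAle eq_sym ty.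
have [i its ti] := IH y yts yt tl tts.
by exists i.+1.
Qed.

Lemma subdivision_bounds (x : R) (ts : seq R) : path <%R x ts -> x <= last x ts /\
  forall i, (i < size ts)%N ->
  [/\ x <= nth 0 (x :: ts) i, nth 0 ts i <= last x ts & nth 0 (x :: ts) i < nth 0 ts i].
Proof.
elim: ts x => [|y ts IH] x /=; first by [].
move=> /andP[xy /IH[yl H]]; split; first by rewrite (le_trans (ltW xy)).
case=> [|i] its /=; first by split.
by have [h1 h2 h3] := H i its; split=> //; rewrite (le_trans (ltW xy)).
Qed.

(** Local boundedness on [0, 1], which holds piece by piece, gives boundedness by
    continuous induction on the segment [0, t]. *)
Lemma bounded_pieces (ts : seq R) (u : R -> C) : path <%R 0 ts -> last 0 ts = 1 ->
  (forall i t, (i < size ts)%N -> nth 0 (0 :: ts) i <= t <= nth 0 ts i ->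
    exists2 psi : R -> C, cont_at psi t &
      \forall v \near t, nth 0 (0 :: ts) i < v < nth 0 ts i -> u v = psi v) ->
  bounded_piecewiseC (0 :: ts) u.
Proof.
move=> pts lts H; split.
  move=> t /andP[t0 t1]; rewrite inE negb_or => /andP[_ tts].
  have [|i its /andP[it1 it2]] := subdivision_mem pts t0 _ tts; first by rewrite lts.
  have [|psi pc pE] := H i t its; first by rewrite !ltW.
  move=> eps eps0.
  have ii : \forall v \near t, nth 0 (0 :: ts) i < v < nth 0 ts i.
    have m0 : 0 < Num.min (t - nth 0 (0 :: ts) i) (nth 0 ts i - t) by rewrite lt_min !subr_gt0 it1 it2.
    apply/nearRP; exists (Num.min (t - nth 0 (0 :: ts) i) (nth 0 ts i - t)) => // v.
    rewrite lt_min !ltr_norml => /andP[/andP[v1 _] /andP[_ v2]]; move: v1 v2.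
    set p := nth _ _ _; set q := nth _ _ _ => v1 v2; apply/andP; split; lra.
  have ut : u t = psi t by apply: (nbhs_singleton pE); rewrite it1 it2.
  by apply: filterS3 (pc _ eps0) ii pE => v h1 h2 /(_ h2) ->; rewrite ut.
have loc (t : R) : 0 <= t <= 1 -> exists2 K : R, 0 <= K & \forall v \near t, 0 <= v <= 1 -> cmod (u v) <= K.
  move=> t01.
  have P1 (i : 'I_(size ts)) : exists2 K : R, 0 <= K &
      \forall v \near t, nth 0 (0 :: ts) i < v < nth 0 ts i -> cmod (u v) <= K.
    have [ti|ti] := boolP (nth 0 (0 :: ts) i <= t <= nth 0 ts i).
      have [psi pc pE] := H i t (ltn_ord i) ti.
      exists (cmod (psi t) + 1); first by rewrite addr_ge0 ?cmod_ge0.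
      by apply: filterS2 (cont_bounded pc) pE => v h1 h2 /h2 ->.
    exists 0 => //; move: ti; rewrite negb_and -!ltNge => /orP[ti|ti].
      apply/nearRP; exists (nth 0 (0 :: ts) i - t); first by rewrite subr_gt0.
      move=> v; rewrite ltr_norml => /andP[_ v1] /andP[v2 _]; exfalso; move: v1 v2.
      by set p := nth _ _ _ => v1 v2; lra.
    apply/nearRP; exists (t - nth 0 ts i); first by rewrite subr_gt0.
    move=> v; rewrite ltr_norml => /andP[v1 _] /andP[_ v2]; exfalso; move: v1 v2.
    by set p := nth _ _ _ => v1 v2; lra.
  have [K KP] := choice (fun i => let: ex_intro2 K K0 h := P1 i in ex_intro (fun K => 0 <= K /\ \forall v \near t, nth 0 (0 :: ts) i < v < nth 0 ts i -> cmod (u v) <= K) K (conj K0 h)).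
  have KA : \forall v \near t, forall i : 'I_(size ts), nth 0 (0 :: ts) i < v < nth 0 ts i -> cmod (u v) <= K i.
    have h (i : 'I_(size ts)) : \forall v \near t, nth 0 (0 :: ts) i < v < nth 0 ts i -> cmod (u v) <= K i.
      by have [] := KP i.
    exact: (@filter_forall _ _ (fun (i : 'I_(size ts)) v => nth 0 (0 :: ts) i < v < nth 0 ts i -> cmod (u v) <= K i) _ _ h).
  have K0 : 0 <= \sum_i K i by apply: sumr_ge0 => i _; have [] := KP i.
  exists (\sum_i K i + cmod (u t) + cmod (u 0) + cmod (u 1)); first by rewrite !addr_ge0 ?cmod_ge0.
  have [d d0 dP] := near_avoid (0 :: ts) t.
  have av : \forall v \near t, v != t -> v \notin 0 :: ts by apply/nearRP; exists d.
  have c0 := cmod_ge0 (u t); have c1 := cmod_ge0 (u 0); have c2 := cmod_ge0 (u 1).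
  apply: filterS2 KA av => v Kv vt /andP[v0 v1].
  have [->|vnt] := eqVneq v t; first by lra.
  move: (vt vnt); rewrite inE negb_or => /andP[vn0 vts].
  have v0' : 0 < v by rewrite lt_neqAle eq_sym vn0.
  have [v1E|vn1] := eqVneq v 1; first by rewrite v1E; lra.
  have [|i its vi] := subdivision_mem pts v0' _ vts; first by rewrite lts lt_neqAle vn1.
  have h := Kv (Ordinal its) vi.
  have hs : K (Ordinal its) <= \sum_i K i.
    rewrite (bigD1 (Ordinal its)) //= lerDl; apply: sumr_ge0 => j _; by have [] := KP j.
  by lra.
apply: (@segment_ind R (fun t : R => exists K : R, forall v : R, 0 <= v <= t -> cmod (u v) <= K) _ _ 1); last 2 first.
- exists (cmod (u 0)) => v v0; have -> : v = 0 by apply/eqP; rewrite eq_le andbC.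
  exact: lexx.
- by rewrite ler01 lexx.
move=> t t01; have [K K0 KP] := loc t t01; move: KP => /nearRP[d d0 dP].
have aux (p q : R) : 0 <= p <= 1 -> 0 <= q <= 1 -> `|p - t| < d -> `|q - t| < d ->
    (exists K : R, forall v, 0 <= v <= p -> cmod (u v) <= K) ->
    exists K : R, forall v, 0 <= v <= q -> cmod (u v) <= K.
  move=> p01 q01 pd qd [L LP]; exists (Num.max K L) => v /andP[v0 vq]; rewrite le_max.
  have [vp|vp] := leP v p; first by rewrite LP ?orbT // v0.
  rewrite dP //; last by rewrite v0 (le_trans vq) //; case/andP: q01.
  move: pd qd; rewrite !ltr_norml => /andP[p1 _] /andP[_ q1]; apply/andP; split; lra.
apply/nearRP; exists d => // v vd v01.
have td : `|t - t| < d by rewrite subrr normr0.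
by split; apply: aux.
Qed.

Section Path.
Variables (sigma : R -> X) (ts : seq R).
Hypothesis sigc : {within `[0, 1], continuous sigma}.
Hypothesis pts : path <%R 0 ts.
Hypothesis lts : last 0 ts = 1.
Hypothesis C1 : forall i, (i < size ts)%N -> C1_on sigma (nth 0 (0 :: ts) i) (nth 0 ts i).
Local Notation Th := (sigma \o clamp 0 1).

Lemma Th_cont t : {for t, continuous Th}.
Proof.
apply: (within_comp sigc); last exact: clamp_cont.
by move=> v; rewrite /= in_itv /= clampP ?ler01.
Qed.

Lemma cont_atM (T : topologicalType) (u v : T -> C) p : cont_at u p -> cont_at v p ->
  cont_at (fun q => u q * v q) p.
Proof.
move=> uc vc eps eps0; set K := cmod (v p) + 1 + cmod (u p).
have K0 : 0 < K by rewrite /K; have := cmod_ge0 (v p); have := cmod_ge0 (u p); lra.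
have eK : 0 < eps / K by rewrite divr_gt0.
apply: filterS3 (uc _ eK) (vc _ eK) (cont_bounded vc) => q h1 h2 h3.
have -> : u q * v q - u p * v p = (u q - u p) * v q + u p * (v q - v p) by ring.
rewrite (le_trans (cmodD _ _)) // !cmodM.
have -> : eps = eps / K * (cmod (v p) + 1) + cmod (u p) * (eps / K).
  by rewrite [cmod (u p) * _]mulrC -mulrDr divfK // gt_eqF.
by apply: lerD; [apply: ler_pM; rewrite ?cmod_ge0|rewrite ler_wpM2l ?cmod_ge0].
Qed.

Lemma rder_derivable (c : R -> C) t : derivable (@complex.Re R \o c) t 1 ->
  derivable (@complex.Im R \o c) t 1 ->
  rder rc c t (derive1 (@complex.Re R \o c) t +i* derive1 (@complex.Im R \o c) t).
Proof. by move=> dr di; apply/rderRP; rewrite !derive1E /=; split; apply: derivableP. Qed.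

Lemma near_oo (a b t : R) : a < t < b -> \forall u \near t, a < u < b.
Proof.
move=> /andP[at_ tb]; have m0 : 0 < Num.min (t - a) (b - t) by rewrite lt_min !subr_gt0 at_ tb.
apply/nearRP; exists (Num.min (t - a) (b - t)) => // v.
by rewrite lt_min !ltr_norml => /andP[/andP[v1 _] /andP[_ v2]]; apply/andP; split; lra.
Qed.

Lemma Th_near (t : R) : 0 < t < 1 -> \forall u \near t, Th u = sigma u.
Proof.
by move=> t01; apply: filterS (near_oo t01) => u /andP[u0 u1]; rewrite /= clamp_id // !ltW.
Qed.

Lemma sigma_cont t : 0 < t < 1 -> {for t, continuous sigma}.
Proof.
move=> t01 P /= hP; have tE := nbhs_singleton (Th_near t01); rewrite /= -tE in hP.
have hP' := cont_near (@Th_cont t) hP.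
by apply: filterS2 (Th_near t01) hP' => u E; rewrite /= -E.
Qed.

(** The C^1 function of the hypothesis coincides with the path near t. *)
Lemma velocity_rder (a b t : R) : a < t < b -> C1_on sigma a b ->
  rder rc (fun u => chart_at (sigma t) (sigma u)) t (velocity sigma t).
Proof.
move=> tab ab1; have tin : t \in `[a, b].
  by rewrite in_itv /=; case/andP: tab => *; rewrite !ltW.
have [c [cr ci] cE] := ab1 t tin.
have cE' : \forall u \near t, c u = chart_at (sigma t) (sigma u).
  apply: filterS2 cE (near_oo tab) => u h /andP[u1 u2]; rewrite h // in_itv /=.
  by rewrite !ltW.
have [dr _] := nbhs_singleton cr; have [di _] := nbhs_singleton ci.
have dr' : is_derive t (1 : R) (fun u => complex.Re (chart_at (sigma t) (sigma u))) ('D_1 (@complex.Re R \o c) t).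
  by apply: (near_eq_is_derive _ (derivableP dr)); apply: filterS cE' => u /= ->.
have di' : is_derive t (1 : R) (fun u => complex.Im (chart_at (sigma t) (sigma u))) ('D_1 (@complex.Im R \o c) t).
  by apply: (near_eq_is_derive _ (derivableP di)); apply: filterS cE' => u /= ->.
have Er : 'D_1 (fun u => complex.Re (chart_at (sigma t) (sigma u))) t = 'D_1 (@complex.Re R \o c) t.
  by exact: derive_val.
have Ei : 'D_1 (fun u => complex.Im (chart_at (sigma t) (sigma u))) t = 'D_1 (@complex.Im R \o c) t.
  by exact: derive_val.
by apply/rderRP; rewrite /velocity /= !derive1E Er Ei; split.
Qed.

Definition local_primitive (H D : X -> A) (p : X) : Prop :=
  \forall q \near p, rderA (chart_at q) H q (D q).

Lemma rderA_path (H D : X -> A) (a b t : R) : 0 < t < 1 -> a < t < b -> C1_on sigma a b ->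
  local_primitive H D (sigma t) -> rderA rc (H \o sigma) t (velocity sigma t *: D (sigma t)).
Proof.
move=> t01 tab ab1 /nbhs_singleton HD i; rewrite linearZ /=.
exact: (rder_comp (sigma_cont t01) (velocity_rder tab ab1) (HD i)).
Qed.

(** On each closed piece the pullback agrees with a continuous function, read in the one
    chart around sigma t, although velocity and the form use the charts around each
    sigma u. *)
Lemma pullback_piece (H D : X -> A) (i : nat) (t : R) : (i < size ts)%N ->
  nth 0 (0 :: ts) i <= t <= nth 0 ts i -> local_primitive H D (sigma t) ->
  exists2 psi : R -> A, cont_atA e psi t &
    \forall u \near t, nth 0 (0 :: ts) i < u < nth 0 ts i ->
      velocity sigma u *: D (sigma u) = psi u.
Proof.
move=> its tab HD; have ab1 := C1 its.
have [_ bnd] := subdivision_bounds pts; have [a0 b1 ab] := bnd i its.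
rewrite lts in b1; move: a0 b1 ab tab ab1; set a := nth _ _ _; set b := nth _ _ _.
move=> a0 b1 ab tab ab1; pose c0 := chart_at (sigma t); have cd : chart_dom c0 (sigma t) := chart_at_dom _.
have t01 : 0 <= t <= 1 by case/andP: tab => ta tb; rewrite (le_trans a0 ta) (le_trans tb b1).
have tin : t \in `[a, b] by rewrite in_itv.
have [c [cr ci] cE] := ab1 t tin.
have ct : c t = c0 (sigma t) by rewrite (nbhs_singleton cE).
have Hh : \forall z \near c0 (sigma t), exists d, rderA id (H \o chart_inv c0) z d.
  have h1 := chart_im_near cd; have h2 := near_chart_inv cd HD.
  apply: filterS2 (near_join h1) h2 => z zz; set q := chart_inv c0 z => Hq.
  have [cq cqz] := nbhs_singleton zz.
  have [r rP] := rder_transition (@chart_at_compatible _ X (sigma t) q) cq (chart_at_dom q).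
  have {}Hq := rderA_change rP Hq; exists (1 *: (r *: D q)) => j; rewrite linearZ /=.
  have ic : {for z, continuous (chart_inv c0)} by rewrite -cqz; exact: chart_inv_cont.
  have idd : rder (id : C -> C) id z 1 by exact: rder_id.
  have id2 : rder id (c0 \o chart_inv c0) z 1.
    by apply: rder_near idd; apply: filterS zz => w [_ E] /=; rewrite E.
  exact: rder_comp ic id2 (Hq j).
have [P' [Pd Ph]] := holA_deriv basis_e Hh.
have ccont : cont_at c t.
  have [dr _] := nbhs_singleton cr; have [di _] := nbhs_singleton ci.
  have h := rder_derivable dr di; exact: (rder_cont (x := rc) (@cont_at_real R t) h).
pose psi u := (derive1 (@complex.Re R \o c) u +i* derive1 (@complex.Im R \o c) u) *: P' (c u).
exists psi.
  have [_ drc] := nbhs_singleton cr; have [_ dic] := nbhs_singleton ci.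
  have dc : cont_at (fun u => derive1 (@complex.Re R \o c) u +i* derive1 (@complex.Im R \o c) u) t.
    by apply: cont_ReIm; [exact: drc|exact: dic].
  have Pc := holA_cont Ph; rewrite -ct in Pc.
  move=> j; have Pcj : cont_at ((fun z => coord e j (P' z)) \o c) t.
    by apply/cont_atE; apply: continuous_comp; [exact/cont_atE|apply/cont_atE; exact: Pc].
  have -> : (fun u => coord e j (psi u)) = (fun u =>
     (derive1 (@complex.Re R \o c) u +i* derive1 (@complex.Im R \o c) u) * coord e j (P' (c u))).
    by apply/funext => u; rewrite /psi linearZ.
  exact: cont_atM dc Pcj.
have fact1 : \forall u \near t, local_primitive H D (Th u) /\ chart_dom c0 (Th u).
  have h : \forall q \near sigma t, local_primitive H D q /\ chart_dom c0 q.
    by apply: filterI; [exact: near_join|exact: chart_dom_near].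
  have Tht : Th t = sigma t by rewrite /= clamp_id.
  by rewrite -Tht in h; exact: (cont_near (@Th_cont t) h).
have fact2 : \forall u \near t, rderA id (H \o chart_inv c0) (c u) (P' (c u)).
  rewrite -ct in Pd; have /cont_atE h := ccont.
  exact: (cont_near (P := fun z => rderA id (H \o chart_inv c0) z (P' z)) h Pd).
have cE2 := near_join cE.
have F12 : \forall u \near t, [/\ local_primitive H D (Th u), chart_dom c0 (Th u) &
   rderA id (H \o chart_inv c0) (c u) (P' (c u))] by apply: filterS2 fact1 fact2 => u [].
have cri : \forall u \near t, (derivable (@complex.Re R \o c) u 1) /\ (derivable (@complex.Im R \o c) u 1).
  by apply: filterS2 cr ci => u [? _] [? _].
have F12n := near_join F12.
apply: filterS3 F12n cE2 cri => u F12u cEu [dr di] uab.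
have u01 : 0 < u < 1 by case/andP: uab => ua ub; rewrite (le_lt_trans a0 ua) (lt_le_trans ub b1).
have ThE := Th_near u01.
have [HDu cdu Pu] := nbhs_singleton F12u.
have Thu := nbhs_singleton ThE; rewrite /= in Thu; rewrite /= Thu in HDu.
have h1 := rderA_path u01 uab ab1 HDu.
have cder : rder rc c u (derive1 (@complex.Re R \o c) u +i* derive1 (@complex.Im R \o c) u).
  exact: rder_derivable.
have cc : {for u, continuous c} by apply/cont_atE; exact: (rder_cont (x := rc) (@cont_at_real R u) cder).
apply: (coordA_ext basis_e) => j; rewrite /psi [RHS]linearZ /=.
have h2 := rder_comp cc cder (Pu j).
apply: rderR_uniq (h1 j) _.
apply: rder_near h2; apply: filterS3 (filterI F12u ThE) cEu (near_oo uab) => v [[_ cdv _] Thv] cEv /andP[va vb].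
rewrite /= in Thv cdv *; rewrite Thv in cdv; rewrite -cEv ?chart_invK // in_itv /=.
by rewrite !ltW.
Qed.

Lemma bounded_pullback (D : X -> A) (i : 'I_n.+1) :
  (forall t, 0 <= t <= 1 -> exists H, local_primitive H D (sigma t)) ->
  bounded_piecewiseC (0 :: ts) (pullback sigma (fun p => coord e i (D p))).
Proof.
move=> HD; apply: bounded_pieces => // j t jts tab.
have [_ bnd] := subdivision_bounds pts; have [a0 b1 ab] := bnd j jts; rewrite lts in b1.
have t01 : 0 <= t <= 1 by case/andP: tab => ta tb; rewrite (le_trans a0 ta) (le_trans tb b1).
have [H0 HP] := HD t t01.
have [psi pc pE] := pullback_piece jts tab HP.
exists (fun u => coord e i (psi u)); first exact: pc.
by apply: filterS pE => u h /h <-; rewrite linearZ /= /pullback mulrC.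
Qed.

Variables f g : meromorphicA X n.

Lemma lift_cont (F G K : R -> A) i t : lift e f g (@unit_segment R) Th F G K ->
  [/\ cont_at (fun u => coord e i (F (clamp 0 1 u))) t, cont_at (fun u => coord e i (G (clamp 0 1 u))) t &
    cont_at (fun u => coord e i (K (clamp 0 1 u))) t].
Proof.
move=> L; have t01 := clampP t ler01 : 0 <= clamp 0 1 t <= 1.
have [F0 [G0 [K0 [P E]]]] := L _ t01.
have cc : cont_at (chart_at (Th (clamp 0 1 t))) (Th (clamp 0 1 t)).
  by apply/cont_atE; exact: chart_cont (chart_at_dom _).
have [Fd Gd Kd] := nbhs_singleton P.
have E' := cont_near (@clamp_cont R t) E.
have aux (W W0 : _ -> A) d : rderA (chart_at (Th (clamp 0 1 t))) W0 (Th (clamp 0 1 t)) d ->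
   (\forall u \near t, W (clamp 0 1 u) = W0 (Th (clamp 0 1 u))) ->
   cont_at (fun u => coord e i (W (clamp 0 1 u))) t.
  move=> Wd WE; have Wc := rderA_contA cc Wd i.
  have h : cont_at (fun u => coord e i (W0 (Th (clamp 0 1 u)))) t.
    apply/cont_atE; apply: (@continuous_comp _ _ _ (Th \o clamp 0 1) (fun q => coord e i (W0 q))).
      by apply: continuous_comp; [exact: clamp_cont|exact: Th_cont].
    exact/cont_atE.
  move=> eps eps0; have WEt := nbhs_singleton WE.
  by apply: filterS2 WE (h _ eps0) => u ->; rewrite WEt.
split; [apply: aux Fd _|apply: aux Gd _|apply: aux Kd _];
  by apply: filterS E' => u /(_ (clampP u ler01))[].
Qed.

Lemma path_rderA (D W0 : X -> A) t : 0 < t < 1 -> t \notin 0 :: ts ->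
  local_primitive W0 D (sigma t) -> rderA rc (W0 \o sigma) t (velocity sigma t *: D (sigma t)).
Proof.
move=> t01; rewrite inE negb_or => /andP[_ tts] WP; case/andP: (t01) => t0 t1.
have [|i its tab] := subdivision_mem pts t0 _ tts; first by rewrite lts.
exact: rderA_path t01 tab (C1 its) WP.
Qed.

Lemma cont_at_cst (T : topologicalType) (c : C) (p : T) : cont_at (fun=> c) p.
Proof.
by move=> eps eps0; near=> q; rewrite subrr cmod0 ltW.
Unshelve. all: by end_near. Qed.

Lemma cont_at_sum (T : topologicalType) (I : Type) (r : seq I) (u : I -> T -> C) (p : T) :
  (forall i, cont_at (u i) p) -> cont_at (fun q => \sum_(i <- r) u i q) p.
Proof.
move=> uc; elim: r => [|i r IH].
  have -> : (fun q => \sum_(i <- [::]) u i q) = (fun=> 0) by apply/funext => q; rewrite big_nil.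
  exact: cont_at_cst.
have -> : (fun q => \sum_(j <- i :: r) u j q) = (fun q => u i q + \sum_(j <- r) u j q).
  by apply/funext => q; rewrite big_cons.
exact: cont_atD.
Qed.

Lemma mul_coords (a b : A) :
  a * b = \sum_i \sum_j (coord e i a * coord e j b) *: (tnth e i * tnth e j).
Proof.
rewrite {1}(coord_sum basis_e a) {1}(coord_sum basis_e b) mulr_suml.
by apply: eq_bigr => i _; rewrite mulr_sumr; apply: eq_bigr => j _; rewrite scaler_mulACA.
Qed.

(** The iterated integral is the integral of (F - F(0)) dG, that is, of dK - F(0) dG.
    Coordinate by coordinate, its primitive k and K - F(0) G have the same derivative
    off the exceptional points of sigma. *)
Lemma iterated_integral_lift (F G K : R -> A) : lift e f g (@unit_segment R) Th F G K ->
  iterated_integralA e sigma (dlog e f) (dlog e g) = K 1 - K 0 - F 0 * (G 1 - G 0).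
Proof.
move=> L.
pose cl := clamp (0 : R) 1.
have germ t : 0 <= t <= 1 -> exists F0 G0 K0,
    [/\ local_primitive F0 (dlog e f) (sigma t), local_primitive G0 (dlog e g) (sigma t),
      local_primitive K0 (fun q => F0 q * dlog e g q) (sigma t) &
      \forall w \near t, [/\ F (cl w) = F0 (Th w), G (cl w) = G0 (Th w) & K (cl w) = K0 (Th w)]].
  move=> t01; have [F0 [G0 [K0 [P E]]]] := L t t01; exists F0, G0, K0.
  have ct : cl t = t by rewrite /cl clamp_id.
  rewrite /= clamp_id // in P; split; try by apply: filterS P => q [].
  rewrite -{1}ct in E; have := cont_near (@clamp_cont R t) E.
  by apply: filterS => w /(_ (clampP w ler01)); rewrite /= (clamp_id (clampP w ler01)).
have ub i : bounded_piecewiseC (0 :: ts) (pullback sigma (fun p => coord e i (dlog e f p))).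
  apply: bounded_pullback => // t /germ[F0 [G0 [K0 [h _ _ _]]]]; by exists F0.
have vb i : bounded_piecewiseC (0 :: ts) (pullback sigma (fun p => coord e i (dlog e g p))).
  apply: bounded_pullback => // t /germ[F0 [G0 [K0 [_ h _ _]]]]; by exists G0.
have germ' t : 0 < t < 1 -> t \notin 0 :: ts -> [/\ rderA rc (F \o cl) t (velocity sigma t *: dlog e f (sigma t)),
    rderA rc (G \o cl) t (velocity sigma t *: dlog e g (sigma t)) &
    rderA rc (K \o cl) t (velocity sigma t *: (F (cl t) * dlog e g (sigma t)))].
  move=> t01 tS; have t01' : 0 <= t <= 1 by case/andP: t01 => *; rewrite !ltW.
  have [F0 [G0 [K0 [h1 h2 h3 E]]]] := germ t t01'; have TE := Th_near t01.
  have Et := nbhs_singleton E; rewrite /= clamp_id // in Et; case: Et => Ft _ _.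
  have p1 := path_rderA t01 tS h1; have p2 := path_rderA t01 tS h2; have p3 := path_rderA t01 tS h3.
  rewrite -Ft in p3.
  have E2 : \forall w \near t, [/\ (F0 \o sigma) w = (F \o cl) w, (G0 \o sigma) w = (G \o cl) w &
     (K0 \o sigma) w = (K \o cl) w].
    by apply: filterS2 E TE => w [E1 E2 E3] /= Ew; rewrite E1 E2 E3 /= Ew.
  by split; [apply: rderA_near p1|apply: rderA_near p2|apply: rderA_near p3]; apply: filterS E2 => w [].
have Fprim i : primitive_offC (0 :: ts) (fun t => coord e i (F (cl t)))
    (pullback sigma (fun p => coord e i (dlog e f p))).
  split=> [t|t t01 tS]; first by have [] := lift_cont i t L.
  have [/(_ i) h _ _] := germ' t t01 tS; rewrite linearZ /= mulrC in h; exact: h.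
have kP i j := iterated_primitive (ub i) (vb j) (Fprim i).
pose k i j := s2val (cid2 (kP i j)).
have kprim i j : primitive_offC (0 :: ts) (k i j) (fun t => (coord e i (F (cl t)) - coord e i (F (cl 0))) *
   pullback sigma (fun p => coord e j (dlog e g p)) t) by exact: (s2valP (cid2 (kP i j))).
have kE i j : iterated_integral sigma (fun p => coord e i (dlog e f p)) (fun p => coord e j (dlog e g p)) =
    k i j 1 - k i j 0 by exact: (s2valP' (cid2 (kP i j))).
have cl0 : cl 0 = 0 by rewrite /cl clamp_id // lexx ler01.
have cl1 : cl 1 = 1 by rewrite /cl clamp_id // lexx ler01.
pose T t := \sum_i \sum_j k i j t *: (tnth e i * tnth e j) - (K (cl t) - F 0 * G (cl t)).
have Tprim l : primitive_offC (0 :: ts) (fun t => coord e l (T t)) (fun=> 0).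
  split=> [t|t t01 tS].
    have -> : (fun t => coord e l (T t)) = (fun t =>
        \sum_i \sum_j k i j t * coord e l (tnth e i * tnth e j) +
        (- coord e l (K (cl t)) + \sum_i \sum_j coord e i (F 0) * coord e j (G (cl t)) * coord e l (tnth e i * tnth e j))).
      apply/funext => w; rewrite -(coordM basis_e) /T.
      rewrite [\sum_i _ - _](_ : _ = \sum_i \sum_j k i j w *: (tnth e i * tnth e j) +
        (- K (cl w) + F 0 * G (cl w))); last by rewrite opprB [- _ + _]addrC.
      rewrite linearD [X in _ + X]linearD linearN /=; congr (_ + _).
      rewrite linear_sum; apply: eq_bigr => i _; rewrite linear_sum /=.
      by apply: eq_bigr => j _; rewrite linearZ.
    have ctK i : cont_at (fun t => coord e i (K (cl t))) t by have [] := lift_cont i t L.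
    have ctG i : cont_at (fun t => coord e i (G (cl t))) t by have [] := lift_cont i t L.
    apply: cont_atD; last apply: cont_atD; last 1 first.
    - apply: cont_at_sum => i; apply: cont_at_sum => j; apply: cont_atM; last exact: cont_at_cst.
      by apply: cont_atM; [exact: cont_at_cst|exact: ctG].
    - apply: cont_at_sum => i; apply: cont_at_sum => j; apply: cont_atM; last exact: cont_at_cst.
      by have [] := kprim i j.
    - exact: cont_atN.
  have [_ Gd Kd] := germ' t t01 tS.
  have kd : rderA rc (fun t => \sum_i \sum_j k i j t *: (tnth e i * tnth e j)) t
     (\sum_i \sum_j ((coord e i (F (cl t)) - coord e i (F (cl 0))) *
       pullback sigma (fun p => coord e j (dlog e g p)) t) *: (tnth e i * tnth e j)).
    apply: rderA_sum => i _; apply: rderA_sum => j _; apply: rderA_scale.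
    by have [_ h] := kprim i j; exact: h.
  have gd := rderAMl basis_e (@cont_at_real R t) (F 0) Gd.
  have h := rderAB kd (rderAB Kd gd).
  have E : \sum_i \sum_j ((coord e i (F (cl t)) - coord e i (F (cl 0))) *
       pullback sigma (fun p => coord e j (dlog e g p)) t) *: (tnth e i * tnth e j) -
      (velocity sigma t *: (F (cl t) * dlog e g (sigma t)) -
       F 0 * (velocity sigma t *: dlog e g (sigma t))) = 0.
    have -> : \sum_i \sum_j ((coord e i (F (cl t)) - coord e i (F (cl 0))) *
       pullback sigma (fun p => coord e j (dlog e g p)) t) *: (tnth e i * tnth e j) =
       (F (cl t) - F (cl 0)) * (velocity sigma t *: dlog e g (sigma t)).
      rewrite mul_coords; apply: eq_bigr => i _; apply: eq_bigr => j _.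
      by rewrite linearB linearZ /= /pullback [velocity _ _ * _]mulrC.
    by rewrite cl0 mulrBl -scalerAr subrr.
  rewrite E in h; have := h l; rewrite linear0; exact.
have TE : T 1 = T 0 by apply: (coordA_ext basis_e) => l; exact: cst_offC (Tprim l).
have -> : iterated_integralA e sigma (dlog e f) (dlog e g) =
    \sum_i \sum_j k i j 1 *: (tnth e i * tnth e j) - \sum_i \sum_j k i j 0 *: (tnth e i * tnth e j).
  rewrite /iterated_integralA -sumrB; apply: eq_bigr => i _; rewrite -sumrB; apply: eq_bigr => j _.
  by rewrite kE scalerBl.
move: TE; rewrite /T cl0 cl1; set S1 := \sum_i _; set S0 := \sum_i _ => TE.
have -> : S1 = S0 - (K 0 - F 0 * G 0) + (K 1 - F 0 * G 1) by rewrite -TE subrK.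
by ring.
Unshelve. all: by end_near. Qed.

End Path.

End PathSide.

(** * Logarithms along a path *)

Section Logarithms.
Context (R : realType).
Local Notation C := R[i].

Lemma expC_surj (z : C) : z != 0 -> exists w, expC w = z.
Proof.
move=> z0; have r0 : 0 < cmod z by rewrite cmod_gt0.
pose u := ((cmod z)^-1)%:C * z.
have u1 : complex.Re u ^+ 2 + complex.Im u ^+ 2 = 1.
  have : cmod u = 1 by rewrite cmodM cmod_real gtr0_norm ?invr_gt0 // mulVf // gt_eqF.
  rewrite /cmod; case: (u) => a b /= h; apply: (@pexpIrn _ 1 isT); rewrite ?nnegrE ?ler01 //.
    by rewrite addr_ge0 ?sqr_ge0.
  rewrite expr1 expr1n -[LHS]sqr_sqrtr ?addr_ge0 ?sqr_ge0 //.
  by rewrite h expr1n.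
set a := complex.Re u in u1; set b := complex.Im u in u1.
have a1 : -1 <= a <= 1.
  by rewrite -ler_norml -(@ler_pXn2r _ 2) ?nnegrE ?normr_ge0 ?ler01 // expr1n real_normK ?num_real // -u1 lerDl sqr_ge0.
have [th [cth sth]] : exists th : R, cos th = a /\ sin th = b.
  have ca : cos (acos a) = a by apply: acosK; rewrite in_itv.
  have sa : sin (acos a) = `|b|.
    by rewrite sin_acos // -u1 addrAC subrr add0r sqrtr_sqr.
  have [b0|b0] := leP 0 b; first by exists (acos a); rewrite ca sa ger0_norm.
  by exists (- acos a); rewrite cosN sinN ca sa ltr0_norm // opprK.
exists (ln (cmod z) +i* th).
rewrite /expC /= lnK ?posrE // cth sth.
have -> : a +i* b = u by rewrite /a /b; case: (u).
by rewrite /u mulrA -rmorphM mulfV ?gt_eqF // rmorph1 mul1r.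
Qed.

(** A continuous argument of w gives a continuous logarithm of w, which increases by 2 i
    pi; adding lam o w, which is a function of the closed path w, does not change the
    increment. *)
Lemma path_log (w : R -> C) (theta : R -> R) (lam : C -> C) :
  (forall t, cont_at w t) -> (forall t, {for t, continuous theta}) ->
  (forall t, w t != 0) -> (forall t, cont_at lam (w t)) ->
  w 1 = w 0 -> theta 1 = theta 0 + 1 ->
  (forall t, 0 <= t <= 1 -> w t = (cmod (w t))%:C * unit_circle (theta t)) ->
  exists ell : R -> C, [/\ forall t, cont_at ell t, ell 1 = ell 0 + (0 +i* (2 * pi)) &
    forall t, 0 <= t <= 1 -> expC (ell t) = w t * expC (lam (w t))].
Proof.
move=> wc thc w0 lamc w10 th10 wE.
exists (fun t => (ln (cmod (w t)) +i* (2 * pi * theta t)) + lam (w t)); split.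
- move=> t; apply: cont_atD.
    apply: cont_ReIm => /=.
      have mc : {for t, continuous (fun t => cmod (w t))}.
        move=> P /= /nearRP[d d0 dP]; have /cont_at_nearP h := wc t.
        apply: filterS (h d d0) => v vd; apply: dP; apply: le_lt_trans vd.
        rewrite ler_norml; apply/andP; split.
          rewrite lerNl opprB lerBlDr; have := cmodB_le (w t) (w v).
          have -> : cmod (w v - w t) = cmod (w t - w v) by rewrite -cmodN opprB.
          by have := cmodD (w t - w v) (w v); rewrite subrK.
        by rewrite lerBlDr; have := cmodD (w v - w t) (w t); rewrite subrK.
      have h : {for t, continuous (@ln R \o (fun t => cmod (w t)))}.
        by apply: continuous_comp => //; apply: continuous_ln; rewrite cmod_gt0.
      exact: h.
    have h : {for t, continuous (fun t => 2 * pi * theta t)}.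
      by apply: continuousM; [exact: cst_continuous|exact: thc].
    exact: h.
  by apply/cont_atE; apply: (@continuous_comp _ _ _ w lam); apply/cont_atE.
- rewrite w10 th10; apply: complex_ext; rewrite !ReE /=; ring.
move=> t t01; rewrite expCD; congr (_ * _).
rewrite [RHS](wE t t01) unit_circleE.
have -> : ln (cmod (w t)) +i* (2 * pi * theta t) = (ln (cmod (w t)))%:C + (0 +i* (2 * pi * theta t)).
  by apply: complex_ext; rewrite !ReE /=; ring.
by rewrite expCD expC_real lnK // posrE cmod_gt0.
Qed.

End Logarithms.

(** * The double products as exponentials *)

Section Products.
Context (R : realType) (A : comFalgType R[i]) (m : {pred A}).
Context (n : nat) (e : n.+1.-tuple A).
Local Notation C := R[i].
Hypothesis localA : local_with_maximal_ideal m.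
Hypothesis basis_e : basis_of {:A} e.
Hypothesis e0 : tnth e ord0 = 1.
Hypothesis em : forall i, i != ord0 -> tnth e i \in m.

Lemma fsbig_positive (F : nat -> A) (M : nat) : (forall j, (M < j)%N -> F j = 1) ->
  \big[*%R/1]_(j \in [set j : nat | (0 < j)%N]) F j = \prod_(j <- iota 1 M) F j.
Proof.
move=> F1; rewrite -(@fsbig_widen _ _ _ _ [set` iota 1 M]).
- by rewrite -fsbig_seq ?iota_uniq.
- by move=> j /=; rewrite mem_iota => /andP[].
move=> j [/= j0 jM]; apply: F1; rewrite ltnNge; apply/negP => jM'; apply: jM.
by rewrite mem_iota j0 add1n ltnS.
Qed.

Lemma expA_pair_log N M (a b : int -> A) : (forall j, j < 0 -> a j \in m) ->
  expA m (pair_log N M a b) = \prod_(p <- iota 1 N) \prod_(q <- iota 1 M)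
    (1 - a (- p%:Z) ^+ (q %/ gcdn p q) * b q%:Z ^+ (p %/ gcdn p q)) ^+ gcdn p q.
Proof.
move=> am; rewrite /pair_log (expA_sum localA basis_e e0 em); apply: eq_big_seq => p.
rewrite mem_iota => /andP[p1 _]; rewrite (expA_sum localA basis_e e0 em); apply: eq_big_seq => q.
rewrite mem_iota => /andP[q1 _]; rewrite (expAMn localA basis_e e0 em) (expA_lg localA basis_e e0 em) //.
rewrite mulrC; apply: (m_M localA).
have : (0 < q %/ gcdn p q)%N by rewrite divn_gt0 ?gcdn_gt0 ?p1 // dvdn_leq // dvdn_gcdr.
case: (q %/ gcdn p q)%N => // k _; apply: (m_X localA); apply: am; clear -p1; lia.
Qed.

(** For k > N the coefficient vanishes; for j > N dim A and k <= N, the exponent is at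
    least dim A because gcd(j, k) <= N. *)
Lemma trivial_factor (N k j : nat) (a b : int -> A) : (forall j, j < 0 -> a j \in m) ->
  (forall j : int, j < - N%:Z -> a j = 0) -> (0 < j)%N -> (0 < k)%N ->
  (N < k)%N || (N * \dim {:A} < j)%N ->
  a (- k%:Z) ^+ (j %/ gcdn j k) = 0.
Proof.
move=> am a0 j0 k0.
have g0 : (0 < gcdn j k)%N by rewrite gcdn_gt0 j0.
have jg : (0 < j %/ gcdn j k)%N by rewrite divn_gt0 // dvdn_leq // dvdn_gcdl.
have [kN _|kN] := ltnP N k.
  by rewrite a0 ?expr0n ?gtn_eqF //; clear -kN; lia.
rewrite /= => jN; apply: (m_nilpotent_ge localA); first by apply: am; clear -k0; lia.
rewrite leq_divRL //.
have gk : (gcdn j k <= N)%N by apply: leq_trans kN; rewrite dvdn_leq // dvdn_gcdr.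
by rewrite (leq_trans _ (ltnW jN)) // mulnC leq_mul.
Qed.

Lemma numerator_prod N M (a b : int -> A) : (forall j, j < 0 -> b j \in m) ->
  (forall j : int, j < - N%:Z -> b j = 0) -> (N * \dim {:A} <= M)%N ->
  \big[*%R/1]_(j \in [set j : nat | (0 < j)%N])
    \big[*%R/1]_(k \in [set k : nat | (0 < k)%N])
      (1 - a j%:Z ^+ (k %/ gcdn j k) * b (- k%:Z) ^+ (j %/ gcdn j k)) ^+ gcdn j k =
  expA m (pair_log N M b a).
Proof.
move=> bm b0 NM; rewrite expA_pair_log //.
have F1 j k : (0 < j)%N -> (0 < k)%N -> (N < k)%N || (N * \dim {:A} < j)%N ->
    (1 - a j%:Z ^+ (k %/ gcdn j k) * b (- k%:Z) ^+ (j %/ gcdn j k)) ^+ gcdn j k = 1.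
  by move=> j0 k0 h; rewrite (trivial_factor a bm b0 j0 k0 h) mulr0 subr0 expr1n.
transitivity (\big[*%R/1]_(j \in [set j : nat | (0 < j)%N])
    \prod_(k <- iota 1 N) (1 - a j%:Z ^+ (k %/ gcdn j k) * b (- k%:Z) ^+ (j %/ gcdn j k)) ^+ gcdn j k).
  apply: eq_fsbigr => j; rewrite inE /= => j0; apply: fsbig_positive => k kN.
  by apply: F1 => //; [exact: leq_ltn_trans kN|rewrite kN].
rewrite (@fsbig_positive _ M) => [|j jM].
  rewrite exchange_big /=; apply: eq_bigr => p _; apply: eq_bigr => q _.
  by rewrite gcdnC mulrC.
rewrite big_seq big1 // => k; rewrite mem_iota => /andP[k0 _].
by apply: F1 => //; [exact: leq_ltn_trans jM|rewrite (leq_ltn_trans NM jM) orbT].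
Qed.

Lemma denominator_prod N M (a b : int -> A) : (forall j, j < 0 -> a j \in m) ->
  (forall j : int, j < - N%:Z -> a j = 0) -> (N * \dim {:A} <= M)%N ->
  \big[*%R/1]_(j \in [set j : nat | (0 < j)%N])
    \big[*%R/1]_(k \in [set k : nat | (0 < k)%N])
      (1 - a (- j%:Z) ^+ (k %/ gcdn j k) * b k%:Z ^+ (j %/ gcdn j k)) ^+ gcdn j k =
  expA m (pair_log N M a b).
Proof.
move=> am a0 NM; rewrite expA_pair_log //.
have F1 j k : (0 < j)%N -> (0 < k)%N -> (N < j)%N || (N * \dim {:A} < k)%N ->
    (1 - a (- j%:Z) ^+ (k %/ gcdn j k) * b k%:Z ^+ (j %/ gcdn j k)) ^+ gcdn j k = 1.
  move=> j0 k0 h; have := trivial_factor a am a0 k0 j0 h; rewrite gcdnC => ->.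
  by rewrite mul0r subr0 expr1n.
rewrite (@fsbig_positive _ N) => [|j jN].
  apply: eq_big_seq => j; rewrite mem_iota => /andP[j0 jN].
  apply: fsbig_positive => k kM; apply: F1 => //; first exact: leq_ltn_trans kM.
  by rewrite (leq_ltn_trans NM kM) orbT.
rewrite (@fsbig_positive _ 0) ?big_nil // => k k0; apply: F1 => //; first exact: leq_ltn_trans jN.
by rewrite jN.
Qed.

End Products.

(** * The homotopy from sigma to a small loop around s *)

Section Homotopy.
Context (R : realType) (X : riemannSurfaceType R).
Local Notation C := R[i].
Local Notation cid := (@cont_at_id R _).

Lemma chart_shift_cont (c : chart R X) (s : X) : chart_dom c s ->
  {for s, continuous (fun p => c p - c s)}.
Proof.
move=> cs; apply/cont_atE; apply: cont_atD; last exact: (cont_at_cst (- c s)).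
by apply/cont_atE; exact: chart_cont.
Qed.

(** Both coordinates have a simple zero at s, so that their quotient extends to s with a
    nonzero value, and nonzero germs have logarithms. *)
Lemma log_ratio (s : X) (x : chart R X) : uniformizer s x ->
  exists lam : C -> C, (\forall u \near (0 : C), cont_at lam u) /\
    \forall q \near s, x q = (chart_at s q - chart_at s s) * expC (lam (chart_at s q - chart_at s s)).
Proof.
move=> [xs x0 xt xt']; pose c := chart_at s; have cs : chart_dom c s := chart_at_dom s.
pose phi u := x (chart_inv c (c s + u)).
have phih : hol 0 phi.
  have /nearCP[d d0 dP] := xt' s s cs xs.
  apply/nearCP; exists d => // u; rewrite subr0 => ud.
  have h := dP (c s + u); rewrite addrAC subrr add0r in h.
  exists (1 * derive1 (x \o chart_inv c) (c s + u)).
  have sh : rder id (id \o (fun u : C => c s + u)) u 1.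
    have h1 := rderD (rder_cst id u (c s)) (rder_id id u); rewrite add0r in h1; exact: h1.
  have shc : {for u, continuous (fun u : C => c s + u)}.
    have sh' : rder id (fun u : C => c s + u) u 1 by exact: sh.
    by apply/cont_atE; exact: (rder_cont (cont_at_id u) sh').
  exact: rder_comp shc sh (derivable_rder (h ud)).
have [q [qh qE]] := hol_divide phih.
have phi0 : phi 0 = 0 by rewrite /phi addr0 chart_invK.
have xE : \forall p \near s, x p = (c p - c s) * q (c p - c s).
  have shc := chart_shift_cont cs.
  have qE' : \forall u \near c s - c s, phi u = phi 0 + u * q u by rewrite subrr.
  have h := cont_near shc qE'.
  apply: filterS2 h (chart_dom_near cs) => p; rewrite phi0 add0r => <- cp.
  by rewrite /phi addrC subrK chart_invK.
have [t tP] := rder_transition (xt' s) cs xs; have [t' t'P] := rder_transition (xt s) xs cs.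
have t't : t' * t = 1.
  have h : rder x (x \o id) (id s) (t' * t) by apply: (@rder_comp R X X x c x id s t' t) => //.
  exact: rder_uniq (chart_accum xs) h (rder_id x s).
have qt : q 0 = t.
  have [d qd] := nbhs_singleton qh.
  have h1 := rderM (cont_at_id 0) (rder_id id 0) qd.
  have hB := rderB (rder_id c s) (rder_cst c s (c s)).
  have hB' : rder c (id \o (fun p => c p - c s)) s (1 - 0) by exact: hB.
  have shc := chart_shift_cont cs.
  have h1' : rder id (fun z : C => z * q z) (c s - c s) (1 * q 0 + 0 * d) by rewrite subrr; exact: h1.
  have h2 := rder_comp shc hB' h1'.
  have h3 : rder c x s ((1 - 0) * (1 * q 0 + 0 * d)) by apply: rder_near h2; apply: filterS xE => p ->.
  have := rder_uniq (chart_accum cs) h3 tP; rewrite subr0 !mul1r mul0r addr0; exact.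
have q0 : q 0 != 0.
  by rewrite qt; apply: contra_eq_neq t't => ->; rewrite mulr0 eq_sym oner_neq0.
have [w0 w0E] := expC_surj q0; have [L [Lq Lexp Ld]] := log_ex w0E.
exists (L \o q).
have qc0 : {for 0, continuous q} by apply/cont_atE; exact: hol_cont.
split.
  have h1 := cont_near qc0 Ld.
  apply: filterS2 qh h1 => u [d qd] Lu.
  have qc := rder_cont (cont_at_id u) qd; have Lc := rder_cont (cont_at_id (q u)) Lu.
  by apply/cont_atE; apply: continuous_comp; apply/cont_atE.
have shc := chart_shift_cont cs.
have h0 : \forall u \near c s - c s, expC (L (q u)) = q u by rewrite subrr; exact: cont_near qc0 Lexp.
by apply: filterS2 xE (cont_near shc h0) => p -> /= ->.
Qed.

Lemma cont_unit_circle t : cont_at (@unit_circle R) t.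
Proof.
have lin : {for t, continuous (fun t : R => 2 * pi * t)}.
  by apply: continuousM; [exact: cst_continuous|exact: cvg_id].
apply: cont_ReIm.
  have h : {for t, continuous (@cos R \o (fun t : R => 2 * pi * t))}.
    by apply: continuous_comp => //; exact: continuous_cos.
  exact: h.
have h : {for t, continuous (@sin R \o (fun t : R => 2 * pi * t))}.
  by apply: continuous_comp => //; exact: continuous_sin.
exact: h.
Qed.

Lemma cmod_unit_circle (t : R) : cmod (unit_circle t) = 1.
Proof. by rewrite unit_circleE cmod_expC /= expR0. Qed.

Lemma unit_circle1 : unit_circle 1 = unit_circle 0 :> C.
Proof.
rewrite !unit_circleE mulr1 mulr0 expC_2pi.
by have -> : (0 +i* 0 : C) = 0 by []; rewrite expC0.
Qed.

(** For Re z = 1 the unit circle and for Re z = 0 the circle of radius r around z0, both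
    parametrised by Im z, with the segments between them; clamping makes it a map on the
    plane. *)
Definition annulus_map (z0 : C) (r : R) (z : C) : C :=
  let tau := clamp 0 1 (complex.Re z) in
  (1 - tau)%:C * (z0 + r%:C * unit_circle (complex.Im z)) + tau%:C * unit_circle (complex.Im z).

Lemma annulus_map_cont z0 r z : cont_at (annulus_map z0 r) z.
Proof.
have ec : cont_at (fun z : C => unit_circle (complex.Im z)) z.
  move=> eps eps0; have /nearRP[d d0 dP] := cont_unit_circle (complex.Im z) eps0.
  apply/nearCP; exists d => // w wz; apply: dP; apply: le_lt_trans wz.
  by have := Im_le_cmod (w - z); rewrite !ReE.
have tc : cont_at (fun z : C => (clamp 0 1 (complex.Re z))%:C) z.
  move=> eps eps0; apply/nearCP; exists eps => // w wz.
  rewrite -rmorphB cmod_real (le_trans (clamp_lip _ _ ler01)) // (le_trans _ (ltW wz)) //.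
  by have := Re_le_cmod (w - z); rewrite !ReE.
have t1c : cont_at (fun z : C => (1 - clamp 0 1 (complex.Re z))%:C) z.
  have -> : (fun z : C => (1 - clamp 0 1 (complex.Re z))%:C) =
            (fun z : C => 1 + - (clamp 0 1 (complex.Re z))%:C).
    by apply/funext => w; rewrite rmorphB rmorph1.
  by apply: cont_atD; [exact: cont_at_cst|exact: cont_atN].
apply: cont_atD; last exact: cont_atM.
apply: cont_atM => //; apply: cont_atD; first exact: cont_at_cst.
by apply: cont_atM => //; exact: cont_at_cst.
Qed.

Lemma annulus_map_bound z0 r z : 0 <= r -> cmod z0 + r <= 1 -> cmod (annulus_map z0 r z) <= 1.
Proof.
move=> r0 zr; rewrite /annulus_map; have := clampP (complex.Re z) (@ler01 R).
set tau := clamp _ _ _; set u := unit_circle _ => /andP[t0 t1].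
have u1 : cmod u = 1 by exact: cmod_unit_circle.
rewrite (le_trans (cmodD _ _)) // !cmodM !cmod_real u1 mulr1 !ger0_norm ?subr_ge0 //.
have h : cmod (z0 + r%:C * u) <= 1.
  by rewrite (le_trans (cmodD _ _)) // cmodM cmod_real u1 mulr1 ger0_norm.
have : (1 - tau) * cmod (z0 + r%:C * u) <= (1 - tau) * 1 by rewrite ler_wpM2l // subr_ge0.
by lra.
Qed.

(** At time tau, the equality with z0 would give ((1 - tau) r + tau) u = tau z0 with |u|
    = 1, but |z0| < 1. *)
Lemma annulus_map_neq z0 r z : 0 < r -> cmod z0 < 1 -> annulus_map z0 r z != z0.
Proof.
move=> r0 z1; rewrite /annulus_map; have := clampP (complex.Re z) (@ler01 R).
set tau := clamp _ _ _; set u := unit_circle _ => /andP[t0 t1].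
have u1 : cmod u = 1 by exact: cmod_unit_circle.
apply/eqP => E.
have E2 : ((1 - tau) * r + tau)%:C * u = tau%:C * z0.
  have H : ((1 - tau) * r + tau)%:C * u - tau%:C * z0 =
      ((1 - tau)%:C * (z0 + r%:C * u) + tau%:C * u) - z0.
    by rewrite !(rmorphD, rmorphM, rmorphB, rmorph1) /=; ring.
  by apply/eqP; rewrite -subr_eq0 H E subrr.
have p0 : 0 <= (1 - tau) * r by rewrite mulr_ge0 ?subr_ge0 // ltW.
have : cmod (((1 - tau) * r + tau)%:C * u) = cmod (tau%:C * z0) by rewrite E2.
rewrite !cmodM !cmod_real u1 mulr1 !ger0_norm ?addr_ge0 // => E3.
have t0' : tau * (1 - cmod z0) = - ((1 - tau) * r) by rewrite mulrBr mulr1 -E3; ring.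
have z1' : 0 < 1 - cmod z0 by rewrite subr_gt0.
have : 0 <= tau * (1 - cmod z0) by rewrite mulr_ge0 // ltW.
rewrite t0' oppr_ge0 => h.
have /eqP := le_anti (introT andP (conj h p0)); rewrite mulf_eq0 (gt_eqF r0) orbF subr_eq0 => /eqP t1E.
by move/eqP: t0'; rewrite -t1E subrr mul0r oppr0 mul1r subr_eq0 => /eqP E4; move: z1; rewrite -E4 ltxx.
Qed.

(** The disk bounded by sigma carries the homotopy from the unit circle to a small
    circle around z0, and Z meets the disk at most in h z0 = s. The orientation
    hypothesis on h says that the small loop winds once around s. *)
Lemma homotopy_to_s (sigma : R -> X) (s : X) (Z : set X) (P : X -> Prop) :
  encircles_only sigma s Z -> (\forall q \near s, P q) ->
  exists (Th : C -> X) (theta : R -> R),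
  [/\ forall z, {for z, continuous Th},
      forall z, ~ Z (Th z) /\ Th z != s,
      (forall t, 0 <= t <= 1 -> Th (1 +i* t) = sigma t) /\ (forall t, Th (t +i* 1) = Th (t +i* 0)),
      forall t, P (Th (0 +i* t)) &
      [/\ forall t, {for t, continuous theta}, theta 1 = theta 0 + 1 &
        forall t, 0 <= t <= 1 -> chart_at s (Th (0 +i* t)) - chart_at s s =
          (cmod (chart_at s (Th (0 +i* t)) - chart_at s s))%:C * unit_circle (theta t)]].
Proof.
move=> [h [z0 [[hc hi] sE [z01 hz0] hZ wind]]] sP.
have DE z : [set z : C | `|z| <= 1] z <-> cmod z <= 1 by rewrite /= cmodE -[1]/(1%:C) lecR.
have m1 : cmod z0 < 1 by move: z01; rewrite cmodE -[1]/(1%:C) ltcR.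
have hc0 : {for z0, continuous h}.
  move=> Q /= hQ; have := (subspace_continuousP _ _).1 hc z0 ((DE z0).2 (ltW m1)) Q hQ => hW.
  have hW' : \forall z \near z0, [set z : C | `|z| <= 1] z -> Q (h z) by exact: hW.
  have nD : \forall z \near z0, [set z : C | `|z| <= 1] z.
    apply/nearCP; exists (1 - cmod z0); rewrite ?subr_gt0 // => z zz0; apply/DE.
    by have := cmodD (z - z0) z0; rewrite subrK; move: zz0; lra.
  by apply: filterS2 hW' nD => z Qz Dz; exact: Qz.
have sP' : \forall q \near h z0, P q by rewrite hz0.
have /nearCP[rho rho0 rhoP] := cont_near hc0 sP'.
have [r [r0 rrho r1 rw]] : exists r : R, [/\ 0 < r, r < rho, r <= 1 - cmod z0 &
    winds_around_zero (fun t => chart_at s (h (z0 + r%:C * unit_circle t)) - chart_at s s) 1].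
  have H : \forall r \near (0 : R)^'+, [/\ 0 < r, r < rho, r <= 1 - cmod z0 &
      winds_around_zero (fun t => chart_at s (h (z0 + r%:C * unit_circle t)) - chart_at s s) 1].
    have h1 := nbhs_right_gt (0 : R); have h2 := nbhs_right_lt rho0.
    have z1' : 0 < 1 - cmod z0 by rewrite subr_gt0.
    have h3 := nbhs_right_ltW z1'.
    by apply: filterS2 (filterI h1 h2) (filterI h3 wind) => r [? ?] [? ?].
  by have [r] := filter_ex H; exists r.
have [theta [thc th1 thE]] := rw.
have zr : cmod z0 + r <= 1 by lra.
have DY z : [set z : C | `|z| <= 1] (annulus_map z0 r z).
  by apply/DE; apply: annulus_map_bound => //; exact: ltW.
have Thc z : {for z, continuous (h \o annulus_map z0 r)}.
  by apply: (within_comp hc DY); apply/cont_atE; exact: annulus_map_cont.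
have Ths z : h (annulus_map z0 r z) != s.
  apply/eqP => E; have /negP := annulus_map_neq z r0 m1; apply; apply/eqP.
  exact: (hi _ _ (mem_set (DY z)) (mem_set ((DE z0).2 (ltW m1))) (etrans E (esym hz0))).
have A0 t : annulus_map z0 r (0 +i* t) = z0 + r%:C * unit_circle t.
  by rewrite /annulus_map /= clamp_id ?lexx ?ler01 // subr0 rmorph1 mul1r rmorph0 mul0r addr0.
exists (h \o annulus_map z0 r), (theta \o clamp 0 1); split=> //.
- move=> z; split; last exact: Ths.
  by move=> /= Zz; have := Ths z; rewrite (hZ _ (DY z) Zz) eqxx.
- split=> t.
    move=> t01; rewrite sE ?in_itv //=; congr h; rewrite /annulus_map /= clamp_id ?lexx ?ler01 //.
    by rewrite subrr rmorph0 mul0r add0r rmorph1 mul1r.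
  by rewrite /= /annulus_map /= unit_circle1.
- move=> t /=; rewrite A0; apply: rhoP; rewrite addrAC subrr add0r cmodM cmod_real.
  by rewrite cmod_unit_circle mulr1 gtr0_norm.
split.
- move=> t; apply: (within_comp thc); last exact: clamp_cont.
  by move=> v; rewrite /= in_itv /= clampP ?ler01.
- by rewrite /= !clamp_id ?lexx ?ler01 // th1.
move=> t t01; have [|_ E] := thE t; first by rewrite in_itv.
by rewrite /= A0 clamp_id // {1}E cmodE.
Qed.

End Homotopy.

(** * The period of the lift *)

Section Monodromy.
Context (R : realType) (X : riemannSurfaceType R) (A : comFalgType R[i]) (m : {pred A}).
Context (n : nat) (e : n.+1.-tuple A).
Local Notation C := R[i].
Hypothesis localA : local_with_maximal_ideal m.
Hypothesis basis_e : basis_of {:A} e.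
Hypothesis e0 : tnth e ord0 = 1.
Hypothesis em : forall i, i != ord0 -> tnth e i \in m.
Variables f g : meromorphicA X n.
Local Notation Z := (zero_or_pole f `|` zero_or_pole g).
Local Notation seg := (@unit_segment R).

Lemma lift_eq (T : topologicalType) (S : set T) (Th Th' : T -> X) F G K :
  (forall z, S z -> Th z = Th' z) -> lift e f g S Th F G K -> lift e f g S Th' F G K.
Proof.
move=> TT L z Sz; have [F0 [G0 [K0 [P H]]]] := L z Sz.
exists F0, G0, K0; rewrite -TT //; split=> //; apply: filterS H => w h Sw.
by rewrite -TT //; exact: h.
Qed.

(** By triple_exp, the quotient of exp F by f is locally constant along the path. *)
Lemma lift_exp (Th : R -> X) F G K : (forall t : R, {for t, continuous Th}) ->
  (forall t : R, 0 <= t <= 1 -> ~ Z (Th t)) -> lift e f g seg Th F G K ->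
  forall t : R, 0 <= t <= 1 ->
  expA m (F t) * (valueA e f (Th t))^-1 = expA m (F 0) * (valueA e f (Th 0))^-1 /\
  expA m (G t) * (valueA e g (Th t))^-1 = expA m (G 0) * (valueA e g (Th 0))^-1.
Proof.
move=> Tc TZ L; apply: segment_ind => // t t01.
have [F0 [G0 [K0 [P H]]]] := L t t01.
have h := cont_near (Tc t) (triple_exp localA basis_e e0 em (TZ t t01) P).
have [Et Et' _] := nbhs_singleton H t01.
apply: filterS2 H h => u Hu [h1 h2] u01; have [-> -> _] := Hu u01.
by rewrite h1 h2 Et Et'.
Qed.

Lemma seg0 : seg 0.
Proof. by apply/andP; split; [exact: lexx|exact: ler01]. Qed.

Lemma seg1 : seg 1.
Proof. by apply/andP; split; [exact: ler01|exact: lexx]. Qed.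

Lemma col_cont (a t : R) : {for t, continuous (fun t : R => a +i* t : C)}.
Proof. by apply/cont_atE; apply: cont_ReIm => /=; [exact: cst_continuous|exact: cvg_id]. Qed.

Lemma row_cont (b t : R) : {for t, continuous (fun t : R => t +i* b : C)}.
Proof. by apply/cont_atE; apply: cont_ReIm => /=; [exact: cvg_id|exact: cst_continuous]. Qed.

Section Square.
Variable Th : C -> X.
Hypothesis Thc : forall z, {for z, continuous Th}.
Hypothesis ThZ : forall z, ~ Z (Th z).

Lemma lift_column a F G K : 0 <= a <= 1 -> lift e f g (rect 0 1 0 1) Th F G K ->
  lift e f g seg (fun t => Th (a +i* t)) (fun t => F (a +i* t)) (fun t => G (a +i* t))
    (fun t => K (a +i* t)).
Proof.
move=> a01 L.
have S (t : R) : seg t -> rect 0 1 0 1 (a +i* t) by move=> t01; split; [exact: a01|exact: t01].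
exact: (lift_comp S (fun t _ => @col_cont a t) L).
Qed.

Lemma lift_row b F G K : 0 <= b <= 1 -> lift e f g (rect 0 1 0 1) Th F G K ->
  lift e f g seg (fun t => Th (t +i* b)) (fun t => F (t +i* b)) (fun t => G (t +i* b))
    (fun t => K (t +i* b)).
Proof.
move=> b01 L.
have S (t : R) : seg t -> rect 0 1 0 1 (t +i* b) by move=> t01; split; [exact: t01|exact: b01].
exact: (lift_comp S (fun t _ => @row_cont b t) L).
Qed.

(** The lift of the square may be shifted so as to agree with the given one at the
    corner; by lift_path they then agree on the whole side. *)
Lemma square_lift_from Fe Ge Ke : lift e f g seg (fun t => Th (0 +i* t)) Fe Ge Ke ->
  exists F G K, lift e f g (rect 0 1 0 1) Th F G K /\
    forall t : R, 0 <= t <= 1 -> [/\ F (0 +i* t) = Fe t, G (0 +i* t) = Ge t & K (0 +i* t) = Ke t].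
Proof.
move=> Le; have [F [G [K L]]] := square_lift localA basis_e e0 em Thc ThZ.
have z01 := seg0.
have Tc (t : R) : 0 <= t <= 1 -> {for t, continuous (fun t : R => Th (0 +i* t))}.
  by move=> _; apply: continuous_comp; [exact: col_cont|exact: Thc].
have H := lift_path basis_e Tc (lift_column z01 L) Le.
set a := Fe 0 - F (0 +i* 0) in H; set b := Ge 0 - G (0 +i* 0) in H.
set c := _ - a * _ in H.
exists (fun q => F q + a), (fun q => G q + b), (fun q => K q + a * G q + c).
split; first exact: (lift_shift basis_e a b c L).
by move=> t /H[-> -> ->].
Qed.

(** The two horizontal sides are the same path, so the lifts over them differ by an
    element of the Heisenberg group, which is read off at the left ends: it is the
    monodromy around s. *)
Lemma square_period F G K : lift e f g (rect 0 1 0 1) Th F G K ->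
  (forall t : R, Th (t +i* 1) = Th (t +i* 0)) ->
  [/\ F (1 +i* 1) = F (1 +i* 0) + (F (0 +i* 1) - F (0 +i* 0)),
      G (1 +i* 1) = G (1 +i* 0) + (G (0 +i* 1) - G (0 +i* 0)) &
      K (1 +i* 1) = K (1 +i* 0) + (F (0 +i* 1) - F (0 +i* 0)) * G (1 +i* 0) +
        (K (0 +i* 1) - K (0 +i* 0) - (F (0 +i* 1) - F (0 +i* 0)) * G (0 +i* 0))].
Proof.
move=> L Tper.
have z01 := seg0.
have o01 := seg1.
have Tc (t : R) : 0 <= t <= 1 -> {for t, continuous (fun t : R => Th (t +i* 0))}.
  by move=> _; apply: continuous_comp; [exact: row_cont|exact: Thc].
have L1 := lift_eq (fun t _ => Tper t) (lift_row o01 L).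
exact: (lift_path basis_e Tc (lift_row z01 L) L1 o01).
Qed.

End Square.

(** With F0, G0, K0 the explicit lift near s as functions of the logarithm l, and F1, G1
    the values at the base point P of the loop, the left side is the iterated integral
    along sigma. It does not depend on U, V, Y and l, which are the same before and
    after the loop around s. *)
Lemma period_identity (nu mu l P : C) (U V rho Y F1 G1 : A) :
  let F0 l := (nu * l)%:A + U in let G0 l := (mu * l)%:A + V in
  let K0 l := (nu * mu / 2 * l ^+ 2)%:A + (nu * l) *: V + l *: rho + Y in
  let a := F0 (l + P) - F0 l in
  a * G1 + (K0 (l + P) - K0 l - a * G0 l) - F1 * (G0 (l + P) - G0 l) =
  P *: (nu *: G1 - mu *: F1 + rho + (nu * mu * (P / 2))%:A).
Proof.
move=> F0 G0 K0 a.
rewrite {}/a {}/F0 {}/G0 {}/K0.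
have -> : nu * mu / 2 * (l + P) ^+ 2 =
  nu * mu / 2 * l ^+ 2 + (nu * mu * l * P + P * (nu * mu * (P / 2))) by field.
have [al [alM alD] alS] : exists2 al : C -> A,
    (forall c d, al (c * d) = al c * al d) /\ (forall c d, al (c + d) = al c + al d) &
    forall c y, c *: y = al c * y.
  exists (fun c => c%:A) => [|c y]; last by rewrite mulr_algl.
  by split=> c d; [rewrite mulr_algl scalerA|rewrite scalerDl].
by rewrite !alS !(alD, alM); ring.
Qed.

(** The power c^k and exp U cancel, and the constant a0 of the expansion remains. *)
Lemma expA_log_value (k : int) (l c : C) (U a0 v : A) : expC l = c -> a0 \is a GRing.unit ->
  v = c ^ k *: (a0 * expA m U) -> expA m ((k%:~R * l)%:A + U) * v^-1 = a0^-1.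
Proof.
move=> lc a0U vE.
have c0 : c != 0 by rewrite -lc expC_neq0.
have EU : expA m U \is a GRing.unit by exact: (expA_unit localA basis_e e0 em).
have ck : c ^ k != 0 by rewrite expfz_neq0.
have E : expA m ((k%:~R * l)%:A + U) = c ^ k *: expA m U.
  rewrite (expAD localA basis_e e0 em) -scalerA scaler_int (expAMz localA basis_e e0 em).
  by rewrite (expA_alg localA basis_e e0 em) lc -(rmorphXz (in_alg A)) ?unitfE //= mulr_algl.
have vE' : v = a0 * expA m ((k%:~R * l)%:A + U).
  by rewrite E vE; exact: scalerAr.
rewrite vE'.
have EF := expA_unit localA basis_e e0 em ((k%:~R * l)%:A + U).
by rewrite invrM // mulrA mulrV // mul1r.
Qed.

End Monodromy.

(** * The theorem *)

Lemma exprzM_unit (A : comUnitRingType) (y z : A) (k : int) : y \is a GRing.unit -> z \is a GRing.unit ->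
  (y * z) ^ k = y ^ k * z ^ k.
Proof. by move=> yU zU; apply: exprMz_comm => //; exact: mulrC. Qed.

Lemma final_algebra (A : comUnitRingType) (nu mu : int) (EF EG vf vg a0 b0 x y : A) :
  a0 \is a GRing.unit -> b0 \is a GRing.unit -> vf \is a GRing.unit -> vg \is a GRing.unit ->
  y \is a GRing.unit -> EF * vf^-1 = a0^-1 -> EG * vg^-1 = b0^-1 ->
  EG ^ nu * (EF ^ mu)^-1 * (x / y) = (vg ^ nu * a0 ^ mu * x) / (vf ^ mu * b0 ^ nu * y).
Proof.
move=> a0U b0U vfU vgU yU EFE EGE.
have -> : EF = a0^-1 * vf by rewrite -EFE divrK.
have -> : EG = b0^-1 * vg by rewrite -EGE divrK.
rewrite !exprzM_unit ?unitrV // !exprz_inv -!invr_expz.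
have [aU bU fU] : [/\ a0 ^ mu \is a GRing.unit, b0 ^ nu \is a GRing.unit & vf ^ mu \is a GRing.unit].
  by split; exact: unitrXz.
rewrite !invrM ?unitrM ?unitrV ?bU ?fU ?aU // invrK.
move: (vg ^ nu) (a0 ^ mu) (b0 ^ nu)^-1 (vf ^ mu)^-1 y^-1 => p q r t u; ring.
Qed.

Section Final.
Context (R : realType) (X : riemannSurfaceType R) (A : comFalgType R[i]) (m : {pred A}).
Context (n : nat) (e : n.+1.-tuple A).
Local Notation C := R[i].
Hypothesis localA : local_with_maximal_ideal m.
Hypothesis basis_e : basis_of {:A} e.
Hypothesis e0 : tnth e ord0 = 1.
Hypothesis em : forall i, i != ord0 -> tnth e i \in m.
Variables f g : meromorphicA X n.
Local Notation Z := (zero_or_pole f `|` zero_or_pole g).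

(** The sign comes from exp (i pi) = -1. *)
Lemma expA_monodromy (nu mu : int) (F1 G1 rho rho' : A) :
  expA m ((0 +i* (2 * pi))^-1 *: ((0 +i* (2 * pi)) *:
    (nu%:~R *: G1 - mu%:~R *: F1 + (rho - rho') + (nu%:~R * mu%:~R * ((0 +i* (2 * pi)) / 2))%:A))) =
  (-1) ^ (nu * mu) * (expA m G1 ^ nu * (expA m F1 ^ mu)^-1 * (expA m rho / expA m rho')).
Proof.
have P0 : (0 +i* (2 * pi) : C) != 0.
  by apply/eqP => /(congr1 (@complex.Im R)) /= /eqP; rewrite gt_eqF // mulr_gt0 // pi_gt0.
have Pi : (0 +i* (2 * pi) : C) / 2 = 0 +i* pi.
  have two : (2 : C) != 0 by rewrite pnatr_eq0.
  apply: (mulIf two); rewrite divfK //; apply: complex_ext; rewrite !ReE /=; ring.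
have Em : expC (0 +i* pi) = -1 :> C.
  by rewrite /expC /= expR0 cospi sinpi; apply: complex_ext; rewrite !ReE /=; ring.
rewrite scalerA mulVf // scale1r Pi.
rewrite !(expAD localA basis_e e0 em) !(expAN localA basis_e e0 em) !scaler_int.
rewrite -intrM -scalerA scaler_int !(expAMz localA basis_e e0 em) (expA_alg localA basis_e e0 em) Em.
by rewrite scaleN1r mulrC.
Qed.

End Final.

Theorem mainTheorem1 (R : realType) (X : riemannSurfaceType R)
    (A : comFalgType R[i]) (m : {pred A}) (n : nat) (e : n.+1.-tuple A)
    (f g : meromorphicA X n) (s P : X) (x : chart R X) (sigma : R -> X)
    (nu_f nu_g : int) (N_f N_g : nat) (a b : int -> A)
    (compactX : compact [set: X])
    (localA : local_with_maximal_ideal m)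
    (basis_e : basis_of {:A} e)
    (e0 : tnth e ord0 = 1)
    (em : forall i, i != ord0 -> tnth e i \in m)
    (f_inv : invertible f) (g_inv : invertible g)
    (sfg : zero_or_pole f s \/ zero_or_pole g s)
    (x_unif : uniformizer s x)
    (f_exp : product_expansion e m s x f nu_f N_f a)
    (g_exp : product_expansion e m s x g nu_g N_g b)
    (Pfg : ~ (zero_or_pole f `|` zero_or_pole g) P)
    (sigma_C1 : piecewise_C1_path sigma)
    (sigma_loop : simple_loop_at P sigma)
    (sigma_avoids : forall t, t \in `[0, 1] ->
       ~ (zero_or_pole f `|` zero_or_pole g) (sigma t))
    (sigma_around : encircles_only sigma s (zero_or_pole f `|` zero_or_pole g)) :
  expA m ((0 +i* (2 * pi))^-1 *:
          iterated_integralA e sigma (dlog e f) (dlog e g)) =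
  (-1) ^ (nu_f * nu_g) *
  ((valueA e g P ^ nu_f * a 0 ^ nu_g *
    \big[*%R/1]_(j \in [set j : nat | (0 < j)%N])
      \big[*%R/1]_(k \in [set k : nat | (0 < k)%N])
        (1 - a j%:Z ^+ (k %/ gcdn j k) * b (- k%:Z) ^+ (j %/ gcdn j k))
          ^+ gcdn j k) /
   (valueA e f P ^ nu_g * b 0 ^ nu_f *
    \big[*%R/1]_(j \in [set j : nat | (0 < j)%N])
      \big[*%R/1]_(k \in [set k : nat | (0 < k)%N])
        (1 - a (- j%:Z) ^+ (k %/ gcdn j k) * b k%:Z ^+ (j %/ gcdn j k))
          ^+ gcdn j k)).
Proof.
set Z := _ `|` _ in Pfg sigma_avoids sigma_around.
case: (f_exp) => a0U am aN _; case: (g_exp) => b0U bm bN _; case: (x_unif) => xs x0 _ _.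
case: sigma_C1 => sigc [ts [pts lts C1]]; case: sigma_loop => sig0 _ _.
have [M [U [V [Y [delta [MM d0 UV near_s]]]]]] := lift_near_s localA basis_e e0 em x_unif f_exp
  g_exp (maxn (N_f * \dim {:A}) (N_g * \dim {:A})).
move: MM; rewrite geq_max => /andP[MM MM'].
have [lam [lamc xE]] := log_ratio x_unif.
pose c := chart_at s; have cs : chart_dom c s := chart_at_dom s.
(* The homotopy ends at a loop so close to s that all local descriptions hold along it. *)
pose Q q := [/\ chart_dom x q, cmod (x q) < delta, cont_at lam (c q - c s),
  x q = (c q - c s) * expC (lam (c q - c s)) & chart_dom c q].
have Qnear : \forall q \near s, Q q.
  have h1 := chart_dom_near xs; have h2 := chart_dom_near cs.
  have h3 : \forall q \near s, cmod (x q) < delta.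
    have : \forall z \near x s, cmod z < delta.
      by rewrite x0; apply/nearCP; exists delta => // w; rewrite subr0.
    exact: cont_near (chart_cont xs).
  have h4 : \forall q \near s, cont_at lam (c q - c s).
    have lamc' : \forall u \near c s - c s, cont_at lam u by rewrite subrr.
    exact: (cont_near (chart_shift_cont cs) lamc').
  by apply: filterS3 (filterI h1 h2) (filterI h3 h4) xE => q [? ?] [? ?] ?; split.
have [Th [theta [Thc ThZ [ThS Thper] ThQ [thc th1 thE]]]] := homotopy_to_s sigma_around Qnear.
(* The small loop p and its coordinate w in the chart around s, shifted to vanish at s. *)
pose p (t : R) := Th (0 +i* t); pose w t := c (p t) - c s.
have pc (t : R) : {for t, continuous p}.
  by apply: continuous_comp; [exact: col_cont|exact: Thc].
have wc (t : R) : cont_at w t.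
  apply: cont_atD; last exact: cont_at_cst.
  have [_ _ _ _ cp] := ThQ t.
  by apply/cont_atE; apply: continuous_comp; [exact: pc|exact: chart_cont].
have w0 t : w t != 0.
  apply/eqP => /eqP; rewrite subr_eq0 => /eqP E; have [_ _ _ _ cp] := ThQ t.
  have := (ThZ (0 +i* t)).2; rewrite -(chart_invK cs) -[chart_at s s]/(c s) -E chart_invK //.
  by rewrite eqxx.
have w10 : w 1 = w 0 by rewrite /w /p Thper.
have lamw t : cont_at lam (w t) by have [] := ThQ t.
have [ell [ellc ell1 ellE]] := path_log wc thc w0 lamw w10 th1 thE.
have ellx t : 0 <= t <= 1 -> expC (ell t) = x (p t).
  by move=> t01; have [_ _ _ -> _] := ThQ t; exact: ellE.
have Le := near_s p ell pc ellc _.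
have {}Le := Le (fun t t01 => And4 (let: And5 h _ _ _ _ := ThQ t in h) (ThZ (0 +i* t)).1 (ellx t t01)
  (let: And5 _ h _ _ _ := ThQ t in h)).
have ThZ' z := (ThZ z).1.
(* The explicit lift on the small loop is continued over the homotopy up to sigma. *)
have [F [G [K [L Ecol]]]] := square_lift_from localA basis_e e0 em Thc ThZ' Le.
have [F0 G0 K0] := Ecol 0 (seg0 R); have [F1 G1 K1] := Ecol 1 (seg1 R).
have [PF PG PK] := square_period basis_e Thc L Thper.
have xp : x (p 1) = x (p 0) by rewrite /p Thper.
have Lside : lift e f g (@unit_segment R) (sigma \o clamp 0 1) (fun t => F (1 +i* t))
    (fun t => G (1 +i* t)) (fun t => K (1 +i* t)).
  apply: lift_eq (lift_column (seg1 R) L) => t t01.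
  by rewrite /= clamp_id // ThS.
rewrite (iterated_integral_lift basis_e sigc pts lts C1 Lside).
have P10 : Th (1 +i* 0) = P by rewrite ThS ?lexx ?ler01.
have [x00 xd] : x (p 0) != 0 /\ cmod (x (p 0)) < delta.
  by split; [rewrite -ellx ?expC_neq0 // (seg0 R)|have [] := ThQ 0].
have xdom : chart_dom x (p 0) by have [] := ThQ 0.
have [fv gv] := UV _ xdom x00 xd.
have rc (t : R) : {for t, continuous (fun t : R => Th (t +i* 0))}.
  by apply: continuous_comp; [exact: row_cont|exact: Thc].
(* Along the path from the small loop to P, exp F / f and exp G / g keep their values 1 / a_0 and
   1 / b_0. *)
have [EF EG] := lift_exp localA basis_e e0 em rc (fun t _ => ThZ' (t +i* 0))
  (lift_row (seg0 R) L) (seg1 R).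
have EF' := expA_log_value localA basis_e e0 em (ellx 0 (seg0 R)) a0U fv.
have EG' := expA_log_value localA basis_e e0 em (ellx 0 (seg0 R)) b0U gv.
rewrite /= in EF EG; rewrite F0 EF' P10 in EF; rewrite G0 EG' P10 in EG.
have -> : K (1 +i* 1) - K (1 +i* 0) - F (1 +i* 0) * (G (1 +i* 1) - G (1 +i* 0)) =
  (0 +i* (2 * pi)) *: (nu_f%:~R *: G (1 +i* 0) - nu_g%:~R *: F (1 +i* 0) +
    (pair_log N_g M b a - pair_log N_f M a b) + (nu_f%:~R * nu_g%:~R * ((0 +i* (2 * pi)) / 2))%:A).
  rewrite -(period_identity nu_f%:~R nu_g%:~R (ell 0) (0 +i* (2 * pi)) (U (x (p 0))) (V (x (p 0)))
    _ (Y (x (p 0)))) -ell1.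
  rewrite PG PK F1 G1 K1 F0 G0 K0 xp.
  move: (F _) (G _) (K _) => ? ? ?; ring.
have [Pf Pg] : ~ zero_or_pole f P /\ ~ zero_or_pole g P by apply/not_orP.
have vfU := value_unit localA basis_e e0 em Pf; have vgU := value_unit localA basis_e e0 em Pg.
rewrite (expA_monodromy localA basis_e e0 em).
rewrite (numerator_prod localA basis_e e0 em a bm bN MM') (denominator_prod localA basis_e e0 em b am aN MM).
congr (_ * _); apply: final_algebra => //.
exact: (expA_unit localA basis_e e0 em).
Qed.
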